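(* Any compact complex manifold $M$ equipped with a maximal torus action (preserving the complex structure) can be obtained via the quotient construction described in the context. That is, there exist an integer $m\ge 0$, a simplicial complex $\mathcal K$ on the vertex set $[m]=\{1,\dots,m\}$, and a complex subspace $\mathfrak h\subset\mathfrak t_{\mathbb C}\cong\mathbb C^m$ satisfying conditions (a) and (b) of the context, such that $M$, as a compact complex manifold equipped with a maximal torus action, is the orbit space $U(\mathcal K)/H$, where $H=\exp\mathfrak h\subset(\mathbb C^* )^m$, with its induced torus action.
   Context: Maximal action: for a smooth effective action of a compact torus $T=(S^1)^k$ on a smooth manifold $M$ one always has $\dim M\ge\dim T+\dim T_x$ for every $x\in M$, where $T_x\subset T$ is the stabilizer of $x$. The effective action is called maximal if there is a point $x\in M$ with $\dim M=\dim T+\dim T_x$ (real dimensions). An action on a complex manifold preserves the complex structure if the differential of multiplication by every group element commutes with the operator of the almost complex structure. Simplicial complex on $[m]$: a family $\mathcal K$ of subsets of $[m]$ closed under the operation of taking subsets. It is not required that every singleton $\{i\}$ belongs to $\mathcal K$. A fan in a finite-dimensional real vector space is a set of polyhedral cones such that every face of each cone is an element of the set and the intersection of any two cones is a face of each of them. It is complete if the union of its cones is the whole space. Quotient construction: let $T=(S^1)^m\subset T_{\mathbb C}=(\mathbb C^* )^m$, let $\mathfrak t\cong\mathbb R^m$ be the Lie algebra of $T$ with standard basis $e_1,\dots,e_m$, and let $\mathfrak t_{\mathbb C}=\mathfrak t\oplus i\mathfrak t\cong\mathbb C^m$ be the Lie algebra of $T_{\mathbb C}$, with exponential map $\exp:\mathfrak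 t_{\mathbb C}\to T_{\mathbb C}$. Let $p:\mathfrak t_{\mathbb C}\to\mathfrak t$ be the natural projection onto the real part (the first summand). Let $\Sigma_{\mathcal K}$ be the fan in $\mathfrak t$ consisting of the cones $\{\sum_{i\in I}\mu_ie_i:\mu_i\ge0\}$, $I\in\mathcal K$. Let $$U(\mathcal K)=\mathbb C^m\setminus\bigcup_{I\notin\mathcal K}\{z\in\mathbb C^m: z_j=0\text{ for all }j\in I\},$$ which is the toric variety corresponding to $\Sigma_{\mathcal K}$ and on which $(\mathbb C^* )^m$ acts coordinatewise. The conditions on a complex subspace $\mathfrak h\subset\mathfrak t_{\mathbb C}$ are: (a) the group $H=\exp\mathfrak h\subset(\mathbb C^* )^m$ intersects trivially every coordinate subtorus $(\mathbb C^* )^I=\{t\in(\mathbb C^* )^m: t_j=1\text{ for }j\notin I\}$ with $I\in\mathcal K$; (b) the projection $q:\mathfrak t\to\mathfrak t/p(\mathfrak h)$ maps the fan $\Sigma_{\mathcal K}$ bijectively onto a complete fan, i.e. $q(\Sigma_{\mathcal K})=\{q(\sigma):\sigma\in\Sigma_{\mathcal K}\}$ is a complete fan in $\mathfrak t/p(\mathfrak h)$ and $q$ restricts to a bijection from the union of the cones of $\Sigma_{\mathcal K}$ onto $\mathfrak t/p(\mathfrak h)$. Under (a) and (b) the group $H$ acts freely and properly on $U(\mathcal K)$, and the orbit space $U(\mathcal K)/H$ is a compact complex manifold equipped with a maximal torus action, namely the action induced by the coordinatewise action of $T$ (that is, the action of the torus $T/(T\cap H)$).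
   Formalization: The manifold M is assumed connected; the claim fails otherwise, e.g. for two disjoint copies of CP^1 with the same circle rotation, since U(K)/H is always connected. *)

(* Defs.v *)
From HB Require Import structures.
From mathcomp Require Import all_boot all_order all_algebra.
From mathcomp Require Import all_classical all_reals all_analysis.
From mathcomp Require Import complex ring.

Set Implicit Arguments.
Unset Strict Implicit.
Unset Printing Implicit Defensive.

Import Order.TTheory GRing.Theory Num.Theory.
Import numFieldNormedType.Exports.

Local Open Scope classical_set_scope.
Local Open Scope ring_scope.
Local Open Scope quotient_scope.

(* [R[i]] itself carries no topology in the libraries; ascribing the type
   [numClosedFieldType] makes the norm topology of number fields available,
   so that ['rV[C R]_n] is a normed space over [C R] and [differentiable]
   between such spaces means complex differentiable. *)
Definition C (R : realType) : numClosedFieldType := R[i].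

Section ComplexVectors.
Context {R : realType}.

Definition mulv n (z w : 'rV[C R]_n) : 'rV[C R]_n :=
  \row_j (z 0 j * w 0 j).

Definition onev n : 'rV[C R]_n := const_mx 1.

Definition cexp (z : C R) : C R :=
  ((expR (complex.Re z) * cos (complex.Im z)) +i*
   (expR (complex.Re z) * sin (complex.Im z)))%C.

(* The exponential map of the complex torus, t_C -> T_C.  With t = R^n the Lie
   algebra of (S^1)^n, the real vector u exponentiates to (e^{i u_j})_j.
   Another normalisation (e.g. 2 pi i) would give the same group exp h for
   every complex subspace h. *)
Definition Exp n (z : 'rV[C R]_n) : 'rV[C R]_n :=
  \row_j cexp ('i%C * z 0 j).

Definition complexv n (u : 'rV[R]_n) : 'rV[C R]_n :=
  \row_j ((u 0 j)%:C)%C.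

Definition realpart n (z : 'rV[C R]_n) : 'rV[R]_n :=
  \row_j complex.Re (z 0 j).

Definition imagpart n (z : 'rV[C R]_n) : 'rV[R]_n :=
  \row_j complex.Im (z 0 j).

Definition torus {n} : set 'rV[C R]_n := [set t | forall j, `|t 0 j| = 1].

Definition ctorus {n} : set 'rV[C R]_n := [set t | forall j, t 0 j != 0].

(* The identification C^n = R^n + i R^n = R^(2n), used for real smoothness and
   for the real differential of a map. *)
Definition realify n (z : 'rV[C R]_n) : 'rV[R]_(n + n) :=
  row_mx (realpart z) (imagpart z).

Definition complexify n (w : 'rV[R]_(n + n)) : 'rV[C R]_n :=
  \row_j (lsubmx w 0 j +i* rsubmx w 0 j)%C.

Definition J n (w : 'rV[R]_(n + n)) : 'rV[R]_(n + n) :=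
  realify (('i%C : C R) *: complexify w).

End ComplexVectors.

Section Smooth.
Context {R : realType}.

(* Only meaningful for open D. *)
Fixpoint Cr_on (r : nat) a b (D : set 'rV[R]_a) (f : 'rV[R]_a -> 'rV[R]_b)
    : Prop :=
  if r is r'.+1 then
    (forall x, D x -> differentiable f x) /\
    (forall v, Cr_on r' D (fun x => 'd f x v))
  else forall x, D x -> {for x, continuous f}.

Definition smooth_on a b (D : set 'rV[R]_a) (f : 'rV[R]_a -> 'rV[R]_b) :=
  forall r, Cr_on r D f.

End Smooth.

(* A homeomorphism from an open subset of [M] onto an open subset of C^n; the
   values of [ch_to] and [ch_of] outside these sets are irrelevant. *)
Record chart (R : realType) (M : topologicalType) (n : nat) := Chart {
  ch_dom : set M;
  ch_to : M -> 'rV[C R]_n;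
  ch_of : 'rV[C R]_n -> M;
  ch_dom_open : open ch_dom;
  ch_cod_open : open (ch_to @` ch_dom);
  ch_toK : {in ch_dom, cancel ch_to ch_of};
  ch_to_continuous : {within ch_dom, continuous ch_to};
  ch_of_continuous : {within ch_to @` ch_dom, continuous ch_of}
}.

Definition ch_cod (R : realType) (M : topologicalType) (n : nat)
  (c : chart R M n) : set 'rV[C R]_n := ch_to c @` ch_dom c.

Record complexManifold (R : realType) (M : topologicalType) (n : nat) :=
  ComplexManifold {
  atlas : set (chart R M n);
  atlas_cover : forall x, exists2 c, atlas c & ch_dom c x;
  atlas_compat : forall c c', atlas c -> atlas c' ->
    forall x, ch_dom c x -> ch_dom c' x ->
      differentiable (ch_to c' \o ch_of c) (ch_to c x);
  manifold_hausdorff : hausdorff_space M;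
  manifold_second_countable : @second_countable M
}.

Definition holomorphic (R : realType) (M N : topologicalType) (a b : nat)
    (X : complexManifold R M a) (Y : complexManifold R N b) (f : M -> N) :=
  continuous f /\
  forall c c', atlas X c -> atlas Y c' ->
    forall x, ch_dom c x -> ch_dom c' (f x) ->
      differentiable (ch_to c' \o f \o ch_of c) (ch_to c x).

Definition biholomorphic (R : realType) (M N : topologicalType) (a b : nat)
    (X : complexManifold R M a) (Y : complexManifold R N b) (f : M -> N) :=
  holomorphic X Y f /\
  exists g : N -> M, [/\ cancel f g, cancel g f & holomorphic Y X g].

Definition real_dim (R : realType) (M : topologicalType) (n : nat)
  (X : complexManifold R M n) : nat := n.*2.

Section TorusActions.
Context {R : realType} {M : topologicalType} {n : nat}.
Context (X : complexManifold R M n) (k : nat).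

(* Only the values of the action at points of [torus k] matter. *)
Implicit Type act : 'rV[C R]_k -> M -> M.

(* Smoothness of T x M -> M is tested in the charts of M and in the local
   coordinates of T given by the local diffeomorphism s |-> exp s. *)
Definition act_coord act (c c' : chart R M n) (w : 'rV[R]_(k + (n + n))) :
    'rV[R]_(n + n) :=
  realify (ch_to c'
    (act (Exp (complexv (lsubmx w))) (ch_of c (complexify (rsubmx w))))).

Definition act_coord_dom act (c c' : chart R M n) : set 'rV[R]_(k + (n + n)) :=
  [set w | ch_cod c (complexify (rsubmx w)) /\
     ch_dom c'
       (act (Exp (complexv (lsubmx w))) (ch_of c (complexify (rsubmx w))))].

Record smooth_action act : Prop := {
  action1 : forall x, act (onev k) x = x;
  actionM : forall s t, torus s -> torus t ->
    forall x, act (mulv s t) x = act s (act t x);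
  action_continuous :
    {within torus `*` [set: M], continuous (fun p => act p.1 p.2)};
  action_smooth : forall c c', atlas X c -> atlas X c' ->
    smooth_on (act_coord_dom act c c') (act_coord act c c')
}.

Definition effective act :=
  forall t, torus t -> (forall x, act t x = x) -> t = onev k.

(* In a holomorphic chart the almost complex structure of M is [J]. *)
Definition preserves_complex_structure act :=
  forall t, torus t -> forall c c', atlas X c -> atlas X c' ->
  forall x, ch_dom c x -> ch_dom c' (act t x) ->
  let g := fun w : 'rV[R]_(n + n) =>
    realify (ch_to c' (act t (ch_of c (complexify w)))) in
  forall v, 'd g (realify (ch_to c x)) (J v) =
            J ('d g (realify (ch_to c x)) v).

Definition stabilizer act (x : M) : set 'rV[C R]_k :=
  [set t | torus t /\ act t x = x].

(* [G] is meant to be a closed subgroup of the torus; its Lie algebra is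
   {v | exp (s v) in G for all real s}. *)
Definition closed_subgroup_dim (G : set 'rV[C R]_k) (d : nat) :=
  exists W : {vspace 'rV[R]_k},
    (forall v, v \in W <-> forall s : R, G (Exp (complexv (s *: v)))) /\
    (\dim W)%VS = d.

Definition maximal_action act :=
  effective act /\
  exists x d, closed_subgroup_dim (stabilizer act x) d /\ real_dim X = (k + d)%N.

End TorusActions.

Section QuotientModule.
Context {K : pzRingType} {V : lmodType K} (S : zmodClosed V).
Context (SZ : GRing.scaler_closed S).

(* The library makes [Quotient.quot S] an additive group; we add scaling. *)
Definition quotient_module of GRing.scaler_closed S : Type := Quotient.quot S.

Local Notation Q := (quotient_module SZ).

HB.instance Definition _ := GRing.Zmodule.copy Q (Quotient.quot S).

Definition quotient_proj (v : V) : Q := \pi_(Quotient.quot S) v.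

Definition quotient_scale (a : K) (x : Q) : Q :=
  quotient_proj (a *: repr (x : Quotient.quot S)).

Fact quotient_proj_surj (x : Q) : exists v, x = quotient_proj v.
Proof. by exists (repr (x : Quotient.quot S)); rewrite /quotient_proj reprK. Qed.

Fact quotient_projD : {morph quotient_proj : u v / u + v}.
Proof. exact: (raddfD (\pi_(Quotient.quot S))). Qed.

Fact quotient_scaleE a v :
  quotient_scale a (quotient_proj v) = quotient_proj (a *: v).
Proof.
apply/eqP; rewrite /quotient_scale /quotient_proj -Quotient.idealrBE.
by rewrite -scalerBr SZ // Quotient.idealrBE reprK.
Qed.

Fact quotient_scalerA a b x :
  quotient_scale a (quotient_scale b x) = quotient_scale (a * b) x.
Proof.
by have [v ->] := quotient_proj_surj x; rewrite !quotient_scaleE scalerA.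
Qed.

Fact quotient_scale1r : left_id 1 quotient_scale.
Proof.
by move=> x; have [v ->] := quotient_proj_surj x; rewrite quotient_scaleE scale1r.
Qed.

Fact quotient_scalerDr : right_distributive quotient_scale +%R.
Proof.
move=> a x y; have [v ->] := quotient_proj_surj x.
have [w ->] := quotient_proj_surj y.
by rewrite -quotient_projD !quotient_scaleE scalerDr quotient_projD.
Qed.

Fact quotient_scalerDl x : {morph quotient_scale^~ x : a b / a + b}.
Proof.
move=> a b; have [v ->] := quotient_proj_surj x.
by rewrite !quotient_scaleE scalerDl quotient_projD.
Qed.

HB.instance Definition _ := GRing.Zmodule_isLmodule.Build K Q
  quotient_scalerA quotient_scale1r quotient_scalerDr quotient_scalerDl.

End QuotientModule.

Section Fans.
Context {R : realType} {V : lmodType R}.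

Definition polyhedral_cone (s : set V) :=
  exists (r : nat) (v : 'I_r -> V),
    s = [set \sum_i mu i *: v i | mu in [set mu : 'I_r -> R |
                                          forall i, 0 <= mu i]].

Definition face (t s : set V) :=
  exists u : {scalar V}, (forall x, s x -> 0 <= u x) /\
    t = s `&` [set x | u x = 0].

Definition support (F : set (set V)) : set V := \bigcup_(s in F) s.

Definition fan (F : set (set V)) :=
  [/\ forall s, F s -> polyhedral_cone s,
      forall s t, F s -> face t s -> F t &
      forall s t, F s -> F t -> face (s `&` t) s /\ face (s `&` t) t].

Definition complete_fan (F : set (set V)) := fan F /\ support F = setT.

End Fans.

(* A simplicial complex on [m], as the family K of its simplices; [set i] is
   not required to be in K. *)
Definition simplicial_complex m (K : {set {set 'I_m}}) :=
  forall A B : {set 'I_m}, A \in K -> B \subset A -> B \in K.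

Section QuotientConstruction.
Context {R : realType} {m : nat}.
Context (K : {set {set 'I_m}}) (h : {vspace 'rV[C R]_m}).

Definition Ucomplex : set 'rV[C R]_m :=
  [set z | forall A : {set 'I_m}, A \notin K ->
             ~ (forall j, j \in A -> z 0 j = 0)].

Definition Hgroup : set 'rV[C R]_m := [set Exp v | v in [set` h]].

Definition coord_subtorus (A : {set 'I_m}) : set 'rV[C R]_m :=
  ctorus `&` [set t | forall j, j \notin A -> t 0 j = 1].

Definition condition_a :=
  forall A, A \in K -> Hgroup `&` coord_subtorus A = [set onev m].

Definition proj_re : pred 'rV[R]_m :=
  fun u => `[< exists2 z, z \in h & u = realpart z >].

Fact proj_re_submod : submod_closed proj_re.
Proof.
split; first by apply/asboolP; exists 0; rewrite ?mem0v //;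
  apply/rowP=> j; rewrite !mxE.
move=> a u v /asboolP[z zh ->] /asboolP[w wh ->]; apply/asboolP.
exists ((a%:C)%C *: z + w); first by rewrite memvD ?memvZ.
apply/rowP=> j; rewrite !mxE.
by case: (z 0 j) => x y; case: (w 0 j) => x' y' /=; rewrite mul0r subr0.
Qed.

HB.instance Definition _ :=
  GRing.isZmodClosed.Build 'rV[R]_m proj_re (GRing.submod_closedB proj_re_submod).

Fact proj_re_scale : GRing.scaler_closed proj_re.
Proof. exact: (GRing.subsemimod_closedZ (GRing.submod_closed_semi proj_re_submod)). Qed.

Definition t_mod_ph : lmodType R := quotient_module proj_re_scale.

Definition q : 'rV[R]_m -> t_mod_ph := quotient_proj proj_re_scale.

Definition coord_cone (A : {set 'I_m}) : set 'rV[R]_m :=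
  [set \sum_(i in A) mu i *: delta_mx 0 i | mu in [set mu : 'I_m -> R |
                                             forall i, 0 <= mu i]].

Definition SigmaK : set (set 'rV[R]_m) := [set coord_cone A | A in [set` K]].

Definition condition_b :=
  complete_fan [set q @` s | s in SigmaK] /\
  set_bij (support SigmaK) [set: t_mod_ph] q.

Lemma cexpD (z w : C R) : cexp (z + w) = cexp z * cexp w.
Proof.
case: z => x y; case: w => x' y'; apply/eqP; rewrite eq_complex /= /cexp /=.
by rewrite expRD cosD sinD; apply/andP; split; apply/eqP; ring.
Qed.

Lemma ExpD (v w : 'rV[C R]_m) : Exp (v + w) = mulv (Exp v) (Exp w).
Proof. by apply/rowP=> j; rewrite !mxE mulrDr cexpD. Qed.

Lemma Exp0 : Exp 0 = onev m :> 'rV[C R]_m.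
Proof.
apply/rowP=> j; rewrite !mxE mulr0 /cexp /= expR0 cos0 sin0 mulr1 mulr0.
by [].
Qed.

Definition orbit_rel (z w : Ucomplex) : bool :=
  `[< exists2 t, Hgroup t & val w = mulv t (val z) >].

Fact orbit_rel_refl : reflexive orbit_rel.
Proof.
move=> z; apply/asboolP; exists (onev m); first by exists 0; rewrite ?Exp0 //= mem0v.
by apply/rowP=> j; rewrite !mxE mul1r.
Qed.

Fact orbit_rel_imply z w : orbit_rel z w -> orbit_rel w z.
Proof.
move=> /asboolP[_ [v vh <-] wz]; apply/asboolP; exists (Exp (- v)).
  by exists (- v) => //=; rewrite memvN.
have E : mulv (Exp (- v)) (Exp v) = onev m by rewrite -ExpD addNr Exp0.
have /rowP E' := E; rewrite wz; apply/rowP=> j.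
by have := E' j; rewrite !mxE mulrA => ->; rewrite mul1r.
Qed.

Fact orbit_rel_sym : symmetric orbit_rel.
Proof. by move=> z w; apply/idP/idP; apply: orbit_rel_imply. Qed.

Fact orbit_rel_trans : transitive orbit_rel.
Proof.
move=> y x z /asboolP[_ [v vh <-] yx] /asboolP[_ [w wh <-] zy].
apply/asboolP; exists (Exp (w + v)).
  by exists (w + v) => //=; rewrite memvD.
by rewrite zy yx ExpD; apply/rowP=> j; rewrite !mxE mulrA.
Qed.

Canonical orbit_equiv :=
  EquivRel orbit_rel orbit_rel_refl orbit_rel_sym orbit_rel_trans.

Definition orbit_space : topologicalType :=
  quotient_topology {eq_quot orbit_rel}.

Definition orbit_pi (z : Ucomplex) : orbit_space := \pi_orbit_space z.

(* Near a point [z] of the open set U(K), the projection U(K) -> U(K)/H read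
   as a map on C^m (with a junk value outside U(K)). *)
Definition orbit_pi_at (z : Ucomplex) (w : 'rV[C R]_m) : orbit_space :=
  orbit_pi (insubd z w).

(* The complex structure of the orbit space of a free proper holomorphic
   action: the one for which the projection is a holomorphic submersion. *)
Definition orbit_manifold d (Y : complexManifold R orbit_space d) :=
  forall c, atlas Y c -> forall z : Ucomplex, ch_dom c (orbit_pi z) ->
    let g := ch_to c \o orbit_pi_at z in
    differentiable g (val z) /\
    (forall v, exists u, 'd g (val z) u = v).

Lemma Ucomplex_ctorus (t z : 'rV[C R]_m) :
  ctorus t -> Ucomplex z -> Ucomplex (mulv t z).
Proof.
move=> tT zU A AK tz0; apply: (zU A AK) => j jA; apply/eqP.
by have /eqP := tz0 j jA; rewrite mxE mulf_eq0 (negPf (tT j)).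
Qed.

Lemma torus_ctorus (t : 'rV[C R]_m) : torus t -> ctorus t.
Proof. by move=> tT j; rewrite -normr_eq0 tT oner_neq0. Qed.

Definition Uact (t : 'rV[C R]_m) (z : Ucomplex) : Ucomplex :=
  insubd z (mulv t (val z)).

Lemma val_Uact (t : 'rV[C R]_m) (z : Ucomplex) :
  ctorus t -> val (Uact t z) = mulv t (val z).
Proof.
move=> tT; rewrite /Uact insubdK //; apply/mem_set.
by apply: Ucomplex_ctorus => //; apply: set_valP.
Qed.

Definition orbit_act (t : 'rV[C R]_m) (x : orbit_space) : orbit_space :=
  orbit_pi (Uact t (repr x)).

Lemma orbit_act_pi (t : 'rV[C R]_m) (z : Ucomplex) :
  ctorus t -> orbit_act t (orbit_pi z) = orbit_pi (Uact t z).
Proof.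
move=> tT; apply/eqmodP/asboolP.
have /eqmodP/asboolP[s sH szr] : repr (orbit_pi z) = z %[mod {eq_quot orbit_rel}].
  exact: reprK.
exists s => //; rewrite !val_Uact // szr.
by apply/rowP=> j; rewrite !mxE mulrCA.
Qed.

(* [rho] induces an isomorphism of the torus T/(T cap H) onto (S^1)^k. *)
Record torus_quotient_iso k (rho : 'rV[C R]_m -> 'rV[C R]_k) : Prop := {
  rhoM : forall s t, torus s -> torus t -> rho (mulv s t) = mulv (rho s) (rho t);
  rho_continuous : {within torus, continuous rho};
  rho_surj : rho @` torus = torus;
  rho_ker : torus `&` [set t | rho t = onev k] = torus `&` Hgroup
}.

End QuotientConstruction.

(* Main.v *)
(* The torus action generates commuting holomorphic vector fields; as M is compact, their
   complexification integrates to an action [Phi] of C^k.  At a point whose isotropy group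
   has the maximal dimension d = 2n - k, averaging over the isotropy torus linearizes the
   action and yields an equivariant injection [sg] of C^d such that (v, z) |-> Phi_v (sg z)
   is a submersion.  If sg (1, ..., 1) = x0, the rows of [lam] span a simplicial cone: the
   limit of Phi_(i t w) x0 as t -> oo lies in this chart iff w lies in the cone modulo
   Q = Re Lie (Stab x0).  Comparing such limits shows that two cones meet in a common face;
   crossing a facet leads to another chart, compactness leaves finitely many of them, and
   walking along a generic segment shows that the cones cover R^k / Q.  The charts then glue
   to a submersion U(K) -> M whose fibres are the orbits of H. *)
Require Import Defs.
From HB Require Import structures.
From mathcomp Require Import all_boot all_order all_algebra.
From mathcomp Require Import all_classical all_reals all_analysis.
From mathcomp Require Import complex ring lra zify.

Set Implicit Arguments.
Unset Strict Implicit.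
Unset Printing Implicit Defensive.

Import Order.TTheory GRing.Theory Num.Theory.
Import numFieldNormedType.Exports.

Local Open Scope classical_set_scope.
Local Open Scope ring_scope.

(** * Real-valued moduli and norms of complex matrices *)

Section RealNorm.
Context {R : realType}.

(** All quotient data are read off at one point x0 whose C^k-orbit is open and dense: [Lam] maps C^m
    onto C^k, and h is the preimage under [Lam] of the Lie algebra of the stabilizer of x0. The rays
    of the fan need not generate the lattice of the torus, nor even span R^k, so m counts the rays
    together with k further indices on which [Lam] is the identity; no simplex contains these ghost
    vertices. A ray comes with a definite generator, not only a direction: its circle has period 2
    pi at x0, and this forces a ray shared by two charts to be the same vector in both. The
    dimension hypothesis enters through two inequalities valid at every point: if e is the dimension
    of the isotropy group and r the complex rank of the generators, then e + r <= n and k <= e + 2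
    r. Together with k + d = 2 n they turn e = d into e + r = n, which is what makes the isotropy
    representation standard. The action is assumed smooth, with each torus element respecting the
    complex structure. Holomorphy of the generating fields is deduced from the symmetry of second
    derivatives; everything later rests on Taylor estimates with quadratic remainder. *)

Definition rc (a : R) : C R := (a%:C)%C.

Lemma rcD a b : rc (a + b) = rc a + rc b. Proof. exact: rmorphD. Qed.
Lemma rcB a b : rc (a - b) = rc a - rc b. Proof. exact: rmorphB. Qed.
Lemma rcN a : rc (- a) = - rc a. Proof. exact: rmorphN. Qed.
Lemma rcM a b : rc (a * b) = rc a * rc b. Proof. exact: rmorphM. Qed.
Lemma rcV a : rc a^-1 = (rc a)^-1. Proof. exact: fmorphV. Qed.
Lemma rc0 : rc 0 = 0. Proof. by []. Qed.
Lemma rc1 : rc 1 = 1. Proof. by []. Qed.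
Lemma rc_nat n : rc n%:R = n%:R. Proof. exact: rmorph_nat. Qed.
Lemma rc_inj : injective rc. Proof. by move=> x y []. Qed.
Lemma rc_eq0 a : (rc a == 0) = (a == 0). Proof. exact: fmorph_eq0. Qed.
Lemma rc_le a b : (rc a <= rc b) = (a <= b). Proof. exact: lecR. Qed.
Lemma rc_lt a b : (rc a < rc b) = (a < b). Proof. exact: ltcR. Qed.

Definition ab (z : C R) : R := complex.Re `|z|.

Lemma rcab (z : C R) : rc (ab z) = `|z|.
Proof. by rewrite /ab /rc RRe_real // normr_real. Qed.
Lemma ab_ge0 (z : C R) : 0 <= ab z. Proof. by rewrite -rc_le rcab normr_ge0. Qed.
Lemma abD (a b : C R) : ab (a + b) <= ab a + ab b.
Proof. by rewrite -rc_le rcD !rcab ler_normD. Qed.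
Lemma abM (a b : C R) : ab (a * b) = ab a * ab b.
Proof. by apply: rc_inj; rewrite rcM !rcab normrM. Qed.
Lemma abN (a : C R) : ab (- a) = ab a. Proof. by rewrite /ab normrN. Qed.
Lemma abV (a : C R) : ab a^-1 = (ab a)^-1.
Proof. by apply: rc_inj; rewrite rcV !rcab normfV. Qed.
Lemma ab0 : ab 0 = 0. Proof. by rewrite /ab normr0. Qed.
Lemma ab1 : ab 1 = 1. Proof. by apply: rc_inj; rewrite rcab normr1. Qed.
Lemma ab_eq0 (a : C R) : (ab a == 0) = (a == 0).
Proof. by rewrite -rc_eq0 rcab normr_eq0. Qed.
Lemma ab_gt0 (a : C R) : a != 0 -> 0 < ab a.
Proof. by rewrite lt_def ab_ge0 andbT ab_eq0. Qed.
Lemma abE (z : C R) : ab z = Num.sqrt (complex.Re z ^+ 2 + complex.Im z ^+ 2).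
Proof. by rewrite /ab normc_def. Qed.
Lemma ab_rc (a : R) : ab (rc a) = `|a|.
Proof. by rewrite abE /= expr0n /= addr0 sqrtr_sqr. Qed.
Lemma ab_Re (z : C R) : `|complex.Re z| <= ab z.
Proof. by rewrite abE -sqrtr_sqr ler_wsqrtr // lerDl sqr_ge0. Qed.
Lemma ab_Im (z : C R) : `|complex.Im z| <= ab z.
Proof. by rewrite abE -sqrtr_sqr ler_wsqrtr // lerDr sqr_ge0. Qed.
Lemma ab_i : ab 'i%C = 1.
Proof. by rewrite abE /= expr0n /= add0r expr1n sqrtr1. Qed.
Lemma complex_ReIm (z : C R) :
  z = rc (complex.Re z) + 'i%C * rc (complex.Im z).
Proof. exact: complexE. Qed.
Lemma ab_ReIm (z : C R) : ab z <= `|complex.Re z| + `|complex.Im z|.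
Proof.
rewrite [X in ab X]complex_ReIm; apply: le_trans (abD _ _) _.
by rewrite abM ab_i mul1r !ab_rc.
Qed.
Lemma ab_sum (I : Type) (r : seq I) (P : pred I) (F : I -> C R) :
  ab (\sum_(i <- r | P i) F i) <= \sum_(i <- r | P i) ab (F i).
Proof.
elim/big_rec2: _ => [|i a b _ h]; first by rewrite ab0.
by apply: le_trans (abD _ _) _; rewrite lerD2l.
Qed.

Definition rn m n (A : 'M[C R]_(m, n)) : R := complex.Re `|A|.

Lemma rcrn m n (A : 'M[C R]_(m, n)) : rc (rn A) = `|A|.
Proof. by rewrite /rn /rc RRe_real // normr_real. Qed.

Section Generic.
Context {m n : nat}.
Implicit Types x y z : 'M[C R]_(m, n).

Lemma rn_ge0 x : 0 <= rn x. Proof. by rewrite -rc_le rcrn normr_ge0. Qed.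
Lemma rn0 : rn (0 : 'M[C R]_(m, n)) = 0. Proof. by rewrite /rn normr0. Qed.
Lemma rn0_eq0 x : rn x = 0 -> x = 0.
Proof. by move=> h; apply: normr0_eq0; rewrite -rcrn h. Qed.
Lemma rn_le0 x : rn x <= 0 -> x = 0.
Proof. by move=> h; apply: rn0_eq0; apply/le_anti; rewrite h rn_ge0. Qed.
Lemma rnD x y : rn (x + y) <= rn x + rn y.
Proof. by rewrite -rc_le rcD !rcrn ler_normD. Qed.
Lemma rnN x : rn (- x) = rn x. Proof. by rewrite /rn normrN. Qed.
Lemma rn_distC x y : rn (x - y) = rn (y - x). Proof. by rewrite /rn distrC. Qed.
Lemma rnB x y : rn (x - y) <= rn x + rn y.
Proof. by rewrite -(rnN y); exact: rnD. Qed.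
Lemma rn_dist x y z : rn (x - z) <= rn (x - y) + rn (y - z).
Proof. by rewrite -rc_le rcD !rcrn ler_distD. Qed.
Lemma rn_sub x y : rn x - rn y <= rn (x - y).
Proof. by rewrite lerBlDr; have := rnD (x - y) y; rewrite subrK. Qed.
Lemma rn_sum (I : Type) (r : seq I) (P : pred I) (F : I -> 'M[C R]_(m, n)) :
  rn (\sum_(i <- r | P i) F i) <= \sum_(i <- r | P i) rn (F i).
Proof.
elim/big_rec2: _ => [|i a b _ h]; first by rewrite rn0.
by apply: le_trans (rnD _ _) _; rewrite lerD2l.
Qed.
Lemma rn_small x : (forall e, 0 < e -> rn x <= e) -> x = 0.
Proof.
move=> h; apply: rn_le0; apply/ler_addgt0Pr => e e0.
by rewrite add0r; exact: h.
Qed.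
Lemma rnZ a x : rn (a *: x) = ab a * rn x.
Proof. by apply: rc_inj; rewrite rcM rcrn rcab rcrn normrZ. Qed.

Lemma rn_coord x i j : ab (x i j) <= rn x.
Proof.
rewrite -rc_le rcab rcrn [leRHS]mx_normE -[leLHS]nngE num_le.
exact: (le_bigmax _ _ (i, j)).
Qed.

Lemma rn_mx_le x (e : R) : 0 <= e -> (forall i j, ab (x i j) <= e) -> rn x <= e.
Proof.
move=> e0 h; rewrite -rc_le rcrn.
have [x0|/mx_norm_neq0[ij xij]] := eqVneq (mx_norm x) 0.
  by have -> : `|x| = rc 0 by []; rewrite rc_le.
by have -> : `|x| = `|x ij.1 ij.2| by []; rewrite -rcab rc_le.
Qed.
End Generic.

Lemma rn_mulmx m n p (A : 'M[C R]_(m, n)) (B : 'M[C R]_(n, p)) :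
  rn (A *m B) <= n%:R * rn A * rn B.
Proof.
apply: rn_mx_le => [|i j]; first by rewrite !mulr_ge0 ?rn_ge0.
rewrite mxE; apply: le_trans (ab_sum _ _ _) _.
apply: le_trans (_ : \sum_(k < n) rn A * rn B <= _).
  by apply: ler_sum => k _; rewrite abM ler_pM ?ab_ge0 ?rn_coord.
by rewrite sumr_const card_ord -[leLHS]mulr_natl mulrA.
Qed.

Lemma rn_row_mx n1 n2 (x : 'rV[C R]_n1) (y : 'rV[C R]_n2) (e : R) :
  rn x <= e -> rn y <= e -> rn (row_mx x y) <= e.
Proof.
move=> xe ye; apply: rn_mx_le => [|i j]; first exact: le_trans (rn_ge0 x) xe.
by rewrite mxE; case: (fintype.split j) => k; apply: le_trans (rn_coord _ _ _) _.
Qed.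

Lemma rn_lsub n1 n2 (x : 'rV[C R]_(n1 + n2)) : rn (lsubmx x) <= rn x.
Proof. by apply: rn_mx_le => [|i j]; rewrite ?rn_ge0 ?mxE ?rn_coord. Qed.

Lemma rn_rsub n1 n2 (x : 'rV[C R]_(n1 + n2)) : rn (rsubmx x) <= rn x.
Proof. by apply: rn_mx_le => [|i j]; rewrite ?rn_ge0 ?mxE ?rn_coord. Qed.

Lemma nbhs_norm_real (V : normedModType (C R)) (p : V) (A : set V) :
  nbhs p A <-> exists2 e : R, 0 < e & forall y : V, `|y - p| < rc e -> A y.
Proof.
split=> [/nbhs_normP[e /= e0 h]|[e e0 h]].
  have eE : rc (complex.Re e) = e by rewrite /rc RRe_real // gtr0_real.
  exists (complex.Re e); first by rewrite -rc_lt eE.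
  by move=> y ye; apply: h; rewrite /ball_ /= distrC -eE.
apply/nbhs_normP; exists (rc e) => /=; first by rewrite -[0]/(rc 0) rc_lt.
by move=> y /=; rewrite distrC; exact: h.
Qed.

Lemma nbhs_rn m n (p : 'M[C R]_(m, n)) (A : set 'M[C R]_(m, n)) :
  nbhs p A <-> exists2 e : R, 0 < e & forall y : 'M[C R]_(m, n), rn (y - p) < e -> A y.
Proof.
split=> [/nbhs_norm_real[e e0 h]|[e e0 h]].
  by exists e => // y ye; apply: h; rewrite -rcrn rc_lt.
by apply/nbhs_norm_real; exists e => // y; rewrite -rcrn rc_lt; exact: h.
Qed.
End RealNorm.

(* Decision procedures compare atoms up to conversion, which is slow on norms
   and matrix entries.  The tactics below rewrite matrix expressions into a
   syntactic normal form (the same operation can be reached through different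
   canonical structures) and generalize them first. *)
Definition madd (R : realType) m n (x y : 'M[C R]_(m, n)) := x + y.
Definition mopp (R : realType) m n (x : 'M[C R]_(m, n)) := - x.
Definition mscale (R : realType) m n (a : C R) (x : 'M[C R]_(m, n)) := a *: x.
Definition mmul (R : realType) m n p (x : 'M[C R]_(m, n)) (y : 'M[C R]_(n, p)) :=
  x *m y.
Definition rnn (R : realType) m n (x : 'M[C R]_(m, n)) := rn x.

Ltac normM T m n x := lazymatch x with
  | @Algebra.add _ ?a ?b =>
      let a' := normM T m n a in let b' := normM T m n b in
      constr:(@madd T m n a' b')
  | @Algebra.opp _ ?a => let a' := normM T m n a in constr:(@mopp T m n a')
  | @GRing.scale _ _ ?c ?a =>
      let a' := normM T m n a in constr:(@mscale T m n c a')
  | @mulmx _ _ ?q _ ?a ?b =>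
      let a' := normM T m q a in let b' := normM T q n b in
      constr:(@mmul T m q n a' b')
  | _ => x
  end.

Ltac gen_rn :=
  repeat match goal with
  | H : is_true ?P |- _ => match P with context [rn _] => revert H end
  | H : ?a = ?b |- _ =>
      match a with context [rn _] => revert H | _ =>
      match b with context [rn _] => revert H end end
  end;
  repeat match goal with |- context [@rn ?A ?m ?n ?x] =>
    let x' := normM A m n x in
    change (@rn A m n x) with (@rnn A m n x') end;
  repeat match goal with |- context [@rnn ?A ?m ?n ?x] =>
    generalize (@rnn A m n x); intro end;
  intros.

Ltac rlra := solve [gen_rn; lra].
Ltac rnra := solve [gen_rn; nra].

Definition ment (R : realType) m n (x : 'M[C R]_(m, n)) i j : C R := x i j.

Lemma ment_ext (R : realType) m n (x y : 'M[C R]_(m, n)) :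
  (forall i j, ment x i j = ment y i j) -> x = y.
Proof. by move=> h; apply/matrixP. Qed.

Lemma ment_add (R : realType) m n (x y : 'M[C R]_(m, n)) i j a b :
  ment x i j = a -> ment y i j = b -> ment (madd x y) i j = a + b.
Proof. by move=> <- <-; rewrite /ment mxE. Qed.
Lemma ment_opp (R : realType) m n (x : 'M[C R]_(m, n)) i j a :
  ment x i j = a -> ment (mopp x) i j = - a.
Proof. by move=> <-; rewrite /ment mxE. Qed.
Lemma ment_scale (R : realType) m n (c : C R) (x : 'M[C R]_(m, n)) i j a :
  ment x i j = a -> ment (mscale c x) i j = c * a.
Proof. by move=> <-; rewrite /ment mxE. Qed.
Lemma ment_0 (R : realType) m n i j : ment (0 : 'M[C R]_(m, n)) i j = 0.
Proof. by rewrite /ment mxE. Qed.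

Ltac mproof T m n i j x := lazymatch x with
  | @Algebra.add _ ?a ?b =>
      let pa := mproof T m n i j a in let pb := mproof T m n i j b in
      constr:(ment_add pa pb)
  | @Algebra.opp _ ?a => let pa := mproof T m n i j a in constr:(ment_opp pa)
  | @GRing.scale _ _ ?c ?a =>
      let pa := mproof T m n i j a in constr:(ment_scale c pa)
  | @Algebra.zero _ => constr:(@ment_0 T m n i j)
  | _ => let x' := normM T m n x in constr:(erefl (@ment T m n x' i j))
  end.

Ltac mxring :=
  apply: ment_ext => ? ?;
  match goal with |- @ment ?T ?m ?n ?x ?i ?j = @ment _ _ _ ?y _ _ =>
    let px := mproof T m n i j x in let py := mproof T m n i j y in
    refine (etrans px (etrans _ (esym py))) end;
  repeat match goal with |- context [@ment ?T ?m ?n ?a ?i ?j] =>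
    generalize (@ment T m n a i j); intro end;
  ring.

(** * Limits along an ultrafilter on the natural numbers *)

Section UltraLimit.

(** An ultrafilter containing all tails. Every bounded sequence converges along it, so limits of a
    whole family of sequences are taken at once, without extracting subsequences. *)
Definition natU : set_system nat := sval (cid (ultraFilterLemma (F := \oo) _)).

Lemma natU_ultra : UltraFilter natU.
Proof. by rewrite /natU; case: cid => G []. Qed.

#[local] Existing Instance natU_ultra.

Lemma natU_ge N : natU [set j | (N <= j)%N].
Proof. by rewrite /natU; case: cid => G [/= _]; apply; exact: nbhs_infty_ge. Qed.

Lemma natU_ex (A : set nat) : natU A -> exists j, A j.
Proof. by move=> /filter_ex. Qed.

Lemma natUI (A B : set nat) : natU A -> natU B -> natU (A `&` B).
Proof. exact: filterI. Qed.

Lemma natU_compact (T : topologicalType) (A : set T) (u : nat -> T) :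
  compact A -> (forall j, A (u j)) ->
  exists2 l, A l & forall N, nbhs l N -> natU [set j | N (u j)].
Proof.
move=> cA uA.
have UB : (u @ natU) A by apply: (@filterE _ natU) => j; exact: uA.
have PF : ProperFilter (u @ natU) by apply: fmap_proper_filter.
have [l [Al ul]] := cA (u @ natU) PF UB.
exists l => // N nN.
have [//|nA] := in_ultra_setVsetC [set j | N (u j)] natU_ultra.
by have [y []] := ul (~` N) N nA nN.
Qed.

Context {R : realType}.

Lemma ulim_real (u : nat -> R) B : (forall j, `|u j| <= B) ->
  exists l, forall e, 0 < e -> natU [set j | `|u j - l| < e].
Proof.
move=> uB; have [j|l _ ul] := natU_compact (u := u) (@segment_compact R (- B) B).
  by rewrite /= in_itv /= -ler_norml.
exists l => e e0; have := ul _ (nbhsx_ballx l e e0).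
by apply: filterS => j /=; rewrite /ball /= distrC.
Qed.

Lemma ulim m n (u : nat -> 'M[C R]_(m, n)) B : (forall j, rn (u j) <= B) ->
  exists l, forall e, 0 < e -> natU [set j | rn (u j - l) < e].
Proof.
move=> uB.
have H (f : C R -> R) : (forall z, `|f z| <= ab z) ->
  exists l : 'I_m * 'I_n -> R, forall e, 0 < e ->
    natU [set k | forall ij, `|f (u k ij.1 ij.2) - l ij| < e].
  move=> fB.
  have fuB ij k : `|f (u k ij.1 ij.2)| <= B.
    exact: le_trans (le_trans (fB _) (rn_coord _ _ _)) (uB k).
  have [l lP] := fin_all_exists (fun ij => ulim_real (fuB ij)).
  by exists l => e e0; apply: filter_forall => ij; exact: lP.
have [lr lrP] := H _ ab_Re; have [li liP] := H _ ab_Im.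
exists (\matrix_(i, j) (lr (i, j) +i* li (i, j))%C) => e e0.
have e4 : 0 < e / 4 by rewrite divr_gt0.
apply: filterS (natUI (lrP _ e4) (liP _ e4)) => k /= [hr hi].
apply: le_lt_trans (_ : e / 2 < e); last by lra.
apply: rn_mx_le => [|i j]; first by lra.
rewrite !mxE; apply: le_trans (ab_ReIm _) _.
have := hr (i, j); have := hi (i, j) => /=.
case: (u k i j) => a b /=; lra.
Qed.
End UltraLimit.

(** * Holomorphy with quadratic remainder *)

Section QuadraticDifferentiability.
Context {R : realType}.

(* Complex differentiability with a locally uniform quadratic remainder: it is
   stable under composition, inversion, flows and limits of averages, so that
   Cauchy's theory is never needed. *)
Definition qhol_with a b (f : 'rV[C R]_a -> 'rV[C R]_b)
    (f' : 'rV[C R]_a -> 'M[C R]_(a, b)) (p : 'rV[C R]_a) :=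
  exists r K : R, 0 < r /\ forall x y : 'rV[C R]_a, rn (x - p) < r -> rn (y - p) < r ->
    rn (f y - f x - (y - x) *m f' x) <= K * rn (y - x) ^+ 2.

Definition qhol a b (f : 'rV[C R]_a -> 'rV[C R]_b) p :=
  exists f', qhol_with f f' p.

(** Consequences of [qhol_with] that are used together, with one radius and one constant. The
    Lipschitz property of the derivative is not assumed: [qhol_nice] extracts it from the remainder
    estimate. *)
Record nice a b (f : 'rV[C R]_a -> 'rV[C R]_b) (f' : 'rV[C R]_a -> 'M[C R]_(a, b))
    (p : 'rV[C R]_a) (r K : R) : Prop := Nice {
  nice_r : 0 < r;
  nice_K : 0 < K;
  nice_T : forall x y : 'rV[C R]_a, rn (x - p) < r -> rn (y - p) < r ->
    rn (f y - f x - (y - x) *m f' x) <= K * rn (y - x) ^+ 2;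
  nice_L : forall x y : 'rV[C R]_a, rn (x - p) < r -> rn (y - p) < r ->
    rn (f' y - f' x) <= K * rn (y - x);
  nice_B : forall x : 'rV[C R]_a, rn (x - p) < r -> rn (f' x) <= K;
  nice_fL : forall x y : 'rV[C R]_a, rn (x - p) < r -> rn (y - p) < r ->
    rn (f y - f x) <= K * rn (y - x) }.

Lemma nice_shrink a b (f : 'rV[C R]_a -> 'rV[C R]_b) f' p r K r' K' :
  nice f f' p r K -> 0 < r' -> r' <= r -> K <= K' -> nice f f' p r' K'.
Proof.
case=> r0 K0 T L B fL r'0 rr KK; split => //; first exact: lt_le_trans KK.
- move=> x y xr yr; apply: le_trans (T _ _ (lt_le_trans xr rr) (lt_le_trans yr rr)) _.
  by rewrite ler_wpM2r // exprn_ge0 // rn_ge0.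
- move=> x y xr yr; apply: le_trans (L _ _ (lt_le_trans xr rr) (lt_le_trans yr rr)) _.
  by rewrite ler_wpM2r // rn_ge0.
- by move=> x xr; apply: le_trans KK; apply: B; exact: lt_le_trans rr.
- move=> x y xr yr; apply: le_trans (fL _ _ (lt_le_trans xr rr) (lt_le_trans yr rr)) _.
  by rewrite ler_wpM2r // rn_ge0.
Qed.

Lemma row_delta m n (A : 'M[C R]_(m, n)) i c :
  (c *: delta_mx 0 i : 'rV_m) *m A = c *: row i A.
Proof. by rewrite -scalemxAl -rowE. Qed.

Lemma rn_delta n (i : 'I_n) : rn (delta_mx 0 i : 'rV[C R]_n) = 1.
Proof.
apply/le_anti/andP; split.
  apply: rn_mx_le => [//|j l]; rewrite mxE; case: (_ && _); first by rewrite ab1.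
  by rewrite ab0.
by have := rn_coord (delta_mx 0 i : 'rV[C R]_n) 0 i; rewrite mxE !eqxx ab1.
Qed.

Lemma rn_rows m n (A : 'M[C R]_(m, n)) e : 0 <= e ->
  (forall i, rn (row i A) <= e) -> rn A <= e.
Proof.
move=> e0 h; apply: rn_mx_le => // i j.
by apply: le_trans (h i); have := rn_coord (row i A) 0 j; rewrite mxE.
Qed.

(* Expanding f at three points x, y, z with z - y = |x - y| e_i compares the
   i-th rows of the two derivatives. *)
Lemma qhol_nice a b (f : 'rV[C R]_a -> 'rV[C R]_b) f' p :
  qhol_with f f' p -> exists r K, nice f f' p r K.
Proof.
move=> [r [K [r0 T]]].
have T' (x y : 'rV[C R]_a) : rn (x - p) < r -> rn (y - p) < r ->
    rn (f y - f x - (y - x) *m f' x) <= `|K| * rn (y - x) ^+ 2.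
  move=> xr yr; apply: le_trans (T _ _ xr yr) _.
  by rewrite ler_wpM2r ?ler_norm // exprn_ge0 // rn_ge0.
have [k kE] : exists k : R, `|K| = k by exists `|K|.
have k0 : 0 <= k by rewrite -kE.
rewrite kE in T'.
have [s s0 rE] : exists2 s : R, 0 < s & r = 4 * s by exists (r / 4); lra.
have L (x y : 'rV[C R]_a) : rn (x - p) < s -> rn (y - p) < s ->
    rn (f' y - f' x) <= 6 * k * rn (y - x).
  move=> xs ys; move DE: (rn (y - x)) => D.
  have D0 : 0 <= D by rewrite -DE rn_ge0.
  have D2 : D < 2 * s.
    by have := rn_dist y p x; rewrite (rn_distC p) DE; rlra.
  have [Dz|Dn] := eqVneq D 0.
    by move: DE; rewrite Dz mulr0 => /rn0_eq0/eqP; rewrite subr_eq0 => /eqP->; rewrite subrr rn0 lexx.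
  apply: rn_rows => [|i]; first by rewrite !mulr_ge0.
  pose h := rc D *: delta_mx 0 i : 'rV[C R]_a; pose z := y + h.
  have hD : rn h = D by rewrite rnZ rn_delta ab_rc mulr1 ger0_norm.
  have zr : rn (z - p) < r.
    by have := rnD (y - p) h; rewrite hD /z (addrAC y h); rlra.
  have xr : rn (x - p) < r by rlra.
  have yr : rn (y - p) < r by rlra.
  have := T' _ _ xr zr; have := T' _ _ yr zr; have := T' _ _ xr yr.
  rewrite DE.
  have -> : z - y = h by rewrite /z addrC addKr.
  have zx : rn (z - x) <= 2 * D.
    by have := rnD (y - x) h; rewrite hD DE /z (addrAC y h); rlra.
  have zx2 : k * rn (z - x) ^+ 2 <= k * (2 * D) ^+ 2.
    by rewrite ler_wpM2l // lerXn2r ?nnegrE ?rn_ge0 // mulr_ge0.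
  rewrite hD; set u1 := f y - _ - _; set u2 := f z - _ - _; set u3 := f z - _ - _.
  move=> h1 h2 h3.
  have E : h *m (f' y - f' x) = u3 - u2 - u1.
    rewrite /u1 /u2 /u3 mulmxBr /z !mulmxBl !mulmxDl.
    mxring.
  have : rn (h *m (f' y - f' x)) <= 6 * k * D * D.
    rewrite E; have := rnB (u3 - u2) u1; have := rnB u3 u2; rewrite expr2 in h1 h2.
    have e4 : (2 * D) ^+ 2 = 4 * (D * D) by ring.
    rewrite e4 in zx2; have : 0 <= k * (D * D) by rewrite !mulr_ge0.
    rlra.
  rewrite row_delta rnZ ab_rc ger0_norm // [leRHS]mulrC ler_pM2l //.
  by rewrite lt_def Dn.
pose B := rn (f' p) + 6 * k * s.
have B0 : 0 <= B by rewrite addr_ge0 ?rn_ge0 // !mulr_ge0 // ltW.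
have fB (x : 'rV[C R]_a) : rn (x - p) < s -> rn (f' x) <= B.
  move=> xs; have ps : rn (p - p) < s by rewrite subrr rn0.
  have h1 := L _ _ ps xs; have h2 := rnD (f' x - f' p) (f' p).
  rewrite subrK in h2.
  have h3 : 6 * k * rn (x - p) <= 6 * k * s by rewrite ler_wpM2l ?mulr_ge0 // ltW.
  by rewrite /B; rlra.
exists s, (1 + 7 * k + B + 2 * k * s + a%:R * B); split => //.
- by rewrite addrAC; have := ler0n R a; rnra.
- move=> x y xs ys.
  have xr : rn (x - p) < r by rlra.
  have yr : rn (y - p) < r by rlra.
  apply: le_trans (T' _ _ xr yr) _; rewrite ler_wpM2r ?exprn_ge0 ?rn_ge0 //.
  by have := ler0n R a; rnra.
- move=> x y xs ys; apply: le_trans (L _ _ xs ys) _; rewrite ler_wpM2r ?rn_ge0 //.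
  by have := ler0n R a; rnra.
- move=> x xs; apply: le_trans (fB _ xs) _.
  by have := ler0n R a; rnra.
- move=> x y xs ys.
  have xr : rn (x - p) < r by rlra.
  have yr : rn (y - p) < r by rlra.
  have h1 := T' _ _ xr yr.
  have h2 := rnD (f y - f x - (y - x) *m f' x) ((y - x) *m f' x).
  rewrite subrK in h2.
  have h3 := rn_mulmx (y - x) (f' x); have h4 := fB _ xs.
  have D2 : rn (y - x) <= 2 * s.
    by have := rn_dist y p x; rewrite (rn_distC p); rlra.
  have d0 := rn_ge0 (y - x); set d := rn (y - x) in h1 h3 d0 D2 *.
  have h5 : k * d ^+ 2 <= 2 * k * s * d.
    rewrite expr2 mulrA ler_wpM2r //; have := ler_wpM2l k0 D2; rlra.
  have h6 : a%:R * d * rn (f' x) <= a%:R * B * d.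
    by rewrite [leRHS]mulrAC ler_wpM2l // mulr_ge0.
  have := ler0n R a; rnra.
Qed.

Lemma nice_qhol a b (f : 'rV[C R]_a -> 'rV[C R]_b) f' p r K :
  nice f f' p r K -> qhol_with f f' p.
Proof. by case=> r0 K0 T _ _ _; exists r, K. Qed.

Lemma qhol_near a b (f : 'rV[C R]_a -> 'rV[C R]_b) f' p : qhol_with f f' p ->
  exists2 r, 0 < r & forall x : 'rV[C R]_a, rn (x - p) < r -> qhol_with f f' x.
Proof.
move=> [r [K [r0 T]]]; exists (r / 2); first by rlra.
move=> x xr; exists (r / 2), K; split; first by rlra.
by move=> y z yx zx; apply: T;
  [have := rn_dist y x p | have := rn_dist z x p]; rlra.
Qed.

Lemma qhol_with_ext a b (f g : 'rV[C R]_a -> 'rV[C R]_b) f' p r : 0 < r ->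
  (forall x : 'rV[C R]_a, rn (x - p) < r -> f x = g x) -> qhol_with f f' p -> qhol_with g f' p.
Proof.
move=> r0 fg [s [K [s0 T]]]; exists (Num.min r s), K; rewrite lt_min r0; split => //.
by move=> x y; rewrite !lt_min => /andP[xr xs] /andP[yr ys]; rewrite -!fg //; exact: T.
Qed.

Lemma qhol_ext a b (f g : 'rV[C R]_a -> 'rV[C R]_b) p r : 0 < r ->
  (forall x : 'rV[C R]_a, rn (x - p) < r -> f x = g x) -> qhol f p -> qhol g p.
Proof. by move=> r0 fg [f' h]; exists f'; exact: qhol_with_ext fg h. Qed.

(** Testing on t times a basis vector and dividing by t bounds the corresponding row by a multiple
    of t; let t tend to 0. *)
Lemma rn_lin_small a b (A : 'M[C R]_(a, b)) r K : 0 < r ->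
  (forall h : 'rV_a, rn h < r -> rn (h *m A) <= K * rn h ^+ 2) -> A = 0.
Proof.
move=> r0 h; apply/row_matrixP => i; rewrite row0; apply: rn_small => e e0.
pose t := Num.min (r / 2) (e / (1 + `|K|)).
have K0 := normr_ge0 K.
have t0 : 0 < t by rewrite lt_min !divr_gt0 // ltr_pwDl.
have tr : t < r by rewrite gt_min; apply/orP; left; rlra.
have te : t * (1 + `|K|) <= e by rewrite -ler_pdivlMr ?ltr_pwDl // ge_min lexx orbT.
have tE : rn (rc t *: delta_mx 0 i : 'rV[C R]_a) = t.
  by rewrite rnZ rn_delta mulr1 ab_rc gtr0_norm.
have := h (rc t *: delta_mx 0 i); rewrite tE => /(_ tr).
rewrite row_delta rnZ ab_rc gtr0_norm // [leRHS]mulrC expr2 -mulrA ler_pM2l //.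
have := ler_norm K; rnra.
Qed.

Lemma qhol_uniq a b (f : 'rV[C R]_a -> 'rV[C R]_b) f' g' p :
  qhol_with f f' p -> qhol_with f g' p -> f' p = g' p.
Proof.
move=> [r [K [r0 T]]] [s [L [s0 S]]]; apply/eqP; rewrite -subr_eq0; apply/eqP.
have m0 : 0 < Num.min r s by rewrite lt_min r0.
apply: (rn_lin_small (K := K + L) m0) => h; rewrite lt_min => /andP[hr hs].
have pr : rn (p - p) < r by rewrite subrr rn0.
have ps : rn (p - p) < s by rewrite subrr rn0.
have := T p (p + h) pr; have := S p (p + h) ps; have -> : p + h - p = h by rewrite addrC addKr.
move=> S1 T1.
have E : h *m (f' p - g' p) =
    (f (p + h) - f p - h *m g' p) - (f (p + h) - f p - h *m f' p).
  by rewrite mulmxBr; mxring.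
rewrite E; have := rnB (f (p + h) - f p - h *m g' p) (f (p + h) - f p - h *m f' p).
by have := T1 hr; have := S1 hs; rlra.
Qed.

Lemma qhol_with_comp a b c (f : 'rV[C R]_a -> 'rV[C R]_b) f'
    (g : 'rV[C R]_b -> 'rV[C R]_c) g' p :
  qhol_with f f' p -> qhol_with g g' (f p) ->
  qhol_with (g \o f) (fun x => f' x *m g' (f x)) p.
Proof.
move=> /qhol_nice[r [K [r0 K0 fT fL' fB fL]]] /qhol_nice[s [L [s0 L0 gT gL' gB gL]]].
exists (Num.min r (s / K)), (b%:R * K * L + L * K ^+ 2).
rewrite lt_min r0 divr_gt0 //; split => // x y; rewrite !lt_min => /andP[xr xs] /andP[yr ys].
have pr : rn (p - p) < r by rewrite subrr rn0.
have fs (z : 'rV[C R]_a) : rn (z - p) < r -> rn (z - p) < s / K -> rn (f z - f p) < s.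
  move=> zr zs; apply: le_lt_trans (fL _ _ pr zr) _.
  by rewrite mulrC -ltr_pdivlMr.
have h1 := gT _ _ (fs x xr xs) (fs y yr ys).
have h2 := rn_mulmx (f y - f x - (y - x) *m f' x) (g' (f x)).
have h3 := fT _ _ xr yr; have h4 := gB _ (fs x xr xs); have h5 := fL _ _ xr yr.
have -> : (g \o f) y - (g \o f) x - (y - x) *m (f' x *m g' (f x)) =
  (g (f y) - g (f x) - (f y - f x) *m g' (f x)) +
  (f y - f x - (y - x) *m f' x) *m g' (f x).
  by rewrite /= mulmxA (mulmxBl (f y - f x)) addrA subrK.
apply: le_trans (rnD _ _) _.
have d0 := rn_ge0 (y - x); set d := rn (y - x) in h3 h5 d0 *.
have h6 : L * rn (f y - f x) ^+ 2 <= L * K ^+ 2 * d ^+ 2.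
  rewrite -mulrA ler_wpM2l ?(ltW L0) // -exprMn lerXn2r ?nnegrE ?rn_ge0 //.
  by rewrite mulr_ge0 // ltW.
have h7 : b%:R * rn (f y - f x - (y - x) *m f' x) * rn (g' (f x)) <=
    b%:R * (K * d ^+ 2) * L.
  apply: ler_pM => //; rewrite ?mulr_ge0 ?rn_ge0 //.
  by apply: ler_wpM2l.
rlra.
Qed.

Lemma qhol_comp a b c (f : 'rV[C R]_a -> 'rV[C R]_b) (g : 'rV[C R]_b -> 'rV[C R]_c) p :
  qhol f p -> qhol g (f p) -> qhol (g \o f) p.
Proof. by move=> [f' hf] [g' hg]; eexists; exact: qhol_with_comp hf hg. Qed.

Lemma qhol_with_affine a b (A : 'M[C R]_(a, b)) (c : 'rV[C R]_b) p :
  qhol_with (fun x => x *m A + c) (fun=> A) p.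
Proof.
exists 1, 0; split => // x y _ _.
by rewrite opprD addrACA subrr addr0 mulmxBl subrr rn0 mul0r.
Qed.

Lemma qhol_with_add a b (f g : 'rV[C R]_a -> 'rV[C R]_b) f' g' p :
  qhol_with f f' p -> qhol_with g g' p ->
  qhol_with (fun x => f x + g x) (fun x => f' x + g' x) p.
Proof.
move=> [r [K [r0 T]]] [s [L [s0 S]]]; exists (Num.min r s), (K + L).
rewrite lt_min r0; split => // x y; rewrite !lt_min => /andP[xr xs] /andP[yr ys].
have -> : f y + g y - (f x + g x) - (y - x) *m (f' x + g' x) =
  (f y - f x - (y - x) *m f' x) + (g y - g x - (y - x) *m g' x).
  by rewrite mulmxDr; mxring.
apply: le_trans (rnD _ _) _; rewrite mulrDl lerD //; [exact: T|exact: S].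
Qed.

Lemma qhol_with_sum a b (I : Type) (s : seq I) (f : I -> 'rV[C R]_a -> 'rV[C R]_b)
    f' p : (forall i, qhol_with (f i) (f' i) p) ->
  qhol_with (fun x => \sum_(i <- s) f i x) (fun x => \sum_(i <- s) f' i x) p.
Proof.
move=> h; elim: s => [|i s ih].
  exists 1, 0; split => // x y _ _; rewrite !big_nil mulmx0 !subr0 rn0.
  by rewrite mul0r.
have := qhol_with_add (h i) ih.
move=> [r [K [r0 T]]]; exists r, K; split => // x y xr yr.
by rewrite !big_cons; exact: T.
Qed.

Lemma qhol_with_mulr a b c (f : 'rV[C R]_a -> 'rV[C R]_b) f' (A : 'M[C R]_(b, c)) p :
  qhol_with f f' p -> qhol_with (fun x => f x *m A) (fun x => f' x *m A) p.
Proof.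
move=> h; have := qhol_with_comp h (qhol_with_affine A 0 _).
by apply: qhol_with_ext; [exact: ltr01|move=> x _ /=; rewrite addr0].
Qed.

Lemma qhol_with_row a b c (f : 'rV[C R]_a -> 'rV[C R]_b) f'
   (g : 'rV[C R]_a -> 'rV[C R]_c) g' p :
  qhol_with f f' p -> qhol_with g g' p ->
  qhol_with (fun x => row_mx (f x) (g x)) (fun x => row_mx (f' x) (g' x)) p.
Proof.
move=> [r [K [r0 T]]] [s [L [s0 S]]]; exists (Num.min r s), (`|K| + `|L|).
rewrite lt_min r0; split => // x y; rewrite !lt_min => /andP[xr xs] /andP[yr ys].
rewrite mul_mx_row !opp_row_mx !add_row_mx mulrDl.
have d0 : 0 <= rn (y - x) ^+ 2 by rewrite exprn_ge0 // rn_ge0.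
have hK : K * rn (y - x) ^+ 2 <= `|K| * rn (y - x) ^+ 2.
  by rewrite ler_wpM2r // ler_norm.
have hL : L * rn (y - x) ^+ 2 <= `|L| * rn (y - x) ^+ 2.
  by rewrite ler_wpM2r // ler_norm.
apply: rn_row_mx.
  apply: le_trans (T _ _ xr yr) _; apply: le_trans hK _.
  by rewrite lerDl mulr_ge0.
apply: le_trans (S _ _ xs ys) _; apply: le_trans hL _.
by rewrite lerDr mulr_ge0.
Qed.

(** A scalar function is encoded with values in 1 x 1 matrices, so that scaling is a matrix product
    and the product rule stays within row vectors. *)
Lemma qhol_with_smul a b (s : 'rV[C R]_a -> 'rV[C R]_1) s' (f : 'rV[C R]_a -> 'rV[C R]_b)
    f' p : qhol_with s s' p -> qhol_with f f' p ->
  qhol_with (fun x => s x *m f x) (fun x => s' x *m f x + s x 0 0 *: f' x) p.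
Proof.
move=> /qhol_nice[r [K [r0 K0 sT sL' sB sL]]] /qhol_nice[t [L [t0 L0 fT fL' fB fL]]].
pose F := rn (f p) + L * t; pose S := rn (s p) + K * r.
have rp q : 0 < q -> rn (p - p) < q by rewrite subrr rn0.
have F0 : 0 <= F by rewrite addr_ge0 ?rn_ge0 // mulr_ge0 // ltW.
have S0 : 0 <= S by rewrite addr_ge0 ?rn_ge0 // mulr_ge0 // ltW.
exists (Num.min r t), (K * F + S * L + K * L).
rewrite lt_min r0; split => // x y; rewrite !lt_min => /andP[xr xt] /andP[yr yt].
have fx : rn (f x) <= F.
  have := fL _ _ (rp _ t0) xt; have := rnD (f x - f p) (f p); rewrite subrK.
  by have := ler_wpM2l (ltW L0) (ltW xt); rewrite /F; rlra.
have sx : rn (s x) <= S.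
  have := sL _ _ (rp _ r0) xr; have := rnD (s x - s p) (s p); rewrite subrK.
  by have := ler_wpM2l (ltW K0) (ltW xr); rewrite /S; rlra.
have sE z : s z = (s z 0 0)%:M by exact: mx11_scalar.
have -> : s y *m f y - s x *m f x - (y - x) *m (s' x *m f x + s x 0 0 *: f' x) =
  (s y - s x - (y - x) *m s' x) *m f x + s x *m (f y - f x - (y - x) *m f' x)
  + (s y - s x) *m (f y - f x).
  have -> : (y - x) *m (s' x *m f x + s x 0 0 *: f' x) =
      (y - x) *m s' x *m f x + s x *m ((y - x) *m f' x).
    by rewrite mulmxDr mulmxA -scalemxAr {2}(sE x) mul_scalar_mx.
  move: ((y - x) *m s' x) ((y - x) *m f' x) => u w.
  by rewrite !(mulmxBl, mulmxBr); mxring.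
have d0 := rn_ge0 (y - x).
have h1 := sT _ _ xr yr; have h2 := fT _ _ xt yt.
have h3 := sL _ _ xr yr; have h4 := fL _ _ xt yt.
set d := rn (y - x) in d0 h1 h2 h3 h4 *.
have g (u : 'rV[C R]_1) (v : 'rV[C R]_b) e1 e2 : rn u <= e1 -> rn v <= e2 ->
    rn (u *m v) <= e1 * e2.
  move=> ue ve; apply: le_trans (rn_mulmx _ _) _.
  by rewrite mul1r ler_pM ?rn_ge0.
apply: le_trans (rnD _ _) _; have := rnD ((s y - s x - (y - x) *m s' x) *m f x)
  (s x *m (f y - f x - (y - x) *m f' x)).
have := g _ _ _ _ h1 fx; have := g _ _ _ _ sx h2; have := g _ _ _ _ h3 h4.
have -> : K * d * (L * d) = K * L * d ^+ 2 by ring.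
rlra.
Qed.

Lemma mulmxr_continuous a b (A : 'M[C R]_(a, b)) :
  continuous (mulmxr A : 'rV[C R]_a -> 'rV[C R]_b).
Proof.
move=> x N /nbhs_rn[e e0 h]; apply/nbhs_rn.
have c0 : 0 < a%:R * rn A + 1.
  by apply: ltr_wpDl => //; rewrite mulr_ge0 ?rn_ge0.
exists (e / (a%:R * rn A + 1)); first by rewrite divr_gt0.
move=> y; rewrite ltr_pdivlMr // => yx; apply: h => /=.
rewrite -mulmxBl; apply: le_lt_trans (rn_mulmx _ _) _.
apply: le_lt_trans yx; rewrite mulrAC mulrC ler_wpM2l ?rn_ge0 //.
by rewrite lerDl ler01.
Qed.

Lemma diff_of_estimate (V W : normedModType (C R)) (f : V -> W)
    (df : {linear V -> W}) p : continuous df ->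
  (forall e : R, 0 < e -> exists2 d : R, 0 < d & forall y : V, `|y| < rc d ->
     `|f (y + p) - f p - df y| <= rc e * `|y|) ->
  differentiable f p /\ 'd f p = df :> (V -> W).
Proof.
move=> cd h.
have fE : f \o shift p = cst (f p) + df +o_ (0 : V) id.
  apply/eqaddoP => e e0.
  have eE : rc (complex.Re e) = e by rewrite /rc RRe_real // gtr0_real.
  have re0 : 0 < complex.Re e by rewrite -rc_lt eE.
  have [d d0 hd] := h _ re0; apply/nbhs_norm_real; exists d => // y.
  rewrite subr0 => /hd; rewrite eE.
  by congr (`| _ | <= _); rewrite !fctE /= opprD addrA.
have dE := diff_unique cd fE; split => //.
by apply/diff_locallyP; rewrite dE.
Qed.

(** The bridge back to [differentiable], through which the projection onto the orbit space is
    finally recognized as a holomorphic submersion. *)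
Lemma qhol_diff a b (f : 'rV[C R]_a -> 'rV[C R]_b) f' p :
  qhol_with f f' p -> differentiable f p /\ 'd f p = mulmxr (f' p) :> (_ -> _).
Proof.
move=> [r [K [r0 T]]]; apply: diff_of_estimate; first exact: mulmxr_continuous.
move=> e e0; exists (Num.min r (e / (1 + `|K|))).
  by rewrite lt_min r0 divr_gt0 // ltr_pwDl.
move=> y; rewrite -!rcrn rc_lt lt_min ltr_pdivlMr ?ltr_pwDl // => /andP[yr ye] /=.
rewrite -rcM rc_le.
have pr : rn (p - p) < r by rewrite subrr rn0.
have ypr : rn (y + p - p) < r by rewrite addrK.
have := T _ _ pr ypr; rewrite addrK => h.
apply: le_trans h _; rewrite expr2 mulrA ler_wpM2r ?rn_ge0 //.
apply: le_trans (ltW ye); rewrite mulrC ler_wpM2l ?rn_ge0 //.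
by have := ler_norm K; rlra.
Qed.
End QuadraticDifferentiability.

(** * Contractions and the inverse function theorem *)

Section InverseFunction.
Context {R : realType}.

Lemma pow2_small (B e : R) : 0 < e -> exists N, forall j, (N <= j)%N ->
  B * (2^-1) ^+ j <= e.
Proof.
move=> e0; exists (Num.truncn (`|B| / e)).+1 => j Nj.
have h1 : `|B| / e < j%:R.
  apply: lt_le_trans (_ : (Num.truncn (`|B| / e)).+1%:R <= _); last by rewrite ler_nat.
  by rewrite truncnS_gt.
have h2 : j%:R <= 2 ^+ j :> R.
  by rewrite -natrX ler_nat ltnW // ltn_expl.
rewrite exprVn ler_pdivrMr ?exprn_gt0 //.
rewrite ltr_pdivrMr // in h1; have := ler_norm B; nra.
Qed.

(** The partial sums stay bounded, so they have an ultralimit, and the geometric bound on the tails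
    passes to it. *)
Lemma geometric_limit n (u : nat -> 'rV[C R]_n) B :
  (forall j, rn (u j.+1 - u j) <= B * (2^-1) ^+ j) ->
  exists l : 'rV[C R]_n, forall j, rn (l - u j) <= 2 * B * (2^-1) ^+ j.
Proof.
move=> uB; have B0 : 0 <= B by have := uB 0%N; rewrite expr0 mulr1; apply: le_trans; exact: rn_ge0.
have p0 j : 0 <= (2^-1) ^+ j :> R by rewrite exprn_ge0.
have H j i : rn (u (j + i)%N - u j) <= 2 * B * (2^-1) ^+ j.
  suff: rn (u (j + i)%N - u j) <= 2 * B * (2^-1) ^+ j - 2 * B * (2^-1) ^+ (j + i).
    by move/le_trans; apply; rewrite gerBl mulr_ge0 // mulr_ge0.
  elim: i => [|i ih]; first by rewrite addn0 !subrr rn0.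
  have := uB (j + i)%N; have := rn_dist (u (j + i).+1) (u (j + i)%N) (u j).
  rewrite addnS exprS; have := p0 (j + i)%N; rlra.
have [j|l lP] := ulim (u := u) (B := rn (u 0%N) + 2 * B).
  have := H 0%N j; rewrite add0n expr0 mulr1; have := rnD (u j - u 0%N) (u 0%N).
  by rewrite subrK; rlra.
exists l => j; apply/ler_addgt0Pr => e e0.
have [i [/= il ji]] := natU_ex (natUI (lP e e0) (natU_ge j)).
have := H j (i - j)%N; rewrite subnKC //; have := rn_dist l (u i) (u j).
by rewrite (rn_distC l (u i)); rlra.
Qed.

Lemma contraction_fixpoint n (T : 'rV[C R]_n -> 'rV[C R]_n) p r : 0 <= r ->
  (forall x : 'rV[C R]_n, rn (x - p) <= r -> rn (T x - p) <= r) ->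
  (forall x y : 'rV[C R]_n, rn (x - p) <= r -> rn (y - p) <= r ->
     rn (T x - T y) <= 2^-1 * rn (x - y)) ->
  exists2 x, rn (x - p) <= r & T x = x.
Proof.
move=> r0 Tr Tc; pose u j := iter j T p.
have ur j : rn (u j - p) <= r.
  by elim: j => [|j ih]; [rewrite subrr rn0|apply: Tr].
have du j : rn (u j.+1 - u j) <= r * (2^-1) ^+ j.
  elim: j => [|j ih]; first by rewrite expr0 mulr1; exact: ur 1%N.
  have := Tc _ _ (ur j.+1) (ur j); rewrite -/(u j.+2) exprS.
  by move/le_trans; apply; rewrite mulrCA ler_pM2l // invr_gt0.
have [l lP] := geometric_limit du.
have lr : rn (l - p) <= r.
  apply/ler_addgt0Pr => e e0; have [N NP] := pow2_small (2 * r) e0.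
  have := lP N; have := NP N (leqnn N); have := ur N; have := rn_dist l (u N) p.
  by rlra.
exists l => //; apply/eqP; rewrite -subr_eq0; apply/eqP; apply: rn_small => e e0.
have e4 : 0 < e / 4 by rewrite divr_gt0.
have [N NP] := pow2_small (2 * r) e4.
have h1 := lP N; have h2 := lP N.+1; have h3 := NP N (leqnn N).
have h4 := NP N.+1 (leqnSn N); have h5 := Tc _ _ lr (ur N).
have h6 := rn_dist (T l) (u N.+1) l; rewrite (rn_distC (u N.+1)) in h6.
by have e1 : rn (T l - u N.+1) <= 2^-1 * rn (l - u N) by []; rlra.
Qed.

(** A vector v of the left kernel would satisfy |v| = |v (A - 1)| <= |v| / 2. *)
Lemma near1_unit n (A : 'M[C R]_n) : n%:R * rn (A - 1%:M) <= 2^-1 -> A \in unitmx.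
Proof.
move=> h; rewrite -row_free_unit -kermx_eq0; apply/eqP/row_matrixP => i.
rewrite row0; apply: rn_le0.
have : row i (kermx A) *m A = 0 by rewrite -row_mul mulmx_ker row0.
move: (row i (kermx A)) => v vA.
have := rn_mulmx v (A - 1%:M); rewrite mulmxBr vA mulmx1 sub0r rnN.
have := rn_ge0 v; rewrite mulrAC; have := ler_wpM2l (rn_ge0 v) h; rlra.
Qed.

Lemma near1_inv n (A : 'M[C R]_n) (v : 'rV[C R]_n) :
  n%:R * rn (A - 1%:M) <= 2^-1 -> rn (v *m invmx A) <= 2 * rn v.
Proof.
move=> h; have Au := near1_unit h; set w := v *m _.
have -> : v = w + w *m (A - 1%:M).
  by rewrite mulmxBr mulmx1 /w mulmxKV // subrKC.
have := rn_mulmx w (A - 1%:M); have := ler_wpM2l (rn_ge0 w) h.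
have := rn_sub w (- (w *m (A - 1%:M))); rewrite opprK rnN mulrAC; rlra.
Qed.

(** Near p the map f - id has Lipschitz constant 1/2, so x |-> x + z - f x is a contraction and f is
    injective with a Lipschitz inverse. The quadratic remainder of the inverse is that of f
    multiplied by the inverse matrix of f' at g x. *)
Lemma inverse_function n (f : 'rV[C R]_n -> 'rV[C R]_n) f' p :
  qhol_with f f' p -> f' p = 1%:M ->
  exists (r1 r2 : R) (g : 'rV[C R]_n -> 'rV[C R]_n) g', [/\ 0 < r1, 0 < r2,
    (forall x y : 'rV[C R]_n, rn (x - p) < r1 -> rn (y - p) < r1 ->
       rn (x - y) <= 2 * rn (f x - f y)),
    (forall z : 'rV[C R]_n, rn (z - f p) < r2 ->
       f (g z) = z /\ rn (g z - p) <= 2 * rn (z - f p) /\ rn (g z - p) < r1) &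
    qhol_with g g' (f p) /\ g' (f p) = 1%:M].
Proof.
move=> /qhol_nice[r [K H]] f1.
have r0 := nice_r H; have K0 := nice_K H.
have c0 : 0 < 1 + 16 * (n%:R + 1) * K.
  by rewrite ltr_pwDl // !mulr_ge0 // ?ltW // addr_ge0.
(* This choice bounds both K r1 and n K r1 by 1/16. The remainder and the variation of f' then
   contribute at most 1/4 each to the Lipschitz constant of f - id. *)
have [r1 r10 [r1r r1K]] : exists2 r1 : R, 0 < r1 & r1 <= r / 2 /\ r1 * (1 + 16 * (n%:R + 1) * K) <= 1.
  exists (Num.min (r / 2) (1 / (1 + 16 * (n%:R + 1) * K))).
    by rewrite lt_min !divr_gt0.
  split; first by rewrite ge_min lexx.
  by rewrite -ler_pdivlMr // ge_min lexx orbT.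
have n0 : 0 <= n%:R :> R by [].
have n1 : 0 <= n%:R * (K * r1) by rewrite !mulr_ge0 // ltW.
have Kr0 : 0 <= K * r1 by rewrite mulr_ge0 // ltW.
have Kr : K * r1 <= 16^-1 by nra.
have nKr : n%:R * (K * r1) <= 16^-1 by nra.
have in_r (x : 'rV[C R]_n) : rn (x - p) <= r1 -> rn (x - p) < r by move=> h; rlra.
have pr : rn (p - p) < r by rewrite subrr rn0.
have f'1 (x : 'rV[C R]_n) : rn (x - p) <= r1 -> n%:R * rn (f' x - 1%:M) <= 4^-1.
  move=> xr; have := nice_L H pr (in_r _ xr); rewrite f1 => h.
  have h1 : K * rn (x - p) <= K * r1 by rewrite ler_pM2l.
  have h2 := ler_wpM2l n0 (le_trans h h1).
  by apply: le_trans h2 _; lra.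
have f'2 (x : 'rV[C R]_n) : rn (x - p) <= r1 -> n%:R * rn (f' x - 1%:M) <= 2^-1.
  by move=> /f'1 h; lra.
have lip (x y : 'rV[C R]_n) : rn (x - p) <= r1 -> rn (y - p) <= r1 ->
    rn ((f x - f y) - (x - y)) <= 2^-1 * rn (x - y).
  move=> xr yr; have h1 := nice_T H (in_r _ yr) (in_r _ xr).
  have E : (f x - f y) - (x - y) =
    (f x - f y - (x - y) *m f' y) + (x - y) *m (f' y - 1%:M).
    by rewrite mulmxBr mulmx1; mxring.
  rewrite E; have h2 := rn_mulmx (x - y) (f' y - 1%:M).
  have d0 := rn_ge0 (x - y).
  have h3 := ler_wpM2l d0 (f'1 _ yr).
  have h4 : K * rn (x - y) <= 4^-1.
    have h5 : rn (x - y) <= 2 * r1.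
      by have := rn_dist x p y; rewrite (rn_distC p); rlra.
    have := ler_wpM2l (ltW K0) h5; rewrite mulrCA; rlra.
  have h6 := ler_wpM2r d0 h4.
  have := rnD (f x - f y - (x - y) *m f' y) ((x - y) *m (f' y - 1%:M)).
  rewrite expr2 mulrA in h1; rewrite mulrAC mulrC in h2; rlra.
have inj (x y : 'rV[C R]_n) : rn (x - p) <= r1 -> rn (y - p) <= r1 ->
    rn (x - y) <= 2 * rn (f x - f y).
  move=> xr yr; have := lip _ _ xr yr.
  have E : x - y = (f x - f y) - ((f x - f y) - (x - y)) by mxring.
  have := rnB (f x - f y) ((f x - f y) - (x - y)); rewrite -E; rlra.
have [r2 r20 r2E] : exists2 r2 : R, 0 < r2 & r1 = 4 * r2.
  by exists (r1 / 4); lra.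
have sol (z : 'rV[C R]_n) : rn (z - f p) < r2 -> exists2 x, rn (x - p) <= r1 / 2 & f x = z.
  move=> zr.
  have [||x y xr yr|x xr fx] := @contraction_fixpoint n (fun x => x + z - f x) p (r1 / 2).
  - by lra.
  - move=> x xr; have xr1 : rn (x - p) <= r1 by rlra.
    have pr1 : rn (p - p) <= r1 by rewrite subrr rn0 ltW.
    have h := lip _ _ xr1 pr1.
    have E : x + z - f x - p = (z - f p) - ((f x - f p) - (x - p)) by mxring.
    rewrite E; have := rnB (z - f p) ((f x - f p) - (x - p)); rlra.
  - have h := lip _ _ (_ : rn (x - p) <= r1) (_ : rn (y - p) <= r1).
    have E : x + z - f x - (y + z - f y) = - ((f x - f y) - (x - y)) by mxring.
    by rewrite E rnN; apply: h; rlra.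
  - exists x => //; have E : f x = (x + z) - (x + z - f x) by mxring.
    by rewrite E fx; mxring.
pose g z := xget p [set x : 'rV[C R]_n | rn (x - p) <= r1 / 2 /\ f x = z].
have gP (z : 'rV[C R]_n) : rn (z - f p) < r2 -> rn (g z - p) <= r1 / 2 /\ f (g z) = z.
  by move=> /sol[x xr fx]; rewrite /g; case: xgetP => [y -> []|/(_ x)] //=; case.
have gr (z : 'rV[C R]_n) : rn (z - f p) < r2 -> rn (g z - p) <= r1.
  by move=> /gP[h _]; rlra.
have pr1 : rn (p - p) <= r1 by rewrite subrr rn0 ltW.
exists r1, r2, g, (fun z => invmx (f' (g z))); split => //.
- by move=> x y xr yr; apply: inj; exact: ltW.
- move=> z zr; have [h1 h2] := gP _ zr; split => //; split; last by rlra.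
  by have := inj _ _ (gr _ zr) pr1; rewrite h2.
split; last first.
  have fpr : rn (f p - f p) < r2 by rewrite subrr rn0.
  have [_ h2] := gP _ fpr; have := inj _ _ (gr _ fpr) pr1.
  rewrite h2 subrr rn0 mulr0 => /rn_le0/eqP; rewrite subr_eq0 => /eqP ->.
  by rewrite f1 invmx1.
exists r2, (8 * K); split => // x y xr yr.
have [_ fx] := gP _ xr; have [_ fy] := gP _ yr.
have h := f'2 _ (gr _ xr); have u := near1_unit h.
have h1 := nice_T H (in_r _ (gr _ xr)) (in_r _ (gr _ yr)).
have h2 := inj _ _ (gr _ yr) (gr _ xr); rewrite fx fy in h1 h2.
have E : g y - g x - (y - x) *m invmx (f' (g x)) =
    - ((y - x - (g y - g x) *m f' (g x)) *m invmx (f' (g x))).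
  by rewrite [in RHS]mulmxBl mulmxK //; mxring.
rewrite E rnN; apply: le_trans (near1_inv _ h) _.
have h3 : rn (g y - g x) ^+ 2 <= (2 * rn (y - x)) ^+ 2.
  by rewrite lerXn2r ?nnegrE ?mulr_ge0 ?rn_ge0.
have := ler_wpM2l (ltW K0) h3; rewrite exprMn; rlra.
Qed.
End InverseFunction.

(** * Openness of submersions; derivatives of curves *)

Section CurveDerivative.
Context {R : realType}.

(** If S F'(p) = 1, the restriction of F to the affine slice y |-> y S + p has derivative 1 at 0,
    and the inverse function theorem applies to it. *)
Lemma submersion_open a n (F : 'rV[C R]_a -> 'rV[C R]_n) F' p :
  qhol_with F F' p -> row_full (F' p) -> forall e : R, 0 < e ->
  exists2 d : R, 0 < d & forall z : 'rV[C R]_n, rn (z - F p) < d ->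
    exists2 x : 'rV[C R]_a, rn (x - p) < e & F x = z.
Proof.
move=> hF /row_fullP[S SF] e e0.
have h0 : qhol_with (fun y => y *m S + p) (fun=> S) (0 : 'rV[C R]_n).
  exact: qhol_with_affine.
have hc : qhol_with (F \o (fun y => y *m S + p))
    (fun y => S *m F' (y *m S + p)) (0 : 'rV[C R]_n).
  by apply: (qhol_with_comp h0); rewrite mul0mx add0r.
have [|r1 [r2 [g [g' [r10 r20 _ gP _]]]]] := inverse_function hc.
  by rewrite mul0mx add0r.
have c0 : 0 < 2 * (n%:R * (rn S + 1)) + 1 :> R.
  by apply: ltr_wpDl => //; rewrite !mulr_ge0 // addr_ge0 // rn_ge0.
exists (Num.min r2 (e / (2 * (n%:R * (rn S + 1)) + 1))).
  by rewrite lt_min r20 divr_gt0.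
have E0 : (F \o (fun y => y *m S + p)) 0 = F p by rewrite /= mul0mx add0r.
move=> z; rewrite lt_min ltr_pdivlMr // => /andP[zr ze].
rewrite E0 in gP; have [fg [gz _]] := gP _ zr.
exists (g z *m S + p) => //; rewrite addrK subr0 in gz *.
apply: le_lt_trans ze; apply: le_trans (rn_mulmx _ _) _.
have z0 := rn_ge0 (z - F p); have s0 := rn_ge0 S.
have h1 : n%:R * rn (g z) * rn S <= n%:R * (2 * rn (z - F p)) * rn S.
  by rewrite ler_wpM2r // ler_wpM2l.
have n0 := ler0n R n; apply: le_trans h1 _.
have : 0 <= n%:R * rn (z - F p) by rewrite mulr_ge0.
by move: z0 s0; gen_rn; nra.
Qed.

(** An epsilon-delta form, because the time is real while the values lie in a complex vector
    space. *)
Definition hasd n (y : R -> 'rV[C R]_n) (t : R) (v : 'rV[C R]_n) :=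
  forall e : R, 0 < e -> exists2 d : R, 0 < d & forall s, `|s - t| < d ->
    rn (y s - y t - rc (s - t) *: v) <= e * `|s - t|.

Lemma hasd_ext n (y z : R -> 'rV[C R]_n) t v d : 0 < d ->
  (forall s, `|s - t| < d -> y s = z s) -> hasd y t v -> hasd z t v.
Proof.
move=> d0 yz h e e0; have [d' d'0 hd] := h e e0.
exists (Num.min d d'); first by rewrite lt_min d0.
have tt : `|t - t| < d by rewrite subrr normr0.
by move=> s; rewrite lt_min => /andP[sd sd']; rewrite -!yz //; exact: hd.
Qed.

Lemma hasd_lip n (y : R -> 'rV[C R]_n) t v e : 0 < e -> hasd y t v ->
  exists2 d : R, 0 < d & forall s, `|s - t| < d ->
    rn (y s - y t) <= (rn v + e) * `|s - t|.
Proof.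
move=> e0 /(_ e e0)[d d0 h]; exists d => // s /h.
have := rnD (y s - y t - rc (s - t) *: v) (rc (s - t) *: v).
by rewrite subrK rnZ ab_rc; rlra.
Qed.

Lemma hasd_const n (c : 'rV[C R]_n) t : hasd (fun=> c) t 0.
Proof.
move=> e e0; exists 1 => // s _.
by rewrite subrr scaler0 subr0 rn0 mulr_ge0 // ltW.
Qed.

Lemma hasd_line n (c v : 'rV[C R]_n) t : hasd (fun s => c + rc s *: v) t v.
Proof.
move=> e e0; exists 1 => // s _.
have -> : c + rc s *: v - (c + rc t *: v) - rc (s - t) *: v = 0.
  by rewrite rcB; mxring.
by rewrite rn0 mulr_ge0 // ltW.
Qed.

Lemma hasd_add n (y z : R -> 'rV[C R]_n) t v w :
  hasd y t v -> hasd z t w -> hasd (fun s => y s + z s) t (v + w).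
Proof.
move=> hy hz e e0; have e2 : 0 < e / 2 by rewrite divr_gt0.
have [d d0 h] := hy _ e2; have [d' d'0 h'] := hz _ e2.
exists (Num.min d d'); first by rewrite lt_min d0.
move=> s; rewrite lt_min => /andP[/h h1 /h' h2].
have -> : y s + z s - (y t + z t) - rc (s - t) *: (v + w) =
  (y s - y t - rc (s - t) *: v) + (z s - z t - rc (s - t) *: w) by mxring.
have := rnD (y s - y t - rc (s - t) *: v) (z s - z t - rc (s - t) *: w); rlra.
Qed.

Lemma hasd_qhol n m (f : 'rV[C R]_n -> 'rV[C R]_m) f' (y : R -> 'rV[C R]_n) t v :
  qhol_with f f' (y t) -> hasd y t v -> hasd (f \o y) t (v *m f' (y t)).
Proof.
move=> [r [K [r0 T]]] hy e e0.
pose V := rn v + 1; have V0 : 0 < V by rewrite ltr_wpDl ?rn_ge0.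
pose A := n%:R * rn (f' (y t)) + 1.
have A0 : 0 < A by rewrite ltr_wpDl ?mulr_ge0 ?rn_ge0.
have [d1 d10 h1] := hasd_lip ltr01 hy.
have e2 : 0 < e / (2 * A) by rewrite divr_gt0 // mulr_gt0.
have [d2 d20 h2] := hy _ e2.
pose B := 2 * (1 + `|K|) * V ^+ 2.
have B0 : 0 < B by rewrite !mulr_gt0 ?exprn_gt0 // ltr_pwDl.
exists (Num.min d1 (Num.min d2 (Num.min (r / V) (e / B)))).
  by rewrite !lt_min d10 d20 !divr_gt0.
move=> s; rewrite !lt_min => /andP[s1 /andP[s2 /andP[sr se]]].
have {h1}h1 := h1 _ s1; have {h2}h2 := h2 _ s2.
have yr : rn (y t - y t) < r by rewrite subrr rn0.
have sr' : rn (y s - y t) < r.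
  by apply: le_lt_trans h1 _; rewrite mulrC -ltr_pdivlMr.
have h3 := T _ _ yr sr'.
set D := `|s - t| in h1 h2 se *.
have D0 : 0 <= D by exact: normr_ge0.
have -> : (f \o y) s - (f \o y) t - rc (s - t) *: (v *m f' (y t)) =
  (f (y s) - f (y t) - (y s - y t) *m f' (y t)) +
  (y s - y t - rc (s - t) *: v) *m f' (y t).
  by rewrite (mulmxBl (y s - y t)) -scalemxAl /= ; mxring.
apply: le_trans (rnD _ _) _.
have h4 := rn_mulmx (y s - y t - rc (s - t) *: v) (f' (y t)).
have h5 : n%:R * rn (y s - y t - rc (s - t) *: v) * rn (f' (y t)) <= e / 2 * D.
  have -> : e / 2 * D = A * (e / (2 * A) * D) by field; lra.
  rewrite mulrAC; apply: ler_pM => //; rewrite ?mulr_ge0 ?rn_ge0 //.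
  by rewrite /A lerDl.
have h6 : K * rn (y s - y t) ^+ 2 <= e / 2 * D.
  have k1 : rn (y s - y t) ^+ 2 <= (V * D) ^+ 2.
    by rewrite lerXn2r ?nnegrE ?rn_ge0 // mulr_ge0 // ltW.
  have k2 : (1 + `|K|) * (V * D) ^+ 2 <= e / 2 * D.
    have : D * B <= e by rewrite -ler_pdivlMr // ltW.
    rewrite /B; have := D0; rewrite exprMn; nra.
  apply: le_trans k2; apply: le_trans (_ : (1 + `|K|) * rn (y s - y t) ^+ 2 <= _).
    rewrite ler_wpM2r ?exprn_ge0 ?rn_ge0 //.
    by apply: le_trans (ler_norm K) _; rewrite lerDr.
  by rewrite ler_wpM2l // addr_ge0.
by rlra.
Qed.

Lemma hasd_mulr n m (A : 'M[C R]_(n, m)) (y : R -> 'rV[C R]_n) t v :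
  hasd y t v -> hasd (fun s => y s *m A) t (v *m A).
Proof.
move=> h; have := hasd_qhol (qhol_with_affine A 0 (y t)) h.
by apply: hasd_ext ltr01 _ => s _ /=; rewrite addr0.
Qed.

Lemma hasd_opp n (y : R -> 'rV[C R]_n) t v : hasd y t v -> hasd (fun s => - y s) t (- v).
Proof.
move=> h; have := hasd_mulr (- 1%:M) h; rewrite mulmxN mulmx1.
by apply: hasd_ext ltr01 _ => s _; rewrite mulmxN mulmx1.
Qed.

Lemma hasd_sub n (y z : R -> 'rV[C R]_n) t v w :
  hasd y t v -> hasd z t w -> hasd (fun s => y s - z s) t (v - w).
Proof. by move=> hy /hasd_opp; exact: hasd_add. Qed.

Lemma hasd_row n m (y : R -> 'rV[C R]_n) (z : R -> 'rV[C R]_m) t v w :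
  hasd y t v -> hasd z t w -> hasd (fun s => row_mx (y s) (z s)) t (row_mx v w).
Proof.
move=> hy hz e e0; have [d d0 h] := hy _ e0; have [d' d'0 h'] := hz _ e0.
exists (Num.min d d'); first by rewrite lt_min d0.
move=> s; rewrite lt_min => /andP[/h h1 /h' h2].
by rewrite scale_row_mx !opp_row_mx !add_row_mx rn_row_mx.
Qed.

Lemma hasd_rescale n (y : R -> 'rV[C R]_n) (c t : R) v :
  hasd y (c * t) v -> hasd (fun s => y (c * s)) t (rc c *: v).
Proof.
move=> h e e0; have c0 : 0 < 1 + `|c| by rewrite ltr_pwDl.
have ec : 0 < e / (1 + `|c|) by rewrite divr_gt0.
have [d d0 hd] := h _ ec; exists (d / (1 + `|c|)); first by rewrite divr_gt0.
move=> s; rewrite ltr_pdivlMr // => sd.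
have D0 : 0 <= `|s - t| by [].
have csd : `|c * s - c * t| <= (1 + `|c|) * `|s - t|.
  by rewrite -mulrBr normrM ler_wpM2r // lerDr.
have := hd (c * s); rewrite scalerA -rcM [(s - t) * c]mulrC mulrBr => h1.
apply: le_trans (h1 _) _; first by apply: le_lt_trans csd _; rewrite mulrC.
apply: le_trans (ler_wpM2l (ltW ec) csd) _.
by rewrite mulrA divfK // gt_eqF.
Qed.

Lemma hasd_shift n (y : R -> 'rV[C R]_n) (c t : R) v :
  hasd y (c + t) v -> hasd (fun s => y (c + s)) t v.
Proof.
move=> h e e0; have [d d0 hd] := h _ e0; exists d => // s sd.
have E : c + s - (c + t) = s - t by ring.
by have := hd (c + s); rewrite E => /(_ sd).
Qed.

Lemma hasd_uniq n (y : R -> 'rV[C R]_n) t v w : hasd y t v -> hasd y t w -> v = w.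
Proof.
move=> hv hw; apply/eqP; rewrite -subr_eq0; apply/eqP; apply: rn_small => e e0.
have e2 : 0 < e / 2 by rewrite divr_gt0.
have [d d0 h] := hasd_sub hv hw e2.
have td : `|t + d / 2 - t| = d / 2.
  by rewrite addrAC subrr add0r gtr0_norm; lra.
have tdd : `|t + d / 2 - t| < d by rewrite td; lra.
have := h _ tdd; rewrite td !subrr sub0r rnN rnZ ab_rc td mulrC ler_pM2r ?divr_gt0 //.
by rlra.
Qed.

(* Real induction: the set of s for which the bound with constant K + e holds
   on [a, s] contains its supremum and cannot stop before b. *)
Lemma mean_value_bound n (y y' : R -> 'rV[C R]_n) a b K : a <= b ->
  (forall t, a <= t <= b -> hasd y t (y' t)) ->
  (forall t, a <= t <= b -> rn (y' t) <= K) ->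
  rn (y b - y a) <= K * (b - a).
Proof.
move=> ab hy hK; apply/ler_addgt0Pr => e0 e00.
have [e e_gt0 eE] : exists2 e : R, 0 < e & e * (b - a) <= e0.
  exists (e0 / (1 + (b - a))); first by rewrite divr_gt0 //; lra.
  rewrite mulrAC ler_pdivrMr; last by lra.
  by rewrite ler_pM2l //; lra.
pose S := [set s | a <= s <= b /\ rn (y s - y a) <= (K + e) * (s - a)].
have Sa : S a by split; [rewrite lexx|rewrite !subrr rn0 mulr0].
have Sb : ubound S b by move=> s [/andP[]].
have supS : has_sup S by split; [exists a|exists b].
pose c := sup S.
have ac : a <= c by apply: ub_le_sup => //; exists b.
have cb : c <= b by apply: ge_sup => //; exists a.
have cab : a <= c <= b by rewrite ac cb.
have [d d0 hd] := hasd_lip e_gt0 (hy _ cab).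
have hd' s : `|s - c| < d -> rn (y s - y c) <= (K + e) * `|s - c|.
  move=> /hd/le_trans; apply; rewrite ler_wpM2r // lerD2r; exact: hK.
have Sc : S c.
  split => //; have [s Ss cs] := sup_adherent d0 supS.
  have sc : s <= c by apply: ub_le_sup => //; exists b.
  case: Ss => sab hs; have nE : `|s - c| = c - s by rewrite distrC ger0_norm // subr_ge0.
  have scd : `|s - c| < d by rewrite nE /c; lra.
  have := hd' _ scd; rewrite nE rn_distC.
  have := rn_dist (y c) (y s) (y a); rlra.
have [cE|cNb] := eqVneq c b.
  by case: Sc; rewrite cE => _ h; lra.
have {}cb : c < b by rewrite lt_neqAle cNb.
pose s := Num.min b (c + d / 2).
have cs : c < s by rewrite lt_min cb /=; lra.
have sd : s <= c + d / 2 by rewrite ge_min lexx orbT.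
have nE : `|s - c| = s - c by rewrite ger0_norm // subr_ge0 ltW.
have : S s.
  split; first by rewrite (le_trans ac (ltW cs)) ge_min lexx.
  have scd : `|s - c| < d by rewrite nE; lra.
  have := hd' _ scd; rewrite nE.
  by case: Sc => _; have := rn_dist (y s) (y c) (y a); rlra.
move=> Ss; have : s <= c by apply: ub_le_sup => //; exists b.
by rewrite leNgt cs.
Qed.
End CurveDerivative.

(** * Primitives of continuous curves *)

Section Primitive.
Context {R : realType}.

Lemma real_primitive (g : R -> R) (T : R) : continuous g ->
  exists2 G : R -> R, G 0 = 0 & forall t, `|t| < T -> forall e : R, 0 < e ->
    exists2 d : R, 0 < d & forall s, `|s - t| < d ->
      `|G s - G t - (s - t) * g t| <= e * `|s - t|.
Proof.
move=> cg; pose F := fun x : R => \int[lebesgue_measure]_(t in [set` Interval (BLeft (- T)) (BRight x)]) g t.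
exists (fun x => F x - F 0); first by rewrite subrr.
move=> t; rewrite ltr_norml => /andP[Tt tT] e e0.
have ig : lebesgue_measure.-integrable [set` Interval (BLeft (- T)) (BRight T)] (EFin \o g).
  apply: continuous_compact_integrable; first exact: segment_compact.
  by apply: continuous_subspaceT.
have [|dF dE] := continuous_FTC1 tT ig _ (cg t); first by rewrite /= lte_fin.
move: dF => /cvg_ex[l /= dl].
have lE : l = g t.
  rewrite -dE derive1E /derive; apply/esym/cvg_lim => //.
move/cvgrPdist_le : dl => /(_ _ e0).
rewrite near_withinE => /nbhs_normP[d /= d0 hd]; exists d => // s sd.
have -> : F s - F 0 - (F t - F 0) - (s - t) * g t = F s - F t - (s - t) * g t by ring.
have [->|st] := eqVneq s t; first by rewrite !subrr mul0r subrr normr0 mulr0.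
have st0 : s - t != 0 by rewrite subr_eq0.
have := hd (s - t); rewrite /ball_ /= sub0r normrN => /(_ sd st0).
rewrite [_ *: 1]mulr1 subrK lE [_ *: _]/(_ * _) => h.
have -> : F s - F t - (s - t) * g t = - ((s - t) * (g t - (s - t)^-1 * (F s - F t))).
  by field.
by rewrite normrN normrM mulrC ler_wpM2r.
Qed.

Definition continuous_curve n (y : R -> 'rV[C R]_n) :=
  forall t (e : R), 0 < e -> exists2 d : R, 0 < d & forall s, `|s - t| < d ->
    rn (y s - y t) <= e.

Lemma primitive n (f : R -> 'rV[C R]_n) (T : R) : continuous_curve f ->
  exists2 F : R -> 'rV[C R]_n, F 0 = 0 & forall t, `|t| < T -> hasd F t (f t).
Proof.
move=> cf.
have H (p : C R -> R) : (forall z, `|p z| <= ab z) -> {morph p : z w / z - w} ->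
    exists G : 'I_n -> R -> R, forall i, G i 0 = 0 /\ forall t, `|t| < T ->
    forall e : R, 0 < e -> exists2 d : R, 0 < d & forall s, `|s - t| < d ->
      `|G i s - G i t - (s - t) * p (f t 0 i)| <= e * `|s - t|.
  move=> pB pD.
  have pc i : continuous (fun t => p (f t 0 i)).
    move=> t; apply/cvgrPdist_le => e e0; have [d d0 hd] := cf t e e0.
    apply/nbhs_normP; exists d => // s /=; rewrite distrC => /hd h.
    rewrite distrC -pD; apply: le_trans (pB _) _; apply: le_trans h.
    by have := rn_coord (f s - f t) 0 i; rewrite !mxE.
  have hG i : exists G : R -> R, G 0 = 0 /\ forall t, `|t| < T ->
    forall e : R, 0 < e -> exists2 d : R, 0 < d & forall s, `|s - t| < d ->
      `|G s - G t - (s - t) * p (f t 0 i)| <= e * `|s - t|.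
    by have [G G0 GP] := real_primitive T (pc i); exists G.
  exact: (fin_all_exists hG).
have [G1 G1P] := H _ (@ab_Re _) (fun z w => ltac:(by case: z; case: w)).
have [G2 G2P] := H _ (@ab_Im _) (fun z w => ltac:(by case: z; case: w)).
exists (fun t => \row_i (G1 i t +i* G2 i t)%C).
  by apply/rowP => i; rewrite !mxE (G1P i).1 (G2P i).1.
move=> t tT e e0; have e2 : 0 < e / 2 by rewrite divr_gt0.
have h1 i : exists d : R, 0 < d /\ forall s, `|s - t| < d ->
   `|G1 i s - G1 i t - (s - t) * complex.Re (f t 0 i)| <= e / 2 * `|s - t| /\
   `|G2 i s - G2 i t - (s - t) * complex.Im (f t 0 i)| <= e / 2 * `|s - t|.
  have [d d0 hd] := (G1P i).2 t tT _ e2; have [d' d'0 hd'] := (G2P i).2 t tT _ e2.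
  exists (Num.min d d'); rewrite lt_min d0; split => // s.
  by rewrite lt_min => /andP[s1 s2]; split; [exact: hd|exact: hd'].
have [d dP] := fin_all_exists h1.
exists (\big[Num.min/1]_i d i).
  by apply/bigmin_gtP; split => // i _; exact: (dP i).1.
move=> s sd; apply: rn_mx_le; first by rewrite mulr_ge0 // ltW.
move=> i0 i; rewrite !mxE; apply: le_trans (ab_ReIm _) _.
have sdi : `|s - t| < d i by apply: lt_le_trans sd _; exact: bigmin_le_cond.
have [] := (dP i).2 s sdi.
rewrite (ord1 i0); case: (f t 0 i) => a b /=.
rewrite !mul0r subr0 addr0; move: (`|s - t|) => D; lra.
Qed.
End Primitive.

(** * Gronwall estimate and Picard iteration *)

Section Flow.
Context {R : realType}.

Lemma hasd_of_primitive n (y : R -> 'rV[C R]_n) t v e : 0 < e ->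
  hasd y t v -> exists2 d : R, 0 < d & forall s, `|s - t| < d -> rn (y s - y t) <= e.
Proof.
move=> e0 /(hasd_lip ltr01)[d d0 hd].
have v0 := rn_ge0 v; have c0 : 0 < rn v + 1 by rlra.
exists (Num.min d (e / (rn v + 1))); first by rewrite lt_min d0 divr_gt0.
move=> s; rewrite lt_min ltr_pdivlMr // => /andP[/hd h1 h2].
by apply: le_trans h1 _; rewrite mulrC ltW.
Qed.

(** Freezing the time outside [-T, T] turns a curve given on this interval into one on the whole
    line, as [primitive] requires. *)
Definition clamp (T t : R) := Num.max (- T) (Num.min T t).

Lemma clamp_in T t : 0 <= T -> `|clamp T t| <= T.
Proof.
move=> T0; rewrite ler_norml /clamp le_max lexx /= ge_max.
by rewrite ge_min lexx andbT; lra.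
Qed.

Lemma clamp_id T t : `|t| <= T -> clamp T t = t.
Proof. by rewrite ler_norml /clamp => /andP[h1 h2]; rewrite min_r // max_r. Qed.

Lemma clamp_lip T s t : 0 <= T -> `|clamp T s - clamp T t| <= `|s - t|.
Proof.
move=> _; rewrite /clamp.
have hM (a x y : R) : `|Num.max a x - Num.max a y| <= `|x - y|.
  have := ler_norm (x - y); have := ler_norm (y - x); rewrite (distrC y) ler_norml.
  by case: (leP a x) => ?; case: (leP a y) => ?; lra.
have hm (a x y : R) : `|Num.min a x - Num.min a y| <= `|x - y|.
  have := ler_norm (x - y); have := ler_norm (y - x); rewrite (distrC y) ler_norml.
  by case: (leP a x) => ?; case: (leP a y) => ?; lra.
exact: le_trans (hM _ _ _) (hm _ _ _).
Qed.

Lemma mean_value_bound0 n (y y' : R -> 'rV[C R]_n) T K :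
  (forall t, `|t| < T -> hasd y t (y' t)) ->
  (forall t, `|t| < T -> rn (y' t) <= K) ->
  forall t, `|t| < T -> rn (y t - y 0) <= K * `|t|.
Proof.
move=> hy hK t tT; have [t0|t0] := leP 0 t.
  have H s : 0 <= s <= t -> `|s| < T.
    by move: tT; rewrite ger0_norm // => tT /andP[s0 st]; rewrite ger0_norm //; lra.
  rewrite ger0_norm // -[X in _ <= K * X]subr0.
  by apply: (mean_value_bound (y' := y')) => // s /H; [exact: hy|exact: hK].
have H s : t <= s <= 0 -> `|s| < T.
  by move: tT; rewrite ltr0_norm // => tT /andP[s0 st]; rewrite ler0_norm //; lra.
rewrite ltr0_norm // -[X in _ <= K * X]add0r rn_distC.
by apply: (mean_value_bound (y' := y')); rewrite ?(ltW t0) // => s /H; [exact: hy|exact: hK].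
Qed.

(** On an interval so short that 2 L T <= 1, the mean value inequality bounds the supremum of |u| by
    the data plus half of itself; no exponential is involved. *)
Lemma gronwall n (u u' : R -> 'rV[C R]_n) T L A :
  0 <= L -> 2 * L * T <= 1 -> (forall t, `|t| < T -> hasd u t (u' t)) ->
  (exists B, forall t, `|t| < T -> rn (u t) <= B) ->
  (forall t, `|t| < T -> rn (u' t) <= L * rn (u t) + A) ->
  forall t, `|t| < T -> rn (u t) <= 2 * (rn (u 0) + `|A| * T).
Proof.
move=> L0 LT hu [B uB] hu' t tT.
have T0 : 0 < T by apply: le_lt_trans tT.
pose S := [set rn (u s) | s in [set s | `|s| < T]].
have supS : has_sup S.
  by split; [exists (rn (u t)); exists t|exists B => _ [s sT <-]; exact: uB].
have leS s : `|s| < T -> rn (u s) <= sup S.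
  by move=> sT; apply: ub_le_sup; [case: supS|exists s].
have S0 : 0 <= sup S by apply: le_trans (leS _ tT); exact: rn_ge0.
have A0 := normr_ge0 A; have AA := ler_norm A.
have K0 : 0 <= L * sup S + `|A| by rewrite addr_ge0 // mulr_ge0.
have H s : `|s| < T -> rn (u s) <= rn (u 0) + (L * sup S + `|A|) * T.
  move=> sT; have h : rn (u s - u 0) <= (L * sup S + `|A|) * `|s|.
    apply: (mean_value_bound0 hu) => // r rT; apply: le_trans (hu' _ rT) _.
    by rewrite lerD // ler_wpM2l // leS.
  have h2 : (L * sup S + `|A|) * `|s| <= (L * sup S + `|A|) * T.
    by rewrite ler_wpM2l // ltW.
  by have := rnD (u s - u 0) (u 0); rewrite subrK; rlra.
have hS : sup S <= rn (u 0) + (L * sup S + `|A|) * T.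
  by apply: ge_sup; [case: supS|move=> _ [s sT <-]; exact: H].
apply: le_trans (leS _ tT) _.
have : L * sup S * T <= sup S / 2.
  by have := ler_wpM2r S0 LT; rewrite mul1r; nra.
move: (rn (u 0)) hS => r; nra.
Qed.

(** The iterates are controlled on the closed interval [-T, T]; clamping makes each of them a
    primitive on an interval of radius 2 T, so that the endpoints are interior points. They converge
    geometrically to some y. Applying the Picard operator once more gives a z that is differentiable
    by construction, and y = z on [-T, T]. *)
Lemma picard n (F : 'rV[C R]_n -> 'rV[C R]_n) p w r L B T :
  0 < r -> 0 <= L -> 0 <= B -> 0 < T -> 4 * L * T <= 1 -> 2 * B * T <= r ->
  (forall x y : 'rV[C R]_n, rn (x - p) < 2 * r -> rn (y - p) < 2 * r ->
     rn (F x - F y) <= L * rn (x - y)) ->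
  (forall x : 'rV[C R]_n, rn (x - p) < 2 * r -> rn (F x) <= B) ->
  rn (w - p) < r ->
  exists2 y : R -> 'rV[C R]_n, y 0 = w &
    forall t, `|t| < T -> rn (y t - p) < 2 * r /\ hasd y t (F (y t)).
Proof.
move=> r0 L0 B0 T0 LT BT FL FB wr.
have T2 : 0 < 2 * T by lra.
have step (y : R -> 'rV[C R]_n) : (forall t, `|t| <= T -> rn (y t - p) < 2 * r) ->
    (forall s t, `|s| <= T -> `|t| <= T -> rn (y s - y t) <= B * `|s - t|) ->
  exists z : R -> 'rV[C R]_n, [/\ z 0 = w,
    forall t, `|t| <= T -> rn (z t - p) < 2 * r,
    forall s t, `|s| <= T -> `|t| <= T -> rn (z s - z t) <= B * `|s - t| &
    forall t, `|t| < 2 * T -> hasd z t (F (y (clamp T t)))].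
  move=> yr yL; have T0' := ltW T0.
  have cF : continuous_curve (fun t => F (y (clamp T t))).
    move=> t e e0; have c0 : 0 < L * B + 1 by rewrite ltr_wpDl // mulr_ge0.
    exists (e / (L * B + 1)); first by rewrite divr_gt0.
    move=> s; rewrite ltr_pdivlMr // => st.
    have cs := clamp_in s T0'; have ct := clamp_in t T0'.
    apply: le_trans (FL _ _ (yr _ cs) (yr _ ct)) _.
    have h1 := ler_wpM2l L0 (yL _ _ cs ct).
    have h2 := ler_wpM2l B0 (clamp_lip s t T0').
    have h3 := ler_wpM2l L0 h2.
    by move: (`|s - t|) (normr_ge0 (s - t)) st h3 => D D0 st h3; rlra.
  have [G G0 GP] := primitive (2 * T) cF.
  have zP t : `|t| < 2 * T -> hasd (fun t => w + G t) t (F (y (clamp T t))).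
    by move=> /GP h; have := hasd_add (hasd_const w t) h; rewrite add0r.
  have zL s t : `|s| <= T -> `|t| <= T -> rn (w + G s - (w + G t)) <= B * `|s - t|.
    wlog st : s t / t <= s => [H sT tT|sT tT].
      have [ts|/ltW st] := leP t s; first exact: H.
      by rewrite rn_distC distrC; exact: H.
    rewrite ger0_norm ?subr_ge0 //.
    apply: (@mean_value_bound _ _ (fun t => w + G t)
      (fun t => F (y (clamp T t))) t s B) => // q /andP[tq qs].
      by apply: zP; move: sT tT; rewrite !ler_norml ltr_norml; lra.
    by apply: FB; apply: yr; exact: clamp_in.
  exists (fun t => w + G t); split => //; first by rewrite G0 addr0.
  move=> t tT; have := zL t 0 tT; rewrite normr0 subr0 => /(_ T0').
  have h1 := ler_wpM2l B0 tT.
  have := rnD (w + G t - (w + G 0)) (w - p).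
  have -> : w + G t - (w + G 0) + (w - p) = w + G t - p by rewrite G0; mxring.
  by rewrite !G0; rlra.
pose good (y : R -> 'rV[C R]_n) := (forall t, `|t| <= T -> rn (y t - p) < 2 * r) /\
    (forall s t, `|s| <= T -> `|t| <= T -> rn (y s - y t) <= B * `|s - t|).
pose next (y : R -> 'rV[C R]_n) := xget y [set z : R -> 'rV[C R]_n | [/\ z 0 = w, good z &
    forall t, `|t| < 2 * T -> hasd z t (F (y (clamp T t)))]].
have nextP y : good y -> [/\ next y 0 = w, good (next y) &
    forall t, `|t| < 2 * T -> hasd (next y) t (F (y (clamp T t)))].
  move=> [y1 y2]; rewrite /next; case: xgetP => [z _ //|h].
  by have [z [z0 z1 z2 z3]] := step y y1 y2; have := h z; case.
have Y0 : good (fun=> w).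
  split=> [t _|s t _ _]; first by lra.
  by rewrite subrr rn0 mulr_ge0.
have [Y [Yg Yw Yn]] : exists Y : nat -> R -> 'rV[C R]_n, [/\ forall j, good (Y j),
    forall j, Y j 0 = w &
    forall j t, `|t| < 2 * T -> hasd (Y j.+1) t (F (Y j (clamp T t)))].
  have Yg j : good (iter j next (fun=> w)) by elim: j => // j /nextP[].
  exists (fun j => iter j next (fun=> w)); split => //.
    by case=> // j; have [] := nextP _ (Yg j).
  by move=> j; have [] := nextP _ (Yg j).
have dY j t : `|t| <= T -> rn (Y j.+1 t - Y j t) <= 2 * r * (2^-1) ^+ j.
  elim: j t => [|j ih] t tT.
    rewrite expr0 mulr1.
    have t0 : `|0 : R| <= T by rewrite normr0 ltW.
    have := (Yg 1%N).2 _ _ tT t0; have := (Yg 0%N).2 _ _ tT t0.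
    rewrite !Yw subr0 (rn_distC (Y 0%N t)); have h5 := ler_wpM2l B0 tT.
    by have := rn_dist (Y 1%N t) w (Y 0%N t); rlra.
  have h s : `|s| < 2 * T -> hasd (fun t => Y j.+2 t - Y j.+1 t) s
     (F (Y j.+1 (clamp T s)) - F (Y j (clamp T s))).
    by move=> sT; apply: hasd_sub; exact: Yn.
  have q0 : 0 <= (2^-1) ^+ j :> R by rewrite exprn_ge0.
  have hb s : `|s| < 2 * T -> rn (F (Y j.+1 (clamp T s)) - F (Y j (clamp T s))) <=
      L * (2 * r * (2^-1) ^+ j).
    move=> _; have cs := clamp_in s (ltW T0).
    apply: le_trans (FL _ _ ((Yg _).1 _ cs) ((Yg _).1 _ cs)) _.
    by rewrite ler_wpM2l // ih.
  have tT2 : `|t| < 2 * T by lra.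
  have h5 : rn (Y j.+2 t - Y j.+1 t) <= L * (2 * r * (2^-1) ^+ j) * `|t|.
    have := @mean_value_bound0 _ (fun t => Y j.+2 t - Y j.+1 t)
      (fun s => F (Y j.+1 (clamp T s)) - F (Y j (clamp T s))) _ _ h hb t tT2.
    by rewrite /= !Yw subrr subr0.
  have -> : 2 * r * 2^-1 ^+ j.+1 = 2^-1 * (2 * r * 2^-1 ^+ j) :> R.
    by rewrite exprS; ring.
  apply: le_trans h5 _.
  have h6 := ler_wpM2l L0 tT.
  have h7 : 0 <= 2 * r * (2^-1) ^+ j by rewrite !mulr_ge0 // ltW.
  have := ler_wpM2l h7 h6; have := ler_wpM2l h7 LT.
  by move: (2 * r * (2^-1) ^+ j) h7 (`|t|) => q h7 z; lra.
have lim t : exists l : 'rV[C R]_n, `|t| <= T -> forall j, rn (l - Y j t) <= 2 * (2 * r) * (2^-1) ^+ j.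
  have [tT|tT] := boolP (`|t| <= T); last by exists 0.
  by have [l lP] := geometric_limit (fun j => dY j t tT); exists l.
have [y yP] : exists y : R -> 'rV[C R]_n, forall t, `|t| <= T ->
    forall j, rn (y t - Y j t) <= 2 * (2 * r) * (2^-1) ^+ j.
  exists (fun t => sval (cid (lim t))) => t; by case: (cid (lim t)).
have yL s t : `|s| <= T -> `|t| <= T -> rn (y s - y t) <= B * `|s - t|.
  move=> sT tT; apply/ler_addgt0Pr => e e0; have e2 : 0 < e / 2 by lra.
  have [N NP] := pow2_small (2 * (2 * r)) e2.
  have := NP N (leqnn N); have := yP _ sT N; have := yP _ tT N.
  have := (Yg N).2 _ _ sT tT.
  have := rn_dist (y s) (Y N s) (y t); have := rn_dist (Y N s) (Y N t) (y t).
  by rewrite (rn_distC (Y N t)); rlra.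
have y0 : y 0 = w.
  apply/eqP; rewrite -subr_eq0; apply/eqP; apply: rn_small => e e0.
  have [N NP] := pow2_small (2 * (2 * r)) e0.
  have T0' : `|0 : R| <= T by rewrite normr0 ltW.
  by have := yP _ T0' N; have := NP N (leqnn N); rewrite Yw; rlra.
have yr t : `|t| <= T -> rn (y t - p) < 2 * r.
  move=> tT; have := yL t 0 tT; rewrite normr0 subr0 y0 => /(_ (ltW T0)).
  have := ler_wpM2l B0 tT; have := rn_dist (y t) w p; rlra.
have [z [z0 zr zL zP]] := step y yr yL.
have yz t : `|t| <= T -> y t = z t.
  move=> tT; apply/eqP; rewrite -subr_eq0; apply/eqP; apply: rn_small => e e0.
  have e2 : 0 < e / 2 by lra.
  have [N NP] := pow2_small (2 * (2 * r)) e2.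
  have h s : `|s| < 2 * T -> hasd (fun t => z t - Y N.+1 t) s
     (F (y (clamp T s)) - F (Y N (clamp T s))).
    by move=> sT; apply: hasd_sub; [exact: zP|exact: Yn].
  have hb s : `|s| < 2 * T -> rn (F (y (clamp T s)) - F (Y N (clamp T s))) <=
      L * (e / 2).
    move=> _; have cs := clamp_in s (ltW T0).
    apply: le_trans (FL _ _ (yr _ cs) ((Yg _).1 _ cs)) _.
    by rewrite ler_wpM2l //; apply: le_trans (yP _ cs N) _; exact: NP.
  have tT2 : `|t| < 2 * T by lra.
  have h5 : rn (z t - Y N.+1 t) <= L * (e / 2) * `|t|.
    have := @mean_value_bound0 _ (fun t => z t - Y N.+1 t)
      (fun s => F (y (clamp T s)) - F (Y N (clamp T s))) _ _ h hb t tT2.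
    by rewrite /= z0 Yw subrr subr0.
  have h6 := ler_wpM2l L0 tT; have h7 : 0 <= e / 2 by lra.
  have h8 := ler_wpM2l h7 h6; have h9 := ler_wpM2l h7 LT.
  have := yP _ tT N.+1; have := NP N.+1 (leqnSn N).
  have := rn_dist (y t) (Y N.+1 t) (z t); rewrite (rn_distC (Y N.+1 t)).
  by rlra.
exists z => // t tT; split; first by apply: zr; exact: ltW.
have tT2 : `|t| < 2 * T by lra.
by have := zP _ tT2; rewrite clamp_id ?yz //; exact: ltW.
Qed.
End Flow.

(** * Holomorphic dependence of a local flow on the initial point *)

Section FlowDependence.
Context {R : realType}.

Lemma hasd_sum n (I : Type) (s : seq I) (y : I -> R -> 'rV[C R]_n) v t :
  (forall i, hasd (y i) t (v i)) ->
  hasd (fun r => \sum_(i <- s) y i r) t (\sum_(i <- s) v i).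
Proof.
move=> h; elim: s => [|i s ih].
  rewrite big_nil; apply: hasd_ext ltr01 _ (hasd_const _ _) => r _.
  by rewrite big_nil.
rewrite big_cons; apply: hasd_ext ltr01 _ (hasd_add (h i) ih) => r _.
by rewrite big_cons.
Qed.

Lemma lsubmxE n m (x : 'rV[C R]_(n + m)) : lsubmx x = x *m col_mx 1%:M 0.
Proof. by rewrite -[in RHS](hsubmxK x) mul_row_col mulmx1 mulmx0 addr0. Qed.

Lemma rsubmxE n m (x : 'rV[C R]_(n + m)) : rsubmx x = x *m col_mx 0 1%:M.
Proof. by rewrite -[in RHS](hsubmxK x) mul_row_col mulmx1 mulmx0 add0r. Qed.

Lemma hasd_lsub n m (y : R -> 'rV[C R]_(n + m)) t v :
  hasd y t v -> hasd (fun s => lsubmx (y s)) t (lsubmx v).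
Proof.
move=> /(hasd_mulr (col_mx 1%:M 0)); rewrite -lsubmxE.
by apply: hasd_ext ltr01 _ => s _; rewrite lsubmxE.
Qed.

Lemma hasd_rsub n m (y : R -> 'rV[C R]_(n + m)) t v :
  hasd y t v -> hasd (fun s => rsubmx (y s)) t (rsubmx v).
Proof.
move=> /(hasd_mulr (col_mx 0 1%:M)); rewrite -rsubmxE.
by apply: hasd_ext ltr01 _ => s _; rewrite rsubmxE.
Qed.

Lemma hasd_scale n (c : C R) (y : R -> 'rV[C R]_n) t v :
  hasd y t v -> hasd (fun s => c *: y s) t (c *: v).
Proof.
move=> /(hasd_mulr c%:M); rewrite mul_mx_scalar.
by apply: hasd_ext ltr01 _ => s _; rewrite mul_mx_scalar.
Qed.

Lemma ode_lipschitz n (F : 'rV[C R]_n -> 'rV[C R]_n) p r L T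
    (y z : R -> 'rV[C R]_n) : 0 <= L -> 2 * L * T <= 1 ->
  (forall x y : 'rV[C R]_n, rn (x - p) < r -> rn (y - p) < r ->
     rn (F x - F y) <= L * rn (x - y)) ->
  (forall t, `|t| < T -> rn (y t - p) < r /\ hasd y t (F (y t))) ->
  (forall t, `|t| < T -> rn (z t - p) < r /\ hasd z t (F (z t))) ->
  forall t, `|t| < T -> rn (y t - z t) <= 2 * rn (y 0 - z 0).
Proof.
move=> L0 LT FL hy hz t tT.
have := @gronwall _ _ (fun t => y t - z t) (fun t => F (y t) - F (z t)) T L 0 L0 LT.
rewrite normr0 mul0r addr0; apply => //.
- by move=> s sT; apply: hasd_sub; [exact: (hy _ sT).2|exact: (hz _ sT).2].
- exists (r + r) => s sT; have := (hy _ sT).1; have := (hz _ sT).1.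
  have := rn_dist (y s) p (z s); rewrite (rn_distC p); rlra.
- by move=> s sT; rewrite addr0; apply: FL; [exact: (hy _ sT).1|exact: (hz _ sT).1].
Qed.

(** The equation is solved together with its linearization h' = h F'(y), as one Lipschitz system G
    on C^(n + n). The solutions of the linearized equation form the candidate derivative D, and the
    Gronwall estimate for y_b - y_a - (b - a) D_a, whose equation has a quadratically small source
    term, is the required remainder bound. *)
Lemma local_flow n (F : 'rV[C R]_n -> 'rV[C R]_n) F' p (e : R) : qhol_with F F' p -> 0 < e ->
  exists (r T : R) (y : 'rV[C R]_n -> R -> 'rV[C R]_n), [/\ 0 < r, 0 < T,
    forall w : 'rV[C R]_n, rn (w - p) < r -> y w 0 = w,
    forall (w : 'rV[C R]_n) t, rn (w - p) < r -> `|t| < T ->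
      rn (y w t - p) < e /\ hasd (y w) t (F (y w t)) &
    forall (w : 'rV[C R]_n) t, rn (w - p) < r -> `|t| < T -> qhol (y^~ t) w].
Proof.
move=> /qhol_nice[r1 [K H]] e0.
have r10 := nice_r H; have K0 := nice_K H.
have n0 : 0 <= n%:R :> R by [].
have [r r0 [rr1 re]] : exists2 r : R, 0 < r & 2 * r <= r1 /\ 2 * r <= e.
  exists (Num.min r1 e / 2); first by rewrite divr_gt0 // lt_min r10.
  by rewrite mulrC divfK // !ge_min !lexx orbT.
have in1 (x : 'rV[C R]_n) : rn (x - p) < 2 * r -> rn (x - p) < r1.
  by move=> /lt_le_trans; apply.
pose q : 'rV[C R]_(n + n) := row_mx p 0.
pose G (x : 'rV[C R]_(n + n)) := row_mx (F (lsubmx x)) (rsubmx x *m F' (lsubmx x)).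
have inl (x : 'rV[C R]_(n + n)) : rn (x - q) < 2 * r ->
    rn (lsubmx x - p) < 2 * r /\ rn (rsubmx x) < 2 * r.
  have -> : x - q = row_mx (lsubmx x - p) (rsubmx x).
    by rewrite -[in LHS](hsubmxK x) /q opp_row_mx add_row_mx subr0.
  move=> h; split; apply: le_lt_trans h.
    by rewrite -[X in rn X <= _](row_mxKl _ (rsubmx x)); exact: rn_lsub.
  by rewrite -[X in rn X <= _](row_mxKr (lsubmx x - p)); exact: rn_rsub.
pose L := K + n%:R * K + n%:R * (2 * r) * K.
have L1 : 0 <= n%:R * K by rewrite mulr_ge0 // ltW.
have L2 : 0 <= n%:R * (2 * r) * K by rewrite !mulr_ge0 // ltW.
have KL : K <= L by rewrite /L; lra.
have nKL : n%:R * K <= L by rewrite /L; lra.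
have L0 : 0 <= L by rewrite /L; lra.
have FL (x y : 'rV[C R]_n) : rn (x - p) < 2 * r -> rn (y - p) < 2 * r ->
    rn (F x - F y) <= L * rn (x - y).
  move=> xr yr; apply: le_trans (nice_fL H (in1 _ yr) (in1 _ xr)) _.
  by rewrite ler_wpM2r ?rn_ge0.
have GL (x y : 'rV[C R]_(n + n)) : rn (x - q) < 2 * r -> rn (y - q) < 2 * r ->
    rn (G x - G y) <= L * rn (x - y).
  move=> /inl[xl xr] /inl[yl yr].
  have dl : rn (lsubmx x - lsubmx y) <= rn (x - y).
    by rewrite -linearB; exact: rn_lsub.
  have dr : rn (rsubmx x - rsubmx y) <= rn (x - y).
    by rewrite -linearB; exact: rn_rsub.
  rewrite /G opp_row_mx add_row_mx; apply: rn_row_mx.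
    by apply: le_trans (FL _ _ xl yl) _; rewrite ler_wpM2l.
  have -> : rsubmx x *m F' (lsubmx x) - rsubmx y *m F' (lsubmx y) =
     (rsubmx x - rsubmx y) *m F' (lsubmx x) +
     rsubmx y *m (F' (lsubmx x) - F' (lsubmx y)).
    by rewrite (mulmxBl (rsubmx x)) (mulmxBr (rsubmx y)); mxring.
  apply: le_trans (rnD _ _) _.
  have h1 := rn_mulmx (rsubmx x - rsubmx y) (F' (lsubmx x)).
  have h2 := rn_mulmx (rsubmx y) (F' (lsubmx x) - F' (lsubmx y)).
  have h3 := nice_B H (in1 _ xl); have h4 := nice_L H (in1 _ yl) (in1 _ xl).
  have D0 := rn_ge0 (x - y).
  have h5 : n%:R * rn (rsubmx x - rsubmx y) * rn (F' (lsubmx x)) <= n%:R * rn (x - y) * K.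
    by rewrite ler_pM ?mulr_ge0 ?rn_ge0 // ler_wpM2l.
  have h6 : n%:R * rn (rsubmx y) * rn (F' (lsubmx x) - F' (lsubmx y)) <=
      n%:R * (2 * r) * (K * rn (x - y)).
    rewrite ler_pM ?mulr_ge0 ?rn_ge0 // ?ler_wpM2l //; first exact: ltW.
    by apply: le_trans h4 _; rewrite ler_wpM2l // ltW.
  have h7 : 0 <= K * rn (x - y) by rewrite mulr_ge0 // ltW.
  by rewrite /L; rlra.
have pr1 : rn (p - p) < r1 by rewrite subrr rn0.
pose B := rn (F p) + K * (2 * r) + n%:R * (2 * r) * K.
have B0 : 0 <= B by rewrite !addr_ge0 ?rn_ge0 // mulr_ge0 // ?ltW // mulr_gt0.
have GB (x : 'rV[C R]_(n + n)) : rn (x - q) < 2 * r -> rn (G x) <= B.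
  move=> /inl[xl xr]; apply: rn_row_mx.
    have := nice_fL H pr1 (in1 _ xl); have := rnD (F (lsubmx x) - F p) (F p).
    rewrite subrK /B; have := ler_wpM2l (ltW K0) (ltW xl); rlra.
  apply: le_trans (rn_mulmx _ _) _.
  have h : n%:R * rn (rsubmx x) * rn (F' (lsubmx x)) <= n%:R * (2 * r) * K.
    rewrite ler_pM ?mulr_ge0 ?rn_ge0 // ?ler_wpM2l //; first exact: ltW.
    exact: (nice_B H (in1 _ xl)).
  apply: le_trans h _; rewrite /B lerDr addr_ge0 ?rn_ge0 // mulr_ge0 //; first exact: ltW.
  by lra.
have [T T0 [LT BT]] : exists2 T : R, 0 < T & 4 * L * T <= 1 /\ 2 * B * T <= r.
  exists (Num.min (1 / (4 * L + 1)) (r / (2 * B + 1))).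
    by rewrite lt_min !divr_gt0 //; lra.
  set T := Num.min _ _.
  have h1 : T * (4 * L + 1) <= 1 by rewrite -ler_pdivlMr ?ge_min ?lexx //; lra.
  have h2 : T * (2 * B + 1) <= r by rewrite -ler_pdivlMr ?ge_min ?lexx ?orbT //; lra.
  have h3 : 0 < T by rewrite lt_min !divr_gt0 //; lra.
  by clear -h1 h2 h3; split; lra.
have sol (w : 'rV[C R]_(n + n)) : exists y : R -> 'rV[C R]_(n + n), rn (w - q) < r ->
   y 0 = w /\ forall t, `|t| < T -> rn (y t - q) < 2 * r /\ hasd y t (G (y t)).
  have [wr|] := boolP (rn (w - q) < r); last by exists (fun=> 0).
  by have [y y0 yP] := picard r0 L0 B0 T0 LT BT GL GB wr; exists y.
pose Y w := sval (cid (sol w)).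
have YP (w : 'rV[C R]_(n + n)) : rn (w - q) < r -> Y w 0 = w /\
    forall t, `|t| < T -> rn (Y w t - q) < 2 * r /\ hasd (Y w) t (G (Y w t)).
  by rewrite /Y; case: (cid (sol w)).
move: Y YP => Y YP.
have inq (w h : 'rV[C R]_n) : rn (w - p) < r -> rn h < r -> rn (row_mx w h - q) < r.
  move=> wr hr; rewrite /q opp_row_mx add_row_mx subr0.
  have [m [m1 m2 m3]] : exists m, [/\ rn (w - p) <= m, rn h <= m & m < r].
    exists (Num.max (rn (w - p)) (rn h)); rewrite !le_max !lexx orbT; split => //.
    by rewrite gt_max wr.
  by apply: le_lt_trans m3; exact: rn_row_mx.
have LYP (w h : 'rV[C R]_n) : rn (w - p) < r -> rn h < r -> forall t, `|t| < T ->
    rn (lsubmx (Y (row_mx w h) t) - p) < 2 * r /\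
    hasd (fun t => lsubmx (Y (row_mx w h) t)) t (F (lsubmx (Y (row_mx w h) t))).
  move=> wr hr t tT; have [_ /(_ _ tT)[y1 y2]] := YP _ (inq _ _ wr hr).
  split; first exact: (inl _ y1).1.
  by have := hasd_lsub y2; rewrite /G row_mxKl.
have z0 : rn (0 : 'rV[C R]_n) < r by rewrite rn0.
have LT2 : 2 * L * T <= 1.
  have : 0 <= L * T by rewrite mulr_ge0 // ltW.
  by lra.
pose y (w : 'rV[C R]_n) (t : R) := lsubmx (Y (row_mx w 0) t).
(* By uniqueness, the first component of the solution is independent of the auxiliary initial vector
   h. *)
have yY (w h : 'rV[C R]_n) t : rn (w - p) < r -> rn h < r -> `|t| < T ->
    lsubmx (Y (row_mx w h) t) = y w t.
  move=> wr hr tT; apply/eqP; rewrite -subr_eq0; apply/eqP; apply: rn_le0.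
  have := ode_lipschitz L0 LT2 FL (LYP _ _ wr hr) (LYP _ _ wr z0) tT.
  rewrite (YP _ (inq _ _ wr hr)).1 (YP _ (inq _ _ wr z0)).1 !row_mxKl subrr rn0 mulr0.
  by [].
have yP (w : 'rV[C R]_n) t : rn (w - p) < r -> `|t| < T ->
    rn (y w t - p) < 2 * r /\ hasd (y w) t (F (y w t)).
  by move=> wr tT; exact: LYP wr z0 t tT.
have y0 (w : 'rV[C R]_n) : rn (w - p) < r -> y w 0 = w.
  by move=> wr; rewrite /y (YP _ (inq _ _ wr z0)).1 row_mxKl.
exists r, T, y; split => //.
  move=> w t wr tT; have [h1 h2] := yP w t wr tT; split => //.
  exact: lt_le_trans re.
(* The joint system is solved only for |h| < r, so the rows of D are obtained from the initial
   vectors c e_i and divided by c. *)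
have [c c0 cr] : exists2 c : R, 0 < c & c < r by exists (r / 2); lra.
pose E (i : 'I_n) : 'rV[C R]_n := rc c *: delta_mx 0 i.
have Er i : rn (E i) < r by rewrite rnZ rn_delta mulr1 ab_rc gtr0_norm.
pose D w t : 'M[C R]_n := \matrix_(i, j) (rc c^-1 * rsubmx (Y (row_mx w (E i)) t) 0 j).
have rowD w t i : row i (D w t) = rc c^-1 *: rsubmx (Y (row_mx w (E i)) t).
  by apply/rowP => j; rewrite !mxE.
have hDE w t (h : 'rV[C R]_n) :
    h *m D w t = \sum_i (h 0 i * rc c^-1) *: rsubmx (Y (row_mx w (E i)) t).
  by rewrite mulmx_sum_row; apply: eq_bigr => i _; rewrite rowD scalerA.
have D0 (w h : 'rV[C R]_n) : rn (w - p) < r -> h *m D w 0 = h.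
  move=> wr; rewrite [RHS](row_sum_delta h) hDE; apply: eq_bigr => i _.
  rewrite (YP _ (inq _ _ wr (Er i))).1 row_mxKr /E scalerA -mulrA -rcM mulVf ?gt_eqF //.
  by rewrite rc1 mulr1.
have DP (w h : 'rV[C R]_n) t : rn (w - p) < r -> `|t| < T ->
    hasd (fun t => h *m D w t) t (h *m D w t *m F' (y w t)).
  move=> wr tT; rewrite hDE mulmx_suml.
  apply: hasd_ext ltr01 (fun s _ => esym (hDE w s h)) _; apply: hasd_sum => i.
  rewrite -scalemxAl; apply: hasd_scale.
  have [_ /(_ _ tT)[_ /hasd_rsub]] := YP _ (inq _ _ wr (Er i)).
  by rewrite /G row_mxKr yY.
have DB (w : 'rV[C R]_n) t : rn (w - p) < r -> `|t| < T -> rn (D w t) <= c^-1 * (2 * r).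
  move=> wr tT; apply: rn_rows => [|i]; first by rewrite mulr_ge0 // ?invr_ge0 ltW // mulr_gt0.
  rewrite rowD rnZ ab_rc ger0_norm ?invr_ge0 ?(ltW c0) //.
  have [_ /(_ _ tT)[/inl[_ h] _]] := YP _ (inq _ _ wr (Er i)).
  by apply: ler_wpM2l; [rewrite invr_ge0 ltW|exact: ltW].
move=> w t wr tT.
exists (fun w => D w t), (r - rn (w - p)), (2 * (4 * K) * T); split; first by rewrite subr_gt0.
have inb (x : 'rV[C R]_n) : rn (x - w) < r - rn (w - p) -> rn (x - p) < r.
  by have := rn_dist x w p; rlra.
move=> a b /inb ar /inb br.
set h := b - a.
have dab s : `|s| < T -> rn (y b s - y a s) <= 2 * rn h.
  move=> sT; have := ode_lipschitz L0 LT2 FL (fun t => yP b t br) (fun t => yP a t ar) sT.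
  by rewrite !y0.
have := @gronwall _ _ (fun t => y b t - y a t - h *m D a t)
  (fun t => F (y b t) - F (y a t) - h *m D a t *m F' (y a t)) T L (4 * K * rn h ^+ 2) L0 LT2.
have k0 : 0 <= 4 * K * rn h ^+ 2 by rewrite mulr_ge0 ?exprn_ge0 ?rn_ge0 // mulr_ge0 // ltW.
rewrite !y0 // D0 // subrr rn0 add0r (ger0_norm k0) => /(_ _ _ _ t tT) g.
have -> : 2 * (4 * K) * T * rn h ^+ 2 = 2 * (4 * K * rn h ^+ 2 * T) by ring.
apply: g.
- move=> s sT; apply: hasd_sub; last exact: DP.
  by apply: hasd_sub; [exact: (yP b s br sT).2|exact: (yP a s ar sT).2].
- exists (2 * rn h + n%:R * rn h * (c^-1 * (2 * r))) => s sT.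
  have := dab s sT; have := rnB (y b s - y a s) (h *m D a s).
  have := rn_mulmx h (D a s); have := DB a s ar sT.
  move=> h1; have hh0 : 0 <= n%:R * rn h by rewrite mulr_ge0 ?rn_ge0.
  have := ler_wpM2l hh0 h1; rlra.
- move=> s sT.
  have -> : F (y b s) - F (y a s) - h *m D a s *m F' (y a s) =
    (F (y b s) - F (y a s) - (y b s - y a s) *m F' (y a s)) +
    (y b s - y a s - h *m D a s) *m F' (y a s).
    by rewrite (mulmxBl (y b s - y a s) (h *m D a s)); mxring.
  have ia := in1 _ (yP a s ar sT).1; have ib := in1 _ (yP b s br sT).1.
  have h1 := nice_T H ia ib; have h2 := nice_B H ia.
  have h3 := rn_mulmx (y b s - y a s - h *m D a s) (F' (y a s)).
  set u := y b s - y a s - h *m D a s in h3 *.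
  have h4 : n%:R * rn u * rn (F' (y a s)) <= L * rn u.
    rewrite mulrAC ler_wpM2r ?rn_ge0 //; apply: le_trans nKL.
    by rewrite ler_wpM2l.
  have h5 : K * rn (y b s - y a s) ^+ 2 <= 4 * K * rn h ^+ 2.
    have -> : 4 * K * rn h ^+ 2 = K * (2 * rn h) ^+ 2.
      by move: (rn h) => z; ring.
    rewrite ler_pM2l //.
    by rewrite lerXn2r ?nnegrE ?mulr_ge0 ?rn_ge0 //; exact: dab.
  apply: le_trans (rnD _ _) _; rlra.
Qed.
End FlowDependence.

(** * Taylor estimates for real smooth maps *)

Section RealTaylor.
Context {R : realType}.

Lemma mx_norm_coord m n (A : 'M[R]_(m, n)) i j : `|A i j| <= `|A|.
Proof.
rewrite [leRHS]mx_normE -[leLHS]nngE num_le.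
exact: (le_bigmax _ _ (i, j)).
Qed.

Lemma mx_norm_le m n (A : 'M[R]_(m, n)) (e : R) :
  0 <= e -> (forall i j, `|A i j| <= e) -> `|A| <= e.
Proof.
move=> e0 h; have [A0|/mx_norm_neq0[ij Aij]] := eqVneq (mx_norm A) 0.
  by have -> : `|A| = 0 by [].
by have -> : `|A| = `|A ij.1 ij.2| by [].
Qed.

Lemma rn_complexv n (u : 'rV[R]_n) : rn (complexv u) = `|u|.
Proof.
apply/le_anti/andP; split.
  apply: rn_mx_le => // i j; rewrite mxE ab_rc; exact: mx_norm_coord.
apply: mx_norm_le => [|i j]; first exact: rn_ge0.
by rewrite (ord1 i); have := rn_coord (complexv u) 0 j; rewrite mxE ab_rc.
Qed.

Lemma complexvD n (u v : 'rV[R]_n) : complexv (u + v) = complexv u + complexv v.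
Proof. by apply/rowP => j; rewrite !mxE -[((_ + _)%:C)%C]/(rc _) rcD. Qed.
Lemma complexvN n (u : 'rV[R]_n) : complexv (- u) = - complexv u.
Proof. by apply/rowP => j; rewrite !mxE -[((- _)%:C)%C]/(rc _) rcN. Qed.
Lemma complexvB n (u v : 'rV[R]_n) : complexv (u - v) = complexv u - complexv v.
Proof. by rewrite complexvD complexvN. Qed.
Lemma complexvZ n a (u : 'rV[R]_n) : complexv (a *: u) = rc a *: complexv u.
Proof. by apply/rowP => j; rewrite !mxE -[((_ * _)%:C)%C]/(rc _) rcM. Qed.
Lemma complexv0 n : complexv (0 : 'rV[R]_n) = 0.
Proof. by apply/rowP => j; rewrite !mxE. Qed.

Definition open_at a (D : set 'rV[R]_a) := forall p, D p ->
  exists2 r : R, 0 < r & forall x : 'rV[R]_a, `|x - p| < r -> D x.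

Lemma diff_estimate a b (f : 'rV[R]_a -> 'rV[R]_b) z : differentiable f z ->
  forall e : R, 0 < e -> exists2 d : R, 0 < d & forall k : 'rV[R]_a, `|k| < d ->
    `|f (z + k) - f z - 'd f z k| <= e * `|k|.
Proof.
move=> /diff_locallyP[_ /eqaddoP H] e e0; have := H e e0.
move=> /nbhs_normP[d /= d0 hd]; exists d => // k kd.
have := hd k; rewrite /ball_ /= sub0r normrN => /(_ kd).
by congr (`|_| <= _); rewrite !fctE /= (addrC k) opprD addrA.
Qed.

Lemma diff_hasd a b (f : 'rV[R]_a -> 'rV[R]_b) x h t :
  differentiable f (x + t *: h) ->
  hasd (fun t => complexv (f (x + t *: h))) t (complexv ('d f (x + t *: h) h)).
Proof.
move=> df e e0; have c0 : 0 < 1 + `|h| by rewrite ltr_pwDl.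
have eh : 0 < e / (1 + `|h|) by rewrite divr_gt0.
have [d d0 hd] := diff_estimate df eh.
exists (d / (1 + `|h|)); first by rewrite divr_gt0.
move=> s; rewrite ltr_pdivlMr // => sd.
have D0 := normr_ge0 (s - t).
have sh : `|(s - t) *: h| <= `|s - t| * (1 + `|h|).
  by rewrite normrZ ler_wpM2l // lerDr.
have := hd ((s - t) *: h) (le_lt_trans sh sd).
have -> : x + t *: h + (s - t) *: h = x + s *: h.
  by rewrite -addrA -scalerDl (addrC t) subrK.
rewrite -rn_complexv linearZ /= !complexvB complexvZ => /le_trans; apply.
apply: le_trans (ler_wpM2l (ltW eh) sh) _.
by rewrite mulrCA divfK ?gt_eqF // mulrC.
Qed.

Lemma rowR_sum_delta n (h : 'rV[R]_n) : h = \sum_i h 0 i *: delta_mx 0 i.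
Proof. exact: row_sum_delta. Qed.

Lemma segment_ball a (p x y : 'rV[R]_a) r t : 0 <= t <= 1 ->
  `|x - p| < r -> `|y - p| < r -> `|x + t *: (y - x) - p| < r.
Proof.
move=> /andP[t0 t1] xr yr.
have -> : x + t *: (y - x) - p = (1 - t) *: (x - p) + t *: (y - p).
  by apply/matrixP => i j; rewrite !mxE; ring.
apply: le_lt_trans (ler_normD _ _) _; rewrite !normrZ !ger0_norm ?subr_ge0 //.
move: (`|x - p|) (`|y - p|) xr yr => X Y xr yr.
have [t00|tp] := eqVneq t 0; first by rewrite t00; lra.
have tp' : 0 < t by rewrite lt_def tp.
by nra.
Qed.

Lemma lin_bound a b (l : {linear 'rV[R]_a -> 'rV[R]_b}) (M : R) :
  (forall i, `|l (delta_mx 0 i)| <= M) ->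
  forall h, `|l h| <= a%:R * M * `|h|.
Proof.
move=> lM h.
have -> : l h = \sum_i h 0 i *: l (delta_mx 0 i).
  rewrite {1}(rowR_sum_delta h) linear_sum.
  by apply: eq_bigr => i _; rewrite linearZ.
apply: le_trans (ler_norm_sum _ _ _) _.
apply: le_trans (_ : \sum_(i < a) `|h| * M <= _).
  apply: ler_sum => i _; rewrite normrZ ler_pM //; exact: mx_norm_coord.
rewrite sumr_const card_ord; move: (`|h|) => z.
by have -> : (z * M) *+ a = a%:R * M * z by rewrite -(mulr_natl (z * M) a); ring.
Qed.

Lemma C2_lip a b (D : set 'rV[R]_a) (f : 'rV[R]_a -> 'rV[R]_b) p :
  open_at D -> D p -> Cr_on 1 D f ->
  exists r K : R, [/\ 0 < r, 0 <= K, forall x : 'rV[R]_a, `|x - p| < r -> D x &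
    forall x y : 'rV[R]_a, `|x - p| < r -> `|y - p| < r ->
      `|f y - f x| <= K * `|y - x|].
Proof.
move=> oD Dp [df cf]; have [r0 r00 rD] := oD p Dp.
have H i : exists r : R, 0 < r /\ forall x : 'rV[R]_a, `|x - p| < r ->
    `|'d f x (delta_mx 0 i)| <= 1 + `|'d f p (delta_mx 0 i)|.
  have /cvgrPdist_lt/(_ _ ltr01)/nbhs_normP[d /= d0 hd] := cf (delta_mx 0 i) p Dp.
  exists d; split => // x; rewrite distrC => /hd /= h.
  rewrite -lerBlDr; apply: le_trans (lerB_dist _ _) _.
  by rewrite distrC ltW.
have [r rP] := fin_all_exists H.
pose M := \sum_i (1 + `|'d f p (delta_mx 0 i)|).
have M0 : 0 <= M by apply: sumr_ge0 => i _; rewrite addr_ge0.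
pose s := \big[Num.min/r0]_i r i.
have s0 : 0 < s by apply/bigmin_gtP; split => // i _; exact: (rP i).1.
have sr0 : s <= r0 by apply: bigmin_le_id.
have sr i : s <= r i by apply: bigmin_le_cond.
exists s, (a%:R * M); split => //; first by rewrite mulr_ge0.
  by move=> x xs; apply: rD; exact: lt_le_trans xs sr0.
move=> x y xs ys.
have B (z : 'rV[R]_a) : `|z - p| < s -> forall h, `|'d f z h| <= a%:R * M * `|h|.
  move=> zs; apply: lin_bound => i.
  apply: le_trans ((rP i).2 z (lt_le_trans zs (sr i))) _.
  by rewrite /M (bigD1 i) //= lerDl sumr_ge0 // => j _; rewrite addr_ge0.
have h t : 0 <= t <= 1 -> hasd (fun t => complexv (f (x + t *: (y - x)))) t
    (complexv ('d f (x + t *: (y - x)) (y - x))).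
  by move=> t01; apply: diff_hasd; apply: df; apply: rD;
     apply: lt_le_trans sr0; exact: segment_ball.
have hb t : 0 <= t <= 1 -> rn (complexv ('d f (x + t *: (y - x)) (y - x))) <= a%:R * M * `|y - x|.
  by move=> t01; rewrite rn_complexv; apply: B; exact: segment_ball.
have := mean_value_bound ler01 h hb.
have xy : x + (y - x) = y by rewrite addrC subrK.
by rewrite scale1r scale0r addr0 xy subr0 mulr1 -complexvB rn_complexv.
Qed.

(** The mean value inequality for t |-> f (x + t h) - f x - t df_x(h), whose derivative is
    controlled by the Lipschitz property of the differential. *)
Lemma C2_taylor a b (D : set 'rV[R]_a) (f : 'rV[R]_a -> 'rV[R]_b) p :
  open_at D -> D p -> Cr_on 2 D f ->
  exists r K : R, [/\ 0 < r, 0 <= K, forall x : 'rV[R]_a, `|x - p| < r -> D x,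
    forall x y h : 'rV[R]_a, `|x - p| < r -> `|y - p| < r ->
      `|'d f y h - 'd f x h| <= K * `|y - x| * `|h| &
    forall x y : 'rV[R]_a, `|x - p| < r -> `|y - p| < r ->
      `|f y - f x - 'd f x (y - x)| <= K * `|y - x| ^+ 2].
Proof.
move=> oD Dp [df cf].
have H i : exists rK : R * R, [/\ 0 < rK.1, 0 <= rK.2,
    forall x : 'rV[R]_a, `|x - p| < rK.1 -> D x &
    forall x y : 'rV[R]_a, `|x - p| < rK.1 -> `|y - p| < rK.1 ->
      `|'d f y (delta_mx 0 i) - 'd f x (delta_mx 0 i)| <= rK.2 * `|y - x|].
  by have [r [K [r0 K0 rD rL]]] := C2_lip oD Dp (cf (delta_mx 0 i)); exists (r, K).
have [rK rKP] := fin_all_exists H; have [r0 r00 rD] := oD p Dp.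
pose M := \sum_i (rK i).2.
have M0 : 0 <= M by apply: sumr_ge0 => i _; case: (rKP i).
pose s := \big[Num.min/r0]_i (rK i).1.
have s0 : 0 < s by apply/bigmin_gtP; split => // i _; case: (rKP i).
have sr0 : s <= r0 by apply: bigmin_le_id.
have sr i : s <= (rK i).1 by apply: bigmin_le_cond.
have L (x y h : 'rV[R]_a) : `|x - p| < s -> `|y - p| < s ->
      `|'d f y h - 'd f x h| <= a%:R * M * `|y - x| * `|h|.
  move=> xs ys; rewrite -[a%:R * M * _]mulrA.
  apply: (@lin_bound _ _ ('d f y \- 'd f x)) => i.
  have [_ _ _ h1] := rKP i.
  apply: le_trans (h1 x y (lt_le_trans xs (sr i)) (lt_le_trans ys (sr i))) _.
  rewrite ler_wpM2r // /M (bigD1 i) //= lerDl sumr_ge0 // => j _.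
  by case: (rKP j).
exists s, (a%:R * M); split => //; first by rewrite mulr_ge0.
  by move=> x xs; apply: rD; exact: lt_le_trans xs sr0.
move=> x y xs ys; set h := y - x.
have hd t : 0 <= t <= 1 ->
    hasd (fun t => complexv (f (x + t *: h)) + (- complexv (f x) + rc t *: - complexv ('d f x h))) t
    (complexv ('d f (x + t *: h) h) - complexv ('d f x h)).
  move=> t01; apply: hasd_add; last exact: hasd_line.
  by apply: diff_hasd; apply: df; apply: rD; apply: lt_le_trans sr0; exact: segment_ball.
have hb t : 0 <= t <= 1 ->
    rn (complexv ('d f (x + t *: h) h) - complexv ('d f x h)) <= a%:R * M * `|h| * `|h|.
  move=> t01; rewrite -complexvB rn_complexv.
  apply: le_trans (L x (x + t *: h) h xs _) _; first exact: segment_ball.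
  rewrite ler_wpM2r // ler_wpM2l ?mulr_ge0 // (addrC x) addrK normrZ.
  by case/andP: t01 => t0 t1; rewrite ger0_norm // ler_piMl.
have := mean_value_bound ler01 hd hb.
rewrite scale1r scale0r ?rc0 ?rc1 ?scale0r ?scale1r !addr0 subr0 mulr1 ?subrr ?subr0.
rewrite expr2 mulrA; have -> : x + h = y by rewrite /h addrC subrK.
by rewrite addrA -!complexvB rn_complexv.
Qed.

(* Second differences of f at scale s compute both mixed derivatives. *)
Lemma mixed_derivatives a b (D : set 'rV[R]_a) (f : 'rV[R]_a -> 'rV[R]_b) p u v :
  open_at D -> D p -> Cr_on 3 D f ->
  'd (fun x => 'd f x u) p v = 'd (fun x => 'd f x v) p u.
Proof.
move=> oD Dp [df cf].
move: u v => u0 v0.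
have key (u v : 'rV[R]_a) : exists r K : R, 0 < r /\ forall s : R, 0 <= s < r ->
   `|f (p + s *: u + s *: v) - f (p + s *: u) - f (p + s *: v) + f p -
     (s ^+ 2) *: 'd (fun x => 'd f x u) p v| <= K * s ^+ 3.
  have [r [K [r0 K0 rD rL rT]]] := C2_taylor oD Dp (cf u).
  have r2 : 0 < r / (1 + `|u| + `|v|) by rewrite divr_gt0 // -addrA ltr_pwDl // addr_ge0.
  exists (r / (1 + `|u| + `|v|)), (K * `|v| * (`|v| + `|u|)).
  split=> // s /andP[s0 sr].
  have {}sr : s * (1 + `|u| + `|v|) < r.
    by rewrite -ltr_pdivlMr // -addrA ltr_pwDl // addr_ge0.
  pose g (x : 'rV[R]_a) : 'rV[R]_b := 'd f x u.
  have inr t : 0 <= t <= 1 -> `|p + (t * s) *: u - p| < r /\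
      `|p + s *: v + (t * s) *: u - p| < r.
    move=> /andP[t0 t1].
    have ts : t * s <= s by rewrite ler_piMl.
    have h1 : `|(t * s) *: u| <= s * `|u|.
      by rewrite normrZ ger0_norm ?mulr_ge0 // ler_wpM2r.
    have h2 : `|s *: v| = s * `|v| by rewrite normrZ ger0_norm.
    have h3 : 0 <= s * `|v| by rewrite mulr_ge0.
    split; first by rewrite (addrC p) addrK; lra.
    have -> : p + s *: v + (t * s) *: u - p = s *: v + (t * s) *: u.
      by apply/matrixP => i j; rewrite !mxE; ring.
    by apply: le_lt_trans (ler_normD _ _) _; lra.
  have hd t : 0 <= t <= 1 ->
    hasd (fun t => (complexv (f (p + s *: v + t *: (s *: u))) - complexv (f (p + t *: (s *: u))))
        + (0 + rc t *: - complexv ((s ^+ 2) *: 'd g p v))) t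
      (complexv (s *: g (p + s *: v + (t * s) *: u)) - complexv (s *: g (p + (t * s) *: u))
       - complexv ((s ^+ 2) *: 'd g p v)).
    move=> t01; apply: hasd_add; last exact: hasd_line.
    have [i1 i2] := inr t t01; rewrite -scalerA in i1 i2.
    apply: hasd_sub.
      have := diff_hasd (df _ (rD _ i2)); rewrite linearZ /= -scalerA; exact.
    have := diff_hasd (df _ (rD _ i1)); rewrite linearZ /= -scalerA; exact.
  have hb t : 0 <= t <= 1 ->
    rn (complexv (s *: g (p + s *: v + (t * s) *: u)) - complexv (s *: g (p + (t * s) *: u))
       - complexv ((s ^+ 2) *: 'd g p v)) <= K * `|v| * (`|v| + `|u|) * s ^+ 3.
    move=> t01; have [i1 i2] := inr t t01; rewrite -!complexvB rn_complexv.
    set x := p + (t * s) *: u in i1 *.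
    have E : p + s *: v + (t * s) *: u = x + s *: v by rewrite /x addrAC.
    rewrite E in i2 *.
    have pr : `|p - p| < r by rewrite subrr normr0.
    have T := rT x (x + s *: v) i1 i2; have L := rL p x (s *: v) pr i1.
    rewrite (addrC x) addrK (addrC _ x) in T.
    have -> : s *: g (x + s *: v) - s *: g x - s ^+ 2 *: 'd g p v =
      s *: ((g (x + s *: v) - g x - 'd g x (s *: v)) + ('d g x (s *: v) - 'd g p (s *: v))).
      rewrite addrA subrK; rewrite [in RHS]linearZ /= expr2 -scalerA.
      by rewrite !scalerBr.
    rewrite normrZ (ger0_norm s0).
    have xp : `|x - p| <= s * `|u|.
      rewrite /x (addrC p) addrK normrZ; case/andP: t01 => t0 t1.
      by rewrite ger0_norm ?mulr_ge0 // ler_wpM2r // ler_piMl.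
    have -> : K * `|v| * (`|v| + `|u|) * s ^+ 3 =
      s * (K * (s * `|v|) ^+ 2 + K * (s * `|u|) * (s * `|v|)) by ring.
    rewrite ler_wpM2l //; apply: le_trans (ler_normD _ _) _.
    have vE : `|s *: v| = s * `|v| by rewrite normrZ ger0_norm.
    rewrite vE in T L; apply: lerD => //; apply: le_trans L _.
    by rewrite ler_wpM2r ?mulr_ge0 // ler_wpM2l.
  have := mean_value_bound ler01 hd hb.
  rewrite !scale1r !scale0r ?rc0 ?rc1 ?scale0r ?scale1r !addr0 ?add0r subr0 mulr1.
  rewrite -!complexvB rn_complexv => h; apply: le_trans h.
  rewrite -[fun x => 'd f x u]/g (addrAC p (s *: u)).
  move: (f _) (f _) (f _) (f _) (_ *: 'd g p v) => A B E F G.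
  have -> : F - E - G - (B - A) = F - E - B + A - G; last by [].
  by apply/matrixP => i j; rewrite !mxE; ring.
have fin (A B : 'rV[R]_b) :
  (exists r K : R, 0 < r /\ forall s : R, 0 <= s < r ->
   `|f (p + s *: u0 + s *: v0) - f (p + s *: u0) - f (p + s *: v0) + f p -
     (s ^+ 2) *: A| <= K * s ^+ 3) ->
  (exists r K : R, 0 < r /\ forall s : R, 0 <= s < r ->
   `|f (p + s *: v0 + s *: u0) - f (p + s *: v0) - f (p + s *: u0) + f p -
     (s ^+ 2) *: B| <= K * s ^+ 3) -> A = B; last exact: fin (key u0 v0) (key v0 u0).
move=> [r [K [r0 h1]]] [r' [K' [r'0 h2]]].
have KK0 : 0 <= `|K| + `|K'| by rewrite addr_ge0.
apply/eqP; rewrite -subr_eq0 -normr_le0; apply/ler_addgt0Pr => e e0; rewrite add0r.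
pose s := Num.min (Num.min r r' / 2) (e / (1 + (`|K| + `|K'|))).
have m0 : 0 < Num.min r r' by rewrite lt_min r0.
have s0 : 0 < s by rewrite lt_min !divr_gt0 // ltr_pwDl.
have sm : s < Num.min r r' by rewrite gt_min; apply/orP; left; lra.
move: (sm); rewrite lt_min => /andP[sr sr'].
have se : s * (1 + (`|K| + `|K'|)) <= e.
  by rewrite -ler_pdivlMr ?ltr_pwDl // ge_min lexx orbT.
have {}h1 := h1 s; rewrite ltW // sr in h1; have {h1}h1 := h1 isT.
have {}h2 := h2 s; rewrite ltW // sr' in h2; have {h2}h2 := h2 isT.
set X := _ + f p in h1; set Y := _ + f p in h2.
have XY : X = Y.
  rewrite /X /Y (addrAC p (s *: v0)) ; move: (f (p + s *: u0)) (f (p + s *: v0)) => Z W.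
  by apply/matrixP => i j; rewrite !mxE; ring.
have : `|s ^+ 2 *: (A - B)| <= (`|K| + `|K'|) * s ^+ 3.
  have -> : s ^+ 2 *: (A - B) = (Y - s ^+ 2 *: B) - (X - s ^+ 2 *: A).
    by rewrite XY scalerBr; apply/matrixP => i j; rewrite !mxE; ring.
  apply: le_trans (ler_normB _ _) _; rewrite addrC mulrDl lerD //.
    by apply: le_trans h1 _; rewrite ler_wpM2r ?exprn_ge0 ?(ltW s0) // ler_norm.
  by apply: le_trans h2 _; rewrite ler_wpM2r ?exprn_ge0 ?(ltW s0) // ler_norm.
have s2 : 0 < s ^+ 2 by rewrite exprn_gt0.
rewrite normrZ (gtr0_norm s2).
have -> : (`|K| + `|K'|) * s ^+ 3 = s ^+ 2 * ((`|K| + `|K'|) * s) by ring.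
rewrite ler_pM2l // => h; apply: le_trans h _; apply: le_trans se.
by rewrite mulrC ler_pM2l // lerDr.
Qed.
End RealTaylor.

(** * Real and complex coordinates, and charts *)

Section Coordinates.
Context {R : realType}.

Lemma within_cont (S T : topologicalType) (A : set S) (f : S -> T) p N :
  {within A, continuous f} -> A p -> nbhs (f p) N ->
  exists2 U, nbhs p U & forall q, U q -> A q -> N (f q).
Proof.
move=> cf Ap nN.
have h : nbhs_subspace (p : subspace A) (f @^-1` N) by exact: (cf p N nN).
rewrite -nbhs_subspace_in // in h.
by exists [set q | A q -> N (f q)].
Qed.

Lemma lsub_realify n (z : 'rV[C R]_n) : lsubmx (realify z) = realpart z.
Proof. exact: row_mxKl. Qed.
Lemma rsub_realify n (z : 'rV[C R]_n) : rsubmx (realify z) = imagpart z.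
Proof. exact: row_mxKr. Qed.

Lemma realifyK n : cancel (@realify R n) (@complexify R n).
Proof.
move=> z; apply/rowP => j; rewrite mxE lsub_realify rsub_realify !mxE.
by case: (z 0 j).
Qed.

Lemma complexifyK n : cancel (@complexify R n) (@realify R n).
Proof.
move=> w; rewrite -[RHS]hsubmxK; congr row_mx; by apply/rowP => j; rewrite !mxE.
Qed.

Lemma complexifyE n (w : 'rV[R]_(n + n)) :
  complexify w = complexv w *m col_mx 1%:M ('i%C)%:M.
Proof.
rewrite -[in RHS](hsubmxK w).
have -> : complexv (row_mx (lsubmx w) (rsubmx w)) =
    row_mx (complexv (lsubmx w)) (complexv (rsubmx w)).
  by apply/rowP => j; rewrite !mxE; case: (fintype.split j) => l; rewrite !mxE.
rewrite mul_row_col mulmx1 mul_mx_scalar; apply/rowP => j; rewrite !mxE.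
by rewrite [LHS]complex_ReIm /= /rc.
Qed.

Lemma complexifyD n (u v : 'rV[R]_(n + n)) :
  complexify (u + v) = complexify u + complexify v.
Proof. by rewrite !complexifyE complexvD mulmxDl. Qed.
Lemma complexifyB n (u v : 'rV[R]_(n + n)) :
  complexify (u - v) = complexify u - complexify v.
Proof. by rewrite !complexifyE complexvB mulmxBl. Qed.
Lemma complexifyZ n a (u : 'rV[R]_(n + n)) :
  complexify (a *: u) = rc a *: complexify u.
Proof. by rewrite !complexifyE complexvZ -scalemxAl. Qed.

Lemma realifyD n (u v : 'rV[C R]_n) : realify (u + v) = realify u + realify v.
Proof. by apply: (can_inj (@complexifyK n)); rewrite complexifyD !realifyK. Qed.
Lemma realifyB n (u v : 'rV[C R]_n) : realify (u - v) = realify u - realify v.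
Proof. by apply: (can_inj (@complexifyK n)); rewrite complexifyB !realifyK. Qed.
Lemma realifyZ n a (u : 'rV[C R]_n) : realify (rc a *: u) = a *: realify u.
Proof. by apply: (can_inj (@complexifyK n)); rewrite complexifyZ !realifyK. Qed.

Lemma rn_complexify n (w : 'rV[R]_(n + n)) : rn (complexify w) <= 2 * `|w|.
Proof.
apply: rn_mx_le => [|i j]; first by rewrite mulr_ge0.
rewrite mxE; apply: le_trans (ab_ReIm _) _ => /=; rewrite !mxE.
by have := mx_norm_coord w 0 (lshift n j); have := mx_norm_coord w 0 (rshift n j); lra.
Qed.

Lemma norm_realify n (z : 'rV[C R]_n) : `|realify z| <= rn z.
Proof.
apply: mx_norm_le => [|i j]; first exact: rn_ge0.
rewrite mxE; case: (fintype.split j) => l; rewrite mxE;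
  apply: le_trans (rn_coord z 0 l); [exact: ab_Re|exact: ab_Im].
Qed.

Lemma hasd_complexify n (f : R -> 'rV[R]_(n + n)) t v :
  hasd (fun s => complexv (f s)) t (complexv v) ->
  hasd (fun s => complexify (f s)) t (complexify v).
Proof.
move=> /(hasd_mulr (col_mx 1%:M ('i%C)%:M)); rewrite -complexifyE.
by apply: hasd_ext ltr01 _ => s _; rewrite complexifyE.
Qed.

Lemma complex_linear_mx a b (A : 'rV[C R]_a -> 'rV[C R]_b) :
  (forall u v, A (u + v) = A u + A v) -> (forall t u, A (rc t *: u) = rc t *: A u) ->
  (forall u, A ('i%C *: u) = 'i%C *: A u) ->
  forall h : 'rV[C R]_a, A h = h *m \matrix_j A (delta_mx 0 j).
Proof.
move=> AD AZ Ai h.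
have A0 : A 0 = 0 by rewrite -(scale0r (0 : 'rV[C R]_a)) -[0 in LHS]/(rc 0) AZ scale0r.
have AS (I : Type) (s : seq I) (F : I -> 'rV[C R]_a) :
    A (\sum_(i <- s) F i) = \sum_(i <- s) A (F i).
  by elim: s => [|i s ih]; rewrite ?big_nil // !big_cons AD ih.
have AC (c : C R) u : A (c *: u) = c *: A u.
  by rewrite (complex_ReIm c) !scalerDl AD AZ -!scalerA Ai AZ.
rewrite {1}(row_sum_delta h) AS mulmx_sum_row; apply: eq_bigr => i _.
by rewrite AC rowK.
Qed.

Definition cis (a : R) : C R := (cos a +i* sin a)%C.

Lemma cexp_i (a : R) : cexp ('i%C * rc a) = cis a.
Proof.
have -> : ('i%C * rc a) = (0 +i* a)%C :> C R.
  by apply/eqP; rewrite eq_complex /= !(mul0r, mul1r, subr0, sub0r, add0r, mulr0, oppr0) !eqxx.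
by rewrite /cexp /= expR0 !mul1r.
Qed.

Lemma ab_cis a : ab (cis a) = 1.
Proof. by rewrite abE /= cos2Dsin2 sqrtr1. Qed.

Lemma torus_Exp n (s : 'rV[R]_n) : torus (Exp (complexv s)).
Proof.
by move=> j; rewrite !mxE -rcab -[((_)%:C)%C]/(rc _) cexp_i ab_cis.
Qed.

Lemma Exp_continuous n (s : 'rV[R]_n) (e : R) : 0 < e -> exists2 d : R, 0 < d &
  forall t : 'rV[R]_n, `|t - s| < d -> rn (Exp (complexv t) - Exp (complexv s)) <= e.
Proof.
move=> e0; have e2 : 0 < e / 2 by lra.
have H (j : 'I_n) : exists d : R, 0 < d /\ forall a, `|a - s 0 j| < d ->
    `|cos a - cos (s 0 j)| <= e / 2 /\ `|sin a - sin (s 0 j)| <= e / 2.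
  have /cvgrPdist_le/(_ _ e2)/nbhs_normP[d /= d0 hd] := @continuous_cos R (s 0 j).
  have /cvgrPdist_le/(_ _ e2)/nbhs_normP[d' /= d'0 hd'] := @continuous_sin R (s 0 j).
  exists (Num.min d d'); rewrite lt_min d0; split => // a.
  rewrite lt_min !(distrC a) => /andP[h1 h2].
  by split; rewrite distrC; [exact: hd|exact: hd'].
have [d dP] := fin_all_exists H.
exists (\big[Num.min/1]_i d i).
  by apply/bigmin_gtP; split => // i _; exact: (dP i).1.
move=> t ts; apply: rn_mx_le => [|i j]; first exact: ltW.
rewrite !mxE -![((_)%:C)%C]/(rc _) !cexp_i; apply: le_trans (ab_ReIm _) _ => /=.
have sj : `|t 0 j - s 0 j| < d j.
  have tj : `|t - s| < d j by apply: lt_le_trans ts _; exact: bigmin_le_cond.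
  apply: le_lt_trans tj.
  by have := mx_norm_coord (t - s) 0 j; rewrite !mxE.
by have [h1 h2] := (dP j).2 _ sj; lra.
Qed.

Section Charts.
Context {M : topologicalType} {n : nat} (c : chart R M n).

Lemma ch_toK' x : ch_dom c x -> ch_of c (ch_to c x) = x.
Proof. by move=> cx; apply: ch_toK; exact/mem_set. Qed.

Lemma ch_codP w : ch_cod c w -> ch_dom c (ch_of c w) /\ ch_to c (ch_of c w) = w.
Proof. by move=> [x cx <-]; rewrite ch_toK'. Qed.

Lemma chart_nbhs x (A : set M) : ch_dom c x -> nbhs x A ->
  exists2 r : R, 0 < r & forall w : 'rV[C R]_n, rn (w - ch_to c x) < r ->
    [/\ ch_cod c w, ch_dom c (ch_of c w), A (ch_of c w) & ch_to c (ch_of c w) = w].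
Proof.
move=> cx nA; have cw : ch_cod c (ch_to c x) by exists x.
have nA' : nbhs (ch_of c (ch_to c x)) A by rewrite ch_toK'.
have [U nU UP] := within_cont (@ch_of_continuous _ _ _ c) cw nA'.
have nO : nbhs (ch_to c x) (ch_cod c) by apply: open_nbhs_nbhs; split => //; exact: ch_cod_open.
have [r r0 h] := (nbhs_rn _ _).1 (filterI nU nO).
exists r => // w /h[Uw cdw]; have [h1 h2] := ch_codP cdw; split => //.
exact: UP.
Qed.

Lemma chart_nbhs_to x (r : R) : ch_dom c x -> 0 < r ->
  nbhs x [set y | ch_dom c y /\ rn (ch_to c y - ch_to c x) < r].
Proof.
move=> cx r0.
have nB : nbhs (ch_to c x) [set w : 'rV[C R]_n | rn (w - ch_to c x) < r].
  by apply/nbhs_rn; exists r.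
have [U nU UP] := within_cont (@ch_to_continuous _ _ _ c) cx nB.
have nO : nbhs x (ch_dom c) by apply: open_nbhs_nbhs; split => //; exact: ch_dom_open.
by apply: filterS (filterI nU nO) => y [Uy cy]; split => //; exact: UP.
Qed.
End Charts.
End Coordinates.

(** * Partial differentials *)

Section ActionInCharts.
Context {R : realType}.

Lemma diff_of_estimateR (V W : normedModType R) (f : V -> W)
    (df : {linear V -> W}) p : continuous df ->
  (forall e : R, 0 < e -> exists2 d : R, 0 < d & forall y : V, `|y| < d ->
     `|f (p + y) - f p - df y| <= e * `|y|) ->
  differentiable f p /\ 'd f p = df :> (V -> W).
Proof.
move=> cd h.
have fE : f \o shift p = cst (f p) + df +o_ (0 : V) id.
  apply/eqaddoP => e e0; have [d d0 hd] := h _ e0.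
  apply/nbhs_normP; exists d => // y; rewrite /ball_ /= sub0r normrN => /hd.
  by congr (`| _ | <= _); rewrite !fctE /= opprD addrA (addrC y).
have dE := diff_unique cd fE; split => //.
by apply/diff_locallyP; rewrite dE.
Qed.

Lemma lipschitz_continuous (V W : normedModType R) (l : {linear V -> W}) K :
  0 <= K -> (forall h, `|l h| <= K * `|h|) -> continuous l.
Proof.
move=> K0 lK x; apply/cvgrPdist_le => e e0.
have c0 : 0 < K + 1 by rewrite ltr_wpDl.
apply/nbhs_normP; exists (e / (K + 1)); first by rewrite /= divr_gt0.
move=> y /=; rewrite ltr_pdivlMr // => yx; rewrite -linearB.
apply: le_trans (lK _) _; apply: le_trans (ltW yx); rewrite mulrC ler_wpM2l //.
by rewrite lerDl.
Qed.

Lemma linR_continuous a b (l : {linear 'rV[R]_a -> 'rV[R]_b}) : continuous l.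
Proof.
pose M := \sum_i `|l (delta_mx 0 i)|.
have M0 : 0 <= M by apply: sumr_ge0.
apply: (@lipschitz_continuous _ _ l (a%:R * M)); first by rewrite mulr_ge0.
by move=> h; apply: lin_bound => i; rewrite /M (bigD1 i) //= lerDl sumr_ge0.
Qed.

Lemma norm_row_mx0 a b (h : 'rV[R]_b) : `|row_mx (0 : 'rV[R]_a) h| <= `|h|.
Proof.
apply: mx_norm_le => // i j; rewrite mxE; case: (fintype.split j) => l.
  by rewrite mxE normr0.
exact: mx_norm_coord.
Qed.

Lemma norm_row_mx a b (u : 'rV[R]_a) (h : 'rV[R]_b) : `|row_mx u h| <= `|u| + `|h|.
Proof.
apply: mx_norm_le => [|i j]; first by rewrite addr_ge0.
rewrite mxE; case: (fintype.split j) => l.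
  by apply: le_trans (mx_norm_coord _ _ _) _; rewrite lerDl.
by apply: le_trans (mx_norm_coord _ _ _) _; rewrite lerDr.
Qed.

Lemma row0D a b (u v : 'rV[R]_b) :
  row_mx (0 : 'rV[R]_a) (u + v) = row_mx 0 u + row_mx 0 v.
Proof. by rewrite add_row_mx addr0. Qed.
Lemma row0Z a b t (u : 'rV[R]_b) :
  row_mx (0 : 'rV[R]_a) (t *: u) = t *: row_mx 0 u.
Proof. by rewrite scale_row_mx scaler0. Qed.

Lemma partial_diff a b c (g : 'rV[R]_(a + b) -> 'rV[R]_c) s v h :
  differentiable g (row_mx s v) ->
  'd (fun w => g (row_mx s w)) v h = 'd g (row_mx s v) (row_mx 0 h).
Proof.
move=> dg.
pose l : {linear 'rV[R]_b -> 'rV[R]_c} :=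
  'd g (row_mx s v) \o mulmxr (row_mx 0 1%:M).
have lE w : l w = 'd g (row_mx s v) (row_mx 0 w).
  by rewrite /l /= mul_mx_row mulmx0 mulmx1.
have [|_ ->] := @diff_of_estimateR _ _ (fun w => g (row_mx s w)) l v (@linR_continuous _ _ l).
  move=> e e0; have [d d0 hd] := diff_estimate dg e0; exists d => // y yd.
  have y1 := norm_row_mx0 a y.
  have := hd (row_mx 0 y) (le_lt_trans y1 yd); rewrite add_row_mx addr0 -lE.
  by move/le_trans; apply; rewrite ler_wpM2l // ltW.
exact: lE.
Qed.
End ActionInCharts.

(** * The torus action in charts *)

Section LocalAction.
Context {R : realType} {M : topologicalType} {n : nat}.
Context (X : complexManifold R M n) (k : nat) (act : 'rV[C R]_k -> M -> M).
Context (Hsm : smooth_action X act) (Hps : preserves_complex_structure X act).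

Implicit Types (c : chart R M n) (s t : 'rV[R]_k) (w : 'rV[C R]_n) (x : M).

Definition phi (s : 'rV[R]_k) (x : M) : M := act (Exp (complexv s)) x.

Lemma phi0 x : phi 0 x = x.
Proof. by rewrite /phi complexv0 Exp0 (action1 Hsm). Qed.

Lemma phiD s t x : phi (s + t) x = phi s (phi t x).
Proof. by rewrite /phi complexvD ExpD (actionM Hsm) //; exact: torus_Exp. Qed.

Lemma phiNK s x : phi (- s) (phi s x) = x.
Proof. by rewrite -phiD addNr phi0. Qed.

Lemma phi_cont s x N : nbhs (phi s x) N -> exists2 d : R, 0 < d &
  exists2 U, nbhs x U & forall (t : 'rV[R]_k) y, `|t - s| < d -> U y -> N (phi t y).
Proof.
move=> nN; pose p : 'rV[C R]_k * M := (Exp (complexv s), x).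
have pA : (torus `*` [set: M]) p by split => //; exact: torus_Exp.
have [U [[A B] [/= nA nB] AB] UP] := within_cont (action_continuous Hsm) pA nN.
have [e e0 eA] := (nbhs_rn _ _).1 nA; have e2 : 0 < e / 2 by lra.
have [d d0 hd] := Exp_continuous s e2.
exists d => //; exists B => // t y ts By.
apply: (UP (Exp (complexv t), y)); last by split => //; exact: torus_Exp.
by apply: AB; split => //; apply: eA; apply: le_lt_trans (hd _ ts) _; lra.
Qed.

Definition alpha (c c' : chart R M n) (s : 'rV[R]_k) (w : 'rV[C R]_n) : 'rV[C R]_n :=
  ch_to c' (phi s (ch_of c w)).

Lemma alphaE c c' s w : alpha c c' s w = ch_to c' (phi s (ch_of c w)).
Proof. by []. Qed.

Definition pk (s : 'rV[R]_k) (w : 'rV[C R]_n) : 'rV[R]_(k + (n + n)) :=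
  row_mx s (realify w).

Lemma act_coord_pk c c' s w : act_coord act c c' (pk s w) = realify (alpha c c' s w).
Proof. by rewrite /act_coord /pk row_mxKl row_mxKr realifyK. Qed.

Lemma act_coord_domP c c' s w : act_coord_dom act c c' (pk s w) <->
  ch_cod c w /\ ch_dom c' (phi s (ch_of c w)).
Proof. by rewrite /act_coord_dom /= /pk row_mxKl row_mxKr realifyK. Qed.

Lemma pkE p : p = pk (lsubmx p) (complexify (rsubmx p)).
Proof. by rewrite /pk complexifyK hsubmxK. Qed.

Lemma norm_pkB s w s' w' : `|pk s' w' - pk s w| <= `|s' - s| + rn (w' - w).
Proof.
rewrite /pk opp_row_mx add_row_mx -realifyB; apply: le_trans (norm_row_mx _ _) _.
by rewrite lerD2l norm_realify.
Qed.

Lemma act_dom_open c c' : open_at (act_coord_dom act c c').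
Proof.
move=> p; rewrite {1}(pkE p) => /act_coord_domP.
set s := lsubmx p; set w := complexify (rsubmx p) => -[cw c'p].
have [c1 c2] := ch_codP cw.
have nN : nbhs (phi s (ch_of c w)) (ch_dom c').
  by apply: open_nbhs_nbhs; split => //; exact: ch_dom_open.
have [d d0 [U nU UP]] := phi_cont nN; have [r r0 rP] := chart_nbhs c1 nU.
exists (Num.min d (r / 2)); first by rewrite lt_min d0 divr_gt0.
move=> x; rewrite lt_min => /andP[xd xr]; rewrite (pkE x); apply/act_coord_domP.
have h1 : rn (complexify (rsubmx x) - ch_to c (ch_of c w)) < r.
  rewrite c2 /w -complexifyB -linearB; apply: le_lt_trans (rn_complexify _) _.
  have : `|rsubmx (x - p)| <= `|x - p|.
    by apply: mx_norm_le => // i j; rewrite mxE; exact: mx_norm_coord.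
  by lra.
have [h2 h3 h4 h5] := rP _ h1; split => //; apply: UP => //.
rewrite /s -linearB; apply: le_lt_trans xd.
by apply: mx_norm_le => // i j; rewrite mxE; exact: mx_norm_coord.
Qed.

(* Opaque, since unification must not unfold differentials. *)
Fact As_key : {f : chart R M n -> chart R M n -> 'rV[R]_k -> 'rV[C R]_n -> 'M[C R]_(k, n) |
  forall c c' s w j, row j (f c c' s w) =
  complexify ('d (act_coord act c c') (pk s w) (row_mx (delta_mx 0 j) 0))}.
Proof.
exists (fun c c' s w => \matrix_j
  complexify ('d (act_coord act c c') (pk s w) (row_mx (delta_mx 0 j) 0))).
by move=> c c' s w j; rewrite rowK.
Qed.

Fact Aw_key : {f : chart R M n -> chart R M n -> 'rV[R]_k -> 'rV[C R]_n -> 'M[C R]_n |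
  forall c c' s w j, row j (f c c' s w) =
  complexify ('d (act_coord act c c') (pk s w) (row_mx 0 (realify (delta_mx 0 j))))}.
Proof.
exists (fun c c' s w => \matrix_j
  complexify ('d (act_coord act c c') (pk s w) (row_mx 0 (realify (delta_mx 0 j))))).
by move=> c c' s w j; rewrite rowK.
Qed.

(** [As] and [Aw] are the matrices of the partial differentials of the action in the torus direction
    and in the point direction. That [Aw] represents the whole real differential, and not only its
    values on the basis, is due to the invariance of the complex structure ([AwE]). *)
Definition As := sval As_key.
Definition Aw := sval Aw_key.

Lemma row_As c c' s w j : row j (As c c' s w) =
  complexify ('d (act_coord act c c') (pk s w) (row_mx (delta_mx 0 j) 0)).
Proof. exact: (svalP As_key). Qed.

Lemma row_Aw c c' s w j : row j (Aw c c' s w) =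
  complexify ('d (act_coord act c c') (pk s w) (row_mx 0 (realify (delta_mx 0 j)))).
Proof. exact: (svalP Aw_key). Qed.

Lemma rowB m p (A B : 'M[C R]_(m, p)) i : row i (A - B) = row i A - row i B.
Proof. by apply/rowP => j; rewrite !mxE. Qed.

Lemma AsE c c' s w (u : 'rV[R]_k) :
  complexify ('d (act_coord act c c') (pk s w) (row_mx u 0)) = complexv u *m As c c' s w.
Proof.
rewrite mulmx_sum_row {1}(rowR_sum_delta u).
have -> : row_mx (\sum_i u 0 i *: delta_mx 0 i) 0 =
    \sum_i u 0 i *: row_mx (delta_mx 0 i : 'rV[R]_k) (0 : 'rV[R]_(n + n)).
  elim/big_rec2: _ => [|i a b _ ih]; first by rewrite row_mx0.
  by rewrite -ih scale_row_mx scaler0 add_row_mx addr0.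
rewrite linear_sum; apply: (big_ind2 (fun a b => complexify a = b)).
- by apply/rowP => j; rewrite !mxE.
- by move=> a b a' b' <- <-; rewrite complexifyD.
- by move=> i _; rewrite linearZ /= complexifyZ mxE row_As.
Qed.

Lemma AwE c c' s w (h : 'rV[C R]_n) : atlas X c -> atlas X c' ->
  act_coord_dom act c c' (pk s w) ->
  complexify ('d (act_coord act c c') (pk s w) (row_mx 0 (realify h))) = h *m Aw c c' s w.
Proof.
move=> Xc Xc' D; have [d1 _] := action_smooth Hsm Xc Xc' 1%N.
have dg := d1 _ D; move/act_coord_domP: D => [cw c'w]; have [c1 c2] := ch_codP cw.
have -> : Aw c c' s w = \matrix_j complexify ('d (act_coord act c c') (pk s w)
    (row_mx 0 (realify (delta_mx 0 j)))).
  by apply/row_matrixP => j; rewrite row_Aw rowK.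
apply: (@complex_linear_mx _ _ _ (fun h => complexify ('d _ (pk s w) (row_mx 0 (realify h))))).
- by move=> u v; rewrite realifyD row0D linearD complexifyD.
- by move=> t u; rewrite realifyZ row0Z linearZ complexifyZ.
move=> u; have := Hps (torus_Exp s) Xc Xc' c1 c'w (realify u).
rewrite /J realifyK c2.
have gE : (fun z : 'rV[R]_(n + n) => realify (ch_to c' (act (Exp (complexv s)) (ch_of c (complexify z)))))
    = (fun z => act_coord act c c' (row_mx s z)).
  by apply/funext => v; rewrite /act_coord row_mxKl row_mxKr.
rewrite gE !partial_diff //; rewrite /pk => -> ; by rewrite realifyK.
Qed.

(** A second order expansion, jointly in the torus parameter and in the point. Uniformity in the
    parameter is what later allows compactness of the torus to bound all isotropy elements at
    once. *)
Record action_local_spec c c' s0 w0 (r K : R) : Prop := {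
  al_r : 0 < r;
  al_K : 0 < K;
  al_dom : forall (s : 'rV[R]_k) (w : 'rV[C R]_n), `|s - s0| < r -> rn (w - w0) < r ->
    [/\ ch_cod c w, ch_dom c (ch_of c w), ch_to c (ch_of c w) = w &
        ch_dom c' (phi s (ch_of c w))];
  al_T : forall (s s' : 'rV[R]_k) (w w' : 'rV[C R]_n),
    `|s - s0| < r -> rn (w - w0) < r -> `|s' - s0| < r -> rn (w' - w0) < r ->
    rn (alpha c c' s' w' - alpha c c' s w - complexv (s' - s) *m As c c' s w -
        (w' - w) *m Aw c c' s w) <= K * (`|s' - s| + rn (w' - w)) ^+ 2;
  al_Lw : forall (s s' : 'rV[R]_k) (w w' : 'rV[C R]_n),
    `|s - s0| < r -> rn (w - w0) < r -> `|s' - s0| < r -> rn (w' - w0) < r ->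
    rn (Aw c c' s' w' - Aw c c' s w) <= K * (`|s' - s| + rn (w' - w));
  al_Ls : forall (s s' : 'rV[R]_k) (w w' : 'rV[C R]_n),
    `|s - s0| < r -> rn (w - w0) < r -> `|s' - s0| < r -> rn (w' - w0) < r ->
    rn (As c c' s' w' - As c c' s w) <= K * (`|s' - s| + rn (w' - w));
  al_Bw : forall (s : 'rV[R]_k) (w : 'rV[C R]_n), `|s - s0| < r -> rn (w - w0) < r ->
    rn (Aw c c' s w) <= K }.

Lemma action_local c c' x s0 : atlas X c -> atlas X c' -> ch_dom c x ->
  ch_dom c' (phi s0 x) ->
  exists r K, action_local_spec c c' s0 (ch_to c x) r K.
Proof.
move=> Xc Xc' cx c'x; set w0 := ch_to c x.
have D0 : act_coord_dom act c c' (pk s0 w0).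
  by apply/act_coord_domP; rewrite /w0 ch_toK' //; split => //; exists x.
have [r [K [r0 K0 rD rL rT]]] :=
  C2_taylor (@act_dom_open c c') D0 (action_smooth Hsm Xc Xc' 2%N).
have inr (s : 'rV[R]_k) (w : 'rV[C R]_n) : `|s - s0| < r / 2 -> rn (w - w0) < r / 2 ->
    `|pk s w - pk s0 w0| < r.
  by move=> h1 h2; apply: le_lt_trans (norm_pkB _ _ _ _) _; lra.
have L (l : 'rV[R]_(k + (n + n))) (s s' : 'rV[R]_k) (w w' : 'rV[C R]_n) : `|l| <= 1 ->
    `|s - s0| < r / 2 -> rn (w - w0) < r / 2 -> `|s' - s0| < r / 2 -> rn (w' - w0) < r / 2 ->
    rn (complexify ('d (act_coord act c c') (pk s' w') l) -
        complexify ('d (act_coord act c c') (pk s w) l)) <= 2 * K * (`|s' - s| + rn (w' - w)).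
  move=> l1 h1 h2 h3 h4; rewrite -complexifyB; apply: le_trans (rn_complexify _) _.
  have h5 := rL _ _ l (inr _ _ h1 h2) (inr _ _ h3 h4).
  rewrite -mulrA ler_pM2l //; apply: le_trans h5 _.
  have h6 := norm_pkB s w s' w'.
  have h7 : K * `|pk s' w' - pk s w| * `|l| <= K * `|pk s' w' - pk s w| * 1.
    by rewrite ler_wpM2l // mulr_ge0.
  by apply: le_trans h7 _; rewrite mulr1 ler_wpM2l.
have nl i : `|delta_mx 0 i : 'rV[R]_k| <= 1.
  by apply: mx_norm_le => // a b; rewrite mxE; case: (_ && _); rewrite ?normr1 ?normr0.
pose B := rn (Aw c c' s0 w0) + 2 * K * (r + r).
have B0 : 0 <= B by rewrite addr_ge0 ?rn_ge0 // !mulr_ge0 // addr_ge0 // ltW.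
have Lw (s s' : 'rV[R]_k) (w w' : 'rV[C R]_n) :
    `|s - s0| < r / 2 -> rn (w - w0) < r / 2 -> `|s' - s0| < r / 2 -> rn (w' - w0) < r / 2 ->
    rn (Aw c c' s' w' - Aw c c' s w) <= 2 * K * (`|s' - s| + rn (w' - w)).
  move=> h1 h2 h3 h4; apply: rn_rows => [|i].
    by rewrite !mulr_ge0 // addr_ge0 // rn_ge0.
  rewrite rowB (row_Aw c c' s' w') (row_Aw c c' s w).
  have l1 : `|row_mx (0 : 'rV[R]_k) (realify (delta_mx 0 i : 'rV[C R]_n))| <= 1.
    apply: le_trans (norm_row_mx0 _ _) _.
    by apply: le_trans (norm_realify _) _; rewrite rn_delta.
  exact: (L _ s s' w w' l1 h1 h2 h3 h4).
have s00 : `|s0 - s0| < r / 2 by rewrite subrr normr0 divr_gt0.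
have w00 : rn (w0 - w0) < r / 2 by rewrite subrr rn0 divr_gt0.
exists (r / 2), (2 * K + B + 1); split.
- by rewrite divr_gt0.
- by rewrite ltr_wpDl // addr_ge0 // mulr_ge0.
- move=> s w h1 h2; have [cw c'w] := (act_coord_domP c c' s w).1 (rD _ (inr _ _ h1 h2)).
  by have [h3 h4] := ch_codP cw.
- move=> s s' w w' h1 h2 h3 h4.
  have D1 := rD _ (inr _ _ h1 h2).
  have h := rT _ _ (inr _ _ h1 h2) (inr _ _ h3 h4).
  have E : alpha c c' s' w' - alpha c c' s w - complexv (s' - s) *m As c c' s w -
        (w' - w) *m Aw c c' s w =
     complexify (act_coord act c c' (pk s' w') - act_coord act c c' (pk s w) -
        'd (act_coord act c c') (pk s w) (pk s' w' - pk s w)).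
    rewrite !complexifyB !act_coord_pk !realifyK -addrA -opprD; congr (_ - _).
    rewrite -AsE -AwE // -complexifyD -linearD /= add_row_mx addr0 add0r.
    by rewrite /pk opp_row_mx add_row_mx realifyB.
  rewrite E; apply: le_trans (rn_complexify _) _.
  have h5 : `|pk s' w' - pk s w| ^+ 2 <= (`|s' - s| + rn (w' - w)) ^+ 2.
    by rewrite lerXn2r ?nnegrE ?addr_ge0 ?rn_ge0 // norm_pkB.
  have h6 := ler_wpM2l K0 h5.
  have h7 : 0 <= (`|s' - s| + rn (w' - w)) ^+ 2 by rewrite exprn_ge0 // addr_ge0 // rn_ge0.
  have h8 : 0 <= (B + 1) * (`|s' - s| + rn (w' - w)) ^+ 2 by rewrite mulr_ge0 // addr_ge0.
  by move: ((`|s' - s| + rn (w' - w)) ^+ 2) (`|pk s' w' - pk s w| ^+ 2) h h6 h7 h8 => Y Z; lra.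
- move=> s s' w w' h1 h2 h3 h4; apply: le_trans (Lw _ _ _ _ h1 h2 h3 h4) _.
  by rewrite ler_wpM2r ?addr_ge0 ?rn_ge0 //; lra.
- move=> s s' w w' h1 h2 h3 h4; apply: rn_rows => [|i].
    apply: mulr_ge0; last by rewrite addr_ge0 // rn_ge0.
    by lra.
  rewrite rowB (row_As c c' s' w') (row_As c c' s w).
  have l1 : `|row_mx (delta_mx 0 i : 'rV[R]_k) (0 : 'rV[R]_(n + n))| <= 1.
    apply: le_trans (norm_row_mx _ _) _; have -> : `|0 : 'rV[R]_(n + n)| = 0 by rewrite normr0.
    by rewrite addr0.
  apply: le_trans (L _ s s' w w' l1 h1 h2 h3 h4) _.
  by rewrite ler_wpM2r ?addr_ge0 ?rn_ge0 //; lra.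
- move=> s w h1 h2; have := Lw _ _ _ _ s00 w00 h1 h2.
  have := rnD (Aw c c' s w - Aw c c' s0 w0) (Aw c c' s0 w0); rewrite subrK.
  have h3 : 2 * K * (`|s - s0| + rn (w - w0)) <= 2 * K * (r + r).
    by rewrite ler_wpM2l ?mulr_ge0 //; lra.
  by rewrite /B; move: h3; gen_rn; lra.
Qed.

(** Row j is the generator of the j-th circle factor, read in the chart c. *)
Definition Xm c w := As c c 0 w.

(** The differential of each torus element in the point direction commutes with i. Differentiating
    this identity in the torus direction e_j and exchanging the two derivatives shows that the
    derivative of the generator is complex linear. *)
Lemma field_qhol c x j : atlas X c -> ch_dom c x ->
  qhol (fun w => row j (Xm c w)) (ch_to c x).
Proof.
move=> Xc cx; set w0 := ch_to c x.
have D0 : act_coord_dom act c c (pk 0 w0).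
  by apply/act_coord_domP; rewrite /w0 ch_toK' // phi0; split => //; exists x.
pose g := act_coord act c c; pose D := act_coord_dom act c c.
pose ej : 'rV[R]_(k + (n + n)) := row_mx (delta_mx 0 j) 0.
pose G p := 'd g p ej.
have smg r : Cr_on r D g by exact: (action_smooth Hsm Xc Xc r).
have smG : Cr_on 2 D G by have [_] := smg 3%N; exact.
have [r [K [r0 K0 rD rL rT]]] := C2_taylor (@act_dom_open c c) D0 smG.
pose F' w : 'M[C R]_n := \matrix_i complexify ('d G (pk 0 w) (row_mx 0 (realify (delta_mx 0 i)))).
have F'E w h : D (pk 0 w) ->
    complexify ('d G (pk 0 w) (row_mx 0 (realify h))) = h *m F' w.
  move=> Dw.
  apply: (@complex_linear_mx _ _ _ (fun h => complexify ('d G (pk 0 w) (row_mx 0 (realify h))))).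
  - by move=> u v; rewrite realifyD row0D linearD complexifyD.
  - by move=> t u; rewrite realifyZ row0Z linearZ complexifyZ.
  move=> u.
  pose vi : 'rV[R]_(k + (n + n)) := row_mx 0 (realify ('i%C *: u)).
  pose v1 : 'rV[R]_(k + (n + n)) := row_mx 0 (realify u).
  have Ei : 'd G (pk 0 w) vi = 'd (fun p => 'd g p vi) (pk 0 w) ej.
    exact: (mixed_derivatives ej vi (@act_dom_open c c) Dw (smg 3%N)).
  have E1 : 'd G (pk 0 w) v1 = 'd (fun p => 'd g p v1) (pk 0 w) ej.
    exact: (mixed_derivatives ej v1 (@act_dom_open c c) Dw (smg 3%N)).
  apply: (etrans (congr1 (@complexify R n) Ei)).
  apply: (etrans _ (congr1 (fun z => 'i%C *: complexify z) (esym E1))).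
  have dd v : differentiable (fun p => 'd g p v) (pk 0 w).
    by have [_ /(_ v)[hd _]] := smg 2%N; exact: hd.
  have hh v : hasd (fun t : R => complexify ('d g (pk 0 w + t *: ej) v)) 0
      (complexify ('d (fun p => 'd g p v) (pk 0 w) ej)).
    have := @diff_hasd _ _ _ (fun p => 'd g p v) (pk 0 w) ej 0.
    rewrite scale0r addr0 => /(_ (dd v)); exact: hasd_complexify.
  have [r1 r10 r1D] := act_dom_open Dw.
  have c0 : 0 < 1 + `|ej| by rewrite ltr_pwDl.
  apply: (hasd_uniq (hh vi)).
  apply: (@hasd_ext _ _ (fun t : R => 'i%C *: complexify ('d g (pk 0 w + t *: ej) v1)) _ _ _
    (r1 / (1 + `|ej|))); [by rewrite divr_gt0| |exact: hasd_scale].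
  move=> a; rewrite subr0 ltr_pdivlMr // => sr.
  have Ds : D (pk 0 w + a *: ej).
    apply: r1D; rewrite (addrC (pk 0 w)) addrK normrZ; apply: le_lt_trans sr.
    by rewrite ler_wpM2l // lerDr.
  rewrite (pkE (pk 0 w + a *: ej)) in Ds *.
  by rewrite /v1 /vi !AwE // -scalemxAl.
exists F', (r / 2), (2 * K); split; first by rewrite divr_gt0.
have inr (w : 'rV[C R]_n) : rn (w - w0) < r / 2 -> `|pk 0 w - pk 0 w0| < r.
  by move=> hw; apply: le_lt_trans (norm_pkB _ _ _ _) _; rewrite subrr normr0; lra.
move=> a b /inr ar /inr br.
have E : row j (Xm c b) - row j (Xm c a) - (b - a) *m F' a =
   complexify (G (pk 0 b) - G (pk 0 a) - 'd G (pk 0 a) (pk 0 b - pk 0 a)).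
  rewrite !complexifyB /Xm !row_As; congr (_ - _).
  rewrite -F'E; last exact: rD.
  by rewrite /pk opp_row_mx add_row_mx subrr realifyB.
rewrite E; apply: le_trans (rn_complexify _) _; rewrite -mulrA ler_pM2l //.
apply: le_trans (rT _ _ ar br) _; rewrite ler_wpM2l // lerXn2r ?nnegrE ?rn_ge0 //.
by apply: le_trans (norm_pkB _ _ _ _) _; rewrite subrr normr0 add0r.
Qed.
End LocalAction.

(** * Holomorphic maps into M; invariance of the generators *)

Section IntegralCurves.
Context {R : realType} {M : topologicalType} {n : nat}.
Context (X : complexManifold R M n) (k : nat) (act : 'rV[C R]_k -> M -> M).
Context (Hsm : smooth_action X act) (Hps : preserves_complex_structure X act).
Implicit Types (c : chart R M n) (x : M).

Local Notation phi := (phi act).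
Local Notation alpha := (alpha act).
Local Notation Xm := (Xm act).
Local Notation Aw := (Aw act).

(** The first clause is continuity at u; it gives the chart expressions of the second clause a
    meaning near u. *)
Definition hol b (g : 'rV[C R]_b -> M) (u : 'rV[C R]_b) :=
  (forall N, nbhs (g u) N -> exists2 r : R, 0 < r & forall u' : 'rV[C R]_b,
     rn (u' - u) < r -> N (g u')) /\
  forall c, atlas X c -> ch_dom c (g u) -> qhol (fun u' => ch_to c (g u')) u.

Definition ccont (g : R -> M) t := forall N, nbhs (g t) N ->
  exists2 d : R, 0 < d & forall s, `|s - t| < d -> N (g s).

(** An integral curve, in real time, of the field obtained by combining the generators with the
    complex coefficients v. *)
Definition icurve v (g : R -> M) (T : R) := forall t, `|t| < T -> ccont g t /\
  forall c, atlas X c -> ch_dom c (g t) ->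
    hasd (fun s => ch_to c (g s)) t (v *m Xm c (ch_to c (g t))).

Lemma dom_nbhs c x : ch_dom c x -> nbhs x (ch_dom c).
Proof. by move=> cx; apply: open_nbhs_nbhs; split => //; exact: ch_dom_open. Qed.

Lemma alpha_qhol c c' x s : atlas X c -> atlas X c' -> ch_dom c x ->
  ch_dom c' (phi s x) -> qhol_with (alpha c c' s) (Aw c c' s) (ch_to c x).
Proof.
move=> Xc Xc' cx c'x; have [r [K H]] := action_local Hsm Hps Xc Xc' cx c'x.
exists r, K; split; first exact: al_r H.
move=> w w' wr wr'; have sr : `|s - s| < r by rewrite subrr normr0 (al_r H).
have := al_T H sr wr sr wr'.
by rewrite subrr complexv0 mul0mx subr0 normr0 add0r.
Qed.

Lemma orbit_hasd c x (a : 'rV[R]_k) : atlas X c -> ch_dom c x ->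
  hasd (fun t : R => ch_to c (phi (t *: a) x)) 0 (complexv a *m Xm c (ch_to c x)).
Proof.
move=> Xc cx; have c0x : ch_dom c (phi 0 x) by rewrite (phi0 Hsm).
have [r [K H]] := action_local Hsm Hps Xc Xc cx c0x.
move=> e e0; have r0 := al_r H; have K0 := al_K H.
have A0 : 0 < 1 + `|a| by rewrite ltr_pwDl.
have A2 : 0 < K * (1 + `|a|) ^+ 2 by rewrite mulr_gt0 // exprn_gt0.
exists (Num.min (r / (1 + `|a|)) (e / (K * (1 + `|a|) ^+ 2))).
  by rewrite lt_min !divr_gt0.
move=> t; rewrite subr0 lt_min !ltr_pdivlMr // => /andP[t1 t2].
have w0 : rn (ch_to c x - ch_to c x) < r by rewrite subrr rn0.
have s0 : `|0 - 0 : 'rV[R]_k| < r by rewrite subrr normr0.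
have ta : `|t *: a| <= `|t| * (1 + `|a|) by rewrite normrZ ler_wpM2l // lerDr.
have s1 : `|t *: a - 0| < r by rewrite subr0; exact: le_lt_trans t1.
have := al_T H s0 w0 s1 w0.
rewrite !subr0 subrr mul0mx subr0 rn0 addr0 complexvZ -scalemxAl.
rewrite !alphaE /= ch_toK' // scale0r => h; apply: le_trans h _.
have h1 : `|t *: a| ^+ 2 <= (`|t| * (1 + `|a|)) ^+ 2.
  by rewrite lerXn2r ?nnegrE ?mulr_ge0 // ltW.
apply: le_trans (ler_wpM2l (ltW K0) h1) _.
have D0 := normr_ge0 t; have := ler_wpM2r D0 (ltW t2).
by rewrite exprMn; move: (`|t|) ((1 + `|a|) ^+ 2) => z y; lra.
Qed.

Lemma mx_real_ext m (A B : 'M[C R]_(k, m)) :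
  (forall a : 'rV[R]_k, complexv a *m A = complexv a *m B) -> A = B.
Proof.
move=> h; apply/row_matrixP => j; have := h (delta_mx 0 j).
have -> : complexv (delta_mx 0 j) = delta_mx 0 j :> 'rV[C R]_k.
  by apply/rowP => i; rewrite !mxE; case: (_ && _).
by rewrite -!rowE.
Qed.

Lemma ccont_phi s (g : R -> M) t : ccont g t -> ccont (fun r => phi s (g r)) t.
Proof.
move=> cg N /(phi_cont Hsm)[d d0 [U nU UP]]; have [e e0 h] := cg U nU.
by exists e => // r /h Ur; apply: UP => //; rewrite subrr normr0.
Qed.

(** The torus is commutative: differentiate phi (t a) (phi s x) = phi s (phi (t a) x) at t = 0. Real
    vectors a suffice to identify complex matrices. *)
Lemma field_invariant c c' x s : atlas X c -> atlas X c' -> ch_dom c x ->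
  ch_dom c' (phi s x) ->
  Xm c (ch_to c x) *m Aw c c' s (ch_to c x) = Xm c' (ch_to c' (phi s x)).
Proof.
move=> Xc Xc' cx c'x; apply: mx_real_ext => a; rewrite mulmxA.
have h1 := orbit_hasd a Xc' c'x.
have h2 := orbit_hasd a Xc cx.
have q := alpha_qhol Xc Xc' cx c'x.
have xE : ch_to c (phi ((0 : R) *: a) x) = ch_to c x by rewrite scale0r (phi0 Hsm).
have h3 := @hasd_qhol _ _ _ (alpha c c' s) (Aw c c' s) _ _ _
  (eq_rect _ (fun z => qhol_with _ _ z) q _ (esym xE)) h2.
rewrite xE in h3; apply: (hasd_uniq h3).
have cc : ccont (fun t : R => phi (t *: a) x) 0.
  move=> N; rewrite scale0r => /(phi_cont Hsm)[d d0 [U nU UP]].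
  have A0 : 0 < 1 + `|a| by rewrite ltr_pwDl.
  exists (d / (1 + `|a|)); first by rewrite divr_gt0.
  move=> t; rewrite subr0 ltr_pdivlMr // => td; apply: UP; last exact: nbhs_singleton.
  by rewrite subr0 normrZ; apply: le_lt_trans td; rewrite ler_wpM2l // lerDr.
have [|d d0 dP] := cc (ch_dom c); first by rewrite scale0r (phi0 Hsm); exact: dom_nbhs.
apply: (hasd_ext d0 _ h1) => t td /=.
rewrite !alphaE ch_toK'; last exact: dP.
by rewrite -(phiD Hsm) addrC (phiD Hsm).
Qed.
End IntegralCurves.

(** * Local existence and uniqueness of integral curves on M *)

Section LocalFlowOnM.
Context {R : realType} {M : topologicalType} {n : nat}.
Context (X : complexManifold R M n) (k : nat) (act : 'rV[C R]_k -> M -> M).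
Context (Hsm : smooth_action X act) (Hps : preserves_complex_structure X act).
Implicit Types (c : chart R M n) (x : M) (v : 'rV[C R]_k).

Local Notation phi := (phi act).
Local Notation Xm := (Xm act).
Local Notation hol := (hol X).
Local Notation icurve := (icurve X act).

Lemma qhol_cont a b (f : 'rV[C R]_a -> 'rV[C R]_b) u (e : R) : qhol f u -> 0 < e ->
  exists2 r : R, 0 < r & forall u' : 'rV[C R]_a, rn (u' - u) < r -> rn (f u' - f u) < e.
Proof.
move=> [f' /qhol_nice[r [K H]]] e0; have K0 := nice_K H.
exists (Num.min r (e / K)); first by rewrite lt_min (nice_r H) divr_gt0.
move=> u'; rewrite lt_min ltr_pdivlMr // => /andP[ur ue].
have u0 : rn (u - u) < r by rewrite subrr rn0 (nice_r H).
by apply: le_lt_trans (nice_fL H u0 ur) _; rewrite mulrC.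
Qed.

Lemma ccont_chart c (b : R -> 'rV[C R]_n) t w : ch_cod c (b t) -> hasd b t w ->
  ccont (fun s => ch_of c (b s)) t.
Proof.
move=> cb hb N nN; have [c1 c2] := ch_codP cb.
have [r r0 rP] := chart_nbhs c1 nN.
have r2 : 0 < r / 2 by lra.
have [d d0 hd] := hasd_of_primitive r2 hb; exists d => // s /hd h.
have h2 : rn (b s - ch_to c (ch_of c (b t))) < r by rewrite c2; apply: le_lt_trans h _; lra.
by have [] := rP _ h2.
Qed.

Lemma icurve_of_chart c (b : R -> 'rV[C R]_n) t v : atlas X c -> ch_cod c (b t) ->
  hasd b t (v *m Xm c (b t)) -> ccont (fun s => ch_of c (b s)) t /\
  forall c', atlas X c' -> ch_dom c' (ch_of c (b t)) ->
   hasd (fun s => ch_to c' (ch_of c (b s))) t (v *m Xm c' (ch_to c' (ch_of c (b t)))).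
Proof.
move=> Xc cb hb; split; first exact: ccont_chart hb.
move=> c' Xc' c'b; have [c1 c2] := ch_codP cb.
have c'0 : ch_dom c' (phi 0 (ch_of c (b t))) by rewrite (phi0 Hsm).
have q := alpha_qhol Hsm Hps Xc Xc' c1 c'0; rewrite c2 in q.
have := hasd_qhol q hb; rewrite -mulmxA.
have := field_invariant Hsm Hps Xc Xc' c1 c'0; rewrite c2 (phi0 Hsm) => ->.
by apply: hasd_ext ltr01 _ => s _ /=; rewrite alphaE (phi0 Hsm).
Qed.

Lemma icurve_chart_change c (g : R -> M) t v : atlas X c -> ch_dom c (g t) -> ccont g t ->
  hasd (fun s => ch_to c (g s)) t (v *m Xm c (ch_to c (g t))) ->
  forall c', atlas X c' -> ch_dom c' (g t) ->
   hasd (fun s => ch_to c' (g s)) t (v *m Xm c' (ch_to c' (g t))).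
Proof.
move=> Xc cg cont hg c' Xc' c'g.
have cb : ch_cod c (ch_to c (g t)) by exists (g t).
have gE := ch_toK' cg.
have [_ /(_ c' Xc')] := icurve_of_chart Xc cb hg; rewrite gE => /(_ c'g).
have [d d0 hd] := cont _ (dom_nbhs cg).
by apply: hasd_ext d0 _ => s sd; rewrite ch_toK' //; exact: hd.
Qed.

Lemma hol_of_chart c b (f : 'rV[C R]_b -> 'rV[C R]_n) u : atlas X c -> qhol f u ->
  ch_cod c (f u) -> hol (fun u => ch_of c (f u)) u.
Proof.
move=> Xc qf cf; have [c1 c2] := ch_codP cf; split.
  move=> N nN; have [r r0 rP] := chart_nbhs c1 nN.
  have [d d0 hd] := qhol_cont qf r0; exists d => // u' /hd h.
  by rewrite -[X in rn (_ - X)]c2 in h; have [] := rP _ h.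
move=> c' Xc' c'f.
have c'0 : ch_dom c' (phi 0 (ch_of c (f u))) by rewrite (phi0 Hsm).
have q := alpha_qhol Hsm Hps Xc Xc' c1 c'0; rewrite c2 in q.
have [f' hf] := qf; have := qhol_with_comp hf q => h; eexists.
apply: qhol_with_ext ltr01 _ h => u' _ /=; by rewrite alphaE (phi0 Hsm).
Qed.

Lemma hol_ext b (g h : 'rV[C R]_b -> M) u (r : R) : 0 < r ->
  (forall u' : 'rV[C R]_b, rn (u' - u) < r -> g u' = h u') -> hol g u -> hol h u.
Proof.
move=> r0 gh [c1 c2]; have u0 : rn (u - u) < r by rewrite subrr rn0.
split; rewrite -gh //.
  move=> N /c1[d d0 hd]; exists (Num.min r d); first by rewrite lt_min r0.
  by move=> u'; rewrite lt_min => /andP[ur ud]; rewrite -gh //; exact: hd.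
by move=> c Xc cg; apply: qhol_ext r0 _ (c2 c Xc cg) => u' /gh ->.
Qed.

Lemma hol_comp a b (f : 'rV[C R]_a -> 'rV[C R]_b) (g : 'rV[C R]_b -> M) u :
  qhol f u -> hol g (f u) -> hol (fun u => g (f u)) u.
Proof.
move=> qf [c1 c2]; split.
  move=> N /c1[r r0 hr]; have [d d0 hd] := qhol_cont qf r0.
  by exists d => // u' /hd; exact: hr.
by move=> c Xc cg; have := qhol_comp qf (c2 c Xc cg).
Qed.

(** Adjoining v as a coordinate with zero velocity turns dependence on the field into dependence on
    the initial point, which [local_flow] controls. *)
Lemma field_joint_qhol c x v : atlas X c -> ch_dom c x ->
  qhol (fun y : 'rV[C R]_(k + n) => row_mx (0 : 'rV_k) (lsubmx y *m Xm c (rsubmx y)))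
    (row_mx v (ch_to c x)).
Proof.
move=> Xc cx.
have [f' f'P] := fin_all_exists (fun j => field_qhol Hsm Hps j Xc cx).
pose S j : 'M[C R]_(k + n, 1) := col_mx (delta_mx j 0) 0.
have h j : exists g', qhol_with (fun y : 'rV[C R]_(k + n) => (y *m S j) *m row j (Xm c (rsubmx y))) g'
    (row_mx v (ch_to c x)).
  have h1 : qhol_with (fun y : 'rV[C R]_(k + n) => y *m col_mx 0 1%:M + 0)
      (fun=> col_mx 0 1%:M) (row_mx v (ch_to c x)) by exact: qhol_with_affine.
  have h2 : qhol_with (fun y : 'rV[C R]_(k + n) => y *m S j + 0)
      (fun=> S j) (row_mx v (ch_to c x)) by exact: qhol_with_affine.
  have h3 := @qhol_with_comp _ _ _ _ _ _ (fun w => row j (Xm c w)) (f' j) _ h1.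
  rewrite -rsubmxE addr0 row_mxKr in h3.
  have h4 := qhol_with_smul h2 (h3 (f'P j)); eexists.
  apply: qhol_with_ext ltr01 _ h4 => y _ /=.
  by rewrite !addr0 -rsubmxE.
have [g' g'P] := fin_all_exists h.
have hs := qhol_with_sum (index_enum 'I_k) g'P.
have hz : qhol_with (fun y : 'rV[C R]_(k + n) => y *m 0 + 0 : 'rV[C R]_k) (fun=> 0)
   (row_mx v (ch_to c x)) by exact: qhol_with_affine.
have hr := qhol_with_row hz hs; eexists.
apply: qhol_with_ext ltr01 _ hr => y _ /=.
rewrite mulmx0 addr0 mulmx_sum_row; congr row_mx; apply: eq_bigr => j _.
rewrite -[in LHS](hsubmxK y) mul_row_col mulmx0 addr0 -mul_scalar_mx; congr (_ *m _); last by rewrite hsubmxK.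
apply/rowP => i; rewrite ord1 !mxE eqxx mulr1n (bigD1 j) //= big1 ?addr0.
  by rewrite !mxE !eqxx mulr1.
by move=> l lj; rewrite !mxE eqxx andbT (negPf lj) mulr0.
Qed.

Lemma local_icurve x : exists d : R, 0 < d /\ exists2 U, nbhs x U &
  exists c Pf, atlas X c /\ forall y v, U y -> rn v < d ->
    [/\ ch_dom c y, qhol Pf (row_mx v (ch_to c y)), ch_cod c (Pf (row_mx v (ch_to c y))) &
    exists g : R -> M, [/\ g 0 = y, icurve v g 2 & g 1 = ch_of c (Pf (row_mx v (ch_to c y)))]].
Proof.
have [c Xc cx] := atlas_cover X x.
have nT : nbhs x setT by exact: filterT.
have [r1 r10 r1P] := chart_nbhs cx nT.
pose F (y : 'rV[C R]_(k + n)) := row_mx (0 : 'rV[C R]_k) (lsubmx y *m Xm c (rsubmx y)).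
have [F' hF] : qhol F (row_mx 0 (ch_to c x)) by exact: field_joint_qhol.
have [r [T [y [r0 T0 y0 yP yq]]]] := local_flow hF r10.
set p := row_mx 0 _ in y0 yP yq.
have T2 : 0 < T / 2 by lra.
exists (r * (T / 2) / 2); split; first by rewrite divr_gt0 // mulr_gt0.
exists [set z | ch_dom c z /\ rn (ch_to c z - ch_to c x) < r / 2].
  by apply: chart_nbhs_to => //; lra.
(* Running along v for time 1 is running along v / (T / 2) for time T / 2, which lies inside the
   interval of existence. *)
pose l : 'M[C R]_(k + n) := block_mx (rc (T / 2)^-1)%:M 0 0 1%:M.
have lE v w : row_mx v w *m l = row_mx (rc (T / 2)^-1 *: v) w.
  by rewrite /l mul_row_block !mulmx0 mulmx1 addr0 add0r mul_mx_scalar.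
exists c, (fun z => rsubmx (y (z *m l + 0) (T / 2))); split => // z v [cz zr] vd.
have T2' : T / 2 < T by lra.
have TT : `|T / 2| < T by rewrite gtr0_norm.
have inr : rn (row_mx (rc (T / 2)^-1 *: v) (ch_to c z) - p) < r.
  apply: le_lt_trans (_ : r / 2 < r); last by lra.
  rewrite /p opp_row_mx add_row_mx subr0; apply: rn_row_mx; last exact: ltW.
  rewrite rnZ ab_rc ger0_norm ?invr_ge0 ?(ltW T2) // mulrC ler_pdivrMr //.
  by rewrite mulrAC ltW.
set q := row_mx _ _ in inr.
have yPq t : `|t| < T -> rn (y q t - p) < r1 /\ hasd (y q) t (F (y q t)).
  by move=> tT; exact: yP.
have yl t : `|t| < T -> lsubmx (y q t) = rc (T / 2)^-1 *: v.
  move=> tT; apply/eqP; rewrite -subr_eq0; apply/eqP; apply: rn_le0.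
  have h s : `|s| < T -> hasd (fun s => lsubmx (y q s)) s 0.
    by move=> sT; have := hasd_lsub (yPq s sT).2; rewrite /F row_mxKl.
  have h0 (s : R) : `|s| < T -> rn (0 : 'rV[C R]_k) <= 0 by rewrite rn0.
  have := mean_value_bound0 h h0 tT.
  by rewrite y0 // /q row_mxKl mul0r.
have yr t : `|t| < T -> rn (rsubmx (y q t) - ch_to c x) < r1.
  move=> /yPq[h _]; apply: le_lt_trans h; have -> : ch_to c x = rsubmx p by rewrite /p row_mxKr.
  by rewrite -linearB; exact: rn_rsub.
have yh t : `|t| < T -> hasd (fun s => rsubmx (y q s)) t
    (rc (T / 2)^-1 *: v *m Xm c (rsubmx (y q t))).
  by move=> tT; have := hasd_rsub (yPq t tT).2; rewrite /F row_mxKr yl.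
have sT (t : R) : `|t| < 2 -> `|T / 2 * t| < T.
  by move=> t2; rewrite normrM gtr0_norm //; move: (`|t|) t2 => s; nra.
have bh (t : R) : `|t| < 2 -> hasd (fun s => rsubmx (y q (T / 2 * s))) t
    (v *m Xm c (rsubmx (y q (T / 2 * t)))).
  move=> t2; have := hasd_rescale (yh _ (sT _ t2)).
  have E1 : rc (T / 2) * rc (T / 2)^-1 = 1 :> C R.
    by rewrite rcV divff // rc_eq0 gt_eqF.
  have -> : rc (T / 2) *: (rc (T / 2)^-1 *: v *m Xm c (rsubmx (y q (T / 2 * t)))) =
      v *m Xm c (rsubmx (y q (T / 2 * t))); last exact.
  move: (Xm c _) => Z; rewrite -scalemxAl scalerA.
  move: E1; move: (rc _ * rc _) => u ->; exact: scale1r.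
have bc (t : R) : `|t| < 2 -> ch_cod c (rsubmx (y q (T / 2 * t))).
  by move=> t2; have [] := r1P _ (yr _ (sT _ t2)).
have qE : row_mx v (ch_to c z) *m l + 0 = q by rewrite addr0 lE.
split => //.
- have h1 : qhol_with (fun z : 'rV[C R]_(k + n) => z *m l + 0) (fun=> l) (row_mx v (ch_to c z)).
    exact: qhol_with_affine.
  have h2 := yq q (T / 2) inr TT; rewrite -qE in h2.
  have [g' hg] := h2; have h3 := qhol_with_comp h1 hg.
  have h4 := qhol_with_mulr (col_mx 0 1%:M) h3; eexists.
  by apply: qhol_with_ext ltr01 _ h4 => w _ /=; rewrite -rsubmxE.
- by rewrite qE -[X in y q X]mulr1; apply: bc; rewrite normr1; lra.
exists (fun t => ch_of c (rsubmx (y q (T / 2 * t)))); split.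
- by rewrite mulr0 y0 // /q row_mxKr ch_toK'.
- by move=> t t2; exact: icurve_of_chart (bc t t2) (bh t t2).
- by rewrite mulr1 qE.
Qed.

Lemma icurve_shift v (g : R -> M) T a t : `|a + t| < T ->
  icurve v g T -> ccont (fun s => g (a + s)) t /\ forall c, atlas X c -> ch_dom c (g (a + t)) ->
    hasd (fun s => ch_to c (g (a + s))) t (v *m Xm c (ch_to c (g (a + t)))).
Proof.
move=> aT hg; have [c1 c2] := hg _ aT; split.
  move=> N /c1[d d0 hd]; exists d => // s sd; apply: hd.
  by have -> : a + s - (a + t) = s - t by ring.
by move=> c Xc cg; exact: hasd_shift (c2 c Xc cg).
Qed.

Lemma icurve_rescale v (g : R -> M) T (a : R) : icurve v g T ->
  forall S, (forall t, `|t| < S -> `|a * t| < T) -> icurve (rc a *: v) (fun t => g (a * t)) S.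
Proof.
move=> hg S ST t tS; have [c1 c2] := hg _ (ST t tS); split.
  move=> N /c1[d d0 hd]; have a0 : 0 < 1 + `|a| by rewrite ltr_pwDl.
  exists (d / (1 + `|a|)); first by rewrite divr_gt0.
  move=> s; rewrite ltr_pdivlMr // => sd; apply: hd.
  rewrite -mulrBr normrM; apply: le_lt_trans sd; rewrite mulrC ler_wpM2l //.
  by rewrite lerDr.
by move=> c Xc cg; rewrite -scalemxAl; exact: hasd_rescale (c2 c Xc cg).
Qed.

Lemma icurve_local_uniq v (g h : R -> M) T a : `|a| < T -> icurve v g T -> icurve v h T ->
  g a = h a -> exists2 d : R, 0 < d & forall s, `|s - a| < d -> g s = h s.
Proof.
move=> aT hg hh gh; have [c Xc cg] := atlas_cover X (g a).
have q : qhol (fun w => v *m Xm c w) (ch_to c (g a)).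
  have [f' f'P] := fin_all_exists (fun j => field_qhol Hsm Hps j Xc cg).
  have h1 j := qhol_with_mulr (v 0 j)%:M (f'P j).
  have hs := qhol_with_sum (index_enum 'I_k) h1; eexists.
  apply: qhol_with_ext ltr01 _ hs => w _ /=; rewrite mulmx_sum_row.
  by apply: eq_bigr => j _; rewrite mul_mx_scalar.
have [f' /qhol_nice[r [K H]]] := q; have r0 := nice_r H; have K0 := nice_K H.
have nN := chart_nbhs_to cg r0.
have [d1 d10 h1] := (hg _ aT).1 _ nN.
have [|d2 d20 h2] := (hh _ aT).1 [set y | ch_dom c y /\ rn (ch_to c y - ch_to c (g a)) < r].
  by rewrite -gh.
have Ta : 0 < T - `|a| by rewrite subr_gt0.
pose S := Num.min (Num.min d1 d2) (Num.min (T - `|a|) (1 / (2 * K))).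
have S0 : 0 < S by rewrite !lt_min d10 d20 Ta divr_gt0 // mulr_gt0.
have Sd1 : S <= d1 by rewrite !ge_min lexx.
have Sd2 : S <= d2 by rewrite !ge_min lexx orbT.
have STa : S <= T - `|a| by rewrite !ge_min lexx !orbT.
have SK : 2 * K * S <= 1.
  have : S <= 1 / (2 * K) by rewrite !ge_min lexx !orbT.
  by rewrite ler_pdivlMr ?mulr_gt0 // mulrC.
have sa s : `|s| < S -> `|a + s - a| < d1 /\ `|a + s - a| < d2 /\ `|a + s| < T.
  move=> sS; rewrite (addrC a) addrK; split; first exact: lt_le_trans Sd1.
  split; first exact: lt_le_trans Sd2.
  by rewrite addrC; apply: le_lt_trans (ler_normD _ _) _; lra.
have key (f : R -> M) : icurve v f T ->
   (forall s, `|s| < S -> ch_dom c (f (a + s)) /\ rn (ch_to c (f (a + s)) - ch_to c (g a)) < r) ->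
   forall s, `|s| < S -> rn (ch_to c (f (a + s)) - ch_to c (g a)) < r /\
     hasd (fun s => ch_to c (f (a + s))) s (v *m Xm c (ch_to c (f (a + s)))).
  move=> hf fP s sS; have [f1 f2] := fP s sS; split => //.
  have [_ [_ aS]] := sa s sS.
  by have [_ /(_ c Xc f1)] := icurve_shift aS hf.
have gP s : `|s| < S -> ch_dom c (g (a + s)) /\ rn (ch_to c (g (a + s)) - ch_to c (g a)) < r.
  by move=> /sa[s1 _]; exact: h1.
have hP s : `|s| < S -> ch_dom c (h (a + s)) /\ rn (ch_to c (h (a + s)) - ch_to c (g a)) < r.
  by move=> /sa[_ [s1 _]]; exact: h2.
have L (x y : 'rV[C R]_n) : rn (x - ch_to c (g a)) < r -> rn (y - ch_to c (g a)) < r ->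
    rn (v *m Xm c x - v *m Xm c y) <= K * rn (x - y).
  by move=> xr yr; have := nice_fL H yr xr; apply.
have lip := ode_lipschitz (ltW K0) SK L (key g hg gP) (key h hh hP).
exists S => // s sS.
have := lip (s - a) sS; rewrite addr0 gh subrr rn0 mulr0 => /rn_le0/eqP.
have -> : a + (s - a) = s by ring.
rewrite subr_eq0 => /eqP E.
have [g1 _] := gP _ sS; have [g2 _] := hP _ sS.
rewrite (_ : a + (s - a) = s) in g1 g2; last by ring.
by rewrite -(ch_toK' g1) E ch_toK'.
Qed.

(** The curves still agree at the supremum of the times up to which they agree, because M is
    Hausdorff; local uniqueness then prevents this supremum from being smaller than b. *)
Lemma icurve_uniq_pos v (g h : R -> M) T : icurve v g T -> icurve v h T -> g 0 = h 0 ->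
  forall t : R, 0 <= t < T -> g t = h t.
Proof.
move=> hg hh gh0 b /andP[b0 bT].
pose S := [set s : R | 0 <= s <= b /\ forall r : R, 0 <= r <= s -> g r = h r].
have S0 : S 0.
  split; first by rewrite lexx.
  by move=> r r0; have -> : r = 0 by apply/le_anti; rewrite andbC.
have Sb : ubound S b by move=> s [/andP[]].
have supS : has_sup S by split; [exists 0|exists b].
pose s0 := sup S.
have s00 : 0 <= s0 by apply: ub_le_sup => //; exists b.
have s0b : s0 <= b by apply: ge_sup => //; exists 0.
have low (r : R) : 0 <= r -> r < s0 -> g r = h r.
  move=> r0 rs; have d0 : 0 < s0 - r by rewrite subr_gt0.
  have [s Ss ss] := sup_adherent d0 supS; case: Ss => _; apply.
  by rewrite r0 /=; move: ss; rewrite -/s0; lra.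
have s0T : `|s0| < T by rewrite ger0_norm //; exact: le_lt_trans s0b bT.
have gh : g s0 = h s0.
  have [->//|sN] := eqVneq s0 0.
  have sp : 0 < s0 by rewrite lt_def sN.
  apply: (manifold_hausdorff X) => A B nA nB.
  have [d1 d10 h1] := (hg _ s0T).1 _ nA; have [d2 d20 h2] := (hh _ s0T).1 _ nB.
  pose d := Num.min s0 (Num.min d1 d2); have dp : 0 < d by rewrite !lt_min sp d10.
  have ds : d <= s0 by rewrite ge_min lexx.
  have dd1 : d <= d1 by rewrite !ge_min lexx orbT.
  have dd2 : d <= d2 by rewrite !ge_min lexx !orbT.
  have E : `|s0 - d / 2 - s0| = d / 2.
    by rewrite (addrC s0) addrK normrN gtr0_norm //; lra.
  exists (g (s0 - d / 2)); split; first by apply: h1; rewrite E; lra.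
  by rewrite low; [apply: h2; rewrite E|..]; lra.
have [d d0 hd] := icurve_local_uniq s0T hg hh gh.
have ge (r : R) : 0 <= r -> r < s0 + d -> g r = h r.
  move=> r0 rs; have [rs0|rs0] := ltP r s0; first exact: low.
  by apply: hd; rewrite ger0_norm ?subr_ge0 //; lra.
have [sb|bs] := leP (s0 + d / 2) b.
  have : S (s0 + d / 2).
    split; first by apply/andP; split; lra.
    by move=> r /andP[r0 rs]; apply: ge => //; lra.
  move=> Ss; have : s0 + d / 2 <= s0 by apply: ub_le_sup => //; exists b.
  by rewrite gerDl leNgt divr_gt0.
by apply: ge => //; lra.
Qed.

Lemma icurve_uniq v (g h : R -> M) T : icurve v g T -> icurve v h T -> g 0 = h 0 ->
  forall t, `|t| < T -> g t = h t.
Proof.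
move=> hg hh gh0 t; have [t0|t0] := leP 0 t.
  by rewrite ger0_norm // => tT; apply: (icurve_uniq_pos hg hh) => //; rewrite t0.
rewrite ltr0_norm // => tT.
have sgn s : `|s| < T -> `|-1 * s| < T by rewrite mulN1r normrN.
have hg' := icurve_rescale hg sgn; have hh' := icurve_rescale hh sgn.
have := icurve_uniq_pos hg' hh'; rewrite mulr0 => /(_ gh0 (- t)).
by rewrite mulN1r opprK; apply; rewrite tT oppr_ge0 ltW.
Qed.
End LocalFlowOnM.

(** * The action of C^k on M *)

Lemma iter_comp (T : Type) (f g h : T -> T) : (forall x, f x = g (h x)) ->
  (forall x, g (h x) = h (g x)) -> forall N x, iter N f x = iter N g (iter N h x).
Proof.
move=> fE com; have comj j y : h (iter j g y) = iter j g (h y).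
  by elim: j => //= j <-; rewrite com.
by elim=> //= N ih x; rewrite ih fE comj.
Qed.

Section GlobalFlow.
Context {R : realType} {M : topologicalType} {n : nat}.
Context (X : complexManifold R M n) (k : nat) (act : 'rV[C R]_k -> M -> M).
Context (Hsm : smooth_action X act) (Hps : preserves_complex_structure X act).
Context (Hcpt : compact [set: M]).
Implicit Types (c : chart R M n) (x y : M) (v w : 'rV[C R]_k).

Local Notation phi := (phi act).
Local Notation Xm := (Xm act).
Local Notation hol := (hol X).
Local Notation icurve := (icurve X act).

(** The time-one flow along v. The default value x is taken only when no integral curve exists on
    (-2, 2); by compactness this never happens for small v. *)
Definition fl v x : M :=
  if pselect (exists g : R -> M, g 0 = x /\ icurve v g 2) is left h
  then projT1 (cid h) 1 else x.

Lemma flE v x (g : R -> M) : g 0 = x -> icurve v g 2 -> fl v x = g 1.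
Proof.
move=> g0 hg; rewrite /fl; case: pselect => [h|[]]; last by exists g.
case: (cid h) => f [f0 hf] /=; apply: (icurve_uniq Hsm Hps hf hg); first by rewrite f0.
by rewrite normr1; lra.
Qed.

(** Joint holomorphy in the field and in the point is expressed by substituting arbitrary
    holomorphic l and g, which avoids charts on the product of C^k and M. *)
Definition flow_spec (d : R) x := forall v, rn v < d ->
  (exists g : R -> M, g 0 = x /\ icurve v g 2) /\
  forall b (l : 'rV[C R]_b -> 'rV[C R]_k) (g : 'rV[C R]_b -> M) u,
    qhol l u -> hol g u -> g u = x -> l u = v -> hol (fun u => fl (l u) (g u)) u.

Lemma flow_spec_local x : exists2 d : R, 0 < d & \forall y \near x, flow_spec d y.
Proof.
have [d [d0 [U nU [c [Pf [Xc H]]]]]] := local_icurve Hsm Hps x.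
exists d => //; have nV := nbhs_interior nU.
apply: filterS nV => y Vy v vd; have [cy qP cP [g [g0 hg g1]]] := H y v (interior_subset Vy) vd.
split; first by exists g.
move=> b l h u ql hh hy lv.
have [l' hl] := ql; have [h' hh'] : qhol (fun u => ch_to c (h u)) u.
  by apply: hh.2 => //; rewrite hy.
have hr := qhol_with_row hl hh'.
have qf : qhol (fun u => Pf (row_mx (l u) (ch_to c (h u)))) u.
  by apply: qhol_comp; [eexists; exact: hr|rewrite hy lv].
have cf : ch_cod c (Pf (row_mx (l u) (ch_to c (h u)))) by rewrite hy lv.
have vl : 0 < d - rn (l u) by rewrite subr_gt0 lv.
have [r1 r10 h1] := qhol_cont ql vl.
have [|r2 r20 h2] := hh.1 U; first by rewrite hy.
have r0 : 0 < Num.min r1 r2 by rewrite lt_min r10.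
apply: (hol_ext r0 _ (hol_of_chart Hsm Hps Xc qf cf)).
move=> u'; rewrite lt_min => /andP[/h1 u1 /h2 u2].
have ld : rn (l u') < d.
  by rewrite -(subrK (l u) (l u')); apply: le_lt_trans (rnD _ _) _; rewrite -ltrBrDr.
have [_ _ _ [g' [g'0 hg' g'1]]] := H _ _ u2 ld.
by rewrite (flE g'0 hg') g'1.
Qed.

(** Compactness of M makes the bound on v independent of the point; completeness of all complex
    flows will follow by iteration. *)
Lemma flow_spec_uniform : exists2 d : R, 0 < d & forall x, flow_spec d x.
Proof.
have H := (compact_near_coveringP [set: M]).1 Hcpt R (0^'+) flow_spec _.
have /filter_ex[d [d0 Hd]] : \forall d \near 0^'+, 0 < d /\ [set: M] `<=` flow_spec d.
  apply: filterI; first exact: nbhs_right_gt.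
  apply: H => x _; have [d d0 hd] := flow_spec_local x.
  exists ([set y | flow_spec d y], [set r | r < d]) => /=.
    by split => //; exact: nbhs_right_lt.
  move=> [y r] /= [hy rd] v vr; apply: hy; exact: lt_trans vr rd.
by exists d => // x; exact: Hd.
Qed.

Definition vel v (g : R -> M) t := ccont g t /\
  forall c, atlas X c -> ch_dom c (g t) ->
    hasd (fun s => ch_to c (g s)) t (v *m Xm c (ch_to c (g t))).

Lemma vel_ext v (g h : R -> M) t (d : R) : 0 < d -> (forall s, `|s - t| < d -> g s = h s) ->
  vel v g t -> vel v h t.
Proof.
move=> d0 gh [c1 c2]; have t0 : `|t - t| < d by rewrite subrr normr0.
have E := gh t t0; split.
  move=> N; rewrite -E => /c1[r r0 hr]; exists (Num.min d r); first by rewrite lt_min d0.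
  by move=> s; rewrite lt_min => /andP[sd sr]; rewrite -gh //; exact: hr.
by move=> c Xc; rewrite -E => cg; apply: hasd_ext d0 _ (c2 c Xc cg) => s /gh ->.
Qed.

Lemma vel_shift v (g : R -> M) a t : vel v g (a + t) -> vel v (fun s => g (a + s)) t.
Proof.
move=> [c1 c2]; split; last by move=> c Xc cg; exact: hasd_shift (c2 c Xc cg).
move=> N /c1[d d0 hd]; exists d => // s sd; apply: hd.
by have -> : a + s - (a + t) = s - t by ring.
Qed.

Lemma vel_unshift v (g : R -> M) t : vel v (fun s => g (t + s)) 0 -> vel v g t.
Proof.
have tE : - t + t = 0 by rewrite addNr.
rewrite -{1}tE => /vel_shift; apply: vel_ext ltr01 _ => s _.
by rewrite addrA subrr add0r.
Qed.

Lemma vel_of_chart c v (g : R -> M) t : atlas X c -> ch_dom c (g t) -> ccont g t ->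
  hasd (fun s => ch_to c (g s)) t (v *m Xm c (ch_to c (g t))) -> vel v g t.
Proof.
move=> Xc cg cc h; split; first exact: cc.
move=> c' Xc' c'g; exact: (icurve_chart_change Hsm Hps Xc cg cc h).
Qed.

Lemma vel_phi v (g : R -> M) t s : vel v g t -> vel v (fun r => phi s (g r)) t.
Proof.
move=> [c1 c2]; split; first exact: (ccont_phi Hsm c1).
move=> c' Xc' c'g; have [c Xc cg] := atlas_cover X (g t).
have q := alpha_qhol Hsm Hps Xc Xc' cg c'g.
have := hasd_qhol q (c2 c Xc cg).
rewrite -mulmxA (field_invariant Hsm Hps Xc Xc' cg c'g).
have [d d0 hd] := c1 _ (dom_nbhs cg).
by apply: hasd_ext d0 _ => r /hd cr /=; rewrite alphaE ch_toK'.
Qed.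

Lemma vel_orbit (a : 'rV[R]_k) x t : vel (complexv a) (fun s => phi (s *: a) x) t.
Proof.
have h0 y : vel (complexv a) (fun s => phi (s *: a) y) 0.
  have [c Xc cy] := atlas_cover X y.
  have y0 : phi ((0 : R) *: a) y = y by rewrite scale0r (phi0 Hsm).
  apply: (@vel_of_chart c); rewrite ?y0 //; last exact: (orbit_hasd Hsm Hps).
  move=> N; rewrite scale0r => /(phi_cont Hsm)[d d0 [U nU UP]].
  have A0 : 0 < 1 + `|a| by rewrite ltr_pwDl.
  exists (d / (1 + `|a|)); first by rewrite divr_gt0.
  move=> s; rewrite subr0 ltr_pdivlMr // => sd; apply: UP; last exact: nbhs_singleton.
  by rewrite subr0 normrZ; apply: le_lt_trans sd; rewrite ler_wpM2l // lerDr.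
apply: vel_unshift; apply: vel_ext ltr01 _ (h0 (phi (t *: a) x)) => s _ /=.
by rewrite -(phiD Hsm) -scalerDl addrC.
Qed.

Section SmallTimes.
Context (e : R) (e0 : 0 < e) (He : forall x, flow_spec e x).

Lemma fl_hol b (l : 'rV[C R]_b -> 'rV[C R]_k) (g : 'rV[C R]_b -> M) u :
  rn (l u) < e -> qhol l u -> hol g u -> hol (fun u => fl (l u) (g u)) u.
Proof. by move=> le ql hg; have [_ ] := He (g u) le; apply. Qed.

Lemma fl_phi v s x : rn v < e -> fl v (phi s x) = phi s (fl v x).
Proof.
move=> ve; have [[g [g0 hg]] _] := He x ve.
rewrite (flE g0 hg) (@flE _ _ (fun t => phi s (g t))) ?g0 // => t tT.
exact: vel_phi (hg t tT).
Qed.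

Lemma fl_complexv (a : 'rV[R]_k) x : fl (complexv a) x = phi a x.
Proof.
rewrite (@flE _ _ (fun t => phi (t *: a) x)) ?scale1r //.
  by rewrite scale0r (phi0 Hsm).
by move=> t _; exact: vel_orbit.
Qed.

Lemma fl0 x : fl 0 x = x.
Proof.
have -> : 0 = complexv 0 :> 'rV[C R]_k by rewrite complexv0.
by rewrite fl_complexv (phi0 Hsm).
Qed.

Lemma fl_long v y : rn v < e / 4 -> exists h : R -> M, [/\ h 0 = y, icurve v h 8 &
  forall t : R, `|t| < 4 -> fl (rc t *: v) y = h t].
Proof.
move=> ve; have v4 : rn (rc 4 *: v) < e.
  by rewrite rnZ ab_rc ger0_norm // mulrC -ltr_pdivlMr.
have [[g [g0 hg]] _] := He y v4.
have h8 (t : R) : `|t| < 8 -> `|4^-1 * t| < 2.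
  by rewrite normrM ger0_norm ?invr_ge0 // => ?; rewrite ltr_pdivrMl //; lra.
have hh := icurve_rescale hg h8.
have E : rc 4^-1 *: (rc 4 *: v) = v.
  by rewrite scalerA -rcM mulVf ?pnatr_eq0 // scale1r.
rewrite E in hh; exists (fun t => g (4^-1 * t)); split; rewrite ?mulr0 // => t t4.
have ht (s : R) : `|s| < 2 -> `|t * s| < 8.
  by rewrite normrM; move: (normr_ge0 s) (normr_ge0 t) t4; move: (`|s|) (`|t|) => a b; nra.
have := icurve_rescale hh ht => /flE ->; first by rewrite mulr1.
by rewrite !mulr0.
Qed.

Lemma fl_same v y (s t : R) : rn v < e / 4 -> `|t| < 3 -> `|s| < 1 ->
  fl (rc (t + s) *: v) y = fl (rc s *: v) (fl (rc t *: v) y).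
Proof.
move=> ve t3 s1; have [h [h0 hh hE]] := fl_long y ve.
rewrite !hE; [|by lra|by apply: le_lt_trans (ler_normD _ _) _; lra].
rewrite (@flE _ _ (fun r => h (t + s * r))) ?mulr1 ?mulr0 ?addr0 //.
have hs : icurve v (fun r => h (t + r)) 2.
  by move=> r r2; apply: vel_shift; apply: hh; apply: le_lt_trans (ler_normD _ _) _; lra.
apply: (icurve_rescale hs) => r r2; rewrite normrM.
by move: (normr_ge0 s) (normr_ge0 r) r2 s1; move: (`|s|) (`|r|) => a b; nra.
Qed.

(** The flow along v commutes with the torus ([fl_phi]), hence carries the orbit curves of real
    vectors to orbit curves, and their velocities determine the generators. *)
Lemma fl_invariant c c' x v : rn v < e -> atlas X c -> atlas X c' -> ch_dom c x ->
  ch_dom c' (fl v x) -> exists2 D, 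
  qhol_with (fun u => ch_to c' (fl v (ch_of c u))) D (ch_to c x) &
  Xm c (ch_to c x) *m D (ch_to c x) = Xm c' (ch_to c' (fl v x)).
Proof.
move=> ve Xc Xc' cx c'x.
have hid : hol (ch_of c) (ch_to c x).
  apply: (hol_of_chart Hsm Hps Xc (f := id)); last by exists x.
  by exists (fun=> 1%:M); apply: qhol_with_ext ltr01 _ (qhol_with_affine 1%:M 0 _) => u _; rewrite mulmx1 addr0.
have qc : qhol (fun=> v) (ch_to c x).
  by exists (fun=> 0); apply: qhol_with_ext ltr01 _ (qhol_with_affine 0 v _) => u _; rewrite mulmx0 add0r.
have [_ hF] := @fl_hol n (fun=> v) (ch_of c) _ ve qc hid.
have c'F : ch_dom c' (fl v (ch_of c (ch_to c x))) by rewrite ch_toK'.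
have [D qD] := hF c' Xc' c'F; exists D; first exact: qD.
apply: mx_real_ext => a; rewrite mulmxA.
have [_ /(_ c' Xc')h1] := vel_orbit a (fl v x) 0; rewrite scale0r (phi0 Hsm) in h1.
have [h3 /(_ c Xc)h2] := vel_orbit a x 0; rewrite scale0r (phi0 Hsm) in h2.
have xE : ch_to c (phi ((0 : R) *: a) x) = ch_to c x by rewrite scale0r (phi0 Hsm).
rewrite -xE in qD; have := hasd_qhol qD (h2 cx); rewrite xE => h4.
apply: (hasd_uniq h4); have := h1 c'x.
have [|d d0 dP] := h3 (ch_dom c); first by rewrite scale0r (phi0 Hsm); exact: dom_nbhs.
by apply: (hasd_ext d0) => t td /=; rewrite ch_toK' ?fl_phi //; exact: dP.
Qed.

Lemma fl_vel v w (g : R -> M) t : rn v < e -> vel w g t -> vel w (fun s => fl v (g s)) t.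
Proof.
move=> ve [c1 c2]; have [c Xc cg] := atlas_cover X (g t).
have [c' Xc' c'g] := atlas_cover X (fl v (g t)).
have [D qD DE] := fl_invariant ve Xc Xc' cg c'g.
have h := hasd_qhol qD (c2 c Xc cg); rewrite -mulmxA DE in h.
have [d d0 hd] := c1 _ (dom_nbhs cg).
have hid : hol (ch_of c) (ch_to c (g t)).
  apply: (hol_of_chart Hsm Hps Xc (f := id)); last by exists (g t).
  by exists (fun=> 1%:M); apply: qhol_with_ext ltr01 _ (qhol_with_affine 1%:M 0 _) => u _; rewrite mulmx1 addr0.
have qc : qhol (fun=> v) (ch_to c (g t)).
  by exists (fun=> 0); apply: qhol_with_ext ltr01 _ (qhol_with_affine 0 v _) => u _; rewrite mulmx0 add0r.
have [hc _] := @fl_hol n (fun=> v) (ch_of c) _ ve qc hid; rewrite (ch_toK' cg) in hc.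
apply: (@vel_of_chart c' _ (fun s => fl v (g s)) _ Xc' c'g); last first.
  by apply: hasd_ext d0 _ h => s /hd cs /=; rewrite ch_toK'.
move=> N /hc[r r0 hr]; have [d1 d10 h1] := c1 _ (chart_nbhs_to cg r0).
by exists d1 => // s /h1[cs]; move=> /hr; rewrite ch_toK'.
Qed.

(** The derivative of (u, y) |-> fl u y at (0, b 0) consists of two blocks. The block in u is
    computed with b constant, the block in y with v = 0, and the two velocities add up. *)
Lemma fl_vel_add v w (b : R -> M) : rn v < e / 4 -> vel w b 0 ->
  vel (v + w) (fun s => fl (rc s *: v) (b s)) 0.
Proof.
move=> ve [b1 b2]; have [c Xc cz] := atlas_cover X (b 0).
set z := b 0 in b1 b2 cz *.
pose p0 : 'rV[C R]_(k + n) := row_mx 0 (ch_to c z).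
have l0 : lsubmx p0 = 0 by rewrite row_mxKl.
have r0 : rsubmx p0 = ch_to c z by rewrite row_mxKr.
have ql : qhol (fun p : 'rV[C R]_(k + n) => lsubmx p) p0.
  exists (fun=> col_mx 1%:M 0); apply: qhol_with_ext ltr01 _ (qhol_with_affine _ 0 _) => p _.
  by rewrite addr0 -lsubmxE.
have qr : qhol (fun p : 'rV[C R]_(k + n) => rsubmx p) p0.
  exists (fun=> col_mx 0 1%:M); apply: qhol_with_ext ltr01 _ (qhol_with_affine _ 0 _) => p _.
  by rewrite addr0 -rsubmxE.
have hr : hol (fun p : 'rV[C R]_(k + n) => ch_of c (rsubmx p)) p0.
  by apply: (hol_of_chart Hsm Hps Xc qr); rewrite r0; exists z.
have le : rn (lsubmx p0) < e by rewrite l0 rn0.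
have [F1 F2] := @fl_hol _ (fun p => lsubmx p) (fun p => ch_of c (rsubmx p)) _ le ql hr.
have Fp0 : fl (lsubmx p0) (ch_of c (rsubmx p0)) = z by rewrite l0 r0 fl0 ch_toK'.
rewrite Fp0 in F1 F2; have [G qG] := F2 c Xc cz.
have key (v1 : 'rV[C R]_k) u (bb : R -> M) : bb 0 = z -> ccont bb 0 ->
    hasd (fun s => ch_to c (bb s)) 0 u ->
    hasd (fun s => ch_to c (fl (rc s *: v1) (bb s))) 0 (v1 *m usubmx (G p0) + u *m dsubmx (G p0)) /\
    ccont (fun s => fl (rc s *: v1) (bb s)) 0.
  move=> bb0 cb hb; have := hasd_line 0 v1 0 => hl.
  have hp : hasd (fun s => row_mx (rc s *: v1) (ch_to c (bb s))) 0 (row_mx v1 u).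
    by apply: hasd_ext ltr01 _ (hasd_row hl hb) => s _; rewrite add0r.
  have pE : row_mx (rc 0 *: v1) (ch_to c (bb 0)) = p0 by rewrite rc0 scale0r bb0.
  have [|d d0 hd] := cb (ch_dom c); first by rewrite bb0; exact: dom_nbhs.
  split.
    rewrite -mul_row_col vsubmxK -pE; rewrite -pE in qG.
    by apply: (hasd_ext d0 _ (hasd_qhol qG hp)) => s /hd cs /=; rewrite row_mxKl row_mxKr ch_toK'.
  move=> N; rewrite bb0 rc0 scale0r fl0 => /F1[r rp hr'].
  have r2 : 0 < r / 2 by rewrite divr_gt0.
  have [d1 d10 h1] := hasd_of_primitive r2 hp.
  exists (Num.min d d1); first by rewrite lt_min d0.
  move=> s; rewrite lt_min => /andP[/hd cs /h1]; rewrite pE => hs.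
  have := hr' _ (le_lt_trans hs _); rewrite row_mxKl row_mxKr ch_toK' //; apply.
  by lra.
have [h1 c1] := key v _ b erefl b1 (b2 c Xc cz).
have f0 : fl (rc 0 *: v) (b 0) = z by rewrite rc0 scale0r fl0.
have cf : ch_dom c (fl (rc 0 *: v) (b 0)) by rewrite f0.
suff E : v *m usubmx (G p0) + w *m Xm c (ch_to c z) *m dsubmx (G p0) =
   (v + w) *m Xm c (ch_to c (fl (rc 0 *: v) (b 0))).
  rewrite E in h1; exact: (@vel_of_chart c _ (fun s => fl (rc s *: v) (b s)) _ Xc cf c1 h1).
rewrite f0 mulmxDl; congr (_ + _).
  have [h [h0 hh hE]] := fl_long z ve.
  have c0 : ccont (fun _ : R => z) 0 by move=> N nN; exists 1 => // s _; exact: nbhs_singleton.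
  have [h2 _] := key v 0 (fun _ : R => z) erefl c0 (hasd_const _ _).
  rewrite mul0mx addr0 in h2; apply: (hasd_uniq h2).
  have [|_ /(_ c Xc)] := hh 0; first by rewrite normr0.
  rewrite h0 => /(_ cz); apply: (@hasd_ext _ _ _ _ _ _ 1) => // s.
  by rewrite subr0 => s1; rewrite hE //; lra.
have [h3 _] := key 0 _ b erefl b1 (b2 c Xc cz).
rewrite mul0mx add0r in h3; apply: (hasd_uniq h3).
by apply: hasd_ext ltr01 _ (b2 c Xc cz) => s _; rewrite scaler0 fl0.
Qed.

(** The curve t |-> fl (t v) (fl (t w) y) is an integral curve of v + w: the flow along v preserves
    the generators, so the velocity w survives it and v is added. *)
Lemma fl_add v w y : rn v < e / 4 -> rn w < e / 4 -> fl (v + w) y = fl v (fl w y).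
Proof.
move=> ve we; have [h [h0 hh hE]] := fl_long y we.
rewrite -[X in fl v X]/(fl w y) -[w in RHS]scale1r -rc1 hE; last by rewrite normr1; lra.
rewrite (@flE _ _ (fun t => fl (rc t *: v) (h t))) ?scale1r //.
  by rewrite rc0 scale0r fl0.
move=> t t2; apply: vel_unshift.
have tv : rn (rc t *: v) < e.
  rewrite rnZ ab_rc; move: (rn_ge0 v) (normr_ge0 t) ve t2; move: (rn v) (`|t|) => a b; nra.
have hb : vel w (fun s => fl (rc t *: v) (h (t + s))) 0.
  by apply: fl_vel => //; apply: vel_shift; rewrite addr0; apply: hh; lra.
apply: (vel_ext ltr01 _ (fl_vel_add ve hb)) => s; rewrite subr0 => s1.
by rewrite fl_same //; lra.
Qed.

Lemma fl_iter v (N j : nat) x : (0 < N)%N -> rn v < e / 4 -> (j <= N)%N ->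
  iter j (fl (rc N%:R^-1 *: v)) x = fl (rc (j%:R / N%:R) *: v) x.
Proof.
move=> N0 ve; have n0 : (0 : R) < N%:R by rewrite ltr0n.
have small (a : R) : `|a| <= 1 -> rn (rc a *: v) < e / 4.
  by move=> a1; rewrite rnZ ab_rc; apply: le_lt_trans ve; rewrite ler_piMl ?rn_ge0.
elim: j => [_|j ih jN]; first by rewrite /= mul0r rc0 scale0r fl0.
have h1 : rn (rc N%:R^-1 *: v) < e / 4.
  by apply: small; rewrite ger0_norm ?invr_ge0 ?ler0n // invf_le1 // ler1n.
have h2 : rn (rc (j%:R / N%:R) *: v) < e / 4.
  apply: small; rewrite ger0_norm ?divr_ge0 // ler_pdivrMr // mul1r ler_nat.
  exact: ltnW.
rewrite iterS (ih (ltnW jN)); rewrite -(fl_add x h1 h2) -scalerDl -rcD.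
by rewrite -[X in X + _]mul1r -mulrDl addrC natr1.
Qed.

Lemma fl_iter_all v (N : nat) x : (0 < N)%N -> rn v < e / 4 ->
  iter N (fl (rc N%:R^-1 *: v)) x = fl v x.
Proof.
have E : (0 < N)%N -> (N%:R / N%:R : R) = 1 by move=> N0; rewrite divff // pnatr_eq0 -lt0n.
by move=> N0 ve; rewrite (fl_iter _ N0 ve (leqnn N)) (E N0) rc1 scale1r.
Qed.

Lemma iter_mul (f : M -> M) a b x : iter a (iter b f) x = iter (a * b)%N f x.
Proof. by elim: a => //= a ->; rewrite mulSn iterD. Qed.

Lemma fl_iter_indep v (N N' : nat) x : (0 < N)%N -> (0 < N')%N ->
  rn v < e / 4 * N%:R -> rn v < e / 4 * N'%:R ->
  iter N (fl (rc N%:R^-1 *: v)) x = iter N' (fl (rc N'%:R^-1 *: v)) x.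
Proof.
have half (P Q : nat) : (0 < P)%N -> (0 < Q)%N -> rn v < e / 4 * P%:R ->
    iter P (fl (rc P%:R^-1 *: v)) x = iter (P * Q)%N (fl (rc (P * Q)%:R^-1 *: v)) x.
  move=> P0 Q0 vP; rewrite -iter_mul; apply: eq_iter => y.
  rewrite -(@fl_iter_all _ Q _ Q0).
    by rewrite scalerA -rcM natrM invfM mulrC.
  by rewrite rnZ ab_rc ger0_norm ?invr_ge0 // ltr_pdivrMl ?ltr0n // mulrC.
move=> N0 N'0 vN vN'; by rewrite (half N N' N0 N'0 vN) (half N' N N'0 N0 vN') mulnC.
Qed.

Let ok v (N : nat) := (0 < N)%N /\ rn v < e / 4 * N%:R.
Let Nv v := (Num.truncn (rn v / (e / 4))).+1.

Let e4 : 0 < e / 4. Proof. by rewrite divr_gt0. Qed.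

Lemma ok_ge v (N : nat) : rn v / (e / 4) < N%:R -> ok v N.
Proof.
move=> h; split; last by rewrite mulrC -ltr_pdivrMr.
rewrite lt0n; apply: contraTneq h => ->; rewrite -leNgt divr_ge0 ?rn_ge0 //; exact: ltW.
Qed.

Lemma okNv v : ok v (Nv v).
Proof. by apply: ok_ge; exact: truncnS_gt. Qed.

Lemma ok_add v N N' : ok v N -> ok v (N + N')%N.
Proof.
move=> [N0 vN]; split; first by rewrite addn_gt0 N0.
by apply: lt_le_trans vN _; rewrite ler_wpM2l ?ler_nat ?leq_addr // (ltW e4).
Qed.

(** The N-fold iterate of the flow along v / N. Two admissible values of N give the same map, by
    comparison with their product; the truncation only fixes a choice. *)
Definition gflow v x := iter (Nv v) (fl (rc (Nv v)%:R^-1 *: v)) x.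

Lemma gflowE v N x : ok v N -> gflow v x = iter N (fl (rc N%:R^-1 *: v)) x.
Proof. by move=> [? ?]; have [? ?] := okNv v; exact: fl_iter_indep. Qed.

Lemma ok_small v N : ok v N -> rn (rc N%:R^-1 *: v) < e / 4.
Proof.
move=> [N0 vN]; rewrite rnZ ab_rc ger0_norm ?invr_ge0 // ltr_pdivrMl ?ltr0n //.
by rewrite mulrC.
Qed.

Lemma gflow_small v x : rn v < e / 4 -> gflow v x = fl v x.
Proof.
move=> ve; have o1 : ok v 1 by split; rewrite ?mulr1.
by rewrite (gflowE _ o1) [LHS]/= invr1 rc1 scale1r.
Qed.

Lemma gflowD v w x : gflow (v + w) x = gflow v (gflow w x).
Proof.
pose N := (Nv v + Nv w + Nv (v + w))%N.
have ov : ok v N by rewrite /N -addnA; apply: ok_add; exact: okNv.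
have ow : ok w N by rewrite /N -addnA addnCA; apply: ok_add; exact: okNv.
have ovw : ok (v + w) N by rewrite /N addnC; apply: ok_add; exact: okNv.
rewrite (gflowE _ ov) (gflowE _ ow) (gflowE _ ovw) scalerDr.
have := ok_small ov; have := ok_small ow.
move: (_ *: v) (_ *: w) => a b be ae.
apply: iter_comp => y; first exact: fl_add.
by rewrite -(fl_add y ae be) -(fl_add y be ae) addrC.
Qed.

Lemma gflow_hol b (l : 'rV[C R]_b -> 'rV[C R]_k) (g : 'rV[C R]_b -> M) u :
  qhol l u -> hol g u -> hol (fun u => gflow (l u) (g u)) u.
Proof.
move=> ql hg; pose N := Nv (l u).
have [N0 lN] := okNv (l u); rewrite -/N in N0 lN.
have d0 : 0 < e / 4 * N%:R - rn (l u) by rewrite subr_gt0.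
have [r r0 hr] := qhol_cont ql d0.
have okl u' : rn (u' - u) < r -> ok (l u') N.
  move=> /hr h; split=> //; rewrite -(subrK (l u) (l u')).
  by apply: le_lt_trans (rnD _ _) _; rewrite -ltrBrDr.
have qlN : qhol (fun u => rc N%:R^-1 *: l u) u.
  have [l' hl] := ql; exists (fun u => l' u *m (rc N%:R^-1)%:M).
  apply: qhol_with_ext ltr01 _ (qhol_with_mulr _ hl) => u' _.
  by rewrite mul_mx_scalar.
have u0 : rn (u - u) < r by rewrite subrr rn0.
have lNe : rn (rc N%:R^-1 *: l u) < e.
  by apply: lt_trans (ok_small (okl u u0)) _; rewrite ltr_pdivrMr // ltr_pMr // ltr1n.
have H j : hol (fun u => iter j (fl (rc N%:R^-1 *: l u)) (g u)) u.
  elim: j => [|j ih]; first exact: hg.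
  exact: (@fl_hol _ (fun u => rc N%:R^-1 *: l u) _ _ lNe qlN ih).
apply: (hol_ext r0 _ (H N)) => u' /okl o.
by rewrite (gflowE _ o).
Qed.

Lemma gflow0 x : gflow 0 x = x.
Proof. by rewrite gflow_small ?fl0 // rn0. Qed.

Lemma gflow_complexv (a : 'rV[R]_k) x : gflow (complexv a) x = phi a x.
Proof.
have [N0 vN] := okNv (complexv a).
rewrite /gflow; move: (Nv _) N0 => N N0.
rewrite -complexvZ; have E j : iter j (fl (complexv (N%:R^-1 *: a))) x = phi ((j%:R / N%:R) *: a) x.
  elim: j => [|j ih]; first by rewrite /= mul0r scale0r (phi0 Hsm).
  rewrite iterS ih fl_complexv -(phiD Hsm) -scalerDl -[X in X + _]mul1r -mulrDl.
  by rewrite addrC natr1.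
by rewrite E divff ?scale1r // pnatr_eq0 -lt0n.
Qed.

Lemma gflow_vel v x t : vel v (fun s => gflow (rc s *: v) x) t.
Proof.
have h0 y : vel v (fun s => gflow (rc s *: v) y) 0.
  have [N0 _] := okNv v; have := ok_small (okNv v).
  move: (Nv v) N0 => N N0 ve; have n0 : (0 : R) < N%:R by rewrite ltr0n.
  have [h [h0 hh hE]] := fl_long y ve.
  have hN (r : R) : `|r| < 8 / N%:R -> `|N%:R * r| < 8.
    by rewrite normrM ger0_norm // ltr_pdivlMr // mulrC.
  have := icurve_rescale hh hN; rewrite scalerA -rcM divff ?gt_eqF // rc1 scale1r.
  move=> /(_ 0); rewrite normr0 divr_gt0 // => /(_ isT).
  have d0 : 0 < Num.min (1 / N%:R : R) (e / 4 / (1 + rn v)).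
    by rewrite lt_min !divr_gt0 ?ltr_pwDl ?rn_ge0.
  apply: (vel_ext d0) => r; rewrite subr0 lt_min => /andP[].
  have v1 : 0 < 1 + rn v by rewrite ltr_pwDl ?rn_ge0.
  rewrite (ltr_pdivlMr _ _ n0) (ltr_pdivlMr _ _ v1) => r1 r2; rewrite gflow_small; last first.
    by rewrite rnZ ab_rc; apply: le_lt_trans r2; rewrite ler_wpM2l // lerDr.
  rewrite -hE; last by rewrite normrM ger0_norm // mulrC; apply: lt_trans r1 _; rewrite ltr1n.
  have -> : rc (N%:R * r) *: (rc N%:R^-1 *: v) = rc r *: v.
    by rewrite scalerA -rcM mulrAC divff ?gt_eqF // mul1r.
  by [].
apply: vel_unshift; apply: (vel_ext ltr01 _ (h0 (gflow (rc t *: v) x))) => s _.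
by rewrite -gflowD -scalerDl -rcD addrC.
Qed.
End SmallTimes.

Record complex_flow (Phi : 'rV[C R]_k -> M -> M) : Prop := {
  Phi0 : forall x, Phi 0 x = x;
  PhiD : forall v w x, Phi (v + w) x = Phi v (Phi w x);
  Phi_real : forall (a : 'rV[R]_k) x, Phi (complexv a) x = phi a x;
  Phi_hol : forall b (l : 'rV[C R]_b -> 'rV[C R]_k) (g : 'rV[C R]_b -> M) u,
    qhol l u -> hol g u -> hol (fun u => Phi (l u) (g u)) u;
  Phi_vel : forall v x t, vel v (fun s => Phi (rc s *: v) x) t }.

Lemma global_flow : exists Phi, complex_flow Phi.
Proof.
have [e e0 He] := flow_spec_uniform.
exists (gflow e); split.
- exact: gflow0.
- exact: gflowD.
- exact: gflow_complexv.
- exact: gflow_hol.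
- exact: gflow_vel.
Qed.

Lemma vel_Phi Phi v (g : R -> M) T : complex_flow Phi ->
  (forall t, `|t| < T -> vel v g t) -> forall t, `|t| < T -> g t = Phi (rc t *: v) (g 0).
Proof.
move=> HP hg t tT; have hh : icurve v (fun s => Phi (rc s *: v) (g 0)) T.
  by move=> s _; exact: (Phi_vel HP).
apply: (icurve_uniq Hsm Hps hg hh _ tT).
by rewrite rc0 scale0r (Phi0 HP).
Qed.
End GlobalFlow.

(** * The circle and the kernel of the exponential map *)

Section Circle.
Context {R : realType}.
Implicit Types a b : R.

Lemma cisD a b : cis (a + b) = cis a * cis b.
Proof. by rewrite -!cexp_i rcD mulrDr cexpD. Qed.
Lemma cis0 : cis (0 : R) = 1.
Proof. by rewrite /cis cos0 sin0. Qed.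
Lemma cisN a : cis (- a) * cis a = 1.
Proof. by rewrite -cisD addNr cis0. Qed.

Lemma cis_period (z : int) : cis (2 * pi * z%:~R : R) = 1.
Proof.
have nat n : cis (2 * pi * n%:R : R) = 1.
  elim: n => [|n ih]; first by rewrite mulr0 cis0.
  rewrite -[n.+1%:R]natr1 mulrDr cisD ih mulr1 mul1r /cis.
  by rewrite mulr_natl cos2pi sin2pi.
case: z => n; first exact: nat.
by rewrite NegzE mulrNz mulrN; have := cisN (2 * pi * n.+1%:R); rewrite nat mulr1.
Qed.

Lemma cis_eq1 a : cis a = 1 -> exists z : int, a = 2 * pi * z%:~R.
Proof.
have p0 : 0 < 2 * pi :> R by rewrite mulr_gt0 // pi_gt0.
pose z := Num.floor (a / (2 * pi)); pose b := a - 2 * pi * z%:~R.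
move=> ca; have cb : cis b = 1.
  by rewrite /b -mulrN -mulrNz cisD ca cis_period mulr1.
have b0 : 0 <= b by rewrite subr_ge0 mulrC -ler_pdivlMr // floor_le.
have b1 : b < 2 * pi.
  rewrite /b ltrBlDr -[X in _ < X + _]mulr1 -mulrDr mulrC -ltr_pdivrMr //.
  have := floorD1_gt (a / (2 * pi)); by rewrite -/z intrD addrC.
have [bz|bn] := eqVneq b 0.
  by exists z; apply/eqP; rewrite -subr_eq0 -/b bz.
have b2 : 0 < b / 2 < pi by move: b0 b1; rewrite le0r (negPf bn) /=; lra.
have s0 := sin_gt0_pi b2.
have : cos b = 1 by have := congr1 (@complex.Re R) cb.
have -> : b = b / 2 + b / 2 by lra.
rewrite cosD => h; have := cos2Dsin2 (b / 2); rewrite !expr2 => h2.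
have := mulr_gt0 s0 s0; move: (cos _) (sin _) h h2 => u v; lra.
Qed.

Lemma cis_surj (z : C R) : ab z = 1 -> exists a, z = cis a.
Proof.
case: z => x y; rewrite abE /= => h.
have xy : x ^+ 2 + y ^+ 2 = 1.
  by have := sqr_sqrtr (addr_ge0 (sqr_ge0 x) (sqr_ge0 y)); rewrite h expr1n.
have x1 : -1 <= x <= 1.
  have := sqr_ge0 y; rewrite -ler_norml -(@expr_le1 _ 2%N) // real_normK ?num_real //.
  by move: xy; move: (x ^+ 2) (y ^+ 2) => u v; lra.
have c := acosK x1.
have s2 : (sin (acos x)) ^+ 2 = y ^+ 2.
  by have := cos2Dsin2 (acos x); rewrite c; move: xy; move: (x ^+ 2) (y ^+ 2) => u v; lra.
have [sy|sy] := eqVneq (sin (acos x)) y.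
  by exists (acos x); rewrite /cis c sy.
exists (- acos x); rewrite /cis cosN sinN c.
have /eqP := s2; rewrite eqf_sqr (negPf sy) /= => /eqP ->; by rewrite opprK.
Qed.

Lemma Exp_cis k (s : 'rV[R]_k) : Exp (complexv s) = \row_j cis (s 0 j).
Proof. by apply/rowP => j; rewrite !mxE -cexp_i. Qed.

Lemma Exp_cube k (s : 'rV[R]_k) : exists s' : 'rV[R]_k,
  (forall j, 0 <= s' 0 j <= 2 * pi) /\ Exp (complexv s') = Exp (complexv s).
Proof.
have p0 : 0 < 2 * pi :> R by rewrite mulr_gt0 // pi_gt0.
exists (\row_j (s 0 j - 2 * pi * (Num.floor (s 0 j / (2 * pi)))%:~R)).
split=> [j|]; last first.
  by rewrite !Exp_cis; apply/rowP => j; rewrite !mxE -mulrN -mulrNz cisD cis_period mulr1.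
rewrite mxE; apply/andP; split; first by rewrite subr_ge0 mulrC -ler_pdivlMr // floor_le.
rewrite lerBlDr -[X in _ <= X + _]mulr1 -mulrDr mulrC -ler_pdivrMr //.
by have := floorD1_gt (s 0 j / (2 * pi)); rewrite intrD addrC => /ltW.
Qed.
End Circle.

Lemma hausdorff_sep (T : topologicalType) (x y : T) : hausdorff_space T -> x <> y ->
  exists A B, [/\ nbhs x A, nbhs y B & forall z, A z -> B z -> False].
Proof.
rewrite open_hausdorff => H /eqP /H[[A B] /= [xA yB] [oA oB AB]].
exists A, B; split; [exact: open_nbhs_nbhs (conj oA (set_mem xA))|
  exact: open_nbhs_nbhs (conj oB (set_mem yB))|].
by move=> z Az Bz; move/eqP: AB => /seteqP[/(_ z (conj Az Bz))].
Qed.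

(** * Isotropy representations *)

Section Isotropy.
Context {R : realType} {M : topologicalType} {n : nat}.
Context (X : complexManifold R M n) (k : nat) (act : 'rV[C R]_k -> M -> M).
Context (Hsm : smooth_action X act) (Hps : preserves_complex_structure X act).
Implicit Types (p : M) (s : 'rV[R]_k).

Local Notation phi := (phi act).
Local Notation alpha := (alpha act).
Local Notation Aw := (Aw act).

Lemma phi_Exp s s' x : Exp (complexv s) = Exp (complexv s') -> phi s x = phi s' x.
Proof. by move=> h; exact: (congr1 (act^~ x) h). Qed.

Section AtPoint.
Context (c : chart R M n) (Xc : atlas X c) (p : M) (cp : ch_dom c p).
Let w0 := ch_to c p.
Local Notation al := (alpha c c).

Lemma iso_qhol s : phi s p = p -> qhol_with (al s) (Aw c c s) w0.
Proof. by move=> sp; apply: (alpha_qhol Hsm Hps Xc Xc cp); rewrite sp. Qed.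

Definition iso_good s (r K : R) := (exists A', nice (al s) A' w0 r K) /\
  forall w : 'rV[C R]_n, rn (w - w0) < r ->
    [/\ ch_dom c (ch_of c w), ch_to c (ch_of c w) = w & ch_dom c (phi s (ch_of c w))].

(** The torus is the image of a compact cube of parameters. Near a parameter that moves p, no
    parameter fixes p, since M is Hausdorff; near one that fixes p, [action_local] provides
    constants valid for all neighbouring parameters. *)
Lemma isotropy_uniform : exists r K : R, [/\ 0 < r, 0 < K &
  forall s, phi s p = p -> iso_good s r K].
Proof.
pose cube : set 'rV[R]_k := [set s | forall j, `[0, 2 * pi : R]%classic (s 0 j)].
have cubeC : compact cube by apply: (rV_compact (A := fun=> `[0, 2 * pi : R]%classic)) => j; exact: segment_compact.
(* One number serves both as radius and as inverse of the constant, so that compactness can be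
   applied with the filter of small positive reals. *)
pose P (rho : R) s := phi s p = p -> iso_good s rho rho^-1.
have H := (compact_near_coveringP cube).1 cubeC R (0^'+) P _.
have /filter_ex[d [d0 Hd]] : \forall d \near 0^'+, 0 < d /\ cube `<=` P d.
  apply: filterI; first exact: nbhs_right_gt.
  apply: H => s0 _; have [sp|sp] := pselect (phi s0 p = p); last first.
    have [A [B [nA nB AB]]] := hausdorff_sep (manifold_hausdorff X) sp.
    have [d d0 [U nU dP]] := phi_cont Hsm nA.
    exists ([set s | `|s - s0| < d], setT).
      split; last exact: filterT.
      by have := nbhsx_ballx s0 d d0; apply: filterS => s; rewrite -ball_normE /= distrC.
    move=> [s r] /= [sd _] /= ss; case: (AB p); last exact: nbhs_singleton.
    by rewrite -ss; apply: dP => //; exact: nbhs_singleton.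
  have c0 : ch_dom c (phi s0 p) by rewrite sp.
  have [r [K al_]] := action_local Hsm Hps Xc Xc cp c0.
  have r0 := al_r al_; have K0 := al_K al_.
  have a0 : 0 <= K * (r + r) by rewrite mulr_ge0 ?addr_ge0 ?(ltW r0) ?(ltW K0).
  have b0 : 0 <= n%:R * K by rewrite mulr_ge0 ?(ltW K0).
  have [K' [K'0 KK' KB]] : exists K', [/\ 0 < K', K <= K' & K * (r + r) + n%:R * K <= K'].
    exists (K + K * (r + r) + n%:R * K).
    by move: (K * (r + r)) (n%:R * K) a0 b0 => a b a0 b0; split; lra.
  have gd s : `|s - s0| < r -> phi s p = p -> iso_good s r K'.
    move=> ss _; split; last by move=> w wr; have [_ h1 h2 h3] := al_dom al_ ss wr.
    exists (Aw c c s).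
    have T (x y : 'rV[C R]_n) : rn (x - w0) < r -> rn (y - w0) < r ->
        rn (al s y - al s x - (y - x) *m Aw c c s x) <= K * rn (y - x) ^+ 2.
      move=> xr yr; have := al_T al_ ss xr ss yr.
      by rewrite subrr complexv0 mul0mx subr0 normr0 add0r.
    split => //.
    - move=> x y xr yr; apply: le_trans (T x y xr yr) _.
      by rewrite ler_wpM2r ?exprn_ge0 ?rn_ge0.
    - move=> x y xr yr; have := al_Lw al_ ss xr ss yr.
      rewrite subrr normr0 add0r => /le_trans; apply.
      by rewrite ler_wpM2r ?rn_ge0.
    - by move=> x xr; apply: le_trans (al_Bw al_ ss xr) _.
    - move=> x y xr yr; have h1 := T x y xr yr.
      have h2 : rn (y - x) <= r + r.
        by apply: le_trans (rn_dist _ w0 _) _; rewrite lerD ?ltW // rn_distC.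
      have h3 : rn ((y - x) *m Aw c c s x) <= n%:R * K * rn (y - x).
        apply: le_trans (rn_mulmx _ _) _; rewrite mulrAC ler_wpM2r ?rn_ge0 //.
        by rewrite ler_wpM2l // (al_Bw al_ ss xr).
      have h4 := rn_ge0 (y - x).
      rewrite -[al s y - al s x](subrK ((y - x) *m Aw c c s x)).
      apply: le_trans (rnD _ _) _; apply: le_trans (lerD h1 h3) _.
      rewrite expr2 mulrA -mulrDl ler_wpM2r //; apply: le_trans KB; rewrite lerD2r.
      by rewrite ler_wpM2l // (ltW K0).
  exists ([set s | `|s - s0| < r], [set rho : R | 0 < rho /\ rho < Num.min r K'^-1]).
    split; last by apply: filterI; [exact: nbhs_right_gt|apply: nbhs_right_lt; rewrite lt_min r0 invr_gt0].
    by have := nbhsx_ballx s0 r r0; apply: filterS => s; rewrite -ball_normE /= distrC.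
  move=> [s rho] /= [sr [r1 rr]] ss.
  move: rr; rewrite lt_min => /andP[rr rK].
  have [[A' hA] hd] := gd s sr ss; split.
    exists A'; apply: (nice_shrink hA) => //; first exact: ltW.
    by rewrite -[leLHS]invrK lef_pV2 ?posrE ?invr_gt0 // ltW.
  by move=> w wr; apply: hd; exact: lt_trans wr rr.
exists d, d^-1; split=> //; first by rewrite invr_gt0.
move=> s sp; have [s' [s'c s'E]] := Exp_cube s.
have s'p : phi s' p = p by rewrite (phi_Exp p s'E).
have cs' : cube s' by move=> j; rewrite /= in_itv /=; exact: s'c.
have [[A' hA] hd] := Hd s' cs' s'p.
have E : al s' = al s.
  by apply/funext => w; rewrite !alphaE (phi_Exp _ s'E).
rewrite E in hA; split; first by exists A'.
by move=> w /hd; rewrite (phi_Exp _ s'E).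
Qed.

(** The differential of phi s at p; it is the isotropy representation when s fixes p. *)
Definition Diso s := Aw c c s w0.

Lemma iso_w0 s : phi s p = p -> al s w0 = w0.
Proof. by move=> sp; rewrite alphaE ch_toK' // sp. Qed.

Lemma iso_add s s' x : ch_dom c (phi s' (ch_of c x)) -> al (s + s') x = al s (al s' x).
Proof. by move=> h; rewrite !alphaE ch_toK' // (phiD Hsm). Qed.

Lemma phi_fixD s s' : phi s p = p -> phi s' p = p -> phi (s + s') p = p.
Proof. by move=> h h'; rewrite (phiD Hsm) h' h. Qed.

Lemma phi_fixN s : phi s p = p -> phi (- s) p = p.
Proof. by move=> h; rewrite -{1}h (phiNK Hsm). Qed.

Lemma phi_fixMn s j : phi s p = p -> phi (s *+ j) p = p.
Proof. by move=> h; elim: j => [|j ih]; rewrite ?mulr0n ?(phi0 Hsm) // mulrS phi_fixD. Qed.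

Lemma Diso_periodic s s' : phi s p = p -> Exp (complexv s) = Exp (complexv s') ->
  Diso s = Diso s'.
Proof.
move=> sp E; have s'p : phi s' p = p by rewrite -(phi_Exp p E).
apply: (qhol_uniq (iso_qhol sp)); apply: qhol_with_ext ltr01 _ (iso_qhol s'p) => w _.
by rewrite !alphaE (phi_Exp _ E).
Qed.

Lemma Diso_add s s' : phi s p = p -> phi s' p = p -> Diso (s + s') = Diso s' *m Diso s.
Proof.
move=> sp s'p; have [r [K [r0 K0 hr]]] := isotropy_uniform.
have qs := iso_qhol sp; rewrite -(iso_w0 s'p) in qs.
have h := qhol_with_comp (iso_qhol s'p) qs.
have h' : qhol_with (al (s + s')) (fun x => Aw c c s' x *m Aw c c s (al s' x)) w0.
  apply: qhol_with_ext r0 _ h => x xr /=.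
  by have [_ /(_ x xr)[_ _ h2]] := hr s' s'p; rewrite iso_add.
by have := qhol_uniq (iso_qhol (phi_fixD sp s'p)) h'; rewrite /= (iso_w0 s'p).
Qed.

Lemma Diso0 : Diso 0 = 1%:M.
Proof.
have [r [K [r0 K0 hr]]] := isotropy_uniform.
have h : qhol_with (al 0) (fun=> 1%:M) w0.
  apply: qhol_with_ext r0 _ (qhol_with_affine 1%:M 0 w0) => x xr.
  by rewrite mulmx1 addr0 alphaE (phi0 Hsm); have [_ /(_ x xr)[]] := hr 0 (phi0 Hsm p).
exact: (qhol_uniq (iso_qhol (phi0 Hsm p)) h).
Qed.

Lemma Diso_bound : exists K, forall s, phi s p = p -> rn (Diso s) <= K.
Proof.
have [r [K [r0 K0 hr]]] := isotropy_uniform; exists K => s sp.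
have [[A' hA] _] := hr s sp.
rewrite /Diso (qhol_uniq (iso_qhol sp) (nice_qhol hA)).
by apply: (nice_B hA); rewrite subrr rn0.
Qed.

Lemma Diso_cont s0 : phi s0 p = p -> exists r K : R, 0 < r /\
  forall s, `|s - s0| < r -> rn (Diso s - Diso s0) <= K * `|s - s0|.
Proof.
move=> sp; have c0 : ch_dom c (phi s0 p) by rewrite sp.
have [r [K al_]] := action_local Hsm Hps Xc Xc cp c0.
exists r, K; split; first exact: (al_r al_).
move=> s sr; have s00 : `|s0 - s0| < r by rewrite subrr normr0 (al_r al_).
have w00 : rn (w0 - w0) < r by rewrite subrr rn0 (al_r al_).
have := al_Lw al_ s00 w00 sr w00.
by rewrite subrr rn0 addr0.
Qed.

(* The orbit of a point [x] near [p] under the powers of [phi s] stays bounded, while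
   each step differs from the first one by at most half its length. *)
Lemma identity_local s : phi s p = p -> Diso s = 1%:M ->
  exists2 r : R, 0 < r & forall w : 'rV[C R]_n, rn (w - w0) < r -> al s w = w.
Proof.
move=> sp D1; have [r [K [r0 K0 hr]]] := isotropy_uniform.
have DM j : Diso (s *+ j) = 1%:M.
  elim: j => [|j ih]; first by rewrite mulr0n Diso0.
  by rewrite mulrS Diso_add ?ih ?D1 ?mulmx1 //; exact: phi_fixMn.
have K1 : 0 < 1 + K by lra.
have n0 : 0 <= n%:R :> R by [].
have [r1 r10 [r1r r1K]] : exists2 r1 : R, 0 < r1 & r1 * (1 + K) < r /\ (2 * K + n%:R * K) * (r1 * (1 + K)) < 2^-1.
  have t0 : 0 < 2 * K + n%:R * K + 1 by rewrite ltr_wpDl // addr_ge0 // mulr_ge0 // ltW.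
  exists (Num.min (r / (1 + K) / 2) (4^-1 / (2 * K + n%:R * K + 1) / (1 + K))).
    by rewrite lt_min !divr_gt0 ?invr_gt0.
  split.
    rewrite -ltr_pdivlMr //; apply: le_lt_trans (_ : r / (1 + K) / 2 < _).
      by rewrite ge_min lexx.
    by rewrite ltr_pdivrMr // ltr_pMr ?divr_gt0 // ltr1n.
  apply: le_lt_trans (_ : 4^-1 < _); last by lra.
  apply: le_trans (_ : (2 * K + n%:R * K + 1) * (4^-1 / (2 * K + n%:R * K + 1)) <= _).
    apply: ler_pM.
    - by rewrite addr_ge0 // mulr_ge0 // ltW.
    - by rewrite mulr_ge0 ?(ltW K1) // le_min !divr_ge0 ?invr_ge0 ?(ltW r0) ?(ltW K1) ?(ltW t0).
    - by rewrite lerDl.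
    by rewrite -ler_pdivlMr // ge_min lexx orbT.
  by rewrite mulrC divfK ?gt_eqF.
exists r1 => // x xr1; set y := al s x.
have r1K1 : r1 <= r1 * (1 + K) by rewrite ler_peMr ?(ltW r10) // lerDl (ltW K0).
have xr : rn (x - w0) < r by apply: lt_trans xr1 _; exact: le_lt_trans r1K1 r1r.
have [[A1 hA1] hd1] := hr s sp.
have w0r : rn (w0 - w0) < r by rewrite subrr rn0.
have alB j w : rn (w - w0) < r -> rn (al (s *+ j) w - w0) <= K * rn (w - w0).
  move=> wr; have [[A2 hA2] _] := hr _ (phi_fixMn j sp).
  by rewrite -{1}(iso_w0 (phi_fixMn j sp)); exact: (nice_fL hA2).
have yr1 : rn (y - w0) <= K * r1.
  by apply: le_trans (_ : K * rn (x - w0) <= _); [rewrite /y -[s]mulr1n alB|rewrite ler_wpM2l // ltW].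
have yr : rn (y - w0) < r.
  apply: le_lt_trans yr1 _; apply: le_lt_trans r1r; rewrite mulrDr mulr1 mulrC.
  by rewrite lerDr ltW.
have yx : rn (y - x) <= r1 * (1 + K).
  apply: le_trans (rn_dist _ w0 _) _; rewrite (rn_distC w0) mulrDr mulr1 addrC (mulrC r1).
  by rewrite lerD // ltW.
have step j : rn (al (s *+ j.+1) x - al (s *+ j) x - (y - x)) <= 2^-1 * rn (y - x).
  have [_ /(_ x xr)[_ _ cx]] := hr s sp.
  rewrite mulrSr iso_add // -/y.
  have [[A2 hA2] _] := hr _ (phi_fixMn j sp).
  have A1_ : A2 w0 = 1%:M by rewrite -(DM j); exact: qhol_uniq (nice_qhol hA2) (iso_qhol (phi_fixMn j sp)).
  have h1 := nice_T hA2 xr yr; have h2 := nice_L hA2 w0r xr; rewrite A1_ in h2.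
  have E : al (s *+ j) y - al (s *+ j) x - (y - x) =
     (al (s *+ j) y - al (s *+ j) x - (y - x) *m A2 x) + (y - x) *m (A2 x - 1%:M).
    by rewrite mulmxBr mulmx1 addrA subrK.
  rewrite E; apply: le_trans (rnD _ _) _; apply: le_trans (lerD h1 (rn_mulmx _ _)) _.
  have Y0 := rn_ge0 (y - x).
  have -> : K * rn (y - x) ^+ 2 + n%:R * rn (y - x) * rn (A2 x - 1%:M) =
     (K * rn (y - x) + n%:R * rn (A2 x - 1%:M)) * rn (y - x) by ring.
  rewrite ler_wpM2r //; apply: le_trans (ltW r1K).
  have h3 : n%:R * rn (A2 x - 1%:M) <= n%:R * K * (r1 * (1 + K)).
    rewrite -mulrA ler_wpM2l //; apply: le_trans h2 _; rewrite ler_wpM2l ?(ltW K0) //.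
    exact: le_trans (ltW xr1) r1K1.
  have h4 : K * rn (y - x) <= K * (r1 * (1 + K)) by rewrite ler_wpM2l ?(ltW K0).
  rewrite mulrDl; apply: lerD => //; apply: le_trans h4 _.
  by rewrite -mulrA ler_peMl // ?ler1n // mulr_ge0 ?(ltW K0) // mulr_ge0 ?(ltW r10) ?(ltW K1).
have tel N : rn (al (s *+ N) x - x - rc N%:R *: (y - x)) <= N%:R * (2^-1 * rn (y - x)).
  elim: N => [|N ih].
    have [_ /(_ x xr)[_ xE _]] := hr s sp.
    by rewrite mulr0n rc0 scale0r subr0 mul0r alphaE (phi0 Hsm) xE subrr rn0.
  have -> : al (s *+ N.+1) x - x - rc N.+1%:R *: (y - x) =
     (al (s *+ N.+1) x - al (s *+ N) x - (y - x)) + (al (s *+ N) x - x - rc N%:R *: (y - x)).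
    by rewrite -[N.+1%:R]natr1 rcD rc1 scalerDl scale1r; mxring.
  apply: le_trans (rnD _ _) _; apply: le_trans (lerD (step N) ih) _.
  by rewrite -[N.+1%:R]natr1 mulrDl mul1r addrC.
have bd N : rn (al (s *+ N) x - x) <= (1 + K) * r1.
  apply: le_trans (rn_dist _ w0 _) _; rewrite (rn_distC w0) mulrDl mul1r addrC.
  rewrite lerD //; first exact: ltW.
  by apply: le_trans (alB N x xr) _; rewrite ler_wpM2l // ltW.
have fin N : N%:R * rn (y - x) <= 2 * ((1 + K) * r1).
  have h : rn (rc N%:R *: (y - x)) <= rn (al (s *+ N) x - x) + N%:R * (2^-1 * rn (y - x)).
    have -> : rc N%:R *: (y - x) = (al (s *+ N) x - x) - (al (s *+ N) x - x - rc N%:R *: (y - x)).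
      by rewrite [RHS]addrC opprB subrK.
    apply: le_trans (rnD _ _) _; rewrite rnN lerD2l; exact: tel.
  move: h; rewrite rnZ ab_rc ger0_norm // => h; have := bd N.
  by move: (rn (al _ _ - x)) (rn (y - x)) ((1 + K) * r1) h {K1 r1K r1r r1K1} => a b B; lra.
apply/eqP; rewrite -subr_eq0; apply/eqP; apply: rn_small => e e0.
rewrite leNgt; apply/negP => ey.
have := fin (Num.truncn (2 * ((1 + K) * r1) / e)).+1.
have := truncnS_gt (2 * ((1 + K) * r1) / e); move: (Num.truncn _).+1 => N.
rewrite ltr_pdivrMr // => h1 h2; have h3 : N%:R * e <= N%:R * rn (y - x) by rewrite ler_wpM2l // ltW.
by have := lt_le_trans h1 (le_trans h3 h2); rewrite ltxx.
Qed.
End AtPoint.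

(** The set of points near which phi s is the identity is open. It is also closed: at a limit point
    phi s fixes the point and its derivative is still 1, so [identity_local] applies there.
    Connectedness and effectiveness conclude. *)
Lemma isotropy_faithful s p c : connected [set: M] -> effective act -> atlas X c ->
  ch_dom c p -> phi s p = p -> Diso c p s = 1%:M -> Exp (complexv s) = onev k.
Proof.
move=> Mconn eff Xc cp sp D1.
have loc q c' : atlas X c' -> ch_dom c' q -> phi s q = q -> Diso c' q s = 1%:M ->
    \forall z \near q, phi s z = z.
  move=> Xc' c'q sq Dq; have [r r0 hr] := identity_local Xc' c'q sq Dq.
  have c's : ch_dom c' (phi s q) by rewrite sq.
  have [d d0 [U nU dP]] := phi_cont Hsm (dom_nbhs c's).
  apply: filterS (filterI nU (chart_nbhs_to c'q r0)) => z [Uz [cz zr]].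
  have s0 : `|s - s| < d by rewrite subrr normr0.
  have cs : ch_dom c' (phi s z) := dP s z s0 Uz.
  have := hr _ zr; rewrite alphaE ch_toK' // => E.
  by rewrite -(ch_toK' cs) E ch_toK'.
pose B := [set q : M | \forall z \near q, phi s z = z].
have BT : B = setT.
  apply: Mconn.
  - by exists p; exact: loc Xc cp sp D1.
  - exists B; rewrite ?setTI // openE => q /nbhs_interior; apply: filterS => z.
    exact.
  exists B; rewrite ?setTI // => q clq.
  have sq : phi s q = q.
    apply: contrapT => sq; have [A [A' [nA nA' AA]]] := hausdorff_sep (manifold_hausdorff X) sq.
    have [d d0 [U nU dP]] := phi_cont Hsm nA.
    have [z [Bz [Uz A'z]]] := clq _ (filterI nU nA').
    apply: (AA z) => //; have <- : phi s z = z by exact: nbhs_singleton Bz.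
    have s0 : `|s - s| < d by rewrite subrr normr0.
    exact: (dP s z s0 Uz).
  have [c' Xc' c'q] := atlas_cover X q.
  apply: (loc q c') => //.
  have c's : ch_dom c' (phi s q) by rewrite sq.
  have [r [K al_]] := action_local Hsm Hps Xc' Xc' c'q c's.
  have r0 := al_r al_; have K0 := al_K al_.
  apply/eqP; rewrite -subr_eq0; apply/eqP; apply: rn_small => e e0.
  have d0 : 0 < Num.min r (e / K) by rewrite lt_min r0 divr_gt0.
  have [z [Bz [c'z]]] := clq _ (chart_nbhs_to c'q d0).
  rewrite lt_min => /andP[zr ze].
  have s0 : `|s - s| < r by rewrite subrr normr0.
  have q0 : rn (ch_to c' q - ch_to c' q) < r by rewrite subrr rn0.
  have := al_Lw al_ s0 zr s0 q0; rewrite subrr normr0 add0r.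
  have -> : Aw c' c' s (ch_to c' z) = 1%:M.
    have sz : phi s z = z by exact: nbhs_singleton Bz.
    have [r1 r10 hr1] := chart_nbhs c'z Bz.
    have h : qhol_with (alpha c' c' s) (fun=> 1%:M) (ch_to c' z).
      apply: qhol_with_ext r10 _ (qhol_with_affine 1%:M 0 _) => w /hr1[_ _ h1 h2].
      by rewrite mulmx1 addr0 alphaE h1 h2.
    exact: (qhol_uniq (iso_qhol Xc' c'z sz) h).
  move=> h; apply: le_trans h _; rewrite rn_distC -ler_pdivlMl // mulrC.
  exact: ltW.
apply: eff; first exact: torus_Exp.
move=> x; have Bx : B x by rewrite BT.
exact: nbhs_singleton Bx.
Qed.
End Isotropy.

(** * Estimates for the exponential; characters of the real line *)

Section ExponentialCalculus.
Context {R : realType}.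
Implicit Types (a t x y : R).

Lemma is_derive_estimate (f : R -> R) x f' : is_derive x 1 f f' -> forall e : R, 0 < e ->
  exists2 d : R, 0 < d & forall y, `|y - x| < d -> `|f y - f x - (y - x) * f'| <= e * `|y - x|.
Proof.
move=> [df fE] e e0; have /derivable1_diffP dif := df.
have /diff_locallyP[_ /eqaddoP H] := dif.
have /nbhs_normP[d /= d0 hd] := H e e0.
exists d => // y yd; have := hd (y - x); rewrite /ball_ /= sub0r normrN => /(_ yd).
rewrite !fctE /= subrK opprD addrA.
suff -> : 'd f x (y - x) = (y - x) * f' by [].
by rewrite -[y - x in LHS]mulr1 -[_ * 1]/(_ *: (1 : R)) linearZ /= -fE -deriveE.
Qed.

(** Scalars as vectors of length 1, to which the calculus of curves applies. *)
Definition sc (z : C R) : 'rV[C R]_1 := z%:M.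
Lemma rn_sc z : rn (sc z) = ab z.
Proof.
apply/le_anti/andP; split; last by have := rn_coord (sc z) 0 0; rewrite mxE eqxx mulr1n.
apply: rn_mx_le; first exact: ab_ge0.
by move=> i j; rewrite !ord1 mxE eqxx mulr1n.
Qed.
Lemma scB z w : sc z - sc w = sc (z - w). Proof. by rewrite /sc raddfB. Qed.
Lemma scZ z w : z *: sc w = sc (z * w). Proof. by rewrite /sc scale_scalar_mx. Qed.
Lemma sc0 : sc 0 = 0. Proof. by rewrite /sc raddf0. Qed.

Lemma hasd_cis t : hasd (fun s => sc (cis s)) t (sc ('i%C * cis t)).
Proof.
move=> e e0; have e2 : 0 < e / 2 by rewrite divr_gt0.
have [d1 d10 h1] := is_derive_estimate (is_derive_cos t) e2.
have [d2 d20 h2] := is_derive_estimate (is_derive_sin t) e2.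
exists (Num.min d1 d2); first by rewrite lt_min d10.
move=> s; rewrite lt_min => /andP[/h1 u1 /h2 u2].
rewrite scB scZ scB rn_sc; apply: le_trans (ab_ReIm _) _.
have -> : complex.Re (cis s - cis t - rc (s - t) * ('i%C * cis t)) =
   cos s - cos t - (s - t) * - sin t by rewrite /cis /=; ring.
have -> : complex.Im (cis s - cis t - rc (s - t) * ('i%C * cis t)) =
   sin s - sin t - (s - t) * cos t by rewrite /cis /=; ring.
apply: le_trans (lerD u1 u2) _; by rewrite -mulrDl -splitr.
Qed.

Lemma cis_lip t : ab (cis t - 1) <= `|t|.
Proof.
have h s : `|s| < `|t| + 1 -> hasd (fun s => sc (cis s)) s (sc ('i%C * cis s)).
  by move=> _; exact: hasd_cis.
have b s : `|s| < `|t| + 1 -> rn (sc ('i%C * cis s)) <= 1.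
  by rewrite rn_sc abM ab_i ab_cis mulr1.
have tt : `|t| < `|t| + 1 by rewrite ltrDl.
by have := mean_value_bound0 h b tt; rewrite scB rn_sc cis0 mul1r.
Qed.

Lemma cis_taylor t : ab (cis t - 1 - 'i%C * rc t) <= `|t| * `|t|.
Proof.
apply/ler_addgt0Pr => e e0.
pose T := `|t| + e / (1 + `|t|).
have t1 : 0 < 1 + `|t| by rewrite ltr_pwDl.
have tT : `|t| < T by rewrite ltrDl divr_gt0.
have h s : `|s| < T -> hasd (fun s => sc (cis s) - (0 + rc s *: sc 'i%C)) s (sc ('i%C * cis s) - sc 'i%C).
  by move=> _; apply: hasd_sub; [exact: hasd_cis|exact: hasd_line].
have b s : `|s| < T -> rn (sc ('i%C * cis s) - sc 'i%C) <= T.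
  rewrite scB rn_sc -[X in _ - X]mulr1 -mulrBr abM ab_i mul1r => sT.
  exact: le_trans (cis_lip s) (ltW sT).
have := mean_value_bound0 h b tT; rewrite rc0 scale0r addr0 subr0 add0r !scZ !scB rn_sc cis0.
have -> : cis t - rc t * 'i%C - 1 = cis t - 1 - 'i%C * rc t by ring.
move=> /le_trans; apply; rewrite /T mulrDl lerD2l -mulrA ler_piMr ?(ltW e0) //.
by rewrite mulrC ler_pdivrMr // mul1r lerDr.
Qed.

Lemma expR_taylor x : `|x| <= 1 / 2 -> `|expR x - 1 - x| <= 2 * `|x| ^+ 2 /\ expR x <= 2.
Proof.
move=> xh; have h1 := expR_ge1Dx x; have h2 := expR_ge1Dx (- x).
have e0 := expR_gt0 x; have E : expR (- x) * expR x = 1 by rewrite -expRD addNr expR0.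
have x1 : 0 < 1 - x by have := ler_norm x; lra.
have h3 : (1 - x) * expR x <= 1 by have := ler_wpM2r (ltW e0) h2; rewrite E.
have xx : x ^+ 2 = `|x| ^+ 2 by rewrite real_normK ?num_real.
have x2 : 1 / 2 <= 1 - x by have := ler_norm x; lra.
have xN : - x <= 1 / 2 by have := ler_norm (- x); rewrite normrN; lra.
have e2 : expR x <= 2 by move: (expR x) e0 h3 => E' e0 h3; nra.
split=> //; rewrite ger0_norm; last by lra.
rewrite -xx; move: (expR x) e0 h3 h1 e2 => y y0 h3 h1 e2.
have : y * (1 - x) - (1 + x) * (1 - x) <= x ^+ 2 by rewrite expr2; lra.
rewrite -mulrBl expr2 => h4; have y1 : 0 <= y - (1 + x) by lra.
have : (y - (1 + x)) * (1 / 2) <= (y - (1 + x)) * (1 - x) by rewrite ler_wpM2l.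
by lra.
Qed.

Lemma cexp_taylor (z : C R) : ab z <= 1 / 2 -> ab (cexp z - 1 - z) <= 8 * ab z ^+ 2.
Proof.
case: z => x y zh; set z := (x +i* y)%C in zh *.
have xz : `|x| <= ab z := ab_Re z.
have yz : `|y| <= ab z := ab_Im z.
have [t1 t2] := expR_taylor (le_trans xz zh); have c := cis_taylor y.
have e0 := expR_gt0 x.
have E : cexp z - 1 - z = rc (expR x) * (cis y - 1 - 'i%C * rc y) +
    (rc (expR x - 1 - x) * ('i%C * rc y) + rc x * ('i%C * rc y)) + rc (expR x - 1 - x).
  by apply/eqP; rewrite eq_complex /cexp /cis /=; apply/andP; split; apply/eqP; ring.
rewrite E; apply: le_trans (abD _ _) _; apply: le_trans (lerD (abD _ _) (lexx _)) _.
apply: le_trans (lerD (lerD (lexx _) (abD _ _)) (lexx _)) _.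
rewrite !abM ab_i !ab_rc !mul1r (ger0_norm (ltW e0)).
have A0 := ab_ge0 z; have X0 := normr_ge0 x; have Y0 := normr_ge0 y.
set A := ab z in zh xz yz A0 *.
have q1 : `|x| ^+ 2 <= A ^+ 2 by rewrite lerXn2r ?nnegrE.
have q2 : `|y| * `|y| <= A ^+ 2 by rewrite expr2 ler_pM.
have q3 : `|x| * `|y| <= A ^+ 2 by rewrite expr2 ler_pM.
have q0 : 0 <= A ^+ 2 by rewrite exprn_ge0.
have p1 : expR x * ab (cis y - 1 - 'i%C * rc y) <= 2 * A ^+ 2.
  exact: (ler_pM (ltW e0) (ab_ge0 _) t2 (le_trans c q2)).
have p2 : `|expR x - 1 - x| <= 2 * A ^+ 2 by apply: le_trans t1 _; rewrite ler_wpM2l.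
have p3 : `|expR x - 1 - x| * `|y| <= 2 * A ^+ 2.
  rewrite -[leRHS]mulr1; apply: (ler_pM (normr_ge0 _) Y0 p2).
  by apply: le_trans (le_trans yz zh) _; rewrite ler_pdivrMr // mul1r ler1n.
move: (expR x * _) (`|expR x - 1 - x| * `|y|) (`|expR x - 1 - x|) (`|x| * `|y|) (A ^+ 2) p1 p2 p3 q3 q0.
by move=> a1 a2 a3 a4 a5; lra.
Qed.

Lemma cexp_neq0 (z : C R) : cexp z != 0.
Proof.
apply/eqP => h; have : cexp (z - z) = 0 by rewrite cexpD h mul0r.
rewrite subrr /cexp /= expR0 cos0 sin0 mulr1 mulr0 => /eqP.
by rewrite eq_complex /= oner_eq0.
Qed.

Lemma Exp_qhol n (p : 'rV[C R]_n) :
  qhol_with (@Exp R n) (fun u => diag_mx ('i%C *: Exp u)) p.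
Proof.
have K0 : 0 <= rn (Exp p) := rn_ge0 _.
have bnd (z : C R) : ab z <= 1 / 2 -> ab (cexp z) <= 4.
  move=> zh; have h := cexp_taylor zh; have A0 := ab_ge0 z.
  have -> : cexp z = (cexp z - 1 - z) + (1 + z) by ring.
  apply: le_trans (abD _ _) _; apply: le_trans (lerD h (abD _ _)) _; rewrite ab1.
  by move: (ab z) zh A0 {h} => a zh a0; rewrite expr2; nra.
exists (1 / 8), (8 * (4 * rn (Exp p))); split=> // u v up vp.
apply: rn_mx_le => [|i j]; first by rewrite !mulr_ge0 ?exprn_ge0 ?rn_ge0.
rewrite ord1 {i} !mxE.
have dE : ((v - u) *m diag_mx ('i%C *: Exp u)) 0 j = 'i%C * (v 0 j - u 0 j) * cexp ('i%C * u 0 j).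
  by rewrite mul_mx_diag !mxE mulrCA !mulrA.
have := dE; rewrite !mxE => ->.
set h := 'i%C * (v 0 j - u 0 j).
have -> : 'i%C * v 0 j = 'i%C * u 0 j + h by rewrite /h; ring.
rewrite cexpD.
have hv : ab h <= rn (v - u) by rewrite abM ab_i mul1r; have := rn_coord (v - u) 0 j; rewrite !mxE.
have vu : rn (v - u) <= 1 / 4.
  by have := rn_dist v p u; rewrite (rn_distC p) => /le_trans; apply; lra.
have hh : ab h <= 1 / 2 by lra.
have -> : cexp ('i%C * u 0 j) * cexp h - cexp ('i%C * u 0 j) - h * cexp ('i%C * u 0 j) =
  (cexp h - 1 - h) * cexp ('i%C * u 0 j) by ring.
rewrite abM; apply: le_trans (ler_pM (ab_ge0 _) (ab_ge0 _) (cexp_taylor hh) (lexx _)) _.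
have cu : ab (cexp ('i%C * u 0 j)) <= 4 * rn (Exp p).
  have -> : 'i%C * u 0 j = 'i%C * (u 0 j - p 0 j) + 'i%C * p 0 j by ring.
  rewrite cexpD abM; apply: ler_pM; rewrite ?ab_ge0 //; last first.
    by have := rn_coord (Exp p) 0 j; rewrite mxE.
  apply: bnd; rewrite abM ab_i mul1r.
  by have := rn_coord (u - p) 0 j; rewrite !mxE => /le_trans; apply; lra.
rewrite [leRHS]mulrAC; apply: ler_pM => //; rewrite ?ab_ge0 ?mulr_ge0 ?exprn_ge0 ?ab_ge0 //.
by rewrite ler_wpM2l // lerXn2r ?nnegrE ?ab_ge0 ?rn_ge0.
Qed.

(** A primitive F of chi satisfies F (t + s) = F t + chi t F s, so a nonzero value of F shows that
    chi is differentiable at 0. Its derivative is purely imaginary because chi has modulus 1.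
    Dividing by the corresponding exponential leaves a character psi with derivative 0; writing psi
    t as the N-th power of psi (t / N) shows psi = 1. *)
Lemma circle_hom (chi : R -> C R) : (forall s t, chi (s + t) = chi s * chi t) ->
  (forall t, ab (chi t) = 1) ->
  (forall e : R, 0 < e -> exists2 d : R, 0 < d & forall t, `|t| < d -> ab (chi t - 1) <= e) ->
  exists a, forall t, chi t = cis (a * t).
Proof.
move=> cD c1 cc; have c0 : chi 0 = 1.
  have : chi 0 * (chi 0 - 1) = 0 by rewrite mulrBr mulr1 -cD addr0 subrr.
  move=> /eqP; rewrite mulf_eq0 -ab_eq0 c1 oner_eq0 /= subr_eq0 => /eqP.
  exact.
have chN t : chi (- t) * chi t = 1 by rewrite -cD addNr c0.
have cont : continuous_curve (fun t => sc (chi t)).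
  move=> t e e0; have [d d0 hd] := cc e e0; exists d => // s sd.
  rewrite scB rn_sc; have -> : chi s - chi t = (chi (s - t) - 1) * chi t.
    by rewrite mulrBl -cD subrK mul1r.
  by rewrite abM c1 mulr1; exact: hd.
have [F F0 hF] := primitive 4 cont.
have FD t s : `|t| < 2 -> `|s| < 2 -> F (t + s) = F t + chi t *: F s.
  move=> t2 s2; have h r : `|r| < 2 -> hasd (fun r => F (t + r) - chi t *: F r) r 0.
    move=> r2; have tr : `|t + r| < 4 by apply: le_lt_trans (ler_normD _ _) _; lra.
    have r4 : `|r| < 4 by lra.
    have := hasd_sub (hasd_shift (hF _ tr)) (hasd_scale (chi t) (hF _ r4)).
    by rewrite scZ scB cD subrr sc0.
  have b (r : R) : `|r| < 2 -> rn (0 : 'rV[C R]_1) <= 0 by rewrite rn0.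
  have := mean_value_bound0 h b s2; rewrite mul0r => /rn_le0 /eqP.
  by rewrite F0 scaler0 subr0 addr0 subr_eq0 subr_eq => /eqP.
have [a [a0 a1 Fa]] : exists a, [/\ 0 < a, a < 1 & F a 0 0 != 0].
  have z4 : `|0 : R| < 4 by rewrite normr0.
  have h12 : 0 < 1 / 2 :> R by lra.
  have [d d0 hd] := hF 0 z4 (1 / 2) h12.
  exists (Num.min (d / 2) (1 / 2)); split; rewrite ?lt_min ?gt_min ?divr_gt0 //.
    by apply/orP; right; lra.
  set a := Num.min _ _; have a0 : 0 < a by rewrite lt_min !divr_gt0.
  have ad : a < d by rewrite gt_min; apply/orP; left; lra.
  apply/eqP => Fa; have := hd a; rewrite subr0 ger0_norm ?(ltW a0) // => /(_ ad).
  rewrite F0 subr0 => h; have := rn_coord (F a - rc a *: sc (chi 0)) 0 0.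
  rewrite c0 !mxE Fa mulr1 sub0r abN ab_rc ger0_norm ?(ltW a0) // => h'.
  by rewrite c0 in h; have := le_trans h' h; rewrite leNgt gtr_pMl // ltr_pdivrMr // mul1r ltr1n.
have [b chd] : exists b, forall e : R, 0 < e ->
    exists2 d : R, 0 < d & forall t, `|t| < d -> ab (chi t - 1 - b * rc t) <= e * `|t|.
  exists ((chi a - 1) / F a 0 0) => e.
  move=> e0; have a2 : `|a| < 2 by rewrite ger0_norm ?(ltW a0) // (lt_trans a1) // ltr1n.
  have a4 : `|a + 0| < 4 by rewrite addr0 (lt_trans a2) // ltr_nat.
  have z4 : `|0 : R| < 4 by rewrite normr0.
  have h := hasd_sub (hasd_shift (hF _ a4)) (hF 0 z4).
  have f0 : 0 < ab (F a 0 0) by rewrite ab_gt0.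
  have [d d0 hd] := h (e * ab (F a 0 0)) (mulr_gt0 e0 f0).
  have d1 : 0 < Num.min d 1 by rewrite lt_min d0 ltr01.
  exists (Num.min d 1) => // t; rewrite lt_min => /andP[td t1].
  have := hd t; rewrite subr0 => /(_ td); rewrite addr0 F0 subr0 c0.
  have t2 : `|t| < 2 by rewrite (lt_trans t1) // ltr1n.
  rewrite (addrC a) (FD t a t2 a2) (addrC (F t)) addrK.
  have FE : F a = sc (F a 0 0) by exact: mx11_scalar.
  rewrite FE !scZ !scB scZ scB rn_sc.
  have scE z : sc z 0 0 = z by rewrite mxE eqxx mulr1n.
  move: (F a 0 0) Fa f0 {FE} => f Fa f0; rewrite scE.
  have -> : chi t * f - f - rc t * (chi a - 1) = (chi t - 1 - (chi a - 1) / f * rc t) * f.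
    by field.
  by rewrite abM [leRHS]mulrAC ler_pM2r // => h1; exact: h1.
have [bx [by_ bE]] : exists x y, b = (x +i* y)%C by case: (b) => x y; exists x, y.
have bx0 : bx = 0.
  have small (e : R) : 0 < e -> `|bx| <= e.
    move=> e0; have [d d0 hd] := chd e e0.
    have key (h : R) : `|h| < d -> bx * h <= e * `|h|.
      move=> /hd; rewrite bE => he; have := le_trans (ab_Re _) he.
      have := le_trans (ab_Re (chi h)) _; rewrite c1 => /(_ _ (lexx _)).
      case: (chi h) => u v /=; rewrite !mulr0 !subr0.
      move=> /ler_normlP[_ h1] /ler_normlP[h2 _]; lra.
    have d2 : `|d / 2| = d / 2 by rewrite ger0_norm // divr_ge0 // ltW.
    have := key (d / 2); have := key (- (d / 2)); rewrite normrN d2.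
    have dd : d / 2 < d by lra.
    have d20 : 0 < d / 2 by lra.
    move=> /(_ dd) + /(_ dd); rewrite mulrN -mulNr !ler_pM2r // => h1 h2.
    by apply/ler_normlP; split.
  apply/eqP; rewrite -normr_le0; apply/ler_addgt0Pr => e e0.
  by rewrite add0r; exact: small.
exists by_ => t; pose psi t := chi t * cis (- (by_ * t)).
have psiD u v : psi (u + v) = psi u * psi v.
  by rewrite /psi cD mulrDr opprD cisD mulrACA.
have psi1 u : ab (psi u) = 1 by rewrite /psi abM c1 ab_cis mulr1.
have psis (e : R) : 0 < e -> exists2 d : R, 0 < d & forall h, `|h| < d -> ab (psi h - 1) <= e * `|h|.
  move=> e0; have e2 : 0 < e / 2 by rewrite divr_gt0.
  have [d d0 hd] := chd _ e2; have b0 : 0 < 1 + by_ ^+ 2 by rewrite ltr_pwDl // sqr_ge0.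
  exists (Num.min d (e / 2 / (1 + by_ ^+ 2))); first by rewrite lt_min d0 !divr_gt0.
  move=> h; rewrite lt_min => /andP[/hd h1]; rewrite ltr_pdivlMr // => h2.
  have -> : psi h - 1 = (chi h - cis (by_ * h)) * cis (- (by_ * h)).
    by rewrite mulrBl (mulrC (cis (by_ * h))) cisN.
  rewrite abM ab_cis mulr1.
  have -> : chi h - cis (by_ * h) = (chi h - 1 - b * rc h) - (cis (by_ * h) - 1 - 'i%C * rc (by_ * h)).
    rewrite bE bx0; have -> : (0 +i* by_)%C * rc h = 'i%C * rc (by_ * h) :> C R.
      by apply/eqP; rewrite eq_complex /=; apply/andP; split; apply/eqP; ring.
    by ring.
  apply: le_trans (abD _ _) _; rewrite abN; apply: le_trans (lerD h1 (cis_taylor _)) _.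
  have H0 := normr_ge0 h; rewrite normrM.
  have -> : `|by_| * `|h| * (`|by_| * `|h|) = `|by_| ^+ 2 * `|h| * `|h| by ring.
  rewrite real_normK ?num_real // [leRHS](_ : _ = e / 2 * `|h| + e / 2 * `|h|); last by field.
  rewrite lerD2l ler_wpM2r //; apply: le_trans (ltW h2); rewrite mulrC ler_wpM2l //.
  by rewrite lerDr.
have psiN (h : R) N : ab (psi (N%:R * h) - 1) <= N%:R * ab (psi h - 1).
  elim: N => [|N ih].
    by rewrite !mul0r /psi mulr0 oppr0 cis0 c0 mulr1 subrr /ab normr0.
  have -> : N.+1%:R * h = N%:R * h + h by rewrite -[N.+1%:R]natr1 mulrDl mul1r.
  have -> : psi (N%:R * h + h) - 1 = psi (N%:R * h) * (psi h - 1) + (psi (N%:R * h) - 1).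
    by rewrite psiD; ring.
  apply: le_trans (abD _ _) _; rewrite abM psi1 mul1r -[N.+1%:R]natr1 mulrDl mul1r addrC.
  by rewrite lerD2r.
have : psi t = 1.
  apply/eqP; rewrite -subr_eq0 -ab_eq0 -normr_le0 ger0_norm ?ab_ge0 //.
  apply/ler_addgt0Pr => e e0; rewrite add0r.
  have t0 : 0 < 1 + `|t| by rewrite ltr_pwDl.
  have [d d0 hd] := psis _ (divr_gt0 e0 t0).
  have [N [N0 Nd]] : exists N : nat, (0 < N)%N /\ `|t| / N%:R < d.
    exists (Num.truncn (`|t| / d)).+1; split=> //.
    by rewrite ltr_pdivrMr // mulrC -ltr_pdivrMr // truncnS_gt.
  have n0 : (0 : R) < N%:R by rewrite ltr0n.
  have := psiN (t / N%:R) N; rewrite mulrC divfK ?gt_eqF // => /le_trans; apply.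
  have hN : `|t / N%:R| < d by rewrite normrM normfV (ger0_norm (ltW n0)).
  apply: le_trans (ler_wpM2l (ltW n0) (hd _ hN)) _.
  rewrite normrM normfV (ger0_norm (ltW n0)).
  have -> : N%:R * (e / (1 + `|t|) * (`|t| / N%:R)) = e * (`|t| / (1 + `|t|)).
    by field; rewrite !gt_eqF.
  by rewrite ler_piMr ?(ltW e0) // ler_pdivrMr // mul1r lerDr.
rewrite /psi => h; have := congr1 (fun z => z * cis (by_ * t)) h.
by rewrite -mulrA cisN mulr1 mul1r.
Qed.
End ExponentialCalculus.

(** * Simultaneous diagonalization of bounded commuting matrices *)

Section BoundedMatrixGroups.
Context {R : realType}.

Lemma expr_bounded (a K : R) : (forall j, a ^+ j <= K) -> a <= 1.
Proof.
move=> h; rewrite leNgt; apply/negP => a1; have x0 : 0 < a - 1 by rewrite subr_gt0.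
have b j : 1 + j%:R * (a - 1) <= a ^+ j.
  elim: j => [|j ih]; first by rewrite mul0r addr0 expr0.
  rewrite exprS; apply: le_trans (_ : a * (1 + j%:R * (a - 1)) <= _); last first.
    by rewrite ler_wpM2l // (le_trans ler01) // ltW.
  have j0 : 0 <= j%:R * (a - 1) * (a - 1) by rewrite !mulr_ge0 ?(ltW x0).
  by rewrite -[j.+1%:R]natr1; move: (j%:R) j0 => J; lra.
have := le_trans (b (Num.truncn (K / (a - 1))).+1) (h _).
have := truncnS_gt (K / (a - 1)); rewrite ltr_pdivrMr //.
by move: (_ * (a - 1)) => y; lra.
Qed.

(** Suppose w = u (A - a) is nonzero. Boundedness of the powers of A and of its inverse forces |a| =
    1, while u A^j contains the term j a^(j-1) w, whose norm grows linearly. *)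
Lemma bounded_semisimple n (A B : 'M[C R]_n.+1) K (a : C R) (u : 'rV[C R]_n.+1) :
  A * B = 1 -> (forall j, rn (A ^+ j) <= K) -> (forall j, rn (B ^+ j) <= K) ->
  u *m (A - a%:M) *m (A - a%:M) = 0 -> u *m (A - a%:M) = 0.
Proof.
move=> AB hA hB; set w := u *m (A - a%:M) => wA.
have wE : w *m A = a *: w.
  by have := wA; rewrite mulmxBr mul_mx_scalar => /eqP; rewrite subr_eq0 => /eqP.
have uE : u *m A = a *: u + w by rewrite /w mulmxBr mul_mx_scalar addrC subrK.
apply/eqP; apply/negPn/negP => w0; have wn : 0 < rn w.
  by rewrite lt_def rn_ge0 andbT; apply: contra w0 => /eqP /rn0_eq0 ->.
have wAj j : w *m A ^+ j = a ^+ j *: w.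
  elim: j => [|j ih]; first by rewrite !expr0 mulmx1 scale1r.
  by rewrite exprS mulmxA wE -scalemxAl ih scalerA -exprS.
have a0 : a != 0.
  apply: contraNneq w0 => a0; have : w *m A *m B = w by rewrite -mulmxA [A *m B]AB mulmx1.
  by rewrite wE a0 scale0r mul0mx => <-.
have wB : w *m B = a^-1 *: w.
  have : w *m A *m B = w by rewrite -mulmxA [A *m B]AB mulmx1.
  by rewrite wE -scalemxAl => h; rewrite -[in RHS]h scalerA mulVf // scale1r.
have wBj j : w *m B ^+ j = a^-1 ^+ j *: w.
  elim: j => [|j ih]; first by rewrite !expr0 mulmx1 scale1r.
  by rewrite exprS mulmxA wB -scalemxAl ih scalerA -exprS.
have abX (z : C R) j : ab (z ^+ j) = ab z ^+ j.
  by elim: j => [|j ih]; rewrite ?expr0 ?ab1 // !exprS abM ih.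
have bd (Y : 'M[C R]_n.+1) (z : C R) : (forall j, rn (Y ^+ j) <= K) ->
    (forall j, w *m Y ^+ j = z ^+ j *: w) -> ab z <= 1.
  move=> hY wY; apply: (@expr_bounded _ (n.+1%:R * K)) => j.
  have := rn_mulmx w (Y ^+ j); rewrite wY rnZ abX mulrAC ler_pM2r // => /le_trans; apply.
  by rewrite ler_wpM2l.
have a1 : ab a = 1.
  apply/le_anti; rewrite (bd A) //=.
  by have := bd B _ hB wBj; rewrite abV invf_le1 // ab_gt0.
have uAj j : u *m A ^+ j.+1 = a ^+ j.+1 *: u + (j.+1%:R * a ^+ j) *: w.
  elim: j => [|j ih]; first by rewrite !expr1 expr0 mulr1 scale1r.
  rewrite exprSr mulmxA ih mulmxDl -!scalemxAl uE wE scalerDr !scalerA.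
  rewrite -addrA -scalerDl -exprSr; congr (_ + _ *: _).
  by rewrite -mulrA -exprSr -{1}[a ^+ j.+1]mul1r -mulrDl addrC natr1.
have fin j : j.+1%:R * rn w <= n.+1%:R * rn u * K + rn u.
  have -> : j.+1%:R * rn w = rn ((j.+1%:R * a ^+ j) *: w).
    by rewrite rnZ abM abX a1 expr1n mulr1 -rc_nat ab_rc ger0_norm.
  have -> : (j.+1%:R * a ^+ j) *: w = u *m A ^+ j.+1 - a ^+ j.+1 *: u by rewrite uAj addrC addKr.
  apply: le_trans (rnD _ _) _; rewrite rnN rnZ abX a1 expr1n mul1r lerD2r.
  by apply: le_trans (rn_mulmx _ _) _; rewrite ler_wpM2l // mulr_ge0 // rn_ge0.
have := fin (Num.truncn ((n.+1%:R * rn u * K + rn u) / rn w)).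
by rewrite leNgt -ltr_pdivrMr // truncnS_gt.
Qed.

(** Repeated roots are removed from the minimal polynomial one at a time by [bounded_semisimple].
    Powers are written as products of constant lists so that n = 0 is included. *)
Lemma bounded_diagonalizable n (A B : 'M[C R]_n) K : A *m B = 1%:M ->
  (forall s : seq 'M[C R]_n, all (pred1 A) s -> rn (foldr mulmx 1%:M s) <= K) ->
  (forall s : seq 'M[C R]_n, all (pred1 B) s -> rn (foldr mulmx 1%:M s) <= K) ->
  diagonalizable A.
Proof.
case: n A B => [|n] A B AB hA hB; first by rewrite [A]flatmx0; exact: diagonalizable0.
have pw (Y : 'M[C R]_n.+1) j : foldr mulmx 1%:M (nseq j Y) = Y ^+ j.
  by elim: j => //= j ->; rewrite exprS.
have hA' j : rn (A ^+ j) <= K by rewrite -pw hA // all_nseq /= eqxx orbT.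
have hB' j : rn (B ^+ j) <= K by rewrite -pw hB // all_nseq /= eqxx orbT.
have ss := bounded_semisimple AB hA' hB'.
have [rs rsE] := closed_field_poly_normal (mxminpoly A).
rewrite (monicP (mxminpoly_monic A)) scale1r in rsE.
apply/diagonalizableP; exists (undup rs); first exact: undup_uniq.
apply: mxminpoly_min; pose H := horner_mx A.
pose P (s : seq (C R)) : {poly C R} := \prod_(x <- s) ('X - x%:P).
have H1 x : horner_mx A ('X - x%:P) = A - x%:M by rewrite rmorphB /= horner_mx_X horner_mx_C.
have key s (u : 'rV[C R]_n.+1) : u *m H (P s) = 0 -> u *m H (P (undup s)) = 0.
  elim: s u => [|x s ih] u //=; rewrite {1}/P big_cons -/(P s).
  case: ifP => [xs|_]; last first.
    by rewrite /P big_cons -/(P s) -/(P (undup s)) /H !rmorphM /= !mulmxA; exact: ih.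
  have PE : P s = P (rem x s) * ('X - x%:P).
    by rewrite /P (perm_big _ (perm_to_rem xs)) big_cons mulrC.
  move=> h; apply: ih; rewrite PE /H rmorphM /= H1 mulmxA; apply: ss.
  by move: h; rewrite PE mulrC /H !rmorphM /= H1 !mulmxA.
have H0 : H (P rs) = 0 by rewrite /H /P -rsE mx_root_minpoly.
apply/row_matrixP => i; rewrite row0 rowE; apply: key.
by rewrite H0 mulmx0.
Qed.

Lemma finite_span n (G : 'M[C R]_n -> Prop) : exists As : seq 'M[C R]_n,
  (forall A, A \in As -> G A) /\ forall A, G A -> A \in <<As>>%VS.
Proof.
pose P r := `[< exists As : seq 'M[C R]_n, (forall A, A \in As -> G A) /\ \dim <<As>> = r >].
have P0 : exists r, P r by exists 0%N; apply/asboolP; exists [::]; rewrite span_nil dimv0.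
have Pb r : P r -> (r <= n * n)%N.
  by move=> /asboolP[As [_ <-]]; apply: leq_trans (dimvS (subvf _)) _; rewrite dimvf.
case: (ex_maxnP P0 Pb) => r /asboolP[As [AsG Asr]] mx; exists As; split=> // A GA.
have /mx : P (\dim <<A :: As>>).
  apply/asboolP; exists (A :: As); split=> // B; rewrite inE => /orP[/eqP->//|]; exact: AsG.
have sub : (<<As>> <= <<A :: As>>)%VS by rewrite span_cons addvSr.
rewrite -Asr => le; have /eqP -> : <<As>>%VS == <<A :: As>>%VS by rewrite eqEdim sub.
by rewrite memv_span // mem_head.
Qed.

(** A finite subfamily spanning the family is diagonalized simultaneously; every other member is a
    linear combination of it, hence diagonal in the same basis. *)
Lemma codiagonalize n (G : 'M[C R]_n -> Prop) :
  (forall A B, G A -> G B -> A *m B = B *m A) -> (forall A, G A -> diagonalizable A) ->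
  exists2 P : 'M[C R]_n, P \in unitmx & forall A, G A ->
    exists d, P *m A = diag_mx d *m P.
Proof.
move=> Gc Gd; have [As [AsG AsP]] := finite_span G.
have [P Pu /allP hP] : codiagonalizable As.
  apply/codiagonalizableP; split; first by move=> A B /AsG GA /AsG GB; exact: Gc.
  by move=> A /AsG; exact: Gd.
exists P => // A /AsP AA.
have [d dE] : exists d : 'I_(size As) -> 'rV[C R]_n, forall i : 'I_(size As), P *m As`_i = diag_mx (d i) *m P.
  apply: (fin_all_exists (P := fun (i : 'I_(size As)) d => P *m As`_i = diag_mx d *m P)) => i.
  have /hP /diagonalizable_forPex[d /(simmxLR Pu) h] : As`_i \in As by rewrite mem_nth.
  by exists d; rewrite [in LHS]h (mxpoly.conjVmx _ Pu) !mulmxA mulmxV // mul1mx.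
exists (\sum_i coord (in_tuple As) i A *: d i).
rewrite {1}(@coord_span _ _ _ (in_tuple As) _ AA) mulmx_sumr raddf_sum mulmx_suml; apply: eq_bigr => i _.
rewrite -scalemxAr dE scalemxAl; congr (_ *m P).
by apply/matrixP => x y; rewrite !mxE mulrnAr.
Qed.
End BoundedMatrixGroups.

(** * Real and complex ranks *)

Section RankLemmas.

Lemma cols_factor (F : fieldType) m n r (A : 'M[F]_(m, n)) (f : 'I_r -> 'I_n) : injective f ->
  (forall i j, j \notin codom f -> A i j = 0) -> A = colsub f A *m rowsub f 1%:M.
Proof.
move=> fi A0; apply/matrixP => i j; rewrite !mxE; case: (boolP (j \in codom f)) => [/codomP[l ->]|jJ].
  rewrite (bigD1 l) //= !mxE eqxx mulr1.
  rewrite big1 ?addr0 // => q ql; rewrite !mxE; case: eqP => [/fi E|_]; last by rewrite mulr0.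
  by case/eqP: ql.
rewrite A0 // big1 // => l _; rewrite !mxE; case: eqP => [E|_]; last by rewrite mulr0.
by case/negP: jJ; rewrite -E codom_f.
Qed.

Lemma rank_cols (F : fieldType) m n (A : 'M[F]_(m, n)) (J : {set 'I_n}) :
  (forall i j, j \notin J -> A i j = 0) -> (\rank A <= #|J|)%N.
Proof.
move=> A0; rewrite (@cols_factor _ _ _ #|J| A enum_val enum_val_inj) ?mulmx_max_rank // => i j jJ.
by apply: A0; apply: contra jJ => jJ; apply/codomP; exists (enum_rank_in jJ j); rewrite enum_rankK_in.
Qed.

Context {R : realType}.

(** Its left kernel consists of the real vectors killed by A. When the rows of A are the generators
    at a point, its rank is the dimension of the orbit of the compact torus. *)
Definition reim k n (A : 'M[C R]_(k, n)) : 'M[R]_(k, n + n) :=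
  row_mx (map_mx (@complex.Re R) A) (map_mx (@complex.Im R) A).

Lemma reimP k n (A : 'M[C R]_(k, n)) (v : 'rV[R]_k) :
  complexv v *m A = 0 <-> v *m reim A = 0.
Proof.
have rs (I : Type) (s : seq I) (F : I -> C R) :
    complex.Re (\sum_(i <- s) F i) = \sum_(i <- s) complex.Re (F i).
  by elim/big_rec2: _ => // i a b _ <-; case: (F i); case: b.
have is_ (I : Type) (s : seq I) (F : I -> C R) :
    complex.Im (\sum_(i <- s) F i) = \sum_(i <- s) complex.Im (F i).
  by elim/big_rec2: _ => // i a b _ <-; case: (F i); case: b.
have E : realify (complexv v *m A) = v *m reim A.
  rewrite /realify /reim mul_mx_row; congr row_mx; apply/rowP => j; rewrite !mxE.
    rewrite rs; apply: eq_bigr => i _; rewrite !mxE; case: (A i j) => a b /=.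
    by rewrite mul0r subr0.
  rewrite is_; apply: eq_bigr => i _; rewrite !mxE; case: (A i j) => a b /=.
  by rewrite mul0r addr0.
have r0 : realify 0 = 0 :> 'rV[R]_(n + n) by have := realifyB (0 : 'rV[C R]_n) 0; rewrite !subrr.
split=> h; first by rewrite -E h r0.
by apply: (can_inj (@realifyK R n)); rewrite E h r0.
Qed.

Lemma rank_reim k n (A : 'M[C R]_(k, n)) : (\rank (reim A) <= (\rank A).*2)%N.
Proof.
rewrite -{1}(mulmx_base A); move: (col_base A) (row_base A) => P Q.
have -> : reim (P *m Q) = reim P *m block_mx (map_mx (@complex.Re R) Q) (map_mx (@complex.Im R) Q)
    (- map_mx (@complex.Im R) Q) (map_mx (@complex.Re R) Q).
  rewrite /reim mul_row_block; congr row_mx; apply/matrixP => i j.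
    rewrite !mxE -big_split /=; elim/big_rec2: _ => // l a b _ <-.
    by rewrite !mxE; case: (P i l) => x y; case: (Q l j) => z w; case: b => b1 b2 /=; ring.
  rewrite !mxE -big_split /=; elim/big_rec2: _ => // l a b _ <-.
  by rewrite !mxE; case: (P i l) => x y; case: (Q l j) => z w; case: b => b1 b2 /=; ring.
rewrite -addnn; exact: mulmx_max_rank.
Qed.
End RankLemmas.

(** * Weights of the isotropy group *)

Section Weights.
Context {R : realType} {M : topologicalType} {n : nat}.
Context (X : complexManifold R M n) (k : nat) (act : 'rV[C R]_k -> M -> M).
Context (Hsm : smooth_action X act) (Hps : preserves_complex_structure X act).
Context (Mconn : connected [set: M]) (eff : effective act).

Local Notation phi := (phi act).
Local Notation Xm := (Xm act).

Context (c : chart R M n) (Xc : atlas X c) (p : M) (cp : ch_dom c p).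
Local Notation D := (Diso act c p).
Let X0 := Xm c (ch_to c p).
(** The dimension of the isotropy group of p. *)
Let e := (k - \rank (reim X0))%N.

Let fixMn := phi_fixMn Hsm.

Lemma Diso_pow s j : phi s p = p ->
  forall q, size q = j -> all (pred1 (D s)) q -> foldr mulmx 1%:M q = D (s *+ j).
Proof.
move=> sp; elim: j => [|j ih] [|A q] //=.
  by rewrite mulr0n (Diso0 Hsm Hps Xc cp).
move=> [sq] /andP[/eqP -> aq]; rewrite (ih _ sq aq) mulrSr.
by rewrite (Diso_add Hsm Hps Xc cp (fixMn j sp) sp).
Qed.

Lemma Diso_diag s : phi s p = p -> diagonalizable (D s).
Proof.
move=> sp; have [K hK] := Diso_bound Hsm Hps Xc cp.
have sN := phi_fixN Hsm sp.
apply: (@bounded_diagonalizable _ _ _ (D (- s)) K).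
- by rewrite -(Diso_add Hsm Hps Xc cp sN sp) addNr (Diso0 Hsm Hps Xc cp).
- by move=> q aq; rewrite (Diso_pow sp erefl aq); apply: hK; exact: fixMn.
- by move=> q aq; rewrite (Diso_pow sN erefl aq); apply: hK; exact: fixMn.
Qed.

(** The isotropy matrices commute and have bounded powers in both directions, so they are
    diagonalizable simultaneously. An eigenvalue and its inverse both have bounded powers, whence
    modulus 1. *)
Lemma Diso_weights : exists2 P : 'M[C R]_n, P \in unitmx &
  exists chi : 'rV[R]_k -> 'rV[C R]_n, forall s, phi s p = p ->
    [/\ P *m D s = diag_mx (chi s) *m P, forall j, ab (chi s 0 j) = 1 &
        forall s', phi s' p = p -> forall j, chi (s + s') 0 j = chi s 0 j * chi s' 0 j].
Proof.
pose G A := exists2 s, phi s p = p & A = D s.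
have [|A [s sp ->]|P Pu hP] := @codiagonalize _ _ G; last first.
- have h s : exists d : 'rV[C R]_n, phi s p = p -> P *m D s = diag_mx d *m P.
    have [sp|nsp] := pselect (phi s p = p); last by exists 0.
    by have [|d dE] := hP (D s); [exists s|exists d].
  have [chi hchi] := choice h; exists P => //; exists chi => s sp.
  have D0 d d' : diag_mx d *m P = diag_mx d' *m P -> forall j, d 0 j = d' 0 j :> C R.
    move=> /(congr1 (fun A => A *m invmx P)); rewrite !mulmxK // => E j.
    by have /matrixP/(_ j j) := E; rewrite !mxE eqxx !mulr1n.
  have add s1 s2 : phi s1 p = p -> phi s2 p = p -> forall j, chi (s1 + s2) 0 j = chi s1 0 j * chi s2 0 j.
    move=> h1 h2 j; have := D0 (chi (s1 + s2)) (\row_i (chi s1 0 i * chi s2 0 i)) _ j; rewrite mxE; apply.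
    rewrite -(hchi _ (phi_fixD Hsm h1 h2)) (Diso_add Hsm Hps Xc cp h1 h2) mulmxA (hchi _ h2).
    rewrite -mulmxA (hchi _ h1) mulmxA; congr (_ *m _); rewrite mulmx_diag; congr diag_mx.
    by apply/rowP => i; rewrite !mxE mulrC.
  have I1 : 1%:M = diag_mx (const_mx 1) :> 'M[C R]_n by rewrite diag_const_mx.
  have chi0 j : chi 0 0 j = 1.
    have z := phi0 Hsm p; have := hchi 0 z; rewrite (Diso0 Hsm Hps Xc cp) mulmx1 -[X in X = _]mul1mx.
    by rewrite I1 => /D0/(_ j); rewrite mxE => <-.
  have pow s1 m : phi s1 p = p -> forall j, chi (s1 *+ m) 0 j = chi s1 0 j ^+ m.
    move=> s1p j; elim: m => [|m ih]; first by rewrite mulr0n chi0 expr0.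
    by rewrite mulrS add // ?ih ?exprS //; exact: fixMn.
  have [K hK] := Diso_bound Hsm Hps Xc cp.
  have le1 s1 j : phi s1 p = p -> ab (chi s1 0 j) <= 1.
    move=> s1p; apply: (@expr_bounded R _ (n%:R * K)) => m.
    have w0 : 0 < rn (row j P).
      rewrite lt_def rn_ge0 andbT; apply/eqP => /rn0_eq0 E.
      have /rowP/(_ j) : delta_mx 0 j = 0 :> 'rV[C R]_n.
        by rewrite -[delta_mx 0 j]mulmx1 -(mulmxV Pu) mulmxA -rowE E mul0mx.
      by rewrite !mxE !eqxx => /eqP; rewrite oner_eq0.
    have E : row j P *m D (s1 *+ m) = chi s1 0 j ^+ m *: row j P.
      rewrite -row_mul (hchi _ (fixMn m s1p)) row_mul row_diag_mx -scalemxAl -rowE (pow _ _ s1p).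
      by [].
    have abX (z : C R) i : ab (z ^+ i) = ab z ^+ i.
      by elim: i => [|i ih]; rewrite ?expr0 ?ab1 // !exprS abM ih.
    have := rn_mulmx (row j P) (D (s1 *+ m)); rewrite E rnZ abX mulrAC ler_pM2r // => /le_trans; apply.
    by rewrite ler_wpM2l // hK //; exact: fixMn.
  split; [exact: hchi| |by move=> s' s'p; exact: add].
  move=> j; apply/le_anti; rewrite le1 //=.
  have := le1 (- s) j (phi_fixN Hsm sp); have := add _ _ (phi_fixN Hsm sp) sp j.
  rewrite addNr chi0 => /(congr1 ab); rewrite ab1 abM => E le1N.
  have A0 := ab_ge0 (chi s 0 j).
  by rewrite [leLHS]E ler_piMl.
- exact: Diso_diag.
move=> A B [s sp ->] [t tp ->].
by rewrite -(Diso_add Hsm Hps Xc cp tp sp) -(Diso_add Hsm Hps Xc cp sp tp) addrC.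
Qed.

Lemma cis_all1 (x : R) : (forall t, cis (t * x) = 1) -> x = 0.
Proof.
move=> h; apply/eqP; apply/negPn/negP => x0.
have := h (pi / x); rewrite divfK // /cis cospi sinpi => /eqP.
rewrite eq_complex /= eqxx andbT => /eqP E.
by have := ltr01 (R := R); rewrite -{1}E oppr_gt0 ltr10.
Qed.

Lemma vel_const v x t : v *m Xm c (ch_to c p) = 0 -> x = p -> vel X act v (fun _ : R => x) t.
Proof.
move=> v0 ->; apply: (@vel_of_chart _ _ _ X k act Hsm Hps c v (fun _ : R => p) t Xc cp).
  by move=> N nN; exists 1 => // s _; exact: nbhs_singleton.
by rewrite v0; exact: hasd_const.
Qed.

Lemma lieP v : complexv v *m X0 = 0 <-> forall t : R, phi (t *: v) p = p.
Proof.
split=> [h t|h].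
  have h1 : icurve X act (complexv v) (fun t => phi (t *: v) p) (`|t| + 1).
    by move=> s _; exact: (vel_orbit Hsm Hps).
  have h2 : icurve X act (complexv v) (fun _ : R => p) (`|t| + 1).
    by move=> s _; exact: vel_const.
  apply: (icurve_uniq Hsm Hps h1 h2); first by rewrite scale0r (phi0 Hsm).
  by rewrite ltrDl.
have := orbit_hasd Hsm Hps v Xc cp; rewrite -/X0 => h1.
apply: (hasd_uniq h1); apply: hasd_ext ltr01 _ (hasd_const (ch_to c p) 0) => s _.
by rewrite h.
Qed.

(** B is a basis of the Lie algebra of the isotropy group, and Am is the matrix of its weights. A
    one-parameter group on which all weights vanish acts on the tangent space as the identity; by
    [isotropy_faithful] it is trivial, so the rows of Am are independent. *)
Lemma weights_basis : exists (B : 'M[R]_(e, k)) (P : 'M[C R]_n) (Am : 'M[R]_(e, n)) chi,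
  [/\ P \in unitmx, row_free B, row_free Am,
      forall v, complexv v *m X0 = 0 <-> (v <= B)%MS &
      [/\ forall s, phi s p = p -> P *m D s = diag_mx (chi s) *m P /\ forall j, ab (chi s 0 j) = 1,
       forall s s', phi s p = p -> phi s' p = p -> forall j, chi (s + s') 0 j = chi s 0 j * chi s' 0 j &
       forall (u : 'rV[R]_e) j, chi (u *m B) 0 j = cis ((u *m Am) 0 j)]].
Proof.
have eE : \rank (kermx (reim X0)) = e by exact: mxrank_ker.
pose B := castmx (eE, erefl k) (row_base (kermx (reim X0))).
have BE : (B :=: kermx (reim X0))%MS by exact: eqmx_trans (eqmx_cast _ _) (eq_row_base _).
have Bf : row_free B by rewrite /row_free BE eE.
have BP v : complexv v *m X0 = 0 <-> (v <= B)%MS.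
  rewrite reimP BE; split=> [/sub_kermxP|/sub_kermxP]; exact.
have [P Pu [chi hchi]] := Diso_weights.
have fixB (u : 'rV[R]_e) (t : R) : phi (t *: (u *m B)) p = p.
  by have /lieP : complexv (u *m B) *m X0 = 0 by apply/BP; exact: submxMl.
have I1 : 1%:M = diag_mx (const_mx 1) :> 'M[C R]_n by rewrite diag_const_mx.
have chi1 s j : phi s p = p -> D s = 1%:M -> chi s 0 j = 1.
  move=> sp D1; have [h _ _] := hchi s sp; move: h; rewrite D1 mulmx1 -{1}[P]mul1mx I1.
  move=> /(congr1 (fun A => A *m invmx P)); rewrite !mulmxK // => /matrixP/(_ j j).
  by rewrite !mxE eqxx !mulr1n => <-.
have fix0 := phi0 Hsm p.
have chi0 j : chi 0 0 j = 1 := chi1 0 j fix0 (Diso0 Hsm Hps Xc cp).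
have hom i j : exists a : R, forall t, chi (t *: row i B) 0 j = cis (a * t).
  have rB t : phi (t *: row i B) p = p by rewrite rowE; exact: fixB.
  apply: circle_hom.
  - by move=> s t; rewrite scalerDl; have [_ _ ->] := hchi _ (rB s).
  - by move=> t; have [_ -> _] := hchi _ (rB t).
  move=> d d0; have [r [K [r0 hK]]] := Diso_cont Hsm Hps Xc cp fix0.
  pose L := 1 + n%:R * (n%:R * rn P * (`|K| * (1 + `|row i B|))) * rn (invmx P).
  have L0 : 0 < L by rewrite ltr_pwDl // !mulr_ge0 ?rn_ge0 // addr_ge0.
  have b0 : 0 < 1 + `|row i B| by rewrite ltr_pwDl.
  exists (Num.min (r / (1 + `|row i B|)) (d / L)); first by rewrite lt_min !divr_gt0.
  move=> t; rewrite lt_min (ltr_pdivlMr _ _ b0) (ltr_pdivlMr _ _ L0) => /andP[t1 t2].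
  have tb : `|t *: row i B| <= `|t| * (1 + `|row i B|) by rewrite normrZ ler_wpM2l // lerDr.
  have tr : `|t *: row i B - 0| < r by rewrite subr0; exact: le_lt_trans tb t1.
  have := hK _ tr; rewrite (Diso0 Hsm Hps Xc cp) subr0 => hD.
  have [hE _ _] := hchi _ (rB t).
  have E : diag_mx (chi (t *: row i B)) - 1%:M = P *m (D (t *: row i B) - 1%:M) *m invmx P.
    by rewrite mulmxBr mulmx1 hE mulmxBl mulmxK // mulmxV.
  have /matrixP/(_ j j) := E; rewrite !mxE eqxx !mulr1n => ->.
  apply: le_trans (_ : rn (P *m (D (t *: row i B) - 1%:M) *m invmx P) <= _).
    by have := rn_coord (P *m (D (t *: row i B) - 1%:M) *m invmx P) j j; rewrite mxE.
  apply: le_trans (rn_mulmx _ _) _.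
  apply: le_trans (_ : n%:R * (n%:R * rn P * (`|K| * (`|t| * (1 + `|row i B|)))) * rn (invmx P) <= _).
    rewrite ler_wpM2r ?rn_ge0 // ler_wpM2l //; apply: le_trans (rn_mulmx _ _) _.
    rewrite ler_wpM2l ?mulr_ge0 ?rn_ge0 //; apply: le_trans hD _.
    apply: le_trans (_ : `|K| * `|t *: row i B| <= _); first by rewrite ler_wpM2r ?ler_norm.
    by rewrite ler_wpM2l.
  have -> : n%:R * (n%:R * rn P * (`|K| * (`|t| * (1 + `|row i B|)))) * rn (invmx P) = `|t| * (L - 1).
    by rewrite /L; ring.
  by apply: le_trans (ltW t2); rewrite ler_wpM2l // gerBl.
have [am hm] := fin_all_exists (fun i => fin_all_exists (hom i)).
have sumP (u : 'rV[R]_e) (r : seq 'I_e) :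
    phi (\sum_(i <- r) u 0 i *: row i B) p = p /\
    forall j, chi (\sum_(i <- r) u 0 i *: row i B) 0 j = cis (\sum_(i <- r) am i j * u 0 i).
  elim: r => [|i r [ih1 ih2]].
    by split=> [|j]; rewrite !big_nil ?fix0 // chi0 cis0.
  have rB : phi (u 0 i *: row i B) p = p by rewrite rowE; exact: fixB.
  split=> [|j]; rewrite !big_cons; first exact: (phi_fixD Hsm rB ih1).
  have [_ _ ->] := hchi _ rB; last exact: ih1.
  by rewrite ih2 hm cisD.
have chiE (u : 'rV[R]_e) j : chi (u *m B) 0 j = cis ((u *m \matrix_(i, j) am i j) 0 j).
  rewrite [in LHS]mulmx_sum_row; have [_ ->] := sumP u (index_enum 'I_e).
  by rewrite mxE; congr cis; apply: eq_bigr => i _; rewrite mxE mulrC.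
exists B, P, (\matrix_(i, j) am i j), chi; split=> //.
  apply: inj_row_free => u u0.
  have uB0 : u *m B = 0.
    apply/rowP => x; rewrite [RHS]mxE; apply: cis_all1 => t.
    have sp := fixB u t.
    have D1 : D (t *: (u *m B)) = 1%:M.
      have [h _ _] := hchi _ sp; rewrite -[LHS]mul1mx -(mulVmx Pu) -mulmxA h.
      have -> : chi (t *: (u *m B)) = const_mx 1.
        by apply/rowP => j; rewrite scalemxAl chiE -scalemxAl u0 scaler0 !mxE cis0.
      by rewrite -I1 mul1mx.
    have := isotropy_faithful Hsm Hps Mconn eff Xc cp sp D1.
    by rewrite Exp_cis => /rowP/(_ x); rewrite !mxE.
  by apply: (row_free_inj Bf); rewrite uB0 mul0mx.
split=> //.
- by move=> s /hchi[h1 h2 _].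
- by move=> s s' /hchi[_ _ h] /h.
Qed.

Lemma isotropy_rows s : phi s p = p -> X0 *m D s = X0.
Proof.
move=> sp; have c0 : ch_dom c (phi s p) by rewrite sp.
by have := field_invariant Hsm Hps Xc Xc cp c0; rewrite sp.
Qed.

(** The case of equality in [isotropy_count]: the directions transverse to the complex orbit are
    then as many as the dimensions of the isotropy group. *)
Definition good_point := (e + \rank X0 = n)%N.

(** The rows of lam are normalized so that u acts on the coordinate f i with weight u_i and
    trivially on the others. By [sd_Z] the orbit directions have no component along the coordinates
    f i; [sd_stab] says that the isotropy group is connected, and [sd_int] that 2 pi times a row of
    lam is a period of the torus. *)
Record slice_data (lam : 'M[R]_(e, k)) (P : 'M[C R]_n) (f : 'I_e -> 'I_n) : Prop := {
  sd_inj : injective f;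
  sd_P : P \in unitmx;
  sd_lie : forall v, complexv v *m X0 = 0 <-> (v <= lam)%MS;
  sd_free : row_free lam;
  sd_D : forall u : 'rV[R]_e,
    P *m D (u *m lam) = diag_mx (\row_j cis ((u *m rowsub f 1%:M) 0 j)) *m P;
  sd_Z : forall i r, (X0 *m invmx P) r (f i) = 0;
  sd_stab : forall s, phi s p = p ->
    exists u : 'rV[R]_e, Exp (complexv s) = Exp (complexv (u *m lam));
  sd_int : forall u : 'rV[R]_e, (forall i, cis (u 0 i) = 1) ->
    Exp (complexv (u *m lam)) = onev k }.

(** Let J be the set of coordinates with a nonzero weight. Independence of the weights gives e <=
    |J|. The generators are fixed by the isotropy, so they vanish on J and rank X0 <= n - |J|. The
    second inequality compares real and complex rank. In the case of equality |J| = e, the weights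
    on J form an invertible matrix, and a change of basis turns it into the identity. *)
Lemma isotropy_count : [/\ (e + \rank X0 <= n)%N, (k <= e + (\rank X0).*2)%N &
  good_point -> exists lam P f, slice_data lam P f].
Proof.
have [B [P [Am [chi [Pu Bf Af BP [hP chiD chiE]]]]]] := weights_basis.
pose J : {set 'I_n} := [set j | [exists i, Am i j != 0]]%SET.
have fixB (u : 'rV[R]_e) : phi (u *m B) p = p.
  have /lieP/(_ 1) : complexv (u *m B) *m X0 = 0 by apply/BP; exact: submxMl.
  by rewrite scale1r.
pose Z := X0 *m invmx P.
have ZD s j r : phi s p = p -> Z r j * chi s 0 j = Z r j.
  move=> sp; have [h _] := hP s sp.
  have E : Z *m diag_mx (chi s) = Z.
    have <- : P *m D s *m invmx P = diag_mx (chi s) by rewrite h mulmxK.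
    by rewrite /Z !mulmxA mulmxKV // isotropy_rows.
  by have /matrixP/(_ r j) := E; rewrite mul_mx_diag mxE.
have AJ i j : j \notin J -> Am i j = 0.
  rewrite inE negb_exists => /forallP/(_ i); rewrite negbK => /eqP.
  exact.
(* The element u acts on the coordinate j by -1 but fixes the generators. *)
have ZJ r j : j \notin ~: J -> Z r j = 0.
  rewrite inE negbK inE => /existsP[i Aij]; pose u := (pi / Am i j) *: delta_mx 0 i : 'rV[R]_e.
  have := ZD _ j r (fixB u); rewrite chiE /u -scalemxAl -rowE !mxE divfK //.
  rewrite /cis cospi sinpi => /eqP; rewrite -subr_eq0 -[X in _ - X]mulr1 -mulrBr mulf_eq0 => /orP[/eqP //|].
  rewrite subr_eq0 eq_complex /= eqxx andbT => /eqP E.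
  by have := ltr01 (R := R); rewrite -{1}E oppr_gt0 ltr10.
have rA : \rank Am = e by apply/eqP.
have eJ : (e <= #|J|)%N by rewrite -{1}rA; exact: rank_cols.
have rZ : \rank Z = \rank X0 by rewrite /Z mxrankMfree // row_free_unit unitmx_inv.
have rJ : (\rank X0 <= n - #|J|)%N.
  by rewrite -rZ; apply: leq_trans (rank_cols ZJ) _; rewrite cardsCs finset.setCK card_ord.
have Jn : (#|J| <= n)%N := leq_trans (max_card (mem J)) (eq_leq (card_ord n)).
have rk : (\rank (reim X0) <= k)%N := rank_leq_row _.
split.
- by apply: leq_trans (leq_add eJ rJ) _; rewrite subnKC.
- by have := rank_reim X0; rewrite /e; move: rk; move: (\rank _) ((\rank _).*2) => a b; lia.
rewrite /good_point => gd; have JE : #|J| = e by move: eJ rJ Jn gd; move: #|J| (\rank X0) => a b; lia.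
pose f (i : 'I_e) : 'I_n := enum_val (cast_ord (esym JE) i).
have fi : injective f by move=> i i' /enum_val_inj /cast_ord_inj.
have fJ j : (j \in codom f) = (j \in J).
  apply/codomP/idP => [[i ->]|jJ]; first exact: enum_valP.
  by exists (cast_ord JE (enum_rank_in jJ j)); rewrite /f cast_ordK enum_rankK_in.
have AE : Am = colsub f Am *m rowsub f 1%:M.
  by apply: cols_factor => // i j; rewrite fJ; exact: AJ.
have A1u : colsub f Am \in unitmx.
  rewrite -row_free_unit /row_free eqn_leq rank_leq_row -{1}rA {1}AE.
  exact: mxrankM_maxl.
pose lam := invmx (colsub f Am) *m B.
have chiL (u : 'rV[R]_e) j : chi (u *m lam) 0 j = cis ((u *m rowsub f 1%:M) 0 j).
  rewrite /lam mulmxA chiE {2}AE; congr (cis (_ 0 j)).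
  by rewrite !mulmxA mulmxKV.
have fixL (u : 'rV[R]_e) : phi (u *m lam) p = p by rewrite /lam mulmxA.
have uf (u : 'rV[R]_e) i : (u *m rowsub f 1%:M) 0 (f i) = u 0 i.
  rewrite mxE (bigD1 i) //= !mxE eqxx mulr1 big1 ?addr0 // => l li.
  by rewrite !mxE (inj_eq fi) (negPf li) mulr0.
have un (u : 'rV[R]_e) j : j \notin J -> (u *m rowsub f 1%:M) 0 j = 0.
  rewrite -fJ => jf; rewrite mxE big1 // => l _; rewrite !mxE; case: eqP => [E|_]; last by rewrite mulr0.
  by case/negP: jf; rewrite -E codom_f.
have I1 : 1%:M = diag_mx (const_mx 1) :> 'M[C R]_n by rewrite diag_const_mx.
have triv s : phi s p = p -> (forall j, chi s 0 j = 1) -> Exp (complexv s) = onev k.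
  move=> sp c1; apply: (isotropy_faithful Hsm Hps Mconn eff Xc cp sp).
  have [h _] := hP s sp; rewrite -[Diso _ _ _ _]mul1mx -(mulVmx Pu) -mulmxA h.
  have -> : chi s = const_mx 1 by apply/rowP => j; rewrite c1 mxE.
  by rewrite -I1 mul1mx.
exists lam, P, f; split=> //.
- by move=> v; rewrite BP /lam (eqmxMfull B) // row_full_unit unitmx_inv.
- by rewrite /row_free /lam mxrankMfree // mxrank_unit // unitmx_inv.
- move=> u; have [-> _] := hP _ (fixL u); congr (diag_mx _ *m _).
  by apply/rowP => j; rewrite [RHS]mxE; exact: chiL.
- by move=> i r; apply: ZJ; rewrite inE negbK -fJ codom_f.
- move=> s sp; have [_ c1] := hP s sp.
  have [a aE] := fin_all_exists (fun i => cis_surj (c1 (f i))).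
  pose u := \row_i a i : 'rV[R]_e.
  have sN := phi_fixN Hsm (fixL u); have sD := phi_fixD Hsm sp sN.
  exists u; have -> : s = s - u *m lam + u *m lam by rewrite subrK.
  suff t : Exp (complexv (s - u *m lam)) = onev k.
    rewrite (complexvD (s - u *m lam)) ExpD t.
    by apply/rowP => j; rewrite !mxE mul1r.
  apply: triv sD _ => j; rewrite chiD //.
  have inv : chi (- (u *m lam)) 0 j = cis (- (u *m rowsub f 1%:M) 0 j).
    by rewrite -mulNmx chiL mulNmx mxE.
  rewrite inv; case: (boolP (j \in J)) => jJ.
    move: jJ; rewrite -fJ => /codomP[i ->]; rewrite uf aE !mxE mulrC; exact: cisN.
  rewrite un // oppr0 cis0 mulr1.
  (* A zero column outside J would push the rank of Z below n - e. A nonzero entry, being fixed by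
     s, forces chi s to be 1 there, even for s in another component of the isotropy group. *)
  have [r Zr] : exists r, Z r j != 0.
    apply: contrapT => nz; have : (\rank Z <= #|(~: J) :\ j|)%N.
      apply: rank_cols => i l; rewrite !inE negb_and !negbK => /orP[/eqP ->|lJ].
        by apply/eqP; apply: contrapT => /negP zz; apply: nz; exists i.
      by apply: ZJ; rewrite inE negbK inE.
    have := cardsD1 j (~: J); rewrite inE jJ rZ => cE; have := cardsC J; rewrite card_ord.
    have JE' := JE; move: cE gd JE'; move: #|~: J| #|J| #|_ :\ _| (\rank X0) => x y z w; rewrite add1n; lia.
  have := ZD s j r sp => /eqP; rewrite -subr_eq0 -[X in _ - X]mulr1 -mulrBr mulf_eq0 (negPf Zr) /=.
  by rewrite subr_eq0 => /eqP.
move=> u u1; apply: triv; first exact: fixL.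
move=> j; rewrite chiL; case: (boolP (j \in J)) => jJ.
  by move: jJ; rewrite -fJ => /codomP[i ->]; rewrite uf.
by rewrite un // cis0.
Qed.
End Weights.

(** * Ultralimits of holomorphic maps *)

Section UltraLimitsOfMaps.
Context {R : realType}.
#[local] Existing Instance natU_ultra.

Lemma natU_le (a b : R) : (forall e : R, 0 < e -> natU [set j : nat | a <= b + e]) -> a <= b.
Proof.
move=> h; apply/ler_addgt0Pr => e e0.
by have /natU_ex[j] := h e e0.
Qed.

(** The quadratic estimate with a common constant is preserved by pointwise limits; it takes the
    place of Montel's theorem. *)
Lemma ulim_qhol a b (f : nat -> 'rV[C R]_a -> 'rV[C R]_b) (f' : nat -> 'rV[C R]_a -> 'M[C R]_(a, b))
    p (r K : R) : 0 < r ->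
  (forall N, forall x y : 'rV[C R]_a, rn (x - p) < r -> rn (y - p) < r ->
     rn (f N y - f N x - (y - x) *m f' N x) <= K * rn (y - x) ^+ 2) ->
  (forall N, forall x : 'rV[C R]_a, rn (x - p) < r -> rn (f N x) <= K /\ rn (f' N x) <= K) ->
  exists g g', qhol_with g g' p /\ forall x : 'rV[C R]_a, rn (x - p) < r -> forall e : R, 0 < e ->
    natU [set N | rn (f N x - g x) < e /\ rn (f' N x - g' x) < e].
Proof.
move=> r0 T Bd.
have h (x : 'rV[C R]_a) : exists l : 'rV[C R]_b * 'M[C R]_(a, b), rn (x - p) < r -> forall e : R, 0 < e ->
    natU [set N | rn (f N x - l.1) < e /\ rn (f' N x - l.2) < e].
  have [xr|xr] := ltP (rn (x - p)) r; last by exists (0, 0).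
  have [l1 h1] := ulim (fun N => (Bd N x xr).1); have [l2 h2] := ulim (fun N => (Bd N x xr).2).
  by exists (l1, l2) => _ e e0; exact: natUI (h1 e e0) (h2 e e0).
have [l hl] := choice h; exists (fun x => (l x).1), (fun x => (l x).2); split; last exact: hl.
exists r, K; split=> // x y xr yr; apply: natU_le => e e0.
have a0 : 0 < 2 + a%:R * rn (y - x) by rewrite ltr_wpDr // mulr_ge0 // rn_ge0.
have d0 : 0 < e / (2 + a%:R * rn (y - x)) by rewrite divr_gt0.
apply: filterS (natUI (hl x xr _ d0) (hl y yr _ d0)) => N [[x1 x2] [y1 y2]] /=.
have E : (l y).1 - (l x).1 - (y - x) *m (l x).2 =
   (f N y - f N x - (y - x) *m f' N x) + ((f N x - (l x).1) - (f N y - (l y).1) +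
     (y - x) *m (f' N x - (l x).2)).
  by rewrite mulmxBr; mxring.
rewrite E; apply: le_trans (rnD _ _) _; apply: lerD; first exact: T.
apply: le_trans (rnD _ _) _; apply: le_trans (lerD (rnB _ _) (rn_mulmx _ _)) _.
apply: le_trans (_ : (2 + a%:R * rn (y - x)) * (e / (2 + a%:R * rn (y - x))) <= e); last first.
  by rewrite mulrC divfK // gt_eqF.
rewrite mulrDl lerD //.
  by rewrite mulrDl mul1r lerD // ltW.
by rewrite ler_wpM2l ?mulr_ge0 ?rn_ge0 // ltW.
Qed.

Lemma rn_avg m n (I : finType) (F : I -> 'M[C R]_(m, n)) (K : R) : (0 < #|I|)%N ->
  (forall i, rn (F i) <= K) -> rn (rc (#|I|%:R)^-1 *: \sum_i F i) <= K.
Proof.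
move=> I0 h; have i0 : (0 : R) < #|I|%:R by rewrite ltr0n.
rewrite rnZ ab_rc ger0_norm ?invr_ge0 ?(ltW i0) // ler_pdivrMl //.
apply: le_trans (rn_sum _ _ _) _; apply: le_trans (ler_sum _ (fun i _ => h i)) _.
by rewrite sumr_const mulr_natl.
Qed.
End UltraLimitsOfMaps.

(** * Linearization of the isotropy action *)

Section Linearization.
Context {R : realType} {M : topologicalType} {n : nat}.
Context (X : complexManifold R M n) (k : nat) (act : 'rV[C R]_k -> M -> M).
Context (Hsm : smooth_action X act) (Hps : preserves_complex_structure X act).

#[local] Existing Instance natU_ultra.
Local Notation phi := (phi act).

Context (c : chart R M n) (Xc : atlas X c) (p : M) (cp : ch_dom c p).
Local Notation D := (Diso act c p).
Local Notation w0 := (ch_to c p).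
Context (e : nat) (lam : 'M[R]_(e, k)).
Context (fixL : forall u : 'rV[R]_e, phi (u *m lam) p = p).
Context (per : forall u : 'rV[R]_e, (forall i, cis (u 0 i) = 1) -> Exp (complexv (u *m lam)) = onev k).

Lemma Exp_lam (u u' : 'rV[R]_e) : (forall i, cis (u 0 i) = cis (u' 0 i)) ->
  Exp (complexv (u *m lam)) = Exp (complexv (u' *m lam)).
Proof.
move=> h; have -> : u = u - u' + u' by rewrite subrK.
rewrite mulmxDl complexvD ExpD per; first by apply/rowP => j; rewrite !mxE mul1r.
by move=> i; rewrite !mxE cisD h mulrC cisN.
Qed.

(** Representatives of the finite subgroup of order (N + 1)^e of the isotropy torus. They are
    indexed by an additive group, so that averages are reindexed by translation. *)
Definition theta N (m : {ffun 'I_e -> 'I_N.+1}) : 'rV[R]_e :=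
  \row_i (2 * pi * ((m i : nat)%:R / N.+1%:R)).

Lemma thetaD N (m l : {ffun 'I_e -> 'I_N.+1}) i :
  cis (theta (m + l) 0 i) = cis ((theta m + theta l) 0 i).
Proof.
rewrite !mxE ffunE /= -mulrDr -mulrDl -natrD.
rewrite [X in _ = cis (_ * (X%:R / _))](divn_eq (m i + l i) N.+1).
have E a b : ((a * N.+1 + b)%:R / N.+1%:R : R) = a%:R + b%:R / N.+1%:R.
  by rewrite natrD natrM mulrDl mulfK ?pnatr_eq0.
transitivity (@cis R (2 * pi * ((m i + l i) %/ N.+1)%:R + 2 * pi * (((m i + l i) %% N.+1)%:R / N.+1%:R))).
  by rewrite cisD (@cis_period R ((m i + l i) %/ N.+1)%N) mul1r.
by congr cis; rewrite E; ring.
Qed.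

Lemma theta_dense N (u : 'rV[R]_e) : exists l : {ffun 'I_e -> 'I_N.+1}, exists v : 'rV[R]_e,
  (forall i, cis (theta l 0 i) = cis (v 0 i)) /\ `|v - u| <= 2 * pi / N.+1%:R.
Proof.
have p0 : 0 < 2 * pi :> R by rewrite mulr_gt0 // pi_gt0.
have n0 : (0 : R) < N.+1%:R by rewrite ltr0n.
pose a i : int := Num.floor (u 0 i * N.+1%:R / (2 * pi)).
have lt i : (`|(a i %% N.+1)%Z|%N < N.+1)%N.
  by rewrite -ltz_nat gez0_abs ?modz_ge0 // ltz_pmod.
exists [ffun i => Ordinal (lt i)].
exists (\row_i (2 * pi * ((a i)%:~R / N.+1%:R))); split=> [i|].
  rewrite !mxE ffunE /=.
  have Ni : (N.+1%:Z)%:~R = N.+1%:R :> R by [].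
  have E x y : ((x * N.+1%:Z + y)%:~R / N.+1%:R : R) = x%:~R + y%:~R / N.+1%:R.
    by rewrite intrD intrM mulrDl Ni mulfK ?pnatr_eq0.
  transitivity (@cis R (2 * pi * (a i %/ N.+1)%Z%:~R + 2 * pi * ((a i %% N.+1)%Z%:~R / N.+1%:R))).
    rewrite cisD cis_period mul1r; congr (cis (_ * (_ / _))).
    by rewrite -[in RHS](gez0_abs (modz_ge0 (a i) _)).
  by congr cis; rewrite [in RHS](divz_eq (a i) N.+1) E; ring.
rewrite -rn_complexv; apply: rn_mx_le => [|i j]; first by rewrite divr_ge0 // ltW.
rewrite ord1 !mxE ab_rc distrC ger0_norm; last first.
  rewrite subr_ge0 mulrA ler_pdivrMr // mulrC -ler_pdivlMr //; exact: floor_le.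
rewrite lerBlDr; have := floorD1_gt (u 0 j * N.+1%:R / (2 * pi)); rewrite -/(a j).
rewrite ltr_pdivrMr // => h.
have -> : 2 * pi / N.+1%:R + 2 * pi * ((a j)%:~R / N.+1%:R) = (a j + 1)%:~R * (2 * pi) / N.+1%:R :> R.
  by rewrite intrD; ring.
by apply/ltW; rewrite ltr_pdivlMr.
Qed.

Lemma alpha_cont_s s w (d : R) : 0 < d -> ch_dom c (phi s (ch_of c w)) ->
  exists2 r : R, 0 < r & forall t : 'rV[R]_k, `|t - s| < r ->
   rn (alpha act c c t w - alpha act c c s w) < d.
Proof.
move=> d0 cs; have [r r0 [U nU UP]] := phi_cont Hsm (chart_nbhs_to cs d0).
exists r => // t tr; rewrite !alphaE.
by have [] := UP t _ tr (nbhs_singleton nU).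
Qed.

Definition cmx m q (A : 'M[R]_(m, q)) : 'M[C R]_(m, q) := map_mx (@rc R) A.

Lemma complexv_mul m q (u : 'rV[R]_m) (A : 'M[R]_(m, q)) :
  complexv (u *m A) = complexv u *m cmx A.
Proof.
apply/rowP => j; rewrite !mxE [LHS](rmorph_sum (real_complex R)).
by apply: eq_bigr => i _; rewrite !mxE [LHS](rmorphM (real_complex R)).
Qed.

Lemma norm_mulmxR m q (u : 'rV[R]_m) (A : 'M[R]_(m, q)) :
  `|u *m A| <= m%:R * `|u| * rn (cmx A).
Proof. by rewrite -!rn_complexv complexv_mul; exact: rn_mulmx. Qed.

Lemma rn_smallM m q (A : 'M[C R]_(m, q)) K : (forall d : R, 0 < d -> rn A <= K * d) -> A = 0.
Proof.
move=> h; apply: rn_small => d d0; have k0 : 0 < 1 + `|K| by rewrite ltr_pwDl.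
apply: le_trans (h _ (divr_gt0 d0 k0)) _; rewrite mulrA ler_pdivrMr // mulrC ler_wpM2l ?(ltW d0) //.
by apply: le_trans (ler_norm _) _; rewrite lerDr.
Qed.

(* Averaging over the finite subgroups of the torus and passing to the limit turns the
   chart into a coordinate system in which the isotropy torus acts linearly. *)
Lemma linearize : exists f f', [/\ qhol_with f f' w0, f w0 = 0, f' w0 = 1%:M &
  exists2 rho : R, 0 < rho & forall (w : 'rV[C R]_n) (u : 'rV[R]_e), rn (w - w0) < rho ->
    f (alpha act c c (u *m lam) w) = f w *m D (u *m lam)].
Proof.
have [r [K [r0 K0 hr]]] := isotropy_uniform Hsm Hps Xc cp.
have [KD hKD] := Diso_bound Hsm Hps Xc cp.
have KD0 : 0 <= KD.
  have z := phi0 Hsm p; exact: le_trans (rn_ge0 _) (hKD 0 z).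
have hA s : exists A', phi s p = p -> nice (alpha act c c s) A' w0 r K.
  have [sp|sp] := pselect (phi s p = p); last by exists (fun=> 0).
  by have [[A' h] _] := hr s sp; exists A'.
have [A' hA'] := choice hA.
pose al s w := alpha act c c s w.
have w0r : rn (w0 - w0) < r by rewrite subrr rn0.
have n0 : 0 <= n%:R :> R by [].
pose sg N (m : {ffun 'I_e -> 'I_N.+1}) := theta m *m lam.
have fixs N m : phi (@sg N m) p = p := fixL _.
have fixN s := phi_fixN Hsm (p := p) (s := s).
(* A group element followed by the inverse of its differential: each term vanishes at w0 and has
   derivative 1 there, hence so does the average. *)
pose t N (m : {ffun 'I_e -> 'I_N.+1}) w := (al (sg N m) w - w0) *m D (- sg N m).
pose f_ N w := rc (#|{ffun 'I_e -> 'I_N.+1}|%:R)^-1 *: \sum_m t N m w.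
pose f_' N w := rc (#|{ffun 'I_e -> 'I_N.+1}|%:R)^-1 *: \sum_m (A' (sg N m) w *m D (- sg N m)).
have G0 N : (0 < #|{: {ffun 'I_e -> 'I_N.+1}}|)%N by rewrite card_ffun card_ord expn_gt0.
pose K1 := n%:R * K * KD.
have K10 : 0 <= K1 by rewrite /K1 !mulr_ge0 // ltW.
have inD m (A : 'M[C R]_(m, n)) s (b : R) : phi s p = p -> rn A <= K * b -> rn (A *m D s) <= K1 * b.
  move=> sp Ab; apply: le_trans (rn_mulmx _ _) _; rewrite /K1 -!mulrA ler_wpM2l //.
  rewrite mulrA (mulrAC K) ; apply: le_trans (_ : K * b * KD <= _); last by rewrite mulrAC.
  by apply: ler_pM; rewrite ?rn_ge0 // hKD.
have avgB m q (F : forall N, {ffun 'I_e -> 'I_N.+1} -> 'M[C R]_(m, q)) N (b : R) :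
    (forall i, rn (F N i) <= b) -> rn (rc (#|{ffun 'I_e -> 'I_N.+1}|%:R)^-1 *: \sum_i F N i) <= b.
  by move=> h; exact: rn_avg.
have T N (x y : 'rV[C R]_n) : rn (x - w0) < r -> rn (y - w0) < r ->
    rn (f_ N y - f_ N x - (y - x) *m f_' N x) <= K1 * rn (y - x) ^+ 2.
  move=> xr yr; rewrite /f_ /f_' -scalerBr -scalemxAr -scalerBr -sumrB mulmx_sumr -sumrB.
  apply: (avgB _ _ (fun N i => t N i y - t N i x - (y - x) *m (A' (sg N i) x *m D (- sg N i)))) => i.
  have -> : t N i y - t N i x - (y - x) *m (A' (sg N i) x *m D (- sg N i)) =
     (al (sg N i) y - al (sg N i) x - (y - x) *m A' (sg N i) x) *m D (- sg N i).
    rewrite /t mulmxA -!mulmxBl; congr (_ *m _); mxring.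
  by apply: inD; [exact: fixN (fixs N i)|exact: (nice_T (hA' _ (fixs N i)))].
have L N (x y : 'rV[C R]_n) : rn (x - w0) < r -> rn (y - w0) < r ->
    rn (f_ N y - f_ N x) <= K1 * rn (y - x).
  move=> xr yr; rewrite /f_ -scalerBr -sumrB.
  apply: (avgB _ _ (fun N i => t N i y - t N i x)) => i.
  have -> : t N i y - t N i x = (al (sg N i) y - al (sg N i) x) *m D (- sg N i).
    rewrite /t -!mulmxBl; congr (_ *m _); mxring.
  by apply: inD; [exact: fixN (fixs N i)|exact: (nice_fL (hA' _ (fixs N i)))].
have f0 N : f_ N w0 = 0.
  rewrite /f_ big1 ?scaler0 // => i _; rewrite /t /al (iso_w0 cp (fixs N i)).
  by rewrite subrr mul0mx.
have fB N (x : 'rV[C R]_n) : rn (x - w0) < r -> rn (f_ N x) <= K1 * r.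
  move=> xr; have := L N _ _ w0r xr; rewrite f0 subr0 => /le_trans; apply.
  by rewrite ler_wpM2l // ltW.
have f'B N (x : 'rV[C R]_n) : rn (x - w0) < r -> rn (f_' N x) <= K1 * 1.
  move=> xr; apply: (avgB _ _ (fun N i => A' (sg N i) x *m D (- sg N i))) => i.
  apply: inD; first exact: fixN (fixs N i).
  by rewrite mulr1; exact: (nice_B (hA' _ (fixs N i))).
have [K2 [K12 K12r]] : exists K2, K1 * 1 <= K2 /\ K1 * r <= K2.
  exists (K1 * 1 + K1 * r); split; rewrite ?lerDl ?lerDr ?mulr_ge0 // ltW //.
have [|N x xr|f [f' [hf hlim]]] := @ulim_qhol _ _ _ f_ f_' w0 r K2 r0.
- move=> N x y xr yr; apply: le_trans (T N x y xr yr) _.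
  by rewrite ler_wpM2r ?exprn_ge0 ?rn_ge0 //; move: K12; rewrite mulr1.
- by split; [exact: le_trans (fB N x xr) K12r|exact: le_trans (f'B N x xr) K12].
exists f, f'; split=> //.
- apply/eqP; rewrite -oppr_eq0 -sub0r; apply/eqP; apply: rn_small => d d0.
  by have /natU_ex[N [h _]] := hlim _ w0r _ d0; rewrite -(f0 N) ltW.
- apply/eqP; rewrite eq_sym -subr_eq0; apply/eqP; apply: rn_small => d d0.
  have /natU_ex[N [_ h]] := hlim _ w0r _ d0; have <- : f_' N w0 = 1%:M; last exact: ltW.
  rewrite /f_' (eq_bigr (fun=> 1%:M)) => [|i _]; last first.
    have -> : A' (sg N i) w0 = D (sg N i).
      exact: qhol_uniq (nice_qhol (hA' _ (fixs N i))) (iso_qhol Hsm Hps Xc cp (fixs N i)).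
    rewrite -(Diso_add Hsm Hps Xc cp (fixN _ (fixs N i)) (fixs N i)) addNr.
    by rewrite (Diso0 Hsm Hps Xc cp).
  have -> : \sum_(i : {ffun 'I_e -> 'I_N.+1}) 1%:M = rc #|{ffun 'I_e -> 'I_N.+1}|%:R *: 1%:M :> 'M[C R]_n.
    by rewrite sumr_const rc_nat scaler_nat.
  rewrite scalerA -rcM mulVf ?rc1 ?scale1r //.
  by rewrite pnatr_eq0 -lt0n.
have K1p : 0 < K + 1 by rewrite ltr_wpDl // ltW.
exists (r / (K + 1)); first by rewrite divr_gt0.
move=> w u; rewrite ltr_pdivlMr // => wr.
have wr1 : rn (w - w0) < r.
  by apply: le_lt_trans wr; rewrite ler_peMr ?rn_ge0 // lerDr ltW.
have alr s : phi s p = p -> rn (al s w - w0) < r.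
  move=> sp; have := nice_fL (hA' s sp) w0r wr1; rewrite (iso_w0 cp sp) => /le_lt_trans; apply.
  by apply: le_lt_trans wr; rewrite mulrC ler_wpM2l ?rn_ge0 // lerDl.
(* Equivariance of the average is exact for parameters in the finite subgroup, by translating the
   index. For an arbitrary u a nearby subgroup element is used, and the errors disappear as N
   grows. *)
have exact_ N (l : {ffun 'I_e -> 'I_N.+1}) (v : 'rV[R]_e) : (forall i, cis (theta l 0 i) = cis (v 0 i)) ->
    f_ N (al (v *m lam) w) = f_ N w *m D (v *m lam).
  move=> lv; rewrite /f_ -scalemxAl mulmx_suml; congr (_ *: _).
  rewrite [in RHS](reindex_inj (addIr l)) /=; apply: eq_bigr => m _.
  have [_ /(_ w wr1)[_ _ dv]] := hr _ (fixL v).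
  rewrite /t /al -(@iso_add R M n X k act Hsm c (sg N m) (v *m lam) w dv) -mulmxA; congr (_ *m _).
    congr (_ - _); rewrite !alphaE; congr (ch_to c _); apply: phi_Exp.
    rewrite -mulmxDl; apply: Exp_lam => i.
    by rewrite thetaD [in LHS]mxE [in RHS]mxE !cisD lv.
  rewrite -(Diso_add Hsm Hps Xc cp (fixL v) (fixN _ (fixs _ _))).
  apply: (Diso_periodic Hsm Hps Xc cp (fixN _ (fixs _ _))).
  rewrite /sg -!mulNmx -mulmxDl; apply: Exp_lam => i.
  have h := thetaD m l i; rewrite [X in _ = cis X]mxE cisD in h.
  rewrite [(- theta m) 0 i]mxE [(v - _) 0 i]mxE [(- theta (m + l)) 0 i]mxE cisD -lv.
  have c1 := cisN (theta (m + l) 0 i); have c2 := cisN (theta m 0 i).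
  rewrite -[LHS]mulr1 -c1 h mulrCA mulrC (mulrA (cis (- theta m 0 i))) c2 mul1r.
  by [].
apply/eqP; rewrite -subr_eq0; apply/eqP.
set s := u *m lam.
have sp : phi s p = p := fixL u.
have [_ /(_ w wr1)[_ _ ds]] := hr _ sp.
have [r' [K' [r'0 hD]]] := Diso_cont Hsm Hps Xc cp sp.
apply: (@rn_smallM _ _ _ (1 + K1 + n%:R * K2 * `|K'| + n%:R * KD)) => d d0.
have [r2 r20 h2] := alpha_cont_s d0 ds.
pose m0 := Num.min (Num.min r' r2) d.
have m00 : 0 < m0 by rewrite !lt_min r'0 r20.
pose Cl := e%:R * (2 * pi) * rn (cmx lam).
have ev : natU [set N | Cl < m0 * N.+1%:R].
  apply: (filterS _ (natU_ge (Num.truncn (Cl / m0)))) => N /= hN.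
  rewrite mulrC -ltr_pdivrMr //; apply: lt_le_trans (truncnS_gt _) _.
  by rewrite ler_nat ltnS.
have /natU_ex[N [[h3 [h4 _]] [h5 _]]] := natUI (natUI ev (hlim _ (alr _ sp) _ d0)) (hlim _ wr1 _ d0).
have [l [v [lv vu]]] := theta_dense N u.
have E := exact_ N l v lv.
have sv : `|v *m lam - s| < m0.
  rewrite /s -mulmxBl; apply: le_lt_trans (norm_mulmxR _ _) _.
  apply: le_lt_trans (_ : Cl / N.+1%:R < _); last by rewrite ltr_pdivrMr ?ltr0n.
  rewrite /Cl (mulrAC (_ * _) (rn _)) ler_wpM2r ?rn_ge0 // -mulrA ler_wpM2l //.
have [sv1 sv2 sv3] : [/\ `|v *m lam - s| < r', `|v *m lam - s| < r2 & `|v *m lam - s| < d].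
  by move: sv; rewrite !lt_min => /andP[/andP[? ?] ?].
have -> : f (alpha act c c s w) - f w *m D s =
   - (f_ N (al s w) - f (al s w)) + (f_ N (al s w) - f_ N (al (v *m lam) w)) +
   f_ N w *m (D (v *m lam) - D s) + (f_ N w - f w) *m D s.
  by rewrite E mulmxBr mulmxBl /al; mxring.
rewrite !mulrDl; apply: le_trans (rnD _ _) _; apply: lerD; last first.
  apply: le_trans (rn_mulmx _ _) _; rewrite mulrAC -!mulrA ler_wpM2l // mulrC.
  by rewrite mulrC; apply: ler_pM; rewrite ?rn_ge0 // ?(hKD _ sp) // ltW.
apply: le_trans (rnD _ _) _; apply: lerD; last first.
  apply: le_trans (rn_mulmx _ _) _; rewrite -!mulrA ler_wpM2l //.
  apply: ler_pM; rewrite ?rn_ge0 //; first exact: le_trans (fB N w wr1) K12r.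
  apply: le_trans (hD _ sv1) _; apply: le_trans (_ : `|K'| * `|v *m lam - s| <= _).
    by rewrite ler_wpM2r ?ler_norm.
  by rewrite ler_wpM2l // ltW.
apply: le_trans (rnD _ _) _; apply: lerD.
  by rewrite mul1r rnN ltW.
apply: le_trans (L N _ _ (alr _ (fixL v)) (alr _ sp)) _; rewrite ler_wpM2l // rn_distC ltW //.
exact: h2.
Qed.
End Linearization.

(** * Real parts of matrix products *)

Section RealParts.
Context {R : realType}.

Lemma Re_sum (I : Type) (s : seq I) (F : I -> C R) :
  complex.Re (\sum_(i <- s) F i) = \sum_(i <- s) complex.Re (F i).
Proof. by elim/big_rec2: _ => // i a b _ <-; case: (F i); case: b. Qed.

Lemma sqri : 'i%C * 'i%C = -1 :> C R.
Proof. by apply/eqP; rewrite eq_complex /=; apply/andP; split; apply/eqP; ring. Qed.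

Lemma realpart_i m (z : 'rV[C R]_m) : realpart ('i%C *: z) = - imagpart z.
Proof. by apply/rowP => j; rewrite !mxE; case: (z 0 j) => x y /=; rewrite mul0r mul1r sub0r. Qed.

Lemma vec_ReIm m (z : 'rV[C R]_m) : z = complexv (realpart z) + 'i%C *: complexv (imagpart z).
Proof. by apply/rowP => j; rewrite !mxE; exact: complex_ReIm. Qed.

Lemma realpart_mulC r m (H : 'M[C R]_(r, m)) (a b : 'rV[R]_r) :
  realpart ((complexv a - 'i%C *: complexv b) *m H) =
  a *m map_mx (@complex.Re R) H + b *m map_mx (@complex.Im R) H.
Proof.
apply/rowP => j; rewrite !mxE Re_sum -big_split; apply: eq_bigr => i _; rewrite !mxE.
by case: (H i j) => x y /=; ring.
Qed.

Lemma cmxM a b c (V : 'M[R]_(a, b)) (W : 'M[R]_(b, c)) : cmx (V *m W) = cmx V *m cmx W.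
Proof. exact: (map_mxM (real_complex R)). Qed.

Lemma cmx_inv a b (V : 'M[R]_(a, b)) (W : 'M[R]_(b, a)) : V *m W = 1%:M -> cmx V *m cmx W = 1%:M.
Proof. by rewrite -cmxM => ->; exact: (map_mx1 (real_complex R)). Qed.
End RealParts.

(** * Holomorphic submersions and the action of C^k *)

Section ComplexAction.
Context {R : realType} {M : topologicalType} {n : nat}.
Context (X : complexManifold R M n) (k : nat) (act : 'rV[C R]_k -> M -> M).
Context (Hsm : smooth_action X act) (Hps : preserves_complex_structure X act).
Context (Phi : 'rV[C R]_k -> M -> M) (HP : complex_flow X act Phi).

Local Notation phi := (phi act).
Local Notation Xm := (Xm act).

Local Notation hol := (hol X).

Lemma qhol_const a b (w : 'rV[C R]_b) (u : 'rV[C R]_a) : qhol (fun=> w) u.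
Proof.
exists (fun=> 0); apply: qhol_with_ext ltr01 _ (qhol_with_affine 0 w _) => y _.
by rewrite mulmx0 add0r.
Qed.

Lemma qhol_id a (u : 'rV[C R]_a) : qhol id u.
Proof.
exists (fun=> 1%:M); apply: qhol_with_ext ltr01 _ (qhol_with_affine 1%:M 0 _) => y _.
by rewrite mulmx1 addr0.
Qed.

Lemma qhol_lsub a b (y : 'rV[C R]_(a + b)) : qhol_with (fun z : 'rV[C R]_(a + b) => lsubmx z) (fun=> col_mx 1%:M 0) y.
Proof.
apply: qhol_with_ext ltr01 _ (qhol_with_affine (col_mx 1%:M 0) 0 _) => z _.
by rewrite addr0 -lsubmxE.
Qed.

Lemma qhol_rsub a b (y : 'rV[C R]_(a + b)) : qhol_with (fun z : 'rV[C R]_(a + b) => rsubmx z) (fun=> col_mx 0 1%:M) y.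
Proof.
apply: qhol_with_ext ltr01 _ (qhol_with_affine (col_mx 0 1%:M) 0 _) => z _.
by rewrite addr0 -rsubmxE.
Qed.

Lemma hol_chart c x : atlas X c -> ch_dom c x -> hol (ch_of c) (ch_to c x).
Proof.
move=> Xc cx; apply: (hol_of_chart Hsm Hps Xc (f := id)); last by exists x.
exact: qhol_id.
Qed.

Lemma Phi_hol1 v b (g : 'rV[C R]_b -> M) u : hol g u -> hol (fun u => Phi v (g u)) u.
Proof. by move=> hg; exact: (@Phi_hol _ _ _ X k act Phi HP b (fun=> v) g u (qhol_const v u) hg). Qed.

Lemma PhiK v x : Phi (- v) (Phi v x) = x.
Proof. by rewrite -(PhiD HP) addNr (Phi0 HP). Qed.

Lemma Phi_inj v : injective (Phi v).
Proof. by move=> x y h; rewrite -(PhiK v x) h PhiK. Qed.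

Definition subm b (g : 'rV[C R]_b -> M) u := hol g u /\
  forall c, atlas X c -> ch_dom c (g u) ->
    exists2 G, qhol_with (fun u' => ch_to c (g u')) G u & row_full (G u).

(** The derivative of g is that of the composite multiplied by the derivative of Phi (-v), so full
    rank of the former forces full rank of the latter. *)
Lemma subm_Phi v c b (g : 'rV[C R]_b -> M) u G : atlas X c -> ch_dom c (g u) -> hol g u ->
  qhol_with (fun u' => ch_to c (g u')) G u -> row_full (G u) ->
  subm (fun u => Phi v (g u)) u.
Proof.
move=> Xc cg hg qG fG; have hv := Phi_hol1 v hg; split; first exact: hv.
move=> c' Xc' c'g; have [G' qG'] := hv.2 c' Xc' c'g; exists G'; first exact: qG'.
have h1 := Phi_hol1 (- v) (hol_chart Xc' c'g).
have E1 : Phi (- v) (ch_of c' (ch_to c' (Phi v (g u)))) = g u by rewrite (ch_toK' c'g) PhiK.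
have c1 : ch_dom c (Phi (- v) (ch_of c' (ch_to c' (Phi v (g u))))) by rewrite E1.
have [T qT] := h1.2 c Xc c1.
have [r r0 hr] := hv.1 _ (dom_nbhs c'g).
have E : G u = G' u *m T (ch_to c' (Phi v (g u))).
  have q : qhol_with (fun u' => ch_to c (g u')) (fun x => G' x *m T (ch_to c' (Phi v (g x)))) u.
    apply: qhol_with_ext r0 _ (qhol_with_comp qG' qT) => u' ur /=.
    by rewrite (ch_toK' (hr u' ur)) PhiK.
  exact: (qhol_uniq qG q).
by move: fG; rewrite /row_full E eqn_leq => /andP[_ h]; rewrite eqn_leq rank_leq_col (leq_trans h) // mxrankM_maxl.
Qed.

Lemma subm_ext b (g h : 'rV[C R]_b -> M) u (r : R) : 0 < r ->
  (forall u' : 'rV[C R]_b, rn (u' - u) < r -> g u' = h u') -> subm g u -> subm h u.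
Proof.
move=> r0 gh [h1 h2]; split; first exact: hol_ext r0 gh h1.
have E : g u = h u by apply: gh; rewrite subrr rn0.
move=> c Xc; rewrite -E => cg; have [G qG fG] := h2 c Xc cg; exists G; last exact: fG.
by apply: qhol_with_ext r0 _ qG => u' /gh ->.
Qed.

Lemma subm_chart c b (g : 'rV[C R]_b -> M) u G : atlas X c -> ch_dom c (g u) -> hol g u ->
  qhol_with (fun u' => ch_to c (g u')) G u -> row_full (G u) -> subm g u.
Proof.
move=> Xc cg hg qG fG; apply: (subm_ext ltr01 _ (subm_Phi 0 Xc cg hg qG fG)) => u' _.
exact: (Phi0 HP).
Qed.

Lemma subm_flow v b (g : 'rV[C R]_b -> M) u : subm g u -> subm (fun u => Phi v (g u)) u.
Proof.
move=> [hg h]; have [c Xc cg] := atlas_cover X (g u); have [G qG fG] := h c Xc cg.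
exact: subm_Phi Xc cg hg qG fG.
Qed.

Lemma row_full_mul a b m (A : 'M[C R]_(a, b)) (B : 'M[C R]_(b, m)) :
  row_full A -> row_full B -> row_full (A *m B).
Proof.
move=> /row_fullP[A' hA] /row_fullP[B' hB]; apply/row_fullP; exists (B' *m A').
by rewrite mulmxA -(mulmxA B') hA mulmx1.
Qed.

Lemma subm_comp a b (l : 'rV[C R]_a -> 'rV[C R]_b) l' (g : 'rV[C R]_b -> M) u :
  qhol_with l l' u -> row_full (l' u) -> subm g (l u) -> subm (fun u => g (l u)) u.
Proof.
move=> ql fl [hg h]; have ql1 : qhol l u by exists l'.
have hgl := hol_comp ql1 hg.
split; first exact: hgl.
move=> c Xc cg; have [G qG fG] := h c Xc cg.
exists (fun x => l' x *m G (l x)); last exact: row_full_mul.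
exact: (qhol_with_comp ql qG).
Qed.

Lemma subm_near b (g : 'rV[C R]_b -> M) u : subm g u ->
  exists2 r : R, 0 < r & forall u' : 'rV[C R]_b, rn (u' - u) < r -> subm g u'.
Proof.
move=> [hg h]; have [c Xc cg] := atlas_cover X (g u); have [G qG fG] := h c Xc cg.
have [r1 r10 h1] := hg.1 _ (dom_nbhs cg).
have [r2 r20 h2] := qhol_near qG.
have [r3 [K H]] := qhol_nice qG; have r30 := nice_r H; have K0 := nice_K H.
have /row_fullP[B hB] := fG.
have d0 : 0 < n%:R * (b%:R * rn B * K) + 1 by rewrite ltr_wpDl // !mulr_ge0 ?rn_ge0 // ltW.
pose r := Num.min (Num.min r1 r2) (Num.min r3 (2^-1 / (n%:R * (b%:R * rn B * K) + 1))).
have r0 : 0 < r by rewrite !lt_min r10 r20 r30 divr_gt0 ?invr_gt0.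
have r00 : 0 < r / 2 by rewrite divr_gt0.
have rr : r / 2 < r by rewrite ltr_pdivrMr // ltr_pMr // ltr1n.
exists (r / 2) => // u' ur; have ur' := lt_trans ur rr.
have [s1 s2 s3 s4] : [/\ rn (u' - u) < r1, rn (u' - u) < r2, rn (u' - u) < r3 &
    rn (u' - u) < 2^-1 / (n%:R * (b%:R * rn B * K) + 1)].
  by move: ur'; rewrite !lt_min => /andP[/andP[? ?] /andP[? ?]].
have cg' : ch_dom c (g u') := h1 u' s1.
have qG' := h2 u' s2.
have qg : qhol (fun u => ch_to c (g u)) u' by exists G.
have cod : ch_cod c (ch_to c (g u')) by exists (g u').
have hh := hol_of_chart Hsm Hps Xc qg cod.
have hg' : hol g u'.
  apply: (hol_ext r00 _ hh) => y yr; apply: ch_toK'; apply: h1.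
  have : rn (y - u) < r1; last by [].
  apply: le_lt_trans (rn_dist y u' u) _; apply: lt_le_trans (ltrD yr ur) _.
  by rewrite -splitr !ge_min lexx.
apply: (subm_chart Xc cg' hg' qG').
have B1 : B *m G u' \in unitmx.
  apply: near1_unit; have -> : B *m G u' - 1%:M = B *m (G u' - G u) by rewrite mulmxBr hB.
  have u0 : rn (u - u) < r3 by rewrite subrr rn0.
  have h3 := nice_L H u0 s3.
  apply: le_trans (_ : (n%:R * (b%:R * rn B * K) + 1) * rn (u' - u) <= _); last first.
    by rewrite mulrC -ler_pdivlMr // ltW.
  rewrite mulrDl mul1r; apply: ler_wpDr; rewrite ?rn_ge0 // -!mulrA ler_wpM2l //.
  by apply: le_trans (rn_mulmx _ _) _; rewrite -!mulrA !ler_wpM2l ?rn_ge0.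
apply/row_fullP; exists (invmx (B *m G u') *m B).
by rewrite -mulmxA mulVmx.
Qed.

Lemma subm_open b (g : 'rV[C R]_b -> M) u (d : R) : subm g u -> 0 < d ->
  \forall y \near g u, exists2 u' : 'rV[C R]_b, rn (u' - u) < d & g u' = y.
Proof.
move=> [hg h] d0; have [c Xc cg] := atlas_cover X (g u); have [G qG fG] := h c Xc cg.
have [r1 r10 h1] := hg.1 _ (dom_nbhs cg).
have m0 : 0 < Num.min d r1 by rewrite lt_min d0.
have [r r0 hr] := submersion_open qG fG m0.
apply: filterS (chart_nbhs_to cg r0) => y [cy /hr[u']]; rewrite lt_min => /andP[ud ur] E.
by exists u' => //; rewrite -(ch_toK' (h1 u' ur)) E ch_toK'.
Qed.

Lemma Phi_cont2 v x N : nbhs (Phi v x) N -> exists2 d : R, 0 < d &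
  exists2 U, nbhs x U & forall v' y, rn (v' - v) < d -> U y -> N (Phi v' y).
Proof.
move=> nN; have [c Xc cx] := atlas_cover X x.
pose y0 : 'rV[C R]_(k + n) := row_mx v (ch_to c x).
have l0 : lsubmx y0 = v by rewrite row_mxKl.
have r0 : rsubmx y0 = ch_to c x by rewrite row_mxKr.
have q1 : qhol (fun y : 'rV[C R]_(k + n) => lsubmx y) y0 by eexists; exact: qhol_lsub.
have q2 : qhol (fun y : 'rV[C R]_(k + n) => rsubmx y) y0 by eexists; exact: qhol_rsub.
have hc : hol (ch_of c) (rsubmx y0) by rewrite r0; exact: hol_chart.
have hg := hol_comp q2 hc.
have [h _] := Phi_hol HP q1 hg.
rewrite l0 r0 (ch_toK' cx) in h; have [d d0 hd] := h N nN.
have d20 : 0 < d / 2 by rewrite divr_gt0.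
exists (d / 2) => //; exists [set y | ch_dom c y /\ rn (ch_to c y - ch_to c x) < d / 2].
  exact: chart_nbhs_to.
move=> v' y vd [cy yd]; have := hd (row_mx v' (ch_to c y)) _.
rewrite row_mxKl row_mxKr (ch_toK' cy); apply.
rewrite /y0 opp_row_mx add_row_mx.
apply: le_lt_trans (_ : d / 2 < _); last by rewrite ltr_pdivrMr // ltr_pMr // ltr1n.
by apply: rn_row_mx; exact: ltW.
Qed.

Lemma hasd_qhol_at m q (f : 'rV[C R]_m -> 'rV[C R]_q) f' (y : R -> 'rV[C R]_m) t v x :
  y t = x -> qhol_with f f' x -> hasd y t v -> hasd (fun s => f (y s)) t (v *m f' x).
Proof. by move=> <- hf hy; exact: (hasd_qhol hf hy). Qed.

Lemma hasd_ray m (b : 'rV[C R]_m) t : hasd (fun s => rc s *: b) t b.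
Proof. by apply: hasd_ext ltr01 _ (hasd_line 0 b t) => s _; rewrite add0r. Qed.

Lemma Exp_hasd e (b : 'rV[C R]_e) t :
  hasd (fun s => Exp (rc s *: b)) t (b *m diag_mx ('i%C *: Exp (rc t *: b))).
Proof. exact: (hasd_qhol_at erefl (Exp_qhol (rc t *: b)) (hasd_ray b t)). Qed.

Lemma mulv_diag e (x z : 'rV[C R]_e) : mulv x z = x *m diag_mx z.
Proof. by apply/rowP => j; rewrite mul_mx_diag !mxE. Qed.

Lemma Exp_path e (b z : 'rV[C R]_e) t :
  hasd (fun s => mulv (Exp (rc s *: b)) z) t (b *m diag_mx ('i%C *: mulv (Exp (rc t *: b)) z)).
Proof.
have := hasd_mulr (diag_mx z) (Exp_hasd b t).
have -> : b *m diag_mx ('i%C *: Exp (rc t *: b)) *m diag_mx z =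
  b *m diag_mx ('i%C *: mulv (Exp (rc t *: b)) z).
  by apply/rowP => j; rewrite !mul_mx_diag !mxE; ring.
by apply: hasd_ext ltr01 _ => s _; rewrite mulv_diag.
Qed.

Lemma mulvA e (x y z : 'rV[C R]_e) : mulv x (mulv y z) = mulv (mulv x y) z.
Proof. by apply/rowP => j; rewrite !mxE mulrA. Qed.

Lemma mulv_Exp e (a b z : 'rV[C R]_e) : mulv (Exp a) (mulv (Exp b) z) = mulv (Exp (a + b)) z.
Proof. by rewrite mulvA -ExpD. Qed.

Lemma mulv_Exp0 e (z : 'rV[C R]_e) : mulv (Exp 0) z = z.
Proof. by rewrite Exp0; apply/rowP => j; rewrite !mxE mul1r. Qed.

Lemma Exp_path0 e (b z : 'rV[C R]_e) :
  hasd (fun s => mulv (Exp (rc s *: b)) z) 0 (b *m diag_mx ('i%C *: z)).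
Proof.
have E : b *m diag_mx ('i%C *: mulv (Exp (rc 0 *: b)) z) = b *m diag_mx ('i%C *: z).
  by rewrite rc0 scale0r mulv_Exp0.
rewrite -E; exact: Exp_path.
Qed.

Lemma rn_mulv e (x z : 'rV[C R]_e) (b : R) : 0 <= b -> (forall j, ab (x 0 j) <= b) -> rn (mulv x z) <= b * rn z.
Proof.
move=> b0 h; apply: rn_mx_le => [|i j]; first by rewrite mulr_ge0 ?rn_ge0.
by rewrite ord1 mxE abM; apply: ler_pM; rewrite ?ab_ge0 ?rn_coord.
Qed.

Lemma ab_cexp_i (z : C R) : ab (cexp ('i%C * z)) = expR (- complex.Im z).
Proof.
have E : cexp ('i%C * z) = rc (expR (- complex.Im z)) * cis (complex.Re z).
  by case: z => x y; apply/eqP; rewrite eq_complex /cexp /cis /=; apply/andP; split; apply/eqP;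
    rewrite ?mul0r ?mul1r ?add0r ?sub0r ?mulr0 ?addr0 ?subr0.
by rewrite E abM ab_cis mulr1 ab_rc ger0_norm // expR_ge0.
Qed.

(** * The equivariant slice near the fixed point of the isotropy torus *)

Section LocalSlice.
Context (c : chart R M n) (Xc : atlas X c) (p : M) (cp : ch_dom c p).
Local Notation D := (Diso act c p).
Local Notation w0 := (ch_to c p).
Local Notation X0 := (Xm c w0).
Context (e : nat) (lam : 'M[R]_(e, k)) (P : 'M[C R]_n) (fj : 'I_e -> 'I_n).
Context (fi : injective fj) (Pu : P \in unitmx).
Context (fixL : forall u : 'rV[R]_e, phi (u *m lam) p = p).
Context (per : forall u : 'rV[R]_e, (forall i, cis (u 0 i) = 1) -> Exp (complexv (u *m lam)) = onev k).
Context (hD : forall u : 'rV[R]_e,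
    P *m D (u *m lam) = diag_mx (\row_j cis ((u *m rowsub fj 1%:M) 0 j)) *m P).
Context (hZ : forall i r, (X0 *m invmx P) r (fj i) = 0) (hrk : (e + \rank X0)%N = n).
(** Its rows are the weight vectors of the isotropy torus, so z F moves under this torus as z does
    under the standard action. *)
Let F : 'M[C R]_(e, n) := rowsub fj 1%:M *m P.

Lemma F_equivariant (u : 'rV[R]_e) (z : 'rV[C R]_e) : z *m F *m D (u *m lam) = mulv (Exp (complexv u)) z *m F.
Proof.
rewrite /F -!mulmxA hD !mulmxA; congr (_ *m P); apply/rowP => j; rewrite mul_mx_diag !mxE.
rewrite mulr_suml; apply: eq_bigr => l _; rewrite !mxE.
case: eqP => [<-|_]; last by rewrite !mulr0 mul0r.
rewrite !mulr1 mulrC -cexp_i; congr (_ * _); congr (cexp (_ * rc _)).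
rewrite (bigD1 l) //= !mxE eqxx mulr1 big1 ?addr0 // => q ql.
by rewrite !mxE (inj_eq fi) (negPf ql) mulr0.
Qed.

Lemma F_inj (z : 'rV[C R]_e) : z *m F = 0 -> z = 0.
Proof.
move=> h; have E : z *m rowsub fj 1%:M = 0 by rewrite -[LHS](mulmxK Pu) -[_ *m _ *m P]mulmxA -/F h mul0mx.
apply/rowP => i; have /rowP/(_ (fj i)) := E; rewrite !mxE (bigD1 i) //= !mxE eqxx mulr1.
by rewrite big1 ?addr0 // => q qi; rewrite !mxE (inj_eq fi) (negPf qi) mulr0.
Qed.

(** The generators have no component along the coordinates f i, so the row spaces of X0 and F are
    complementary and the ranks n - e and e add up. *)
Lemma X0F_full : row_full (col_mx X0 F).
Proof.
have E : col_mx X0 F = col_mx (X0 *m invmx P) (rowsub fj 1%:M) *m P.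
  by rewrite mul_col_mx mulmxKV.
have fE : row_free (rowsub fj (1%:M : 'M[C R]_n)).
  apply: inj_row_free => v h; apply: F_inj; by rewrite /F mulmxA h mul0mx.
have rE : \rank (rowsub fj (1%:M : 'M[C R]_n)) = e by apply/eqP.
have rZ : \rank (X0 *m invmx P) = \rank X0 by rewrite mxrankMfree // row_free_unit unitmx_inv.
rewrite E /row_full mxrankMfree; last by rewrite row_free_unit.
suff dis : (X0 *m invmx P :&: rowsub fj 1%:M = 0)%MS.
  by rewrite -(addsmxE _ _) (mxrank_disjoint_sum dis) rZ rE addnC hrk.
apply/eqP/rowV0P => v; rewrite sub_capmx => /andP[/submxP[a aE] /submxP[b bE]].
suff b0 : b = 0 by rewrite bE b0 mul0mx.
apply/rowP => i; have /rowP/(_ (fj i)) := bE; rewrite aE !mxE.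
rewrite [in RHS](bigD1 i) //= !mxE eqxx mulr1 [X in _ + X]big1 ?addr0 => [<-|q qi]; last first.
  by rewrite !mxE (inj_eq fi) (negPf qi) mulr0.
by rewrite big1 // => q _; rewrite hZ mulr0.
Qed.

(** In linearizing coordinates the slice is the linear space spanned by the weight vectors. Its
    equivariance under the real torus becomes, infinitesimally, a complex linear identity;
    uniqueness of integral curves then gives equivariance along any complex path exp (t a) z that
    stays in the ball. The derivative of (v, z) |-> Phi v (s0 z) at the origin is [col_mx X0 F]. *)
Lemma local_slice : exists (rho : R) (s0 : 'rV[C R]_e -> M), [/\ 0 < rho,
  s0 0 = p,
  (forall z z' : 'rV[C R]_e, rn z < rho -> rn z' < rho -> s0 z = s0 z' -> z = z'),
  (forall z : 'rV[C R]_e, rn z < rho -> hol s0 z) &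
  (forall (a z : 'rV[C R]_e) (T : R), 1 < T -> (forall t, `|t| < T -> rn (mulv (Exp (rc t *: a)) z) < rho) ->
    Phi (a *m cmx lam) (s0 z) = s0 (mulv (Exp a) z)) /\
  (forall z : 'rV[C R]_e, rn z < rho ->
    subm (fun y : 'rV[C R]_(k + e) => Phi (lsubmx y) (s0 (rsubmx y))) (row_mx 0 z))].
Proof.
have [f [f' [hf f0 f1 [rhof rhof0 feq]]]] := linearize Hsm Hps Xc cp fixL per.
have [r1 [r2 [g [g' [r10 r20 ginj ginv [hg g1]]]]]] := inverse_function hf f1.
rewrite f0 in ginv hg g1.
have [r [K [r0 K0 hr]]] := isotropy_uniform Hsm Hps Xc cp.
have [r3 r30 hg3] := qhol_near hg.
have K1 : 0 < 1 + K by rewrite ltr_pwDl // ltW.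
pose m := Num.min (Num.min r2 r3) (Num.min (Num.min rhof r) (r1 / (1 + K)) / 2).
have q0 : 0 < Num.min (Num.min rhof r) (r1 / (1 + K)) by rewrite !lt_min rhof0 r0 divr_gt0.
have m0 : 0 < m by rewrite !lt_min r20 r30 divr_gt0.
pose B := e%:R * rn F + 1.
have B0 : 0 < B by rewrite ltr_wpDl // mulr_ge0 // rn_ge0.
pose rho := m / B; have rho0 : 0 < rho by rewrite divr_gt0.
have zF (z : 'rV[C R]_e) : rn z < rho -> rn (z *m F) < m.
  rewrite ltr_pdivlMr // => h; apply: le_lt_trans h; apply: le_trans (rn_mulmx _ _) _.
  rewrite mulrAC mulrC; apply: ler_wpM2l; rewrite ?rn_ge0 // lerDl //.
have gP (z : 'rV[C R]_e) : rn z < rho -> [/\ f (g (z *m F)) = z *m F, rn (g (z *m F) - w0) < rhof,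
    rn (g (z *m F) - w0) < r, K * rn (g (z *m F) - w0) < r1 & rn (g (z *m F) - w0) < r1].
  move=> /zF; rewrite !lt_min => /andP[/andP[h1 h2] h3].
  have h1' : rn (z *m F - 0) < r2 by rewrite subr0.
  have [q1 [q2 q3]] := ginv _ h1'; rewrite subr0 in q2.
  have q4 : rn (g (z *m F) - w0) < Num.min (Num.min rhof r) (r1 / (1 + K)).
    by apply: le_lt_trans q2 _; rewrite mulrC -ltr_pdivlMr.
  move: q4; rewrite !lt_min => /andP[/andP[q5 q6]]; rewrite ltr_pdivlMr // => q7.
  split=> //; apply: le_lt_trans q7; rewrite mulrDr mulr1 mulrC lerDr; exact: rn_ge0.
pose s0 z := ch_of c (g (z *m F)).
have s0D (z : 'rV[C R]_e) : rn z < rho -> [/\ ch_dom c (s0 z), ch_to c (s0 z) = g (z *m F) & ch_cod c (g (z *m F))].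
  move=> zr; have [_ _ q _ _] := gP z zr; have z0 := phi0 Hsm p.
  have [_ /(_ _ q)[h1 h2 _]] := hr 0 z0.
  by split=> //; rewrite -h2; exists (s0 z).
have g0 : g 0 = w0.
  have r00 : rn (0 - 0 : 'rV[C R]_n) < r2 by rewrite subrr rn0.
  have [_ [h _]] := ginv 0 r00; apply/eqP; rewrite -subr_eq0; apply/eqP; apply: rn_le0.
  by rewrite subrr rn0 mulr0 in h.
have real_eq (u : 'rV[R]_e) (z : 'rV[C R]_e) : rn z < rho -> phi (u *m lam) (s0 z) = s0 (mulv (Exp (complexv u)) z).
  move=> zr; have [q1 q2 q3 q4 q5] := gP z zr.
  have mr : rn (mulv (Exp (complexv u)) z) < rho.
    apply: le_lt_trans zr; rewrite -[leRHS]mul1r; apply: rn_mulv => // j.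
    by rewrite Exp_cis mxE ab_cis.
  have [p1 p2 p3 p4 p5] := gP _ mr.
  have [[A' hA] hd] := hr _ (fixL u); have [d1 d2 d3] := hd _ q3.
  have w0r : rn (w0 - w0) < r by rewrite subrr rn0.
  have al1 : rn (alpha act c c (u *m lam) (g (z *m F)) - w0) < r1.
    by have := nice_fL hA w0r q3; rewrite (iso_w0 cp (fixL u)) => /le_lt_trans; apply.
  have E : alpha act c c (u *m lam) (g (z *m F)) = g (mulv (Exp (complexv u)) z *m F).
    apply/eqP; rewrite -subr_eq0; apply/eqP; apply: rn_le0.
    apply: le_trans (ginj _ _ al1 p5) _; rewrite p1 (feq _ u q2) q1 F_equivariant subrr rn0 mulr0.
    by [].
  by rewrite /s0 -E alphaE (ch_toK' d3).
have zq (z : 'rV[C R]_e) : rn z < rho -> exists g1', qhol_with (fun z : 'rV[C R]_e => g (z *m F)) g1' z.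
  move=> /zF; rewrite !lt_min => /andP[/andP[_ h3] _].
  have qz := qhol_with_affine F 0 z.
  have h : rn ((z *m F + 0) - 0) < r3 by rewrite addr0 subr0.
  have := qhol_with_comp qz (hg3 _ h) => qc; eexists; apply: qhol_with_ext ltr01 _ qc => y _ /=.
  by rewrite addr0.
have s0hol (z : 'rV[C R]_e) : rn z < rho -> hol s0 z.
  move=> zr; have [g2 hg2] := zq z zr; have [_ _ cz] := s0D z zr.
  by apply: (hol_of_chart Hsm Hps Xc (f := fun z => g (z *m F))) => //; exists g2.
have velE (z : 'rV[C R]_e) g2 : rn z < rho -> qhol_with (fun z : 'rV[C R]_e => g (z *m F)) g2 z ->
    cmx lam *m Xm c (g (z *m F)) = diag_mx ('i%C *: z) *m g2 z.
  move=> zr q; apply: mx_real_ext => a; rewrite [LHS]mulmxA [RHS]mulmxA -complexv_mul.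
  have [c1 c2 c3] := s0D z zr.
  have := orbit_hasd Hsm Hps (a *m lam) Xc c1; rewrite c2 => h1.
  have E0 : mulv (Exp (rc 0 *: complexv a)) z = z by rewrite rc0 scale0r mulv_Exp0.
  have h3 := hasd_qhol_at E0 q (Exp_path0 (complexv a) z).
  apply: (hasd_uniq h1); apply: hasd_ext ltr01 _ h3 => t _ /=.
  rewrite -complexvZ scalemxAl real_eq //; have [] := s0D (mulv (Exp (complexv (t *: a))) z) => //.
  apply: le_lt_trans zr; rewrite -[leRHS]mul1r; apply: rn_mulv => // j.
  by rewrite Exp_cis mxE ab_cis.
have z00 : rn (0 : 'rV[C R]_e) < rho by rewrite rn0.
have s00 : s0 0 = p by rewrite /s0 mul0mx g0 ch_toK'.
have path (a z : 'rV[C R]_e) (T : R) : 1 < T ->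
    (forall t, `|t| < T -> rn (mulv (Exp (rc t *: a)) z) < rho) ->
    Phi (a *m cmx lam) (s0 z) = s0 (mulv (Exp a) z).
  move=> T1 hT; pose y t := mulv (Exp (rc t *: a)) z.
  have hv t : `|t| < T -> vel X act (a *m cmx lam) (fun t => s0 (y t)) t.
    move=> tT; have yr := hT t tT; have [g2 hg2] := zq _ yr.
    have [_ _ cy] := s0D _ yr.
    have h := hasd_qhol hg2 (Exp_path a z t); rewrite -mulmxA -(velE _ _ yr hg2) mulmxA in h.
    exact: (icurve_of_chart Hsm Hps Xc cy h).
  have T1' : `|1 : R| < T by rewrite normr1.
  have := vel_Phi Hsm Hps HP hv T1'; rewrite /y rc1 rc0 !scale1r scale0r mulv_Exp0.
  by move=> ->.
have sub0 : subm (fun y : 'rV[C R]_(k + e) => Phi (lsubmx y) (s0 (rsubmx y))) 0.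
  have q1 : qhol (fun y : 'rV[C R]_(k + e) => lsubmx y) 0 by eexists; exact: qhol_lsub.
  have q2 : qhol (fun y : 'rV[C R]_(k + e) => rsubmx y) 0 by eexists; exact: qhol_rsub.
  have l0 : lsubmx (0 : 'rV[C R]_(k + e)) = 0 by apply/rowP => j; rewrite !mxE.
  have r00 : rsubmx (0 : 'rV[C R]_(k + e)) = 0 by apply/rowP => j; rewrite !mxE.
  have h1 : hol s0 (rsubmx (0 : 'rV[C R]_(k + e))) by rewrite r00; exact: s0hol.
  have hh := Phi_hol HP q1 (hol_comp q2 h1).
  have E0 : Phi (lsubmx (0 : 'rV[C R]_(k + e))) (s0 (rsubmx (0 : 'rV[C R]_(k + e)))) = p.
    by rewrite l0 r00 (Phi0 HP) s00.
  have cE : ch_dom c (Phi (lsubmx (0 : 'rV[C R]_(k + e))) (s0 (rsubmx (0 : 'rV[C R]_(k + e))))).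
    by rewrite E0.
  have [G qG] := hh.2 c Xc cE.
  apply: (subm_chart Xc cE hh qG).
  have lineG (v : 'rV[C R]_(k + e)) : hasd (fun s => ch_to c (Phi (rc s *: lsubmx v) (s0 (rc s *: rsubmx v)))) 0 (v *m G 0).
    have z0 : rc 0 *: v = 0 by rewrite rc0 scale0r.
    have h := hasd_qhol_at z0 qG (hasd_ray v 0).
    apply: hasd_ext ltr01 _ h => s _ /=.
    by congr (ch_to c (Phi _ (s0 _))); apply/rowP => j; rewrite !mxE.
  have uG (v : 'rV[C R]_k) : v *m usubmx (G 0) = v *m X0.
    have h2 := lineG (row_mx v 0).
    rewrite -(vsubmxK (G 0)) mul_row_col mul0mx addr0 row_mxKl row_mxKr in h2.
    have [_ h3] := Phi_vel HP v p 0; rewrite rc0 scale0r (Phi0 HP) in h3.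
    apply: (hasd_uniq h2); apply: hasd_ext ltr01 _ (h3 c Xc cp) => s _.
    by rewrite scaler0 s00.
  have dG (v : 'rV[C R]_e) : v *m dsubmx (G 0) = v *m F.
    have h2 := lineG (row_mx 0 v).
    rewrite -(vsubmxK (G 0)) mul_row_col mul0mx add0r row_mxKl row_mxKr in h2.
    have [g2 hg2] := zq _ z00.
    have z0 : rc 0 *: (v *m F) = 0 by rewrite rc0 scale0r.
    have h3 := hasd_qhol_at z0 hg (hasd_ray (v *m F) 0); rewrite g1 mulmx1 in h3.
    have [d d0 hd] := hasd_of_primitive (divr_gt0 rho0 (ltr0Sn R 1)) (hasd_ray v 0).
    apply: (hasd_uniq h2); apply: hasd_ext d0 _ h3 => s /hd.
    rewrite rc0 scale0r subr0 => sv /=.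
    have svr : rn (rc s *: v) < rho.
      by apply: le_lt_trans sv _; rewrite ltr_pdivrMr // ltr_pMr // ltr1n.
    have [_ h4 _] := s0D _ svr.
    by rewrite scaler0 (Phi0 HP) h4 -scalemxAl.
  have GE : G 0 = col_mx X0 F.
    rewrite -[LHS]vsubmxK; congr col_mx; apply/row_matrixP => i; rewrite !rowE; [exact: uG|exact: dG].
  by rewrite GE; exact: X0F_full.
have [r4 r40 hr4] := subm_near sub0.
exists (Num.min rho r4), s0; split=> //.
- by rewrite lt_min rho0.
- move=> z z'; rewrite !lt_min => /andP[zr _] /andP[zr' _] E.
  have [_ h1 _] := s0D z zr; have [_ h2 _] := s0D z' zr'.
  have gE : g (z *m F) = g (z' *m F) by rewrite -h1 -h2 E.
  have [q1 _ _ _ _] := gP z zr; have [q2 _ _ _ _] := gP z' zr'.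
  apply/eqP; rewrite -subr_eq0; apply/eqP; apply: F_inj; rewrite mulmxBl -q1 -q2 gE.
  exact: subrr.
- by move=> z; rewrite lt_min => /andP[zr _]; exact: s0hol.
split.
- by move=> a z T T1 hT; apply: (path a z T T1) => t /hT; rewrite lt_min => /andP[].
move=> z; rewrite lt_min => /andP[_ zr]; apply: hr4; rewrite subr0.
apply: le_lt_trans zr; apply: rn_row_mx => //; rewrite rn0; exact: rn_ge0.
Qed.
End LocalSlice.

(** * Equivariant slices defined on the whole of C^e *)

Record good_chart e (lam : 'M[R]_(e, k)) (p : M) (sg : 'rV[C R]_e -> M) : Prop := {
  gc_0 : sg 0 = p;
  gc_eq : forall a z, Phi (a *m cmx lam) (sg z) = sg (mulv (Exp a) z);
  gc_inj : injective sg;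
  gc_subm : forall u z,
    subm (fun y : 'rV[C R]_(k + e) => Phi (lsubmx y) (sg (rsubmx y))) (row_mx u z);
  gc_free : row_free lam;
  gc_int : forall u : 'rV[R]_e, (forall i, cis (u 0 i) = 1) ->
    Exp (complexv (u *m lam)) = onev k;
  gc_lie : forall v : 'rV[R]_k, (forall t : R, phi (t *: v) p = p) <-> (v <= lam)%MS;
  gc_stab : forall s, phi s p = p ->
    exists u : 'rV[R]_e, Exp (complexv s) = Exp (complexv (u *m lam)) }.

(** The element i t (1, ..., 1), whose exponential is the contraction by exp (- t). *)
Definition bt e (t : R) : 'rV[C R]_e := const_mx ('i%C * rc t).

Lemma btB e (s t : R) : bt e (s - t) = bt e s - bt e t.
Proof. by apply/rowP => j; rewrite !mxE rcB mulrBr. Qed.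

Lemma Exp_bt e (t : R) (z : 'rV[C R]_e) : mulv (Exp (bt e t)) z = rc (expR (- t)) *: z.
Proof.
apply/rowP => j; rewrite !mxE; congr (_ * _).
by apply/eqP; rewrite eq_complex /cexp /rc /= !(mul0r, mulr0, mul1r, subr0, addr0, add0r, sub0r, oppr0) cos0 sin0 mulr1 mulr0 !eqxx.
Qed.

Lemma rn_expR e (t : R) (z : 'rV[C R]_e) : rn (rc (expR t) *: z) = expR t * rn z.
Proof. by rewrite rnZ ab_rc ger0_norm ?expR_ge0. Qed.

Section Extend.
Context (e : nat) (lam : 'M[R]_(e, k)) (p : M) (rho : R) (s0 : 'rV[C R]_e -> M).
Context (rho0 : 0 < rho) (s00 : s0 0 = p).
Context (s0i : forall z z' : 'rV[C R]_e, rn z < rho -> rn z' < rho -> s0 z = s0 z' -> z = z').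
Context (path : forall (a z : 'rV[C R]_e) (T : R), 1 < T ->
  (forall t, `|t| < T -> rn (mulv (Exp (rc t *: a)) z) < rho) ->
  Phi (a *m cmx lam) (s0 z) = s0 (mulv (Exp a) z)).
Context (s0s : forall z : 'rV[C R]_e, rn z < rho ->
  subm (fun y : 'rV[C R]_(k + e) => Phi (lsubmx y) (s0 (rsubmx y))) (row_mx 0 z)).

Lemma rn_mulv_up (a z : 'rV[C R]_e) : (forall j, 0 <= complex.Im (a 0 j)) -> rn (mulv (Exp a) z) <= rn z.
Proof.
move=> a0; rewrite -[leRHS]mul1r; apply: rn_mulv => // j.
by rewrite mxE ab_cexp_i -expR0 ler_expR oppr_le0.
Qed.

(** When the imaginary parts of a are nonnegative, exp a increases no norm. Dividing a by a large N
    makes each step satisfy the hypothesis [path] with T = 2: within the two-sided time interval the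
    norm at most doubles. The N steps are then composed. *)
Lemma upward (a z : 'rV[C R]_e) : rn z < rho / 2 -> (forall j, 0 <= complex.Im (a 0 j)) ->
  Phi (a *m cmx lam) (s0 z) = s0 (mulv (Exp a) z).
Proof.
move=> zr a0; pose N := (Num.truncn (4 * rn a)).+1.
have n0 : (0 : R) < N%:R by rewrite ltr0n.
have aN : 4 * rn a < N%:R := truncnS_gt _.
pose a' := rc N%:R^-1 *: a.
have ImZ (t : R) (b : 'rV[C R]_e) j : complex.Im ((rc t *: b) 0 j) = t * complex.Im (b 0 j).
  by rewrite mxE; case: (b 0 j) => x y /=; rewrite mul0r addr0.
have a'0 j : 0 <= complex.Im (a' 0 j) by rewrite ImZ mulr_ge0 // invr_ge0 ltW.
have step (y : 'rV[C R]_e) : rn y < rho / 2 -> Phi (a' *m cmx lam) (s0 y) = s0 (mulv (Exp a') y).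
  move=> yr; apply: (path (T := 2)) => [|t t2]; first by rewrite ltr1n.
  apply: le_lt_trans (_ : 2 * rn y < rho); last by rewrite mulrC -ltr_pdivlMr.
  apply: rn_mulv => // j; rewrite mxE ab_cexp_i.
  suff h : `|- complex.Im ((rc t *: a') 0 j)| <= 1 / 2 by have [] := expR_taylor h.
  rewrite normrN !ImZ normrM normrM normfV (ger0_norm (ltW n0)).
  have h1 : `|complex.Im (a 0 j)| <= rn a := le_trans (ab_Im _) (rn_coord _ _ _).
  have h2 : N%:R^-1 * `|complex.Im (a 0 j)| <= 1 / 4.
    rewrite mulrC ler_pdivrMr //; apply: le_trans h1 _.
    by rewrite mulrC mul1r ler_pdivlMr // mulrC ltW.
  have -> : 1 / 2 = 2 * (1 / 4) :> R by field.
  by apply: ler_pM => //; exact: ltW.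
have it j : Phi ((rc j%:R *: a') *m cmx lam) (s0 z) = s0 (mulv (Exp (rc j%:R *: a')) z).
  elim: j => [|j ih]; first by rewrite rc0 scale0r mul0mx (Phi0 HP) mulv_Exp0.
  have E : rc j.+1%:R *: a' = a' + rc j%:R *: a'.
    by rewrite -[j.+1%:R]natr1 rcD rc1 scalerDl scale1r addrC.
  rewrite E mulmxDl (PhiD HP) ih step ?mulv_Exp //.
  apply: le_lt_trans zr; apply: rn_mulv_up => i; rewrite ImZ mulr_ge0 //.
have := it N; rewrite /a' scalerA -rcM divff ?gt_eqF // rc1 scale1r.
by [].
Qed.

Let ok (t : R) (z : 'rV[C R]_e) := 0 <= t /\ expR (- t) * rn z < rho / 2.

Lemma ok_large (t : R) z : 2 * rn z / rho <= t -> ok t z.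
Proof.
move=> h; have t0 : 0 <= t by apply: le_trans h; rewrite divr_ge0 ?mulr_ge0 ?rn_ge0 // ltW.
split=> //; rewrite expRN mulrC ltr_pdivrMr ?expR_gt0 //.
have h1 : rn z <= rho / 2 * t.
  move: h; rewrite ler_pdivrMr // => h; rewrite mulrAC ler_pdivlMr // mulrC (mulrC rho).
  exact: h.
apply: le_lt_trans h1 _; rewrite ltr_pM2l ?divr_gt0 //.
by apply: lt_le_trans (expR_ge1Dx t); rewrite ltrDr.
Qed.

(** The point z is contracted into the domain of s0 and the result is flowed back; all sufficiently
    large times give the same value. The time 2 |z| / rho is sufficient because exp t >= 1 + t. *)
Let S (t : R) z := Phi (- (bt e t *m cmx lam)) (s0 (rc (expR (- t)) *: z)).

Lemma S_cons (s t : R) z : ok s z -> s <= t -> S t z = S s z.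
Proof.
move=> [s0' h] st; rewrite /S.
have E : rc (expR (- t)) *: z = mulv (Exp (bt e (t - s))) (rc (expR (- s)) *: z).
  rewrite Exp_bt scalerA -rcM -expRD; congr (rc (expR _) *: _); ring.
rewrite E -upward.
- by rewrite -(PhiD HP) btB mulmxBl addrA addNr add0r.
- by rewrite rn_expR.
by move=> j; rewrite mxE /= mul0r mul1r add0r subr_ge0.
Qed.

Definition slice_ext z := S (2 * rn z / rho) z.

Lemma slice_extE (t : R) z : ok t z -> slice_ext z = S t z.
Proof.
move=> ot; rewrite /slice_ext; have ol := ok_large (lexx (2 * rn z / rho)).
by have [tl|tl] := leP t (2 * rn z / rho); [rewrite (S_cons ot tl)|rewrite (S_cons ol (ltW tl))].
Qed.

Lemma slice_ext_eq (a z : 'rV[C R]_e) : Phi (a *m cmx lam) (slice_ext z) = slice_ext (mulv (Exp a) z).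
Proof.
pose t := 2 * rn z / rho + 2 * rn (mulv (Exp a) z) / rho.
have p0 (y : 'rV[C R]_e) : 0 <= 2 * rn y / rho by rewrite divr_ge0 ?mulr_ge0 ?rn_ge0 // ltW.
have o1 : ok t z by apply: ok_large; rewrite lerDl.
have o2 : ok t (mulv (Exp a) z) by apply: ok_large; rewrite lerDr.
rewrite (slice_extE o1) (slice_extE o2) /S -(PhiD HP) addrC (PhiD HP); congr (Phi _ _).
set y := rc (expR (- t)) *: z.
have yr : rn y < rho / 2 by rewrite rn_expR; have [] := o1.
have -> : rc (expR (- t)) *: mulv (Exp a) z = mulv (Exp a) y.
  by apply/rowP => j; rewrite !mxE mulrCA.
have y'r : rn (mulv (Exp a) y) < rho / 2.
  have <- : rc (expR (- t)) *: mulv (Exp a) z = mulv (Exp a) y.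
    by apply/rowP => j; rewrite !mxE mulrCA.
  by rewrite rn_expR; have [] := o2.
apply: (Phi_inj (v := bt e (rn a) *m cmx lam)).
rewrite -(PhiD HP) -mulmxDl !upward ?mulv_Exp //.
  by move=> j; rewrite mxE /= mul0r mul1r add0r rn_ge0.
move=> j; rewrite !mxE; have := le_trans (ab_Im (a 0 j)) (rn_coord a 0 j).
case: (a 0 j) => x w /=; rewrite mul0r mul1r add0r => /ler_normlP[h _].
by rewrite -lerBlDr sub0r.
Qed.

Lemma slice_ext_inj : injective slice_ext.
Proof.
move=> z z'; pose t := 2 * rn z / rho + 2 * rn z' / rho.
have p0 (y : 'rV[C R]_e) : 0 <= 2 * rn y / rho by rewrite divr_ge0 ?mulr_ge0 ?rn_ge0 // ltW.
have o1 : ok t z by apply: ok_large; rewrite lerDl.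
have o2 : ok t z' by apply: ok_large; rewrite lerDr.
rewrite (slice_extE o1) (slice_extE o2) => /(Phi_inj) h.
have rr : rho / 2 < rho by rewrite ltr_pdivrMr // ltr_pMr // ltr1n.
have r1 : rn (rc (expR (- t)) *: z) < rho by rewrite rn_expR; apply: lt_trans rr; have [] := o1.
have r2 : rn (rc (expR (- t)) *: z') < rho by rewrite rn_expR; apply: lt_trans rr; have [] := o2.
apply: (scalerI (a := rc (expR (- t)))); last exact: (s0i r1 r2 h).
by rewrite rc_eq0 gt_eqF // expR_gt0.
Qed.

Lemma slice_ext_subm u z :
  subm (fun y : 'rV[C R]_(k + e) => Phi (lsubmx y) (slice_ext (rsubmx y))) (row_mx u z).
Proof.
pose t := 2 * (rn z + 1) / rho.
have okt (z' : 'rV[C R]_e) : rn (z' - z) < 1 -> ok t z'.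
  move=> h; apply: ok_large; rewrite /t ler_wpM2r ?invr_ge0 ?(ltW rho0) // ler_wpM2l //.
  rewrite -(subrK z z') addrC; apply: le_trans (rnD _ _) _; rewrite lerD2l; exact: ltW.
have oz : ok t z by apply: okt; rewrite subrr rn0.
set y0 := rc (expR (- t)) *: z.
have yr : rn y0 < rho.
  rewrite rn_expR; have [_ h] := oz; apply: lt_trans h _.
  by rewrite ltr_pdivrMr // ltr_pMr // ltr1n.
pose A : 'M[C R]_(k + e) := block_mx 1%:M 0 0 (rc (expR (- t)))%:M.
pose w : 'rV[C R]_(k + e) := row_mx (- u) 0.
have lE (y : 'rV[C R]_(k + e)) : y *m A + w = row_mx (lsubmx y - u) (rc (expR (- t)) *: rsubmx y).
  rewrite -{1}(hsubmxK y) /A mul_row_block !mulmx0 mulmx1 addr0 add0r mul_mx_scalar.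
  by rewrite /w add_row_mx addr0.
have l0 : row_mx u z *m A + w = row_mx 0 y0 by rewrite lE row_mxKl row_mxKr subrr.
have fA : row_full A.
  have e0 : rc (expR (- t)) != 0 :> C R by rewrite rc_eq0 gt_eqF // expR_gt0.
  apply/row_fullP; exists (block_mx 1%:M 0 0 (rc (expR (- t)))^-1%:M).
  rewrite /A mulmx_block !mulmx0 !mul0mx mulmx1 !addr0 !add0r -scalar_mxM mulVf //.
  by rewrite -scalar_mx_block.
have h0 := s0s yr; rewrite -l0 in h0.
have h1 := subm_comp (qhol_with_affine A w (row_mx u z)) fA h0.
have h2 := subm_flow (u - bt e t *m cmx lam) h1.
apply: (subm_ext ltr01 _ h2) => y yu.
rewrite lE row_mxKl row_mxKr -(PhiD HP) addrC addrA subrK (PhiD HP); congr (Phi _ _).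
rewrite (@slice_extE t) //; apply: okt; apply: le_lt_trans yu.
have -> : rsubmx y - z = rsubmx (y - row_mx u z) by rewrite linearB /= row_mxKr.
exact: rn_rsub.
Qed.

Lemma slice_ext0 : slice_ext 0 = p.
Proof.
rewrite /slice_ext /S rn0 mulr0 mul0r scaler0 s00.
have -> : bt e 0 = 0 :> 'rV[C R]_e by apply/rowP => j; rewrite !mxE rc0 mulr0.
by rewrite mul0mx oppr0 (Phi0 HP).
Qed.
End Extend.

Context (Mconn : connected [set: M]) (eff : effective act).

Lemma good_chart_exists c p : atlas X c -> ch_dom c p -> good_point act c p ->
  exists e (lam : 'M[R]_(e, k)) sg, e = (k - \rank (reim (Xm c (ch_to c p))))%N /\ good_chart lam p sg.
Proof.
move=> Xc cp gp; have [_ _ /(_ gp)[lam [P [f sd]]]] := isotropy_count Hsm Hps Mconn eff Xc cp.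
have fixL u : phi (u *m lam) p = p.
  have /(lieP Hsm Hps Xc cp)/(_ 1) : complexv (u *m lam) *m Xm c (ch_to c p) = 0.
    by apply/(sd_lie sd); exact: submxMl.
  by rewrite scale1r.
have [rho [s0 [r0 s00 si sh [path ss]]]] :=
  local_slice Xc cp (sd_inj sd) (sd_P sd) fixL (sd_int sd) (sd_D sd) (sd_Z sd) gp.
exists _, lam, (slice_ext lam rho s0); split=> //; split.
- exact: slice_ext0.
- exact: slice_ext_eq.
- exact: slice_ext_inj.
- exact: slice_ext_subm.
- exact: (sd_free sd).
- exact: (sd_int sd).
- by move=> v; rewrite -(sd_lie sd); symmetry; exact: (lieP Hsm Hps Xc cp).
- exact: (sd_stab sd).
Qed.

(** * Stabilizers in C^k *)

(** Membership of v in the Lie algebra of the stabilizer of q. Only real times occur, but by [stabP]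
    the condition is complex linear in v. *)
Definition stab v q := forall t : R, Phi (rc t *: v) q = q.

Lemma stabP c q v : atlas X c -> ch_dom c q -> stab v q <-> v *m Xm c (ch_to c q) = 0.
Proof.
move=> Xc cq; split=> [h|h t].
  have [_ h1] := Phi_vel HP v q 0; rewrite rc0 scale0r (Phi0 HP) in h1.
  apply: (hasd_uniq (h1 c Xc cq)); apply: hasd_ext ltr01 _ (hasd_const (ch_to c q) 0) => s _.
  by rewrite h.
have hv s : `|s| < `|t| + 1 -> vel X act v (fun _ : R => q) s by move=> _; exact: (vel_const Hsm Hps Xc cq).
have tt : `|t| < `|t| + 1 by rewrite ltrDl.
by rewrite -(vel_Phi Hsm Hps HP hv tt).
Qed.

Lemma stabD v w q : stab v q -> stab w q -> stab (v + w) q.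
Proof.
have [c Xc cq] := atlas_cover X q; rewrite !(stabP _ Xc cq) mulmxDl => -> ->.
by rewrite addr0.
Qed.

Lemma stabZ (a : C R) v q : stab v q -> stab (a *: v) q.
Proof.
have [c Xc cq] := atlas_cover X q; rewrite !(stabP _ Xc cq) -scalemxAl => ->.
by rewrite scaler0.
Qed.

Lemma stabN v q : stab v q -> stab (- v) q.
Proof. by move=> h; rewrite -scaleN1r; exact: stabZ. Qed.

Lemma stab1 v q : stab v q -> Phi v q = q.
Proof. by move=> h; have := h 1; rewrite rc1 scale1r. Qed.

Lemma PhiC u v x : Phi u (Phi v x) = Phi v (Phi u x).
Proof. by rewrite -!(PhiD HP) addrC. Qed.

Lemma stab_Phi v u q : stab v q <-> stab v (Phi u q).
Proof.
split=> h t; first by rewrite PhiC h.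
by apply: (Phi_inj (v := u)); rewrite -PhiC h.
Qed.

Lemma stab_real (a : 'rV[R]_k) q : stab (complexv a) q <-> forall t : R, phi (t *: a) q = q.
Proof. by split=> h t; have := h t; rewrite -complexvZ (Phi_real HP). Qed.

Lemma stab_closed v q : (forall N, nbhs q N -> exists2 x, N x & stab v x) -> stab v q.
Proof.
move=> h t; apply: contrapT => ne.
have [A [B [nA nB AB]]] := hausdorff_sep (manifold_hausdorff X) ne.
have [d d0 [U nU dU]] := Phi_cont2 nA.
have [x [Ux Bx] sx] := h _ (filterI nU nB).
apply: (AB x) => //; rewrite -(sx t); apply: dU => //; by rewrite subrr rn0.
Qed.

Lemma Phi_ker (N : 'rV[R]_k) q : Exp (complexv N) = onev k -> Phi (complexv N) q = q.
Proof. by move=> h; rewrite (Phi_real HP) -[RHS](action1 Hsm q) -h. Qed.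

Lemma mulv1 e (z : 'rV[C R]_e) : mulv z (onev e) = z.
Proof. by apply/rowP => j; rewrite !mxE mulr1. Qed.

Lemma complex_log (z : C R) : z != 0 -> exists a, cexp ('i%C * a) = z.
Proof.
move=> z0; have a0 : 0 < ab z by rewrite ab_gt0.
have r0 : rc (ab z) != 0 :> C R by rewrite rc_eq0 gt_eqF.
have [|t tE] := @cis_surj R (z / rc (ab z)).
  by rewrite abM abV ab_rc ger0_norm ?ab_ge0 // divff // gt_eqF.
exists (t +i* (- ln (ab z)))%C.
have -> : cexp ('i%C * (t +i* (- ln (ab z)))%C) = rc (expR (ln (ab z))) * cis t.
  by apply/eqP; rewrite eq_complex /cexp /cis /=; apply/andP; split; apply/eqP;
    rewrite !(mul0r, mul1r, add0r, sub0r, opprK, addr0, subr0).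
by rewrite lnK ?posrE // -tE mulrC divfK.
Qed.

Lemma torus_log e (z : 'rV[C R]_e) : (forall j, z 0 j != 0) -> exists a, Exp a = z.
Proof.
move=> h; have [a aE] := fin_all_exists (fun j => complex_log (h j)).
by exists (\row_j a j); apply/rowP => j; rewrite !mxE aE.
Qed.

Lemma nonzero_near e (z : 'rV[C R]_e) (d : R) : 0 < d -> exists2 z' : 'rV[C R]_e,
  rn (z' - z) < d & forall j, z' 0 j != 0.
Proof.
move=> d0; exists (\row_j if z 0 j == 0 then rc (d / 2) else z 0 j).
  apply: le_lt_trans (_ : d / 2 < d); last by rewrite ltr_pdivrMr // ltr_pMr // ltr1n.
  apply: rn_mx_le => [|i j]; first by rewrite divr_ge0 // ltW.
  rewrite ord1 !mxE; case: eqP => [->|_]; rewrite ?subr0 ?subrr.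
    by rewrite ab_rc ger0_norm // divr_ge0 // ltW.
  have -> : ab (0 : C R) = 0 by apply/eqP; rewrite ab_eq0.
  by rewrite divr_ge0 // ltW.
move=> j; rewrite mxE; case: (eqVneq (z 0 j) 0) => // _.
by rewrite rc_eq0 gt_eqF // divr_gt0.
Qed.

(** The point y is a cluster point of g at +oo. *)
Definition freq (g : R -> M) (y : M) := forall N, nbhs y N -> forall T, exists2 t, T < t & N (g t).

(** * The combinatorics of one chart *)

Section GoodChart.
Context (e : nat) (lam : 'M[R]_(e, k)) (p : M) (sg : 'rV[C R]_e -> M).
Context (gc : good_chart lam p sg).
Local Notation x0 := (sg (onev e)).

Lemma gc_cont z N : nbhs (sg z) N -> exists2 d : R, 0 < d & forall z' : 'rV[C R]_e,
  rn (z' - z) < d -> N (sg z').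
Proof.
move=> nN; have [[h _] _] := gc_subm gc 0 z.
rewrite row_mxKl row_mxKr (Phi0 HP) in h; have [d d0 hd] := h N nN.
exists d => // z' zd; have := hd (row_mx 0 z') _; rewrite row_mxKl row_mxKr (Phi0 HP); apply.
rewrite opp_row_mx add_row_mx subrr; apply: le_lt_trans zd; apply: rn_row_mx => //.
by rewrite rn0 rn_ge0.
Qed.

(** If no coordinate of z vanishes, sg z lies in the orbit of x0 and has the same stabilizer, C^k
    being commutative. Such z are dense, and being stabilized by v is a closed condition. *)
Lemma h0_all v z : stab v x0 -> stab v (sg z).
Proof.
move=> h; apply: stab_closed => N /gc_cont[d d0 hd].
have [z' zd z'0] := nonzero_near z d0; exists (sg z'); first exact: hd.
have [a aE] := torus_log z'0.
rewrite -[z']mulv1 -aE -(gc_eq gc).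
exact: ((stab_Phi v _ _).1 h).
Qed.

(** Contractions of the slice commute with Phi v. Contracting z and z' simultaneously to 0 moves
    both slice points to the centre p. *)
Lemma fix_center v z z' : Phi v (sg z) = sg z' -> Phi v p = p.
Proof.
move=> h; apply: contrapT => ne.
have [A [B [nA nB AB]]] := hausdorff_sep (manifold_hausdorff X) ne.
have [d d0 [U nU dU]] := Phi_cont2 nA.
have nU' := nU; rewrite -(gc_0 gc) in nU'; have nB' := nB; rewrite -(gc_0 gc) in nB'.
have [d1 d10 h1] := gc_cont nU'; have [d2 d20 h2] := gc_cont nB'.
have m0 : 0 < Num.min d1 d2 by rewrite lt_min d10.
pose t := Num.min d1 d2; pose s := t / (1 + t + (rn z + rn z')).
have q0 : 0 < 1 + t + (rn z + rn z') by rewrite ltr_wpDr ?addr_ge0 ?rn_ge0 // addr_gt0.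
have s0 : 0 < s by rewrite divr_gt0.
have E w : mulv (Exp (bt e (- ln s))) w = rc s *: w by rewrite Exp_bt opprK lnK.
have sm (w : 'rV[C R]_e) : rn w <= rn z + rn z' -> rn (rc s *: w - 0) < t.
  move=> hw; rewrite subr0 rnZ ab_rc ger0_norm ?(ltW s0) // /s mulrAC ltr_pdivrMr // ltr_pM2l //.
  by apply: le_lt_trans hw _; rewrite ltrDr addr_gt0.
have hz := sm z (_ : _ <= _); have hz' := sm z' (_ : _ <= _).
move: hz hz'; rewrite lerDl lerDr !rn_ge0 => /(_ isT) + /(_ isT).
rewrite !lt_min => /andP[z1 z2] /andP[z3 z4].
apply: (AB (Phi v (sg (rc s *: z)))).
  by apply: dU; [rewrite subrr rn0|exact: h1].
by rewrite -E -(gc_eq gc) PhiC h (gc_eq gc) E; exact: h2.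
Qed.

Lemma stab_center v z : stab v (sg z) -> stab v p.
Proof. by move=> h t; exact: fix_center (h t). Qed.

Lemma Exp_all1 (a z : 'rV[C R]_e) j : (forall t : R, mulv (Exp (rc t *: a)) z = z) -> a 0 j * z 0 j = 0.
Proof.
move=> h; have := Exp_path0 a z => h1.
have h2 : hasd (fun s => mulv (Exp (rc s *: a)) z) 0 0.
  by apply: hasd_ext ltr01 _ (hasd_const z 0) => s _; rewrite h.
have /rowP/(_ j) := hasd_uniq h1 h2; rewrite mul_mx_diag !mxE => /eqP.
rewrite mulrCA mulf_eq0 => /orP[/eqP iz|/eqP //].
by have := @ab_i R; rewrite iz /ab normr0 => /eqP; rewrite eq_sym oner_eq0.
Qed.

Lemma stab_lam (a : 'rV[C R]_e) z : stab (a *m cmx lam) (sg z) <-> forall j, a 0 j * z 0 j = 0.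
Proof.
split=> [h j|h t].
  by apply: Exp_all1 => t; apply: (gc_inj gc); rewrite -(gc_eq gc) -scalemxAl h.
rewrite scalemxAl (gc_eq gc); congr sg; apply/rowP => j; rewrite !mxE.
have /eqP := h j; rewrite mulf_eq0 => /orP[/eqP ->|/eqP ->]; rewrite ?mulr0 //.
have c0 : cexp (0 : C R) = 1 by rewrite -[X in cexp X](mulr0 'i%C) -rc0 cexp_i cis0.
by rewrite c0 mul1r.
Qed.

(** At x0 all coordinates are 1, so the slice directions are themselves generated by the rows of
    lam; the submersion property then says that the orbit of x0 under C^k is open. *)
Lemma x0_full c : atlas X c -> ch_dom c x0 -> row_full (Xm c (ch_to c x0)).
Proof.
move=> Xc cx; have [_ h] := gc_subm gc 0 (onev e).
rewrite row_mxKl row_mxKr (Phi0 HP) in h; have [G qG fG] := h c Xc cx.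
set y0 := row_mx 0 (onev e) in qG fG.
have uG (v : 'rV[C R]_k) : v *m usubmx (G y0) = v *m Xm c (ch_to c x0).
  have E0 : row_mx (rc 0 *: v) (onev e) = y0 by rewrite rc0 scale0r.
  have h2 := hasd_qhol_at E0 qG (hasd_row (hasd_ray v 0) (hasd_const (onev e) 0)).
  rewrite -(vsubmxK (G y0)) mul_row_col mul0mx addr0 in h2.
  have [_ h3] := Phi_vel HP v x0 0; rewrite rc0 scale0r (Phi0 HP) in h3.
  apply: (hasd_uniq h2); apply: hasd_ext ltr01 _ (h3 c Xc cx) => s _.
  by rewrite row_mxKl row_mxKr.
have dG (a : 'rV[C R]_e) : ('i%C *: a) *m dsubmx (G y0) = a *m cmx lam *m Xm c (ch_to c x0).
  have E0 : row_mx 0 (mulv (Exp (rc 0 *: a)) (onev e)) = y0 by rewrite rc0 scale0r mulv_Exp0.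
  have h2 := hasd_qhol_at E0 qG (hasd_row (hasd_const 0 0) (Exp_path0 a (onev e))).
  rewrite -(vsubmxK (G y0)) mul_row_col mul0mx add0r in h2.
  have E1 : a *m diag_mx ('i%C *: onev e) = 'i%C *: a.
    by apply/rowP => j; rewrite mul_mx_diag !mxE mulr1 mulrC.
  rewrite E1 in h2.
  have [_ h3] := Phi_vel HP (a *m cmx lam) x0 0; rewrite rc0 scale0r (Phi0 HP) in h3.
  apply: (hasd_uniq h2); apply: hasd_ext ltr01 _ (h3 c Xc cx) => s _.
  by rewrite row_mxKl row_mxKr (Phi0 HP) scalemxAl (gc_eq gc).
have uE : usubmx (G y0) = Xm c (ch_to c x0).
  by apply/row_matrixP => i; rewrite !rowE uG.
have dE : dsubmx (G y0) = - ('i%C *: cmx lam) *m Xm c (ch_to c x0).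
  apply/row_matrixP => i; rewrite !rowE mulmxA mulmxN -scalemxAr scalemxAl -mulNmx -dG.
  congr (_ *m _); rewrite scalerN scalerA.
  have -> : ('i%C * 'i%C : C R) = -1 by apply/eqP; rewrite eq_complex /=; apply/andP; split; apply/eqP; ring.
  by rewrite scaleN1r opprK.
move: fG; rewrite -(vsubmxK (G y0)) uE dE /row_full !eqn_leq !rank_leq_col /= => h1.
apply: leq_trans h1 _; rewrite -(addsmxE _ _); apply: mxrankS; rewrite addsmx_sub submx_refl /=.
exact: submxMl.
Qed.

Hypothesis Hd : (k + e = n.*2)%N.

(** Let H be the Lie algebra of the stabilizer of x0, of complex dimension k - n. The real and
    imaginary parts of a basis of H together with the rows of lam number 2 (k - n) + d = k when d =
    e. They are independent: given a relation, the corresponding eta in H also stabilizes p, so its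
    imaginary part is a combination of the rows of lam, hence eta lies in their complex span; at x0,
    where no coordinate vanishes, this forces eta = 0. Thus R^k is the direct sum of Re H and the
    span of lam, and [kap] gives the coordinates along lam. *)
Lemma kappa_exists : exists kap : 'M[R]_(k, e), [/\ lam *m kap = 1%:M,
  forall eta, stab eta x0 -> realpart eta *m kap = 0 /\ imagpart eta *m kap = 0 &
  forall w, exists2 eta, stab eta x0 & w = realpart eta + w *m kap *m lam].
Proof.
have [c Xc cx] := atlas_cover X x0.
pose A := Xm c (ch_to c x0); have fA : row_full A := x0_full Xc cx.
pose Hb := row_base (kermx A).
have HbP v : stab v x0 <-> (v <= Hb)%MS.
  rewrite (stabP v Xc cx) eq_row_base; split=> [h|/sub_kermxP //]; exact/sub_kermxP.
pose ReH := map_mx (@complex.Re R) Hb; pose ImH := map_mx (@complex.Im R) Hb.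
have RH a b : realpart ((complexv a - 'i%C *: complexv b) *m Hb) = a *m ReH + b *m ImH.
  exact: realpart_mulC.
pose S := col_mx (col_mx ReH ImH) lam.
have slp u : stab (u *m cmx lam) p.
  by rewrite -(gc_0 gc) stab_lam => j; rewrite mxE mulr0.
have fS : row_free S.
  apply: inj_row_free => v; rewrite -(hsubmxK v) -(hsubmxK (lsubmx v)).
  move: (lsubmx (lsubmx v)) (rsubmx (lsubmx v)) (rsubmx v) => a b q'.
  rewrite !mul_row_col -RH; set eta := _ *m Hb => E0.
  have se : stab eta x0 by apply/HbP; exact: submxMl.
  have sp : stab eta p by rewrite -(gc_0 gc); exact: h0_all.
  have E1 : realpart eta = - (q' *m lam) by apply/eqP; rewrite -addr_eq0 E0.
  have E2 := vec_ReIm eta; rewrite E1 in E2.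
  have sy : stab (complexv (imagpart eta)) p.
    have -> : complexv (imagpart eta) = (- 'i%C) *: (eta + complexv q' *m cmx lam).
      rewrite {2}E2 -complexv_mul complexvN addrAC addNr add0r scalerA mulNr.
      by rewrite sqri opprK scale1r.
    by apply: stabZ; apply: stabD.
  have /submxP[y' yE] : (imagpart eta <= lam)%MS.
    by apply/(gc_lie gc); apply/stab_real.
  have E3 : eta = ('i%C *: complexv y' - complexv q') *m cmx lam.
    by rewrite {1}E2 yE mulmxBl -scalemxAl -!complexv_mul complexvN addrC.
  have E4 : 'i%C *: complexv y' - complexv q' = 0.
    apply/rowP => j; move: se; rewrite E3 stab_lam => /(_ j).
    by rewrite [onev e 0 j]mxE mulr1 => ->; rewrite mxE.
  have E5 : complexv a - 'i%C *: complexv b = 0.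
    apply: (row_free_inj (row_base_free (kermx A))).
    by rewrite -/Hb -/eta E3 E4 !mul0mx.
  have q0 : q' = 0.
    apply/rowP => j; have /rowP/(_ j) := E4; rewrite !mxE => /(congr1 (@complex.Re R)) /=.
    by rewrite !mul0r mul1r subr0 sub0r => /eqP; rewrite oppr_eq0 => /eqP.
  have ab0' j : a 0 j = 0 /\ b 0 j = 0.
    have /rowP/(_ j) := E5; rewrite !mxE => E6; split.
      have := congr1 (@complex.Re R) E6 => /=; by rewrite !mul0r mul1r subr0 oppr0 addr0.
    have := congr1 (@complex.Im R) E6 => /=; rewrite !mul0r mul1r !add0r.
    by move=> /eqP; rewrite oppr_eq0 => /eqP.
  have -> : a = 0 by apply/rowP => j; rewrite mxE (ab0' j).1.
  have -> : b = 0 by apply/rowP => j; rewrite mxE (ab0' j).2.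
  by rewrite q0 !row_mx0.
have fF : row_full S.
  have h1 : \rank (kermx A) = (k - n)%N by rewrite mxrank_ker (eqP fA).
  have h2 : (n <= k)%N by rewrite -(eqP fA) rank_leq_row.
  by rewrite /row_full (eqP fS) h1; apply/eqP; move: Hd h2; clear; lia.
pose kap : 'M[R]_(k, e) := rsubmx (pinvmx S).
have [E1 [E2 E3]] : lam *m kap = 1%:M /\ ReH *m kap = 0 /\ ImH *m kap = 0.
  have : S *m kap = col_mx 0 1%:M.
    by rewrite /kap mulmx_rsub mulmxVp // scalar_mx_block block_mxEh row_mxKr.
  rewrite /S mul_col_mx => /eq_col_mx[+ h2]; rewrite mul_col_mx -[X in _ = X]col_mx0.
  by move=> /eq_col_mx[h1 h3].
have Re0 eta : stab eta x0 -> realpart eta *m kap = 0.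
  move=> /HbP/submxP[t ->]; rewrite (vec_ReIm t) -[imagpart t]opprK complexvN scalerN RH.
  by rewrite mulmxDl -!mulmxA E2 E3 !mulmx0 addr0.
exists kap; split=> [//|eta he|w].
  split; first exact: Re0.
  by have := Re0 _ (stabZ 'i%C he); rewrite realpart_i mulNmx => /eqP; rewrite oppr_eq0 => /eqP.
have wE : w = w *m pinvmx S *m S by rewrite -mulmxA mulVpmx // mulmx1.
pose u := w *m pinvmx S; pose a := lsubmx (lsubmx u); pose b := rsubmx (lsubmx u).
exists ((complexv a - 'i%C *: complexv b) *m Hb); first by apply/HbP; exact: submxMl.
rewrite RH {1}wE -/u -{1}(hsubmxK u) -(hsubmxK (lsubmx u)) !mul_row_col; congr (_ + _ *m _).
by rewrite /u /kap mulmx_rsub.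
Qed.

Context (kap : 'M[R]_(k, e)) (lk : lam *m kap = 1%:M).
Context (kh : forall eta, stab eta x0 -> realpart eta *m kap = 0 /\ imagpart eta *m kap = 0).
Context (kw : forall w, exists2 eta, stab eta x0 & w = realpart eta + w *m kap *m lam).

Lemma kap_split v eta c : imagpart v = realpart eta + c *m lam ->
  v = complexv (realpart v + imagpart eta) + ('i%C *: eta + ('i%C *: complexv c) *m cmx lam).
Proof.
move=> yE; rewrite {1}(vec_ReIm v) yE complexvD scalerDr -scalemxAl -complexv_mul addrA addrA.
congr (_ + _); rewrite complexvD -addrA; congr (_ + _).
rewrite [X in _ + 'i%C *: X](vec_ReIm eta) scalerDr scalerA sqri scaleN1r.
by rewrite addrCA subrr addr0.
Qed.

(** Such a v fixes the centre p. Subtracting an element of the stabilizer of x0 and a complex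
    combination of the rows of lam leaves a real vector fixing p, which [gc_stab] writes as a
    combination of rows plus a period. *)
Lemma stab_form v z z' : Phi v (sg z) = sg z' -> exists eta a N,
  [/\ v = eta + a *m cmx lam + complexv N, stab eta x0, Exp (complexv N) = onev k &
      z' = mulv (Exp a) z].
Proof.
move=> h; have vp := fix_center h.
have [eta se yE] := kw (imagpart v).
pose s := realpart v + imagpart eta; pose cc := imagpart v *m kap.
have vE : v = complexv s + ('i%C *: eta + ('i%C *: complexv cc) *m cmx lam) := kap_split yE.
have sp : stab ('i%C *: eta + ('i%C *: complexv cc) *m cmx lam) p.
  rewrite -(gc_0 gc); apply: stabD; first by apply: h0_all; exact: stabZ.
  by apply/stab_lam => j; rewrite [X in _ * X]mxE mulr0.
have /(gc_stab gc)[u uE] : phi s p = p.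
  by rewrite -(Phi_real HP) -{2}vp vE (PhiD HP) (stab1 sp).
pose N := s - u *m lam.
have EN : Exp (complexv N) = onev k.
  by rewrite complexvD ExpD uE -ExpD -complexvD subrr complexv0 Exp0.
pose a := 'i%C *: complexv cc + complexv u.
have vE' : v = 'i%C *: eta + a *m cmx lam + complexv N.
  rewrite vE mulmxDl -complexv_mul complexvB.
  move: (complexv s) (_ *m cmx lam) ('i%C *: eta) (complexv (u *m lam)) => A B D E.
  by apply/rowP => l; rewrite !mxE; ring.
exists ('i%C *: eta), a, N; split=> //; first exact: stabZ.
have sz : stab ('i%C *: eta) (sg (mulv (Exp a) z)) by apply: h0_all; exact: stabZ.
by apply: (gc_inj gc); rewrite -h vE' addrC !(PhiD HP) (gc_eq gc) (stab1 sz) (Phi_ker _ EN).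
Qed.

Lemma kap_coeff v eta a N : v = eta + a *m cmx lam + complexv N -> stab eta x0 ->
  v *m cmx kap = a + complexv (N *m kap).
Proof.
move=> -> se; rewrite !mulmxDl -mulmxA -complexv_mul.
have -> : cmx lam *m cmx kap = 1%:M.
  exact: cmx_inv.
have [h1 h2] := kh se.
have -> : eta *m cmx kap = 0.
  by rewrite (vec_ReIm eta) mulmxDl -scalemxAl -!complexv_mul h1 h2 complexv0 scaler0 addr0.
by rewrite mulmx1 add0r.
Qed.

(** * Limits of one-parameter orbits *)

Section Limit.
Context (v0 u' : 'rV[C R]_k) (z0 z' : 'rV[C R]_e) (w : 'rV[R]_k) (j : 'I_e).
Hypothesis fr : freq (fun t => Phi (('i%C * rc t) *: complexv w) (Phi v0 (sg z0))) (Phi u' (sg z')).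
Hypothesis z0j : z0 0 j != 0.
Let c := (w *m kap) 0 j.

(** At arbitrarily large times the orbit is back in the chart around the cluster point, and
    [stab_form] compares its slice coordinate with the initial one. The modulus changes by exp (m -
    t c): the period is real and leaves it unchanged, and m stays bounded because the transverse
    parameter remains near u'. *)
Lemma limit_core : exists K : R, forall ep T : R, 0 < ep -> ep <= 1 -> exists t m (ze : C R),
  [/\ T < t, `|m| <= K, ab ze = expR (m - t * c) * ab (z0 0 j) & ab (ze - z' 0 j) < ep].
Proof.
exists (k%:R * (rn v0 + (rn u' + 1)) * rn (cmx kap)) => ep T e0 e1.
have := subm_open (gc_subm gc u' z') e0; rewrite row_mxKl row_mxKr => nN.
have [t Tt [y yd yE]] := fr nN T.
pose u2 := lsubmx y; pose z2 := rsubmx y.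
have ud : rn (u2 - u') < ep.
  by apply: le_lt_trans yd; have := rn_lsub (y - row_mx u' z'); rewrite raddfB /= row_mxKl.
have zd : rn (z2 - z') < ep.
  by apply: le_lt_trans yd; have := rn_rsub (y - row_mx u' z'); rewrite raddfB /= row_mxKr.
pose v1 := ('i%C * rc t) *: complexv w + v0 - u2.
have E : Phi v1 (sg z0) = sg z2.
  apply: (Phi_inj (v := u2)); rewrite -(PhiD HP) /v1 addrC subrK (PhiD HP).
  exact: (esym yE).
have [eta [a [N [vE se EN zE]]]] := stab_form E.
have aE := kap_coeff vE se.
exists t, (- complex.Im (((v0 - u2) *m cmx kap) 0 j)), (z2 0 j); split=> //.
- rewrite normrN; apply: le_trans (ab_Im _) _; apply: le_trans (rn_coord _ _ _) _.
  apply: le_trans (rn_mulmx _ _) _; rewrite ler_wpM2r ?rn_ge0 // ler_wpM2l //.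
  apply: le_trans (rnB _ _) _; rewrite lerD2l.
  have := rn_sub u2 u'; have := ltW ud; move: e1; clear; move=> h1 h2 h3.
  by rewrite -lerBlDl; apply: le_trans h3 _; apply: le_trans h2 _.
- have -> : z2 0 j = cexp ('i%C * a 0 j) * z0 0 j by rewrite zE !mxE.
  rewrite abM ab_cexp_i; congr (expR _ * _).
  have -> : a 0 j = (v1 *m cmx kap) 0 j - rc ((N *m kap) 0 j).
    by rewrite aE; move: (N *m kap) => B; rewrite !mxE addrK.
  rewrite /v1 /c -addrA mulmxDl -scalemxAl -complexv_mul.
  move: (w *m kap) (N *m kap) ((v0 - u2) *m cmx kap) => B N' W; rewrite !mxE.
  by case: (W 0 j) => x1 x2; rewrite /rc /=; ring.
- by apply: le_lt_trans zd; have := rn_coord (z2 - z') 0 j; rewrite mxE [(- z') 0 j]mxE.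
Qed.

Lemma limit_pos : z' 0 j = 0 -> 0 < c.
Proof.
move=> z'0; have [K hK] := limit_core; rewrite ltNge; apply/negP => c0.
have a0 : 0 < ab (z0 0 j) by exact: ab_gt0.
pose ep := Num.min 1 (expR (- K) * ab (z0 0 j)).
have e0 : 0 < ep by rewrite lt_min ltr01 mulr_gt0 // expR_gt0.
have [|t [m [ze [t0 mK zE]]]] := hK ep 0 e0; first by rewrite ge_min lexx.
rewrite z'0 subr0 zE lt_min => /andP[_]; rewrite ltNge ler_pM2r // ler_expR => /negP; apply.
have /andP[h1 _] : - K <= m <= K by rewrite -ler_norml.
apply: le_trans h1 _; rewrite lerDl oppr_ge0; exact: (mulr_ge0_le0 (ltW t0) c0).
Qed.

Lemma limit_zero : z' 0 j != 0 -> c = 0.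
Proof.
move=> z'0; have [K hK] := limit_core; apply/eqP; apply: contraT => c0.
have a0 : 0 < ab (z0 0 j) by exact: ab_gt0.
have b0 : 0 < ab (z' 0 j) by exact: ab_gt0.
pose ep := Num.min 1 (ab (z' 0 j) / 2).
have e0 : 0 < ep by rewrite lt_min ltr01 divr_gt0.
pose A := ab (z' 0 j) / 2 / ab (z0 0 j); pose B := (ab (z' 0 j) + 1) / ab (z0 0 j).
have A0 : 0 < A by rewrite !divr_gt0.
pose D := K + (`|ln A| + `|ln B|).
have c1 : 0 < `|c| by rewrite normr_gt0.
have [|t [m [ze [tD mK zE]]]] := hK ep (D / `|c|) e0; first by rewrite ge_min lexx.
rewrite lt_min => /andP[z1 z2].
have rE : expR (m - t * c) = ab ze / ab (z0 0 j) by rewrite zE mulfK // gt_eqF.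
have lo : A <= expR (m - t * c).
  rewrite rE ler_pM2r ?invr_gt0 //; have := abD (z' 0 j - ze) ze; rewrite subrK.
  rewrite -(abN (z' 0 j - ze)) opprB => h; have := le_trans h (lerD (ltW z2) (lexx (ab ze))).
  by rewrite -lerBlDl {1}(splitr (ab (z' 0 j))) addrK.
have hi : expR (m - t * c) <= B.
  rewrite rE ler_pM2r ?invr_gt0 //; have := abD (ze - z' 0 j) (z' 0 j); rewrite subrK => h.
  by apply: le_trans h _; rewrite addrC lerD2l ltW.
have l1 : ln A <= m - t * c by rewrite -[leRHS]expRK ler_ln ?posrE // expR_gt0.
have l2 : m - t * c <= ln B.
  by rewrite -[leLHS]expRK ler_ln ?posrE ?expR_gt0 //; apply: lt_le_trans hi; rewrite expR_gt0.
have t0 : 0 < t.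
  apply: le_lt_trans tD; rewrite divr_ge0 // addr_ge0 ?addr_ge0 //.
  by apply: le_trans mK; exact: normr_ge0.
have : t * `|c| <= D.
  rewrite -(gtr0_norm t0) -normrM.
  have -> : t * c = m - (m - t * c) by rewrite opprB addrC subrK.
  apply: le_trans (ler_normB _ _) _; rewrite lerD //.
  move: l1 l2; move: (m - t * c) (ln A) (ln B) => x y z l1 l2.
  rewrite ler_norml; apply/andP; split.
    apply: le_trans l1; rewrite lerNl; apply: le_trans (_ : `|y| <= _); last by rewrite lerDl.
    by rewrite -normrN ler_norm.
  apply: le_trans l2 _; apply: le_trans (ler_norm z) _; by rewrite lerDr.
by rewrite -ler_pdivlMr // leNgt tD.
Qed.
End Limit.
End GoodChart.

(** * Charts normalized at a common point x0 *)

Context (d : nat) (Hd : (k + d = n.*2)%N) (x0 : M).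
Context (Hcpt : compact [set: M]).

(** Every chart sends (1, ..., 1) to the same x0. The cone of the chart, spanned by the rows of lam
    modulo the real parts of the stabilizer of x0, is the set of w with w kap >= 0. *)
Record nchart (lam : 'M[R]_(d, k)) (kap : 'M[R]_(k, d)) (p : M) (sg : 'rV[C R]_d -> M) : Prop := {
  nc_gc : good_chart lam p sg;
  nc_x0 : sg (onev d) = x0;
  nc_lk : lam *m kap = 1%:M;
  nc_kh : forall eta, stab eta x0 -> realpart eta *m kap = 0 /\ imagpart eta *m kap = 0;
  nc_kw : forall w, exists2 eta, stab eta x0 & w = realpart eta + w *m kap *m lam }.

Section NChart.
Context (lam : 'M[R]_(d, k)) (kap : 'M[R]_(k, d)) (p : M) (sg : 'rV[C R]_d -> M).
Context (nc : nchart lam kap p sg).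

Lemma nc_form v (z z' : 'rV[C R]_d) : Phi v (sg z) = sg z' -> exists eta a N,
  [/\ v = eta + a *m cmx lam + complexv N, stab eta x0, Exp (complexv N) = onev k &
      z' = mulv (Exp a) z].
Proof.
move: (nc_kw nc); rewrite -(nc_x0 nc) => kw; exact: (stab_form (nc_gc nc) kw).
Qed.

Lemma nc_split v : exists2 eta, stab eta x0 & v = complexv (realpart v + imagpart eta) +
  ('i%C *: eta + ('i%C *: complexv (imagpart v *m kap)) *m cmx lam).
Proof.
have [eta se yE] := nc_kw nc (imagpart v); exists eta => //.
exact: kap_split yE.
Qed.

Lemma nc_h0 v (z : 'rV[C R]_d) : stab v x0 -> stab v (sg z).
Proof. by rewrite -(nc_x0 nc); exact: (h0_all (nc_gc nc)). Qed.

Lemma nc_log (z : 'rV[C R]_d) : (forall j, z 0 j != 0) -> exists a, Phi (a *m cmx lam) x0 = sg z.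
Proof.
move=> /torus_log[a <-]; exists a; rewrite -(nc_x0 nc) (gc_eq (nc_gc nc)); congr sg; exact: mulv1.
Qed.

Lemma nc_row j : row j lam *m kap = delta_mx 0 j.
Proof. by rewrite rowE -mulmxA (nc_lk nc) mulmx1. Qed.

Lemma nc_real0 v : stab (complexv v) x0 -> v = 0.
Proof.
move=> h; have [k1 _] := nc_kh nc h; have E : realpart (complexv v) = v by apply/rowP => j; rewrite !mxE.
rewrite E in k1; have := nc_h0 0 h; rewrite (gc_0 (nc_gc nc)) => sp.
have /submxP[b bE] : (v <= lam)%MS by apply/(gc_lie (nc_gc nc)); apply/stab_real.
by move: k1; rewrite bE -mulmxA (nc_lk nc) mulmx1 => ->; rewrite mul0mx.
Qed.

Lemma nc_stab_row j (z : 'rV[C R]_d) : stab (complexv (row j lam)) (sg z) <-> z 0 j = 0.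
Proof.
rewrite rowE complexv_mul (stab_lam (nc_gc nc)); split=> [/(_ j)|z0 l]; rewrite !mxE !eqxx ?mul1r //.
by case: eqP => [->|_]; rewrite ?z0 ?mulr0 // mul0r.
Qed.

Lemma loop_period j (s : R) : phi (s *: row j lam) x0 = x0 <-> cis s = 1.
Proof.
have E : phi (s *: row j lam) x0 = sg (Exp (complexv (s *: delta_mx 0 j))).
  rewrite -(Phi_real HP) rowE scalemxAl complexv_mul -(nc_x0 nc) (gc_eq (nc_gc nc)).
  by rewrite mulv1.
rewrite E -{1}(nc_x0 nc) Exp_cis; split=> [/(gc_inj (nc_gc nc))/rowP/(_ j)|h].
  by rewrite !mxE !eqxx mulr1.
congr sg; apply/rowP => l; rewrite !mxE eqxx /=.
by case: eqP => _; rewrite ?mulr1 // mulr0 cis0.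
Qed.

Lemma nc_rowneq i j : row i lam = row j lam -> i = j.
Proof.
move=> /(congr1 (mulmx^~ kap)); rewrite !nc_row => /rowP/(_ i); rewrite !mxE !eqxx /=.
by case: eqP => // _ /eqP; rewrite oner_eq0.
Qed.

Lemma nc_limit v0 u' (z0 z' : 'rV[C R]_d) (w : 'rV[R]_k) j :
  freq (fun t => Phi (('i%C * rc t) *: complexv w) (Phi v0 (sg z0))) (Phi u' (sg z')) ->
  z0 0 j != 0 -> (z' 0 j = 0 -> 0 < (w *m kap) 0 j) /\ (z' 0 j != 0 -> (w *m kap) 0 j = 0).
Proof.
move=> fr z0j; move: (nc_kh nc) (nc_kw nc); rewrite -(nc_x0 nc) => kh kw.
split=> h; first exact: (limit_pos (nc_gc nc) (nc_lk nc) kh kw fr z0j h).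
exact: (limit_zero (nc_gc nc) (nc_lk nc) kh kw fr z0j h).
Qed.

(** A converse of [nc_limit]: v0 moves x0 to the point obtained from the given one by replacing the
    zero coordinates by 1, and the direction b contracts precisely these coordinates. *)
Lemma freq_path (b : 'rV[R]_d) u (z : 'rV[C R]_d) : (forall j, z 0 j = 0 -> 0 < b 0 j) -> (forall j, z 0 j != 0 -> b 0 j = 0) ->
  exists v0, freq (fun t => Phi (('i%C * rc t) *: complexv (b *m lam)) (Phi v0 x0)) (Phi u (sg z)).
Proof.
move=> b1 b2; pose z1 : 'rV[C R]_d := \row_j if z 0 j == 0 then 1 else z 0 j.
have [|a aE] := nc_log (z := z1).
  by move=> j; rewrite mxE; case: ifP => [_|/negbT //]; rewrite oner_neq0.
exists (u + a *m cmx lam) => N nN T.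
have [d1 d10 [U nU dU]] := Phi_cont2 nN.
have [d2 d20 h2] := gc_cont (nc_gc nc) nU.
pose F j := `|(d2 / 2 * b 0 j)^-1|; pose t := `|T| + 1 + \sum_j F j.
have F0 j : 0 <= F j by exact: normr_ge0.
have t0 : 0 < t by rewrite ltr_wpDr ?sumr_ge0 // ltr_wpDl.
exists t.
  rewrite /t -addrA; apply: le_lt_trans (ler_norm T) _.
  by rewrite ltrDl ltr_wpDr ?sumr_ge0.
rewrite (PhiD HP) aE PhiC complexv_mul scalemxAl (gc_eq (nc_gc nc)).
apply: dU; first by rewrite subrr rn0.
have e0 : 0 < d2 / 2 by rewrite divr_gt0.
apply: h2; apply: le_lt_trans (_ : d2 / 2 < d2); last by rewrite ltr_pdivrMr // ltr_pMr // ltr1n.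
apply: rn_mx_le => [|i j]; first exact: ltW.
rewrite ord1 !mxE; case: eqP => [zj|/eqP zj].
  rewrite zj subr0 mulr1 ab_cexp_i; have bj := b1 j zj.
  have -> : complex.Im ('i%C * rc t * rc (b 0 j)) = t * b 0 j by rewrite /rc /=; ring.
  rewrite expRN -[leRHS]invrK lef_pV2 ?posrE ?expR_gt0 ?invr_gt0 //.
  apply: le_trans (expR_ge1Dx _); apply: le_trans (_ : t * b 0 j <= _); last by rewrite lerDr.
  rewrite -ler_pdivrMr //; apply: le_trans (_ : F j <= t).
    by rewrite /F -invfM ler_norm.
  by rewrite /t (bigD1 j) //= addrCA lerDl addr_ge0 ?sumr_ge0 // addr_ge0.
by rewrite b2 // mulr0 mulr0 -[X in cexp X](mulr0 'i%C) -rc0 cexp_i cis0 mul1r subrr ab0 ltW.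
Qed.
End NChart.

(** * Two charts containing the same point *)

Section TwoCharts.
Context (lam lam' : 'M[R]_(d, k)) (kap kap' : 'M[R]_(k, d)) (p p' : M) (sg sg' : 'rV[C R]_d -> M).
Context (A : nchart lam kap p sg) (B : nchart lam' kap' p' sg').
Context (u u' : 'rV[C R]_k) (z z' : 'rV[C R]_d) (E : Phi u (sg z) = Phi u' (sg' z')).

(** A direction that is positive exactly on the zero coordinates of z leads to the common point, so
    [nc_limit] prescribes the signs of its coordinates in the second chart. The directions used are
    the indicator Z of the zero coordinates plus an arbitrary nonnegative multiple of e_j, which
    isolates the contribution of row j. *)
Lemma cp_coeff j l : z 0 j = 0 ->
  (z' 0 l = 0 -> 0 <= (lam *m kap') j l) /\ (z' 0 l != 0 -> (lam *m kap') j l = 0).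
Proof.
move=> zj; pose Z : 'rV[R]_d := \row_i (z 0 i == 0)%:R.
have H (b : 'rV[R]_d) : (forall j, z 0 j = 0 -> 0 < b 0 j) -> (forall j, z 0 j != 0 -> b 0 j = 0) ->
    (z' 0 l = 0 -> 0 < (b *m (lam *m kap')) 0 l) /\ (z' 0 l != 0 -> (b *m (lam *m kap')) 0 l = 0).
  move=> b1 b2; have [v0] := freq_path A u b1 b2; rewrite E -{1}(nc_x0 B) mulmxA => fr.
  by apply: (nc_limit B fr); rewrite mxE oner_neq0.
have Zp i : z 0 i = 0 -> 0 < Z 0 i by move=> zi; rewrite mxE zi eqxx ltr01.
have Z0 i : z 0 i != 0 -> Z 0 i = 0 by move=> /negbTE zi; rewrite mxE zi.
have D (M0 : R) i : (Z + M0 *: delta_mx 0 j) 0 i = Z 0 i + M0 * (i == j)%:R by rewrite !mxE eqxx.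
have Ev (M0 : R) : ((Z + M0 *: delta_mx 0 j) *m (lam *m kap')) 0 l =
    (Z *m (lam *m kap')) 0 l + M0 * (lam *m kap') j l.
  by rewrite mulmxDl -scalemxAl -rowE; move: (lam *m kap') => T; move: (Z *m T) => ZT; rewrite !mxE.
have HM (M0 : R) : 0 <= M0 -> (z' 0 l = 0 -> 0 < (Z *m (lam *m kap')) 0 l + M0 * (lam *m kap') j l) /\
    (z' 0 l != 0 -> (Z *m (lam *m kap')) 0 l + M0 * (lam *m kap') j l = 0).
  move=> M00; rewrite -Ev; apply: H => i zi; rewrite D.
    by apply: ltr_pwDl; [exact: Zp|rewrite mulr_ge0].
  rewrite Z0 // add0r; case: eqP => [ij|_]; last by rewrite mulr0.
  by move: zi; rewrite ij zj eqxx.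
move: HM; move: ((Z *m _) 0 l) ((lam *m kap') j l) => x y HM.
split=> zl; last first.
  have := (HM 0 (lexx 0)).2 zl; rewrite mul0r addr0 => x0'.
  by have := (HM 1 ler01).2 zl; rewrite x0' add0r mul1r.
rewrite leNgt; apply/negP => y0.
have x0' := (HM 0 (lexx 0)).1 zl; rewrite mul0r addr0 in x0'.
have h : 0 <= x / - y by rewrite divr_ge0 // ltW // oppr_gt0.
have := (HM _ h).1 zl.
by rewrite invrN mulrN mulNr divfK ?lt_eqF // subrr ltxx.
Qed.

Lemma row_kap j : row j lam *m kap = row j (lam *m kap') *m (lam' *m kap).
Proof.
have [eta se wE] := nc_kw B (row j lam); rewrite {1}wE mulmxDl (nc_kh A se).1 add0r.
by rewrite row_mul -!mulmxA.
Qed.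

Lemma row_kap_entry j i : \sum_l (lam *m kap') j l * (lam' *m kap) l i = (i == j)%:R.
Proof.
have := row_kap j; rewrite (nc_row A) => /rowP/(_ i).
rewrite [RHS]mxE [LHS]mxE eqxx /= => ->; apply: eq_bigr => l _; by rewrite [in RHS]mxE.
Qed.
End TwoCharts.

(** The transition coefficients on the relevant rows are nonnegative and T T' = 1, so some row of
    lam' is a multiple t of row j, up to a real part of the stabilizer of x0. That part stabilizes
    the common point, so it lies in the span of lam and vanishes. Finally t > 0, and equality of the
    periods makes t and its inverse integers, whence t = 1. *)
Lemma cp_row lam lam' kap kap' p p' sg sg' (A : nchart lam kap p sg) (B : nchart lam' kap' p' sg')
  u u' (z z' : 'rV[C R]_d) : Phi u (sg z) = Phi u' (sg' z') -> forall j, z 0 j = 0 ->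
  exists2 l, z' 0 l = 0 & row j lam = row l lam'.
Proof.
move=> E j zj; pose T := lam *m kap'; pose T' := lam' *m kap.
have TT i : \sum_l T j l * T' l i = (i == j)%:R := row_kap_entry A B j i.
have [l Tl] : exists l, T j l != 0.
  apply: contrapT => ne; have := TT j; rewrite eqxx big1 => [/eqP|l _]; first by rewrite eq_sym oner_eq0.
  have -> : T j l = 0 by apply/eqP; apply: contraT => h; case: ne; exists l.
  by rewrite mul0r.
have zl : z' 0 l = 0.
  apply/eqP; apply: contraT => h; move: Tl; by rewrite /T ((cp_coeff A B E l zj).2 h) eqxx.
have T'0 i : i != j -> T' l i = 0.
  move=> /negbTE ij; have h := TT i; rewrite ij /= in h.
  have /psumr_eq0P h2 : forall m, true -> 0 <= T j m * T' m i.
    move=> m _; have [h1 h3] := cp_coeff A B E m zj; case: (eqVneq (z' 0 m) 0) => zm; last first.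
      by rewrite /T h3 // mul0r.
    apply: mulr_ge0; first exact: h1.
    have [h4 h5] := cp_coeff B A (esym E) i zm; case: (eqVneq (z 0 i) 0) => zi; first exact: h4.
    by rewrite /T' h5.
  by have /eqP := h2 h l isT; rewrite mulf_eq0 (negbTE Tl) => /eqP.
have [eta se rE] := nc_kw A (row l lam').
have rT : row l lam' *m kap = T' l j *: delta_mx 0 j.
  rewrite -row_mul; apply/rowP => i; rewrite [LHS]mxE [RHS]mxE [X in _ * X]mxE eqxx /=.
  by case: (eqVneq i j) => [->|ij]; rewrite ?mulr1 // mulr0 T'0.
rewrite rT -scalemxAl -rowE in rE; set t := T' l j in rE.
pose r := realpart eta.
have r0 : r = 0.
  have sr : stab (complexv r) (sg z).
    have -> : complexv r = complexv (row l lam') - rc t *: complexv (row j lam).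
      by rewrite -complexvZ -complexvB rE addrK.
    apply: stabD; last by apply: stabN; apply: stabZ; apply/(nc_stab_row A).
    have s1 := (stab_Phi (complexv (row l lam')) u' (sg' z')).1 ((nc_stab_row B l z').2 zl).
    by rewrite -E in s1; exact: ((stab_Phi _ u (sg z)).2 s1).
  have /submxP[b bE] : (r <= lam)%MS.
    by apply/(gc_lie (nc_gc A)); apply/stab_real; exact: (stab_center (nc_gc A) sr).
  have := (nc_kh A se).1; rewrite -/r bE -mulmxA (nc_lk A) mulmx1 => ->.
  by rewrite mul0mx.
rewrite -/r r0 add0r in rE.
have t0 : 0 < t.
  have t1 : 0 <= t by exact: (cp_coeff B A (esym E) j zl).1.
  rewrite lt_neqAle t1 andbT; apply/eqP => t2; have := nc_row B l.
  rewrite rE -t2 scale0r mul0mx => /rowP/(_ l); rewrite !mxE !eqxx => /eqP.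
  by rewrite eq_sym oner_eq0.
have per s : cis s = 1 <-> cis (s * t) = 1.
  by rewrite -(loop_period B l) -(loop_period A j) rE scalerA.
have pi2 : 2 * pi != 0 :> R by rewrite mulf_neq0 ?pnatr_eq0 // gt_eqF // pi_gt0.
have c1 (m : int) := @cis_period R m.
have [m1 m1E] := cis_eq1 ((per _).1 (c1 1)); rewrite mulr1 in m1E.
have [m2 m2E] : exists m : int, 2 * pi / t = 2 * pi * m%:~R.
  by apply: cis_eq1; apply/per; rewrite divfK ?gt_eqF // -[_ * pi]mulr1 -[1]/(1%:~R); exact: c1.
have tm1 : t = m1%:~R := mulfI pi2 m1E.
have tm2 : t^-1 = m2%:~R := mulfI pi2 m2E.
have g1 : 1 <= t by rewrite tm1 ler1z -gtz0_ge1 -(ltr0z R) -tm1.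
have g2 : 1 <= t^-1 by rewrite tm2 ler1z -gtz0_ge1 -(ltr0z R) -tm2 invr_gt0.
exists l => //; rewrite rE; suff -> : t = 1 by rewrite scale1r.
by apply/eqP; rewrite eq_le g1 andbT -invf_ge1.
Qed.

(** * Intersections of cones *)

Lemma freq_exists (g : R -> M) : exists y, freq g y.
Proof.
have FP : ProperFilter (g @ +oo%R) by exact: fmap_proper_filter.
have [y [_ hy]] := Hcpt FP filterT; exists y => N nN T.
have FA : (g @ +oo%R) [set g t | t in [set t | T < t]].
  by exists T; split; [exact: num_real|move=> t Tt; exists t].
by have [_ [[t Tt <-] Nt]] := hy _ _ FA nN; exists t.
Qed.

Section Closed.
Context (lam : 'M[R]_(d, k)) (kap : 'M[R]_(k, d)) (p : M) (sg : 'rV[C R]_d -> M).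
Context (A : nchart lam kap p sg).

Definition boxmap (b : 'rV[R]_(k + (d + d))) :=
  Phi (complexv (lsubmx b)) (sg (complexify (rsubmx b))).
(** The image of a compact box. The box contains the cube of periods for the torus parameter and the
    closed unit polydisc for the slice coordinate, so [Kset] contains Phi v x0 as soon as the
    imaginary part of v lies in the cone. *)
Definition Kset : set M :=
  boxmap @` [set b : 'rV[R]_(k + (d + d)) | forall j, `[- (2 * pi + 1), 2 * pi + 1 : R]%classic (b 0 j)].

Lemma kset_closed : closed Kset.
Proof.
apply: compact_closed; first exact: (manifold_hausdorff X).
apply: continuous_compact; last first.
  apply: (rV_compact (A := fun=> `[- (2 * pi + 1), 2 * pi + 1 : R]%classic)) => j.
  exact: segment_compact.
apply: continuous_subspaceT => b N nN.
have [d1 d10 [U nU dU]] := Phi_cont2 nN.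
have [d2 d20 h2] := gc_cont (nc_gc A) nU.
pose e := Num.min d1 (d2 / 3); have e0 : 0 < e by rewrite lt_min d10 divr_gt0.
have := nbhsx_ballx b e e0; apply: filterS => y; rewrite -ball_normE /= distrC => yd.
have l1 : `|lsubmx y - lsubmx b| <= `|y - b|.
  rewrite -rn_complexv -[leRHS]rn_complexv; have := rn_lsub (complexv (y - b)).
  congr (rn _ <= _); by apply/rowP => j; rewrite !mxE.
have l2 : `|rsubmx y - rsubmx b| <= `|y - b|.
  rewrite -rn_complexv -[leRHS]rn_complexv; have := rn_rsub (complexv (y - b)).
  congr (rn _ <= _); by apply/rowP => j; rewrite !mxE.
move: yd; rewrite lt_min => /andP[y1 y2]; apply: dU.
  by rewrite -complexvB rn_complexv; exact: le_lt_trans l1 y1.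
apply: h2; rewrite -complexifyB; apply: le_lt_trans (rn_complexify _) _.
apply: le_lt_trans (_ : 2 * (d2 / 3) < d2); last first.
  by rewrite mulrCA gtr_pMr // ltr_pdivrMr // mul1r ltr_nat.
by rewrite ler_pM2l //; apply: le_trans l2 (ltW y2).
Qed.

Lemma kset_V y : Kset y -> exists v z, y = Phi v (sg z).
Proof. by move=> [b _ <-]; do 2!eexists; reflexivity. Qed.

Lemma kset_in v : (forall j, 0 <= (imagpart v *m kap) 0 j) -> Kset (Phi v x0).
Proof.
move=> v0; have [eta se ->] := nc_split A v.
set s := realpart v + _; set c := imagpart v *m kap in v0 *.
have [s' [s'c s'E]] := Exp_cube s; pose z := Exp ('i%C *: complexv c).
exists (row_mx s' (realify z)); last first.
  rewrite /boxmap row_mxKl row_mxKr realifyK !(PhiD HP) -{1}(nc_x0 A) (gc_eq (nc_gc A)) mulv1.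
  rewrite (stab1 (nc_h0 A _ (stabZ _ se))) !(Phi_real HP); exact: phi_Exp.
have pi0 : 0 <= 2 * pi :> R by rewrite mulr_ge0 // pi_ge0.
have zc j : ab (z 0 j) <= 1.
  have imc (x : 'rV[R]_d) : ab (Exp ('i%C *: complexv x) 0 j) = expR (- x 0 j).
    by rewrite mxE ab_cexp_i !mxE /= mul0r mul1r add0r.
  by rewrite imc -expR0 ler_expR oppr_le0 v0.
have nb (x : R) : `|x| <= 1 -> - (2 * pi + 1) <= x <= 2 * pi + 1.
  by rewrite ler_norml => /andP[h1 h2]; move: h1 h2 pi0; move: (2 * pi) => P; lra.
move=> j /=; rewrite in_itv /=; case: (split_ordP j) => i ->.
  rewrite row_mxEl; have := s'c i; move: pi0; move: (2 * pi) (s' 0 i) => P x; lra.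
rewrite row_mxEr; apply: nb; case: (split_ordP i) => l ->.
  rewrite /realify row_mxEl mxE; exact: le_trans (ab_Re _) (zc l).
rewrite /realify row_mxEr mxE; exact: le_trans (ab_Im _) (zc l).
Qed.

Lemma in_chart (w : 'rV[R]_k) y : (forall j, 0 <= (w *m kap) 0 j) ->
  freq (fun t => Phi (('i%C * rc t) *: complexv w) x0) y -> exists v z, y = Phi v (sg z).
Proof.
move=> w0 fr; apply: kset_V; apply: kset_closed => N /fr/(_ 0)[t t0 Nt].
exists (Phi (('i%C * rc t) *: complexv w) x0); split=> //; apply: kset_in => j.
have -> : imagpart (('i%C * rc t) *: complexv w) = t *: w.
  by apply/rowP => l; rewrite !mxE /= !(mul0r, mulr0, mul1r, addr0, add0r).
by rewrite -scalemxAl mxE mulr_ge0 // ltW.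
Qed.
End Closed.

(** A cluster point of the orbit of x0 in the direction w lies in both charts, their compact sets
    [Kset] being closed. Where w has a nonzero coordinate the cluster point has a zero coordinate,
    so [cp_row] identifies the corresponding rays. *)
Lemma fan_cones lam lam' kap kap' p p' sg sg' (A : nchart lam kap p sg) (B : nchart lam' kap' p' sg')
  (w : 'rV[R]_k) : (forall j, 0 <= (w *m kap) 0 j) -> (forall j, 0 <= (w *m kap') 0 j) ->
  forall j, (w *m kap) 0 j != 0 -> exists2 l, row j lam = row l lam' & (w *m kap') 0 l = (w *m kap) 0 j.
Proof.
move=> w0 w0'; have [y fr] := freq_exists (fun t => Phi (('i%C * rc t) *: complexv w) x0).
have [v [z yE]] := in_chart A w0 fr; have [v' [z' yE']] := in_chart B w0' fr.
have E : Phi v (sg z) = Phi v' (sg' z') by rewrite -yE.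
have fr' : freq (fun t => Phi (('i%C * rc t) *: complexv w) (Phi 0 (sg (onev d)))) (Phi v (sg z)).
  by rewrite -yE (nc_x0 A) (Phi0 HP).
have Z j : (w *m kap) 0 j != 0 -> z 0 j = 0.
  move=> h; apply/eqP; apply: contraT => zj.
  have oj : onev d 0 j != 0 :> C R by rewrite mxE oner_neq0.
  have [_ h2] := nc_limit A fr' oj.
  by move: h; rewrite h2 ?eqxx.
have row' j : (w *m kap) 0 j != 0 -> exists l, row j lam = row l lam'.
  by move=> /Z zj; have [l _ rE] := cp_row A B E zj; exists l.
move=> j wj; have [l rE] := row' j wj; exists l => //.
have [eta se {1}->] := nc_kw A w; rewrite mulmxDl (nc_kh B se).1 add0r -mulmxA.
rewrite mxE (bigD1 j) //= big1 ?addr0 => [|i ij].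
  have := nc_row B l; rewrite -rE -row_mul => /rowP/(_ l); rewrite mxE => ->.
  by rewrite [X in _ * X]mxE !eqxx mulr1.
case: (eqVneq ((w *m kap) 0 i) 0) => [->|wi]; first by rewrite mul0r.
have [m mE] := row' i wi; have := nc_row B m; rewrite -mE -row_mul => /rowP/(_ l); rewrite mxE => ->.
rewrite [X in _ * X]mxE eqxx /=; case: eqP => [lm|_]; last by rewrite mulr0.
by move: ij; rewrite (nc_rowneq A (j := j) (i := i)) ?eqxx // mE rE lm.
Qed.

(** * Crossing a facet *)

(** The slice is translated by u and rescaled by z, which sends (1, ..., 1) to x0. A zero coordinate
    of z would make a row of lam a nonzero real vector stabilizing x0. *)
Lemma nchart_exists (lam : 'M[R]_(d, k)) p sg u z : good_chart lam p sg -> Phi u (sg z) = x0 ->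
  (forall v : 'rV[R]_k, stab (complexv v) x0 -> v = 0) ->
  exists kap p' sg', nchart lam kap p' sg' /\ p' = Phi u p.
Proof.
move=> gc E r0.
have z0 j : z 0 j != 0.
  apply/eqP => zj; have s1 : stab (complexv (row j lam)) (sg z).
    rewrite rowE complexv_mul; apply/(stab_lam gc) => l; rewrite !mxE !eqxx /=.
    by case: eqP => [->|_]; rewrite ?zj ?mulr0 // mul0r.
  have /r0 rz : stab (complexv (row j lam)) x0 by rewrite -E; exact: ((stab_Phi _ u _).1 s1).
  have : delta_mx 0 j = 0 :> 'rV[R]_d by apply: (row_free_inj (gc_free gc)); rewrite -rowE rz mul0mx.
  by move=> /rowP/(_ j); rewrite !mxE !eqxx => /eqP; rewrite oner_eq0.
pose sg' y := Phi u (sg (mulv z y)).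
have mulvC (y y' : 'rV[C R]_d) : mulv y y' = mulv y' y by apply/rowP => j; rewrite !mxE mulrC.
have gc' : good_chart lam (Phi u p) sg'.
  split.
  - rewrite /sg' (_ : mulv z 0 = 0) ?(gc_0 gc) //; apply/rowP => j; by rewrite !mxE mulr0.
  - move=> a y; rewrite /sg' (PhiC) (gc_eq gc); congr (Phi u (sg _)).
    by apply/rowP => j; rewrite !mxE mulrCA.
  - move=> y1 y2 /(Phi_inj)/(gc_inj gc)/rowP h; apply/rowP => j.
    by have := h j; rewrite !mxE => /(mulfI (z0 j)).
  - move=> u1 y; pose A : 'M[C R]_(k + d) := block_mx 1%:M 0 0 (diag_mx z).
    have lE (x : 'rV[C R]_(k + d)) : x *m A + 0 = row_mx (lsubmx x) (mulv z (rsubmx x)).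
      by rewrite addr0 -{1}(hsubmxK x) mul_row_block !mulmx0 mulmx1 addr0 add0r mulvC mulv_diag.
    have fA : row_full A.
      apply/row_fullP; exists (block_mx 1%:M 0 0 (diag_mx (\row_j (z 0 j)^-1))).
      rewrite mulmx_block !mulmx0 !mul0mx !mulmx1 !addr0 !add0r mulmx_diag.
      rewrite [RHS]scalar_mx_block; congr block_mx; apply/matrixP => i j.
      by rewrite !mxE mulVf.
    have h : subm (fun y : 'rV[C R]_(k + d) => Phi (lsubmx y) (sg (rsubmx y))) (row_mx u1 y *m A + 0).
      by rewrite lE row_mxKl row_mxKr; exact: (gc_subm gc).
    have h2 := subm_comp (qhol_with_affine A 0 (row_mx u1 y)) fA h.
    have h3 := subm_flow u h2.
    apply: subm_ext ltr01 _ h3 => x _; rewrite lE row_mxKl row_mxKr; exact: (PhiC).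
  - exact: (gc_free gc).
  - exact: (gc_int gc).
  - move=> v; rewrite -(gc_lie gc) -!(stab_real); symmetry; exact: (stab_Phi).
  - move=> s h; apply: (gc_stab gc); apply: (Phi_inj (v := u)).
    by rewrite -(Phi_real HP) (PhiC) (Phi_real HP).
have x0E : sg' (onev d) = x0 by rewrite /sg' mulv1.
have [kap [lk kh kw]] := kappa_exists gc' Hd; rewrite x0E in kh kw.
by exists kap, (Phi u p), sg'; split=> //; split.
Qed.

Lemma chart_open (lam : 'M[R]_(d, k)) p sg u z : good_chart lam p sg ->
  \forall y \near Phi u (sg z), exists u' z', y = Phi u' (sg z').
Proof.
move=> gc; have := subm_open (gc_subm gc u z) ltr01; rewrite row_mxKl row_mxKr.
by apply: filterS => y [b _ <-]; do 2!eexists; reflexivity.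
Qed.

Lemma orbit_dense lam kap p sg (A : nchart lam kap p sg) z N : nbhs (sg z) N ->
  exists a, N (Phi a x0).
Proof.
move=> /(gc_cont (nc_gc A))[e e0 he]; have [z' zd z'0] := nonzero_near z e0.
have [a aE] := nc_log A z'0; exists (a *m cmx lam); rewrite aE; exact: he.
Qed.

Lemma nchart_at lam kap p sg (A : nchart lam kap p sg) (lam' : 'M[R]_(d, k)) y sg' z u' z' :
  good_chart lam' y sg' -> sg z = Phi u' (sg' z') ->
  exists kap' p' sg2 u, nchart lam' kap' p' sg2 /\ p' = Phi u y.
Proof.
move=> gc E; have := chart_open u' z' gc; rewrite -E => /(orbit_dense A)[a [u1 [z1 aE]]].
have h : Phi (- a + u1) (sg' z1) = x0 by rewrite (PhiD HP) -aE -(PhiD HP) addNr (Phi0 HP).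
have [kap' [p' [sg2 [B pE]]]] := nchart_exists gc h (nc_real0 A).
by exists kap', p', sg2, (- a + u1).
Qed.

Lemma real_stab c q v : atlas X c -> ch_dom c q ->
  stab (complexv v) q <-> v *m reim (Xm c (ch_to c q)) = 0.
Proof. by move=> Xc cq; rewrite (stabP _ Xc cq); exact: reimP. Qed.

Lemma stab_sub c q m (L : 'M[R]_(m, k)) v : atlas X c -> ch_dom c q ->
  (forall i, stab (complexv (row i L)) q) -> (v <= L)%MS -> stab (complexv v) q.
Proof.
move=> Xc cq h /submxP[b ->]; apply/(real_stab _ Xc cq); rewrite -mulmxA.
suff -> : L *m reim (Xm c (ch_to c q)) = 0 by rewrite mulmx0.
by apply/row_matrixP => i; rewrite row_mul row0; apply/(real_stab _ Xc cq).
Qed.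

(** The point q has all coordinates zero except the j-th, so it lies on the invariant curve attached
    to the facet spanned by the rows other than j. Following the direction -row j leads to the
    opposite end y of this curve. The remaining rows stabilize y, so its isotropy group has
    dimension d - 1 or d; the second case holds, and the chart at y is the neighbour across the
    facet. *)
Lemma adjacent lam kap p sg (A : nchart lam kap p sg) (j : 'I_d) :
  exists lam' kap' p' sg' j', [/\ nchart lam' kap' p' sg', (lam *m kap') j j' < 0,
    forall l, l != j -> exists2 l', l' != j' & row l lam = row l' lam' &
    forall l', l' != j' -> exists2 l, l != j & row l lam = row l' lam'].
Proof.
pose q := sg (delta_mx 0 j).
have [y fr] := freq_exists (fun t => Phi (('i%C * rc t) *: complexv (- row j lam)) q).
have sq l : l != j -> stab (complexv (row l lam)) q.
  move=> lj; apply/(nc_stab_row A); rewrite mxE (negbTE lj) andbF; by [].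
have sl l : l != j -> stab (complexv (row l lam)) y.
  move=> lj; apply: (stab_closed) => N nN; have [t _ Nt] := fr N nN 0.
  exists (Phi (('i%C * rc t) *: complexv (- row j lam)) q) => //.
  exact: ((stab_Phi _ _ _).1 (sq l lj)).
have [c Xc cy] := atlas_cover X y; have [c' Xc' cq] := atlas_cover X q.
pose L := row' j lam; pose e := (k - \rank (reim (Xm c (ch_to c y))))%N.
have Lrow i : row i L = row (lift j i) lam by apply/rowP => m; rewrite !mxE.
have nlift i : lift j i != j by rewrite eq_sym neq_lift.
have Ly i : stab (complexv (row i L)) y by rewrite Lrow; exact: sl.
have Lq i : stab (complexv (row i L)) q by rewrite Lrow; exact: sq.
have LF : row_free L.
  apply/row_freeP; exists (col' j kap); apply/matrixP => a b.
  have /matrixP/(_ (lift j a) (lift j b)) := nc_lk A; rewrite !mxE (inj_eq lift_inj) => <-.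
  by apply: eq_bigr => i _; rewrite !mxE.
have Le : (d.-1 <= e)%N.
  rewrite -(eqP LF) /e -mxrank_ker; apply: mxrankS; apply/row_subP => i.
  by apply/sub_kermxP; apply/(real_stab _ Xc cy).
have d0 : (0 < d)%N by apply: leq_ltn_trans (ltn_ord j).
have [h1 h2 _] := isotropy_count Hsm Hps Mconn eff Xc cy.
have gp : good_point act c y.
  rewrite /good_point; move: h1 h2 Le d0 Hd; rewrite -/e; move: e (\rank (Xm _ _)); clear; lia.
have [e' [lam' [sg' [eE gc']]]] := good_chart_exists Xc cy gp.
rewrite -/e in eE.
have fy : freq (fun t => Phi (('i%C * rc t) *: complexv (- row j lam)) (Phi 0 q)) y.
  by rewrite (Phi0 HP).
have [u1 [z1 qE]] : exists u1 z1, q = Phi u1 (sg' z1).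
  have := subm_open (gc_subm gc' 0 0) ltr01; rewrite row_mxKl row_mxKr (Phi0 HP) (gc_0 gc').
  move=> nN; have [t _ [b _ bE]] := fr _ nN 0.
  exists (- (('i%C * rc t) *: complexv (- row j lam)) + lsubmx b), (rsubmx b).
  by rewrite (PhiD HP) bE -(PhiD HP) addNr (Phi0 HP).
have [ed|ed] : e' = d.-1 \/ e' = d.
  by move: h1 h2 Le d0 Hd eE; rewrite -/e; move: e (\rank (Xm _ _)); clear; lia.
(* In dimension d - 1 the chart at y would have q at slice coordinate 0, so y would lie in the orbit
   of q. The j-th coordinate would then stay nonzero in the limit, which requires the direction to
   have j-th coordinate 0 instead of -1. *)
- have LL : (L <= lam')%MS.
    by apply/row_subP => i; apply/(gc_lie gc'); apply/(stab_real); exact: Ly.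
  have L' : (lam' <= L)%MS.
    by rewrite -(geq_leqif (mxrank_leqif_sup LL)) (eqP LF) (eqP (gc_free gc')) ed.
  have z10 : z1 = 0.
    apply/rowP => i; have : stab (complexv (row i lam')) q.
      by apply: (stab_sub Xc' cq Lq); apply: submx_trans L'; exact: row_sub.
    rewrite qE => /(stab_Phi _ u1 _).2; rewrite rowE complexv_mul => /(stab_lam gc' _ _).1/(_ i).
    by rewrite !mxE !eqxx mul1r.
  have yE : Phi (- u1) (sg (delta_mx 0 j)) = y.
    by rewrite -/q qE -(PhiD HP) addNr (Phi0 HP) z10 (gc_0 gc').
  rewrite -yE in fy; have dj : (delta_mx 0 j : 'rV[C R]_d) 0 j != 0 by rewrite mxE !eqxx oner_neq0.
  have := (nc_limit A fy dj).2 dj; rewrite mulNmx (nc_row A) !mxE !eqxx => /eqP.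
  by rewrite oppr_eq0 oner_eq0.
move: lam' sg' gc' z1 qE; rewrite ed => lam' sg' gc' z1 qE.
have [kap' [p' [sg2 [u [B pE]]]]] := nchart_at A gc' qE.
have yE : Phi (- u) (sg2 0) = y by rewrite (gc_0 (nc_gc B)) pE -(PhiD HP) addNr (Phi0 HP).
have [u5 [z4 E]] : exists u5 z4, Phi 0 q = Phi u5 (sg2 z4).
  have := chart_open (- u) 0 (nc_gc B); rewrite yE => nN; have [t _ [u4 [z4 E4]]] := fr _ nN 0.
  exists (- (('i%C * rc t) *: complexv (- row j lam)) + u4), z4.
  by rewrite (PhiD HP _ u4) -E4 -(PhiD HP) addNr.
have dl l : l != j -> (delta_mx 0 j : 'rV[C R]_d) 0 l = 0 by move=> lj; rewrite mxE (negbTE lj) andbF.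
pose T := lam *m kap'; pose T' := lam' *m kap.
have TT m j1 : \sum_l T' m l * T l j1 = (j1 == m)%:R := row_kap_entry B A m j1.
have TT2 m j1 : \sum_l T m l * T' l j1 = (j1 == m)%:R := row_kap_entry A B m j1.
have cpA l : l != j -> exists2 l', z4 0 l' = 0 & row l lam = row l' lam'.
  by move=> lj; exact: (cp_row A B E (dl l lj)).
have cpB l' : z4 0 l' = 0 -> exists2 l, l != j & row l lam = row l' lam'.
  move=> zl; have [l lz rE] := cp_row B A (esym E) zl; exists l => //.
  by apply/eqP => lj; move: lz; rewrite lj mxE !eqxx => /eqP; rewrite oner_eq0.
have Tl l l' i : row l lam = row l' lam' -> T l i = (i == l')%:R.
  by move=> rE; have := nc_row B l'; rewrite -rE -row_mul => /rowP/(_ i); rewrite [LHS]mxE [RHS]mxE eqxx => h; exact: h.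
(* Where z4 has a nonzero coordinate j1, only the term of row j survives in T' T = 1. This rank one
   identity can hold for a single j1, so z4 has exactly one nonzero coordinate j'. *)
have key m j1 : z4 0 j1 != 0 -> T' m j * T j j1 = (j1 == m)%:R.
  move=> zj; rewrite -TT (bigD1 j) //= big1 ?addr0 // => l lj.
  have [l' zl rE] := cpA l lj; rewrite (Tl _ _ _ rE); case: eqP => [jl|_]; last by rewrite mulr0.
  by move: zj; rewrite jl zl eqxx.
have [j' zj'] : exists j', z4 0 j' != 0.
  apply: contrapT => ne; have := TT2 j j; rewrite eqxx big1 => [/eqP|l _]; first by rewrite eq_sym oner_eq0.
  have zl : z4 0 l = 0 by apply/eqP; apply: contraT => h; case: ne; exists l.
  have [i ij rE] := cpB l zl; have := nc_row A i; rewrite rE -row_mul => /rowP/(_ j).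
  by rewrite [LHS]mxE -/T' => ->; rewrite [X in _ * X]mxE [j == i]eq_sym (negbTE ij) andbF mulr0.
have uniq j2 : z4 0 j2 != 0 -> j2 = j'.
  move=> zj2; apply/eqP; apply: contraT => /negbTE ne.
  have := key j' j2 zj2; rewrite ne => /eqP; rewrite mulf_eq0 => /orP[]/eqP h.
    by have := key j' j' zj'; rewrite h mul0r eqxx => /eqP; rewrite eq_sym oner_eq0.
  by have := key j2 j2 zj2; rewrite h mulr0 eqxx => /eqP; rewrite eq_sym oner_eq0.
exists lam', kap', p', sg2, j'; split=> // [|l lj|l' lj'].
- have fq : freq (fun t => Phi (('i%C * rc t) *: complexv (- row j lam)) (Phi u5 (sg2 z4))) (Phi (- u) (sg2 0)).
    by rewrite -E yE.
  have := (nc_limit B fq zj').1 (_ : (0 : 'rV[C R]_d) 0 j' = 0).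
  by rewrite mxE mulNmx -row_mul mxE [X in - X]mxE oppr_gt0; apply.
- have [l' zl rE] := cpA l lj; exists l' => //; apply/eqP => lj'.
  by move: zj'; rewrite -lj' zl eqxx.
- apply: cpB; apply/eqP; apply: contraT => h; by move: lj'; rewrite (uniq _ h) eqxx.
Qed.

(** * Finiteness of the set of cones *)

(** Lower semicontinuity of the rank: if P A Q = 1, then P A' Q remains invertible for A' close to
    A. *)
Lemma rank_near c y : atlas X c -> ch_dom c y -> nbhs y [set y' | ch_dom c y' /\
  (\rank (reim (Xm c (ch_to c y))) <= \rank (reim (Xm c (ch_to c y'))))%N].
Proof.
move=> Xc cy; pose X0 := Xm c (ch_to c y); pose A := reim X0.
have [P PE] : exists P, P *m col_base A = 1%:M by apply/row_fullP; exact: col_base_full.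
have [Q QE] : exists Q, row_base A *m Q = 1%:M by apply/row_freeP; exact: row_base_free.
pose r := \rank A.
pose K := r%:R * (k%:R * rn (cmx P) * ((n + n)%:R * rn (cmx Q))) + 1.
have K0 : 0 < K by rewrite ltr_wpDl // !mulr_ge0 ?rn_ge0.
have e0 : 0 < 2^-1 / K by rewrite divr_gt0 // invr_gt0.
have [rr rr0 hr] := fin_all_exists2 (fun i => qhol_cont (field_qhol Hsm Hps i Xc cy) e0).
have near1 : \forall y' \near y, forall i, ch_dom c y' /\ rn (ch_to c y' - ch_to c y) < rr i.
  by apply: filter_forall => i; exact: chart_nbhs_to cy (rr0 i).
have near2 : nbhs y (ch_dom c) by apply: open_nbhs_nbhs; split; [exact: ch_dom_open|].
apply: filterS (filterI near2 near1) => y' [cy' h]; split=> //.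
pose A' := reim (Xm c (ch_to c y')).
have eD : rn (cmx (A' - A)) <= 2^-1 / K.
  apply: rn_mx_le => [|i j]; first exact: ltW.
  have hi : rn (row i (Xm c (ch_to c y')) - row i X0) < 2^-1 / K := hr i _ (h i).2.
  rewrite mxE ab_rc; case: (split_ordP j) => l ->.
    rewrite [(A' - A) i _]mxE [(- A) i _]mxE /A' /A /reim !row_mxEl !mxE; have := le_trans (ab_Re _) (rn_coord (row i (Xm c (ch_to c y')) - row i X0) 0 l).
    by rewrite !mxE raddfB /= => h1; exact: le_trans h1 (ltW hi).
  rewrite [(A' - A) i _]mxE [(- A) i _]mxE /A' /A /reim !row_mxEr !mxE; have := le_trans (ab_Im _) (rn_coord (row i (Xm c (ch_to c y')) - row i X0) 0 l).
  by rewrite !mxE raddfB /= => h1; exact: le_trans h1 (ltW hi).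
have AE : P *m (A *m Q) = 1%:M.
  by rewrite -[A in A *m Q]mulmx_base -mulmxA QE mulmx1 PE.
have U : cmx (P *m (A' *m Q)) \in unitmx.
  apply: near1_unit.
  have -> : cmx (P *m (A' *m Q)) - 1%:M = cmx P *m (cmx (A' - A) *m cmx Q).
    rewrite -!cmxM mulmxBl mulmxBr AE; apply/matrixP => i j.
    by rewrite !mxE rcB; congr (_ - _); case: (i == j).
  apply: le_trans (_ : r%:R * (k%:R * rn (cmx P) * ((n + n)%:R * (2^-1 / K) * rn (cmx Q))) <= _).
    rewrite ler_wpM2l //; apply: le_trans (rn_mulmx _ _) _; rewrite ler_wpM2l ?mulr_ge0 ?rn_ge0 //.
    apply: le_trans (rn_mulmx _ _) _; rewrite ler_wpM2r ?rn_ge0 // ler_wpM2l //.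
  have -> : r%:R * (k%:R * rn (cmx P) * ((n + n)%:R * (2^-1 / K) * rn (cmx Q))) = (K - 1) * (2^-1 / K).
    by rewrite /K addrK; ring.
  by rewrite mulrCA ger_pMr ?invr_gt0 // ler_pdivrMr // mul1r gerBl.
have rk a b (V : 'M[R]_(a, b)) : \rank (cmx V) = \rank V := mxrank_map (real_complex R) V.
have := mxrank_unit U; rewrite rk -/r => <-.
by apply: leq_trans (mxrankM_maxr _ _) _; exact: mxrankM_maxl.
Qed.

Record NC := MkNC { nl : 'M[R]_(d, k); nk : 'M[R]_(k, d); np : M; ns : 'rV[C R]_d -> M;
  ncP : nchart nl nk np ns }.

(** Every ray of B is a ray of A, whence inclusion of the cones ([ncle_cone]). *)
Definition ncle (B A : NC) := forall j, exists l, row j (nl B) = row l (nl A).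

Lemma np_rank c (B : NC) : atlas X c -> ch_dom c (np B) ->
  \rank (reim (Xm c (ch_to c (np B)))) = (k - d)%N.
Proof.
move=> Xc cB; set A := reim _.
have h (v : 'rV[R]_k) : (v <= kermx A)%MS <-> (v <= nl B)%MS.
  rewrite -(gc_lie (nc_gc (ncP B))) -(stab_real) (real_stab _ Xc cB) -/A.
  by split=> [/sub_kermxP|h]; last apply/sub_kermxP.
have E : \rank (kermx A) = d.
  have <- : \rank (nl B) = d := eqP (gc_free (nc_gc (ncP B))).
  by apply/eqP; rewrite eqn_leq !mxrankS //; apply/rV_subP => v /h.
by have := rank_leq_row A; rewrite mxrank_ker in E; rewrite -E; lia.
Qed.

Definition fincone (U : set M) := exists N (F : 'I_N -> NC), forall B, U (np B) -> exists i, ncle B (F i).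

(** If centres of charts accumulate at y, semicontinuity of the rank makes the isotropy of y as
    large as theirs, so a chart is centred on the orbit of y. Nearby centres lie in this chart; all
    their coordinates vanish in their own charts, so [cp_row] finds each of their rays among those
    of the chart at y. *)
Lemma fincone_local (A0 : NC) (y : M) : exists2 U, nbhs y U & fincone U.
Proof.
have [[N [nN h]]|ne] := pselect (exists N, nbhs y N /\ forall B, ~ N (np B)).
  by exists N => //; exists 1%N, (fun=> A0) => B /h.
have hit N : nbhs y N -> exists B, N (np B).
  move=> nN; apply: contrapT => h; case: ne; exists N; split=> // B NB; by apply: h; exists B.
have [c Xc cy] := atlas_cover X y.
have [B0 [cB0 rB0]] := hit _ (rank_near Xc cy); rewrite (np_rank Xc cB0) in rB0.
have [h1 h2 _] := isotropy_count Hsm Hps Mconn eff Xc cy.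
have dk : (d <= k)%N by rewrite -(eqP (gc_free (nc_gc (ncP A0)))) rank_leq_col.
have gp : good_point act c y.
  rewrite /good_point; move: h1 h2 rB0 Hd dk; move: (\rank (reim _)) (\rank (Xm _ _)); clear; lia.
have [e' [lam' [sg' [eE gc']]]] := good_chart_exists Xc cy gp.
have ed : e' = d.
  move: h1 h2 rB0 Hd dk eE; move: (\rank (reim _)) (\rank (Xm _ _)); clear; lia.
move: lam' sg' gc'; rewrite ed => lam' sg' gc'.
have := chart_open 0 0 gc'; rewrite (Phi0 HP) (gc_0 gc') => /hit[B1 [u1 [z1 E1]]].
rewrite -(gc_0 (nc_gc (ncP B1))) in E1.
have [kap' [p' [sg2 [u [A pE]]]]] := nchart_at (ncP B1) gc' E1.
have := chart_open (- u) 0 (nc_gc A); rewrite (gc_0 (nc_gc A)) pE -(PhiD HP) addNr (Phi0 HP) => nU.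
exists [set y' | exists u' z', y' = Phi u' (sg2 z')]; first exact: nU.
exists 1%N, (fun=> MkNC A) => B [u2 [z2 E2]]; exists ord0 => j /=.
rewrite -(gc_0 (nc_gc (ncP B))) in E2.
have E3 : Phi 0 (ns B 0) = Phi u2 (sg2 z2) by rewrite (Phi0 HP).
have zj : (0 : 'rV[C R]_d) 0 j = 0 by rewrite mxE.
by have [l _ rE] := cp_row (ncP B) A E3 zj; exists l.
Qed.

(** Otherwise the complements of the sets meeting only finitely many cones form a proper filter, and
    a cluster point of it contradicts [fincone_local]. *)
Lemma finite_cones (A0 : NC) : exists N (F : 'I_N -> NC), forall B, exists i, ncle B (F i).
Proof.
suff [N [F h]] : fincone setT by exists N, F => B; exact: h.
apply: contrapT => nQ; pose F : set_system M := [set U | fincone (~` U)].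
have FF : Filter F.
  split.
  - by rewrite /F /= setCT; exists 1%N, (fun=> A0).
  - move=> U V [N1 [F1 h1]] [N2 [F2 h2]]; rewrite /F /= setCI.
    exists (N1 + N2)%N, (fun i => match fintype.split i with inl a => F1 a | inr b => F2 b end) => B [/h1|/h2][i hi].
      by exists (unsplit (inl i)); rewrite unsplitK.
    by exists (unsplit (inr i)); rewrite unsplitK.
  - move=> U V UV [N1 [F1 h1]]; exists N1, F1 => B nV; apply: h1 => /UV; exact: nV.
have FP : ProperFilter F.
  by apply: Build_ProperFilter_ex => U FU; apply: contrapT => ne; apply: nQ;
    rewrite -setC0 (_ : set0 = U) //; apply/esym; rewrite -subset0 => x Ux; case: ne; exists x.
have [y [_ hy]] := Hcpt FP filterT; have [U nU QU] := fincone_local A0 y.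
have FU : F (~` U) by rewrite /F /= setCK.
by have [x [nx Ux]] := hy _ _ FU nU.
Qed.

(** * Completeness of the fan and covering of M *)

Lemma nc_trans (A B : NC) (w : 'rV[R]_k) : w *m nk A = w *m nk B *m (nl B *m nk A).
Proof.
by have [eta se {1}->] := nc_kw (ncP B) w; rewrite mulmxDl (nc_kh (ncP A) se).1 add0r !mulmxA.
Qed.

Lemma nc_row_eq (A B : NC) j l i : row j (nl B) = row l (nl A) -> (nl B *m nk A) j i = (i == l)%:R.
Proof.
by move=> rE; have := nc_row (ncP A) l; rewrite -rE -row_mul => /rowP/(_ i); rewrite [LHS]mxE [RHS]mxE eqxx => h; exact: h.
Qed.

Lemma ncle_cone (B A : NC) (w : 'rV[R]_k) : ncle B A -> (forall j, 0 <= (w *m nk B) 0 j) -> forall j, 0 <= (w *m nk A) 0 j.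
Proof.
move=> h w0 j; rewrite (nc_trans A B) mxE sumr_ge0 // => i _; apply: mulr_ge0 => //.
by have [l rE] := h i; rewrite (nc_row_eq _ rE).
Qed.

Lemma near_pos (tau a b : R) : 0 < a + tau * b -> \forall t \near tau, 0 < a + t * b.
Proof.
move=> h; have b0 : 0 < `|b| + 1 by rewrite ltr_wpDl.
pose e := (a + tau * b) / (`|b| + 1); have e0 : 0 < e by rewrite divr_gt0.
have := nbhsx_ballx tau e e0; apply: filterS => t; rewrite -ball_normE /= => te.
have -> : a + t * b = (a + tau * b) - (tau - t) * b by ring.
rewrite subr_gt0; apply: le_lt_trans (ler_norm _) _; rewrite normrM.
apply: le_lt_trans (_ : `|tau - t| * (`|b| + 1) < _); first by rewrite ler_wpM2l // lerDl.
by rewrite -ltr_pdivlMr.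
Qed.

Lemma near_ne (ps : seq (R * R)) : \forall t \near (0 : R), forall x, x \in ps ->
  (x.1 != 0) || (x.2 != 0) -> t != 0 -> x.1 + t * x.2 != 0.
Proof.
elim: ps => [|[a b] ps ih]; first by apply: filterE.
have h : \forall t \near (0 : R), (a != 0) || (b != 0) -> t != 0 -> a + t * b != 0.
  case: (ltgtP a 0) => a0.
  - have : 0 < - a + 0 * - b by rewrite mul0r addr0 oppr_gt0.
    move=> /near_pos; apply: filterS => t; rewrite mulrN -opprD oppr_gt0 => h _ _.
    by rewrite lt_eqF.
  - have : 0 < a + 0 * b by rewrite mul0r addr0.
    by move=> /near_pos; apply: filterS => t h _ _; rewrite gt_eqF.
  - by apply: filterE => t; rewrite a0 /= add0r => b0 t0; rewrite mulf_neq0.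
apply: filterS (filterI h ih) => t [h1 h2] x; rewrite inE => /orP[/eqP ->|xs]; first exact: h1.
exact: h2.
Qed.

Lemma near_all (I : finType) (tau : R) (P : I -> R -> Prop) :
  (forall i, \forall t \near tau, P i t) -> \forall t \near tau, forall i, P i t.
Proof. by move=> h; apply: (@filter_forall _ _ P (nbhs tau)). Qed.

Lemma pick_right (tau u : R) N : nbhs tau N -> tau < u -> exists2 t, tau < t < u & N t.
Proof.
move=> /nbhs_ballP[e /= e0 he] tu; pose m := Num.min e (u - tau).
have m0 : 0 < m by rewrite lt_min e0 subr_gt0.
have m2 : m / 2 < m by rewrite ltr_pdivrMr // ltr_pMr // ltr1n.
exists (tau + m / 2).
  by rewrite ltrDl divr_gt0 //= -ltrBrDl; apply: lt_le_trans m2 _; rewrite ge_min lexx orbT.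
apply: he; rewrite -ball_normE /= opprD addNKr normrN ger0_norm ?divr_ge0 ?(ltW m0) //.
by apply: lt_le_trans m2 _; rewrite ge_min lexx.
Qed.

Lemma generic_dir (fs : seq 'cV[R]_k) : exists g : 'rV[R]_k, forall f, f \in fs -> f != 0 ->
  (g *m f) 0 0 != 0.
Proof.
elim: fs => [|f fs [g hg]]; first by exists 0.
pose ps := [seq ((g *m h) 0 0, (f^T *m h) 0 0) | h <- f :: fs].
have [t /andP[t0 _] ht] := pick_right (near_ne ps) ltr01.
exists (g + t *: f^T) => h hfs h0; rewrite mulmxDl -scalemxAl [X in X != 0]mxE [X in _ + X]mxE.
apply: (ht ((g *m h) 0 0, (f^T *m h) 0 0)); [exact: (map_f (fun h => ((g *m h) 0 0, (f^T *m h) 0 0)))| |by rewrite gt_eqF].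
move: hfs; rewrite inE => /orP[/eqP hE|hf]; last by rewrite /= hg.
apply/orP; right; rewrite /= hE; apply: contra h0 => /eqP.
rewrite mxE => /psumr_eq0P h2; apply/eqP; rewrite hE; apply/colP => i; rewrite [RHS]mxE.
have h3 (l : 'I_k) : true -> 0 <= f^T 0 l * f l 0 by rewrite mxE -expr2 sqr_ge0.
by have /eqP := h2 h3 i isT; rewrite mxE mulf_eq0 orbb => /eqP.
Qed.

Lemma lin_entry (K : 'M[R]_(k, d)) (x y : 'rV[R]_k) (t : R) j :
  ((x + t *: y) *m K) 0 j = (x *m K) 0 j + t * (y *m K) 0 j.
Proof. by rewrite mulmxDl -scalemxAl [LHS]mxE [X in _ + X]mxE. Qed.

Lemma mulmx_col (K : 'M[R]_(k, d)) (x : 'rV[R]_k) j : (x *m col j K) 0 0 = (x *m K) 0 j.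
Proof. by rewrite colE mulmxA -colE mxE. Qed.

(* A generic segment leaving the union of the cones would have to do so through the relative
   interior of a facet, behind which [adjacent] provides another cone. *)
Lemma complete_cones (A0 : NC) (w : 'rV[R]_k) : exists A : NC, forall j, 0 <= (w *m nk A) 0 j.
Proof.
have [N [F hF]] := finite_cones A0; apply: contrapT => nW.
have neg A : exists j, (w *m nk A) 0 j < 0.
  apply: contrapT => ne; apply: nW; exists A => j; rewrite leNgt; apply/negP => h.
  by apply: ne; exists j.
pose col1 (x : 'I_N * 'I_d) := col x.2 (nk (F x.1)).
have [g0 hg0] := generic_dir [seq col1 x | x : 'I_N * 'I_d].
pose b0 : 'rV[R]_k := const_mx 1 *m nl A0.
have b0E j : (b0 *m nk A0) 0 j = 1 by rewrite -mulmxA (nc_lk (ncP A0)) mulmx1 mxE.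
have near1 : \forall t \near (0 : R), forall j, 0 < (b0 *m nk A0) 0 j + t * (g0 *m nk A0) 0 j.
  by apply: near_all => j; apply: near_pos; rewrite b0E mul0r addr0.
pose ps0 := [seq ((b0 *m col1 x) 0 0, (g0 *m col1 x) 0 0) | x : 'I_N * 'I_d].
have [t0 /andP[t00 _] [pos0 ne0]] := pick_right (filterI near1 (near_ne ps0)) ltr01.
pose s0 := b0 + t0 *: g0.
have s0p j : 0 < (s0 *m nk A0) 0 j by rewrite lin_entry.
have colne i j : col j (nk (F i)) != 0.
  apply/eqP => h; have := congr1 (fun m => (row j (nl (F i)) *m m) 0 0) h.
  rewrite mulmx0 mulmx_col (nc_row (ncP (F i))) !mxE !eqxx => /eqP; by rewrite oner_eq0.
have s0n i j : (s0 *m nk (F i)) 0 j != 0.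
  rewrite lin_entry -!mulmx_col.
  apply: (ne0 ((b0 *m col1 (i, j)) 0 0, (g0 *m col1 (i, j)) 0 0)); last by rewrite gt_eqF.
    exact: (map_f (fun x => ((b0 *m col1 x) 0 0, (g0 *m col1 x) 0 0)) (mem_enum _ (i, j))).
  by rewrite [X in _ || X]hg0 ?orbT //; [exact: (map_f col1 (mem_enum _ (i, j)))|exact: colne].
(* If the coordinates a and b of the i-th cone vanish at one point of the segment from s0 to w',
   their values at s0 and w' are proportional and this functional vanishes at w'. Keeping w' off its
   kernel makes the segment avoid the faces of codimension two. *)
pose f3 (x : 'I_N * ('I_d * 'I_d)) : 'cV[R]_k :=
  (s0 *m nk (F x.1)) 0 x.2.1 *: col x.2.2 (nk (F x.1)) -
  (s0 *m nk (F x.1)) 0 x.2.2 *: col x.2.1 (nk (F x.1)).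
have f3E (x : 'rV[R]_k) i a b : (x *m f3 (i, (a, b))) 0 0 =
    (s0 *m nk (F i)) 0 a * (x *m nk (F i)) 0 b - (s0 *m nk (F i)) 0 b * (x *m nk (F i)) 0 a.
  by rewrite /f3 /= mulmxBr -!scalemxAr [LHS]mxE [X in X + _]mxE [X in _ + X]mxE [X in - X]mxE !mulmx_col.
have [g1 hg1] := generic_dir [seq f3 x | x : 'I_N * ('I_d * 'I_d)].
pose ps1 := [seq ((w *m f3 x) 0 0, (g1 *m f3 x) 0 0) | x : 'I_N * ('I_d * 'I_d)].
have near2 : \forall t \near (0 : R), forall i, exists j, 0 < - (w *m nk (F i)) 0 j + t * - (g1 *m nk (F i)) 0 j.
  apply: near_all => i; have [j wj] := neg (F i).
  have : 0 < - (w *m nk (F i)) 0 j + 0 * - (g1 *m nk (F i)) 0 j by rewrite mul0r addr0 oppr_gt0.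
  by move=> /near_pos; apply: filterS => t h; exists j.
have [t1 /andP[t10 _] [out1 ne1]] := pick_right (filterI near2 (near_ne ps1)) ltr01.
pose w' := w + t1 *: g1.
have w'n i : exists j, (w' *m nk (F i)) 0 j < 0.
  by have [j h] := out1 i; exists j; rewrite lin_entry -oppr_gt0 opprD -mulrN.
have w'f i a b : a != b -> (w' *m f3 (i, (a, b))) 0 0 != 0.
  move=> ab; rewrite mulmxDl -scalemxAl [X in X != 0]mxE [X in _ + X]mxE.
  apply: (ne1 ((w *m f3 (i, (a, b))) 0 0, (g1 *m f3 (i, (a, b))) 0 0)); last by rewrite gt_eqF.
    exact: (map_f (fun x => ((w *m f3 x) 0 0, (g1 *m f3 x) 0 0)) (mem_enum _ (i, (a, b)))).
  rewrite [X in _ || X]hg1 ?orbT //; first exact: (map_f f3 (mem_enum _ (i, (a, b)))).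
  apply/eqP => h; have := congr1 (fun m => (row b (nl (F i)) *m m) 0 0) h.
  rewrite mulmx0 f3E (nc_row (ncP (F i))) !mxE !eqxx (negbTE ab) /= mulr1 mulr0 subr0.
  by apply/eqP; have := s0n i a; rewrite mxE.
pose v := w' - s0; pose st t := s0 + t *: v.
have stE t A j : (st t *m nk A) 0 j = (s0 *m nk A) 0 j + t * (v *m nk A) 0 j by rewrite lin_entry.
pose E : set R := [set t | 0 <= t <= 1 /\ exists i, forall j, 0 <= (st t *m nk (F i)) 0 j].
have E0 : E 0.
  split; first by rewrite lexx ler01.
  have [i hi] := hF A0; exists i; apply: (ncle_cone hi) => j.
  by rewrite stE mul0r addr0 ltW.
have E1 : ubound E 1 by move=> t [/andP[_ ->]].
have sE : has_sup E by split; [exists 0|exists 1].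
pose tau := sup E.
have tau0 : 0 <= tau by exact: (ub_le_sup sE.2 E0).
have tau1 : tau <= 1 by apply: ge_sup => //; exists 0.
have inE t : tau < t < 1 -> ~ exists i, forall j, 0 <= (st t *m nk (F i)) 0 j.
  move=> /andP[h1 h2] hi; have Et : E t by split=> //; rewrite (ltW h2) (le_trans tau0 (ltW h1)).
  by have := ub_le_sup sE.2 Et; rewrite leNgt h1.
(* The supremum is attained: lying strictly outside each of finitely many cones is an open
   condition. *)
have [i hi] : exists i, forall j, 0 <= (st tau *m nk (F i)) 0 j.
  apply: contrapT => ne.
  have neg2 i : exists j, (st tau *m nk (F i)) 0 j < 0.
    apply: contrapT => ne2; apply: ne; exists i => j; rewrite leNgt; apply/negP => h.
    by apply: ne2; exists j.
  have : \forall t \near tau, forall i, exists j, 0 < - (s0 *m nk (F i)) 0 j + t * - (v *m nk (F i)) 0 j.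
    apply: near_all => i; have [j] := neg2 i; rewrite stE -oppr_gt0 opprD -mulrN => /near_pos.
    by apply: filterS => t h; exists j.
  move=> /nbhs_ballP[e /= e0 he]; have [t [Et1 [i hi]] te] := sup_adherent e0 sE.
  have tt : t <= tau by apply: (ub_le_sup sE.2); split=> //; exists i.
  have [|j] := he t _ i.
    by rewrite -ball_normE /= ger0_norm ?subr_ge0 // ltrBlDr -ltrBlDl.
  by rewrite mulrN -opprD -stE oppr_gt0 ltNge hi.
have tlt : tau < 1.
  rewrite lt_neqAle tau1 andbT; apply/eqP => t1E; have [j] := w'n i.
  have -> : w' = st tau by rewrite /st t1E scale1r addrC subrK.
  by rewrite ltNge hi.
have two j j2 : (st tau *m nk (F i)) 0 j = 0 -> (st tau *m nk (F i)) 0 j2 = 0 -> j = j2.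
  rewrite !stE => h1 h2; apply/eqP; apply: contraT => jj; have := w'f i j j2 jj.
  have w'E l : (w' *m nk (F i)) 0 l = (s0 *m nk (F i)) 0 l + (v *m nk (F i)) 0 l.
    have -> : w' = s0 + 1 *: v by rewrite scale1r addrC subrK.
    by rewrite lin_entry mul1r.
  rewrite f3E !w'E; have := s0n i j.
  move: h1 h2; move: ((s0 *m _) 0 j) ((s0 *m _) 0 j2) ((v *m _) 0 j) ((v *m _) 0 j2) => a b c e h1 h2 a0.
  have t0' : tau != 0 by apply: contra a0 => /eqP t0E; move: h1; rewrite t0E mul0r addr0 => ->.
  move=> /eqP; case; apply: (mulfI t0'); rewrite mulr0.
  have -> : tau * (a * (b + e) - b * (a + c)) = a * (b + tau * e) - b * (a + tau * c) by ring.
  by rewrite h1 h2 !mulr0 subrr.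
have pos j : (st tau *m nk (F i)) 0 j != 0 -> 0 < (st tau *m nk (F i)) 0 j.
  by move=> h; rewrite lt_neqAle eq_sym h hi.
have [[j jz]|nz] := pselect (exists j, (st tau *m nk (F i)) 0 j = 0); last first.
  have : \forall t \near tau, forall j, 0 < (s0 *m nk (F i)) 0 j + t * (v *m nk (F i)) 0 j.
    apply: near_all => j; apply: near_pos; rewrite -stE; apply: pos; apply/eqP => h.
    by apply: nz; exists j.
  move=> /pick_right/(_ tlt)[t tt h]; apply: (inE t tt); exists i => j; rewrite stE ltW //.
have [lam' [kap' [p' [sg' [j' [B ng f1 f2]]]]]] := adjacent (ncP (F i)) j.
pose B' := MkNC B; have [i2 le2] := hF B'.
pose T := nl (F i) *m kap'.
have T0 m l : m != j -> T m l = 0 \/ T m l = 1.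
  move=> mj; have [m' _ rE] := f1 m mj; rewrite /T (nc_row_eq (A := B') (B := F i) _ rE).
  by case: eqP => _; [right|left].
have near3 : \forall t \near tau, forall l, l != j -> 0 < (s0 *m nk (F i)) 0 l + t * (v *m nk (F i)) 0 l.
  apply: near_all => l; case: (eqVneq l j) => [->|lj]; first by apply: filterE => t.
  have : 0 < (s0 *m nk (F i)) 0 l + tau * (v *m nk (F i)) 0 l.
    by rewrite -stE; apply: pos; apply/eqP => h; move: lj; rewrite (two l j h jz) eqxx.
  by move=> /near_pos; apply: filterS.
have near4 : \forall t \near tau, forall l', l' != j' -> 0 < (s0 *m nk B') 0 l' + t * (v *m nk B') 0 l'.
  apply: near_all => l'; case: (eqVneq l' j') => [->|lj']; first by apply: filterE => t.
  have : 0 < (s0 *m nk B') 0 l' + tau * (v *m nk B') 0 l'.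
    have [l lj rE] := f2 l' lj'; rewrite -stE (nc_trans B' (F i)) mxE (bigD1 l) //=.
    apply: ltr_pwDl.
      rewrite (nc_row_eq (A := B') (B := F i) _ rE) eqxx mulr1; apply: pos; apply/eqP => h.
      by move: lj; rewrite (two l j h jz) eqxx.
    apply: sumr_ge0 => m _; case: (eqVneq m j) => [->|mj]; first by rewrite jz mul0r.
    by apply: mulr_ge0 => //; have [->|->] := T0 m l' mj.
  by move=> /near_pos; apply: filterS.
have [t tt [h3 h4]] := pick_right (filterI near3 near4) tlt.
(* Just after tau the j-th coordinate alone decides: if it is nonnegative the segment is still in
   the i-th cone, and if it is negative its product with the negative coefficient of [adjacent] is
   positive, so the segment is in the adjacent cone. *)
have [x0'|x0'] := lerP 0 ((st t *m nk (F i)) 0 j).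
  apply: (inE t tt); exists i => l; case: (eqVneq l j) => [->|lj] //.
  by rewrite stE ltW // h3.
apply: (inE t tt); exists i2; apply: (ncle_cone le2) => l'.
case: (eqVneq l' j') => [->|lj']; last by rewrite stE ltW // h4.
rewrite (nc_trans B' (F i)) mxE (bigD1 j) //= big1 ?addr0 => [|m mj].
  by rewrite ltW // nmulr_rgt0.
have [m' mj' rE] := f1 m mj; rewrite (nc_row_eq (A := B') (B := F i) _ rE) eq_sym (negbTE mj').
by rewrite mulr0.
Qed.

(** By completeness of the fan, the finitely many compact sets K i contain the orbit of x0. This
    orbit is dense in the union S of the charts, so the closure of S is contained in the union of
    the K i, hence in S. As S is open, connectedness concludes. *)
Lemma charts_cover (A0 : NC) (y : M) : exists (A : NC) u z, y = Phi u (ns A z).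
Proof.
have [N [F hF]] := finite_cones A0.
pose S : set M := [set y | exists (A : NC) u z, y = Phi u (ns A z)].
suff h : S = setT by have : [set: M] y by []; rewrite -h.
have orb u (A : NC) z U : nbhs (Phi u (ns A z)) U -> exists a, U (Phi a x0).
  move=> /(Phi_cont2)[e e0 [V nV VU]]; have [a Va] := orbit_dense (ncP A) nV.
  by exists (u + a); rewrite (PhiD HP); apply: VU => //; rewrite subrr rn0.
pose K i := Kset (ns (F i)).
have cK i : closed (K i) := kset_closed (ncP (F i)).
have OK a : exists i, K i (Phi a x0).
  have [A hA] := complete_cones A0 (imagpart a); have [i hi] := hF A; exists i.
  exact: (kset_in (ncP (F i)) (ncle_cone hi hA)).
have nK y' : (forall i, ~ K i y') -> \forall y'' \near y', forall i, ~ K i y''.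
  move=> h; apply: filter_forall => i; apply: open_nbhs_nbhs; split; last exact: h.
  by rewrite openC; exact: cK.
apply: Mconn; first by exists x0; exists A0, 0, (onev d); rewrite (Phi0 HP) (nc_x0 (ncP A0)).
  exists S; rewrite ?setTI // openE => _ [A [u [z ->]]].
  apply: filterS (chart_open u z (nc_gc (ncP A))) => y' [u' [z' ->]].
  by exists A, u', z'.
exists S; rewrite ?setTI // => y' cy'.
suff [i Ki] : exists i, K i y'.
  by have [u [z ->]] := kset_V Ki; exists (F i), u, z.
apply: contrapT => ne; have h i : ~ K i y' by move=> Ki; apply: ne; exists i.
have [s [[A [u [z sE]]] Us]] := cy' _ (nK y' h).
have := nK s Us; rewrite sE => /orb[a ha]; have [i Ki] := OK a; exact: (ha i Ki).
Qed.
End ComplexAction.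

(** * Cones and functionals on the quotient space *)

Section QuotientFunctionals.
Context {R : realType} {m : nat} (h : {vspace 'rV[C R]_m}).

Lemma q_eq (u v : 'rV[R]_m) : q h u = q h v <-> exists2 z, z \in h & u - v = realpart z.
Proof.
split=> [/eqP|zE].
  by rewrite /q /quotient_proj -Quotient.idealrBE => /asboolP.
by apply/eqP; rewrite /q /quotient_proj -Quotient.idealrBE; apply/asboolP.
Qed.

Lemma qD (u v : 'rV[R]_m) : q h (u + v) = q h u + q h v.
Proof. exact: quotient_projD. Qed.

Lemma qZ (a : R) (u : 'rV[R]_m) : q h (a *: u) = a *: q h u.
Proof. by symmetry; exact: quotient_scaleE. Qed.

Lemma q_expand (a : 'rV[R]_m) : q h a = \sum_i a 0 i *: q h (delta_mx 0 i).
Proof.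
rewrite {1}(row_sum_delta a).
have q0 : q h 0 = 0 by rewrite -(scale0r (0 : 'rV[R]_m)) qZ scale0r.
by rewrite (big_morph _ qD q0); apply: eq_bigr => i _; rewrite qZ.
Qed.

(** The supporting functionals of faces live on the quotient; they are given by column vectors that
    vanish on the real parts of h. *)
Lemma qfun_exists (Psi : 'cV[R]_m) : (forall z, z \in h -> realpart z *m Psi = 0) ->
  exists u : {scalar t_mod_ph h}, forall v, u (q h v) = (v *m Psi) 0 0.
Proof.
move=> hP; pose f (x : t_mod_ph h) : R := (projT1 (cid (quotient_proj_surj x)) *m Psi) 0 0.
have fE v : f (q h v) = (v *m Psi) 0 0.
  rewrite /f; case: cid => w /= /q_eq[z zh zE].
  by rewrite -[v](subrK w) zE mulmxDl hP // add0r.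
have lin : linear_for *%R f.
  move=> a x y; have [v ->] := quotient_proj_surj x; have [w ->] := quotient_proj_surj y.
  rewrite -[quotient_proj _ v]/(q h v) -[quotient_proj _ w]/(q h w) -qZ -qD !fE.
  by rewrite mulmxDl -scalemxAl [LHS]mxE [X in X + _]mxE.
pose F := GRing.isLinear.Build R (t_mod_ph h) R *%R f lin.
pose g : {scalar t_mod_ph h} := HB.pack f F.
by exists g.
Qed.

Lemma coneP (S : {set 'I_m}) (a : 'rV[R]_m) :
  coord_cone S a <-> (forall i, 0 <= a 0 i) /\ forall i, i \notin S -> a 0 i = 0.
Proof.
have E (mu : 'I_m -> R) i : (\sum_(j in S) mu j *: delta_mx 0 j : 'rV[R]_m) 0 i = if i \in S then mu i else 0.
  rewrite summxE; case: ifPn => iS.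
    rewrite (bigD1 i) //= big1 ?addr0 => [|j /andP[_ ji]]; first by rewrite !mxE !eqxx mulr1.
    by rewrite !mxE eq_sym (negbTE ji) andbF mulr0.
  rewrite big1 // => j jS; rewrite !mxE; case: (eqVneq i j) => [ij|_]; last by rewrite andbF mulr0.
  by move: iS; rewrite ij jS.
split=> [[mu mu0 <-]|[a0 aS]].
  by split=> i; rewrite E; [case: ifP|move=> /negbTE ->].
exists (fun i => a 0 i) => //; apply/rowP => i; rewrite E; case: ifPn => // /aS.
by move=> ->.
Qed.

Lemma face_cone (S : {set 'I_m}) (u : {scalar t_mod_ph h}) :
  (forall i, i \in S -> 0 <= u (q h (delta_mx 0 i))) ->
  (q h @` coord_cone S) `&` [set x | u x = 0] =
  q h @` coord_cone [set i in S | u (q h (delta_mx 0 i)) == 0]%SET.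
Proof.
move=> u0; have uE a : u (q h a) = \sum_i a 0 i * u (q h (delta_mx 0 i)).
  by rewrite q_expand linear_sum; apply: eq_bigr => i _; rewrite linearZ.
apply/seteqP; split=> [x [[a /coneP[a0 aS] <-]]|x [a /coneP[a0 aS] <-]] /=.
  rewrite uE => /psumr_eq0P h0; exists a => //; apply/coneP; split=> // i; rewrite inE negb_and.
  have {}h0 : a 0 i * u (q h (delta_mx 0 i)) = 0.
    apply: h0 => // j _; have [jS|jS] := boolP (j \in S); last by rewrite aS // mul0r.
    by rewrite mulr_ge0 // u0.
  by move=> /orP[/aS //|ui]; apply/eqP; move/eqP: h0; rewrite mulf_eq0 (negbTE ui) orbF.
split; last first.
  rewrite uE big1 // => i _; have [|/aS ->] := boolP (i \in [set i in S | u (q h (delta_mx 0 i)) == 0]%SET).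
    by rewrite inE => /andP[_ /eqP ->]; rewrite mulr0.
  by rewrite mul0r.
exists a => //; apply/coneP; split=> // i iS; apply: aS; by rewrite inE negb_and iS.
Qed.

Lemma polyhedral_q (S : {set 'I_m}) : polyhedral_cone (q h @` coord_cone S).
Proof.
exists m, (fun i => if i \in S then q h (delta_mx 0 i) else 0).
apply/seteqP; split=> [x [a /coneP[a0 aS] <-]|x [mu mu0 <-]].
  exists (fun i => a 0 i) => //; rewrite [RHS]q_expand; apply: eq_bigr => i _.
  by case: ifPn => // /aS ->; rewrite !scale0r.
exists (\row_i if i \in S then mu i else 0).
  by apply/coneP; split=> i; rewrite mxE; [case: ifP|move=> /negbTE ->].
rewrite q_expand; apply: eq_bigr => i _; rewrite mxE.
by case: ifP => //; rewrite scale0r scaler0.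
Qed.
End QuotientFunctionals.

(** * Transport of a complex structure along a homeomorphism *)

Section Transport.
Context {R : realType} {M Q : topologicalType} {n : nat} (X : complexManifold R M n).
Context (f : Q -> M) (g : M -> Q) (fK : cancel f g) (gK : cancel g f).
Context (cf : continuous f) (cg : continuous g).

Lemma pull_cod (c : chart R M n) : (ch_to c \o f) @` (f @^-1` ch_dom c) = ch_to c @` ch_dom c.
Proof.
apply/seteqP; split=> [w [x cx <-]|w [x cx <-]]; first by exists (f x).
by exists (g x); rewrite /= gK.
Qed.

Lemma pull_dom_open (c : chart R M n) : open (f @^-1` ch_dom c).
Proof. by move/continuousP: cf; apply; exact: ch_dom_open. Qed.

Lemma pull_cod_open (c : chart R M n) : open ((ch_to c \o f) @` (f @^-1` ch_dom c)).
Proof. rewrite pull_cod; exact: ch_cod_open. Qed.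

Lemma pull_toK (c : chart R M n) : {in f @^-1` ch_dom c, cancel (ch_to c \o f) (g \o ch_of c)}.
Proof. by move=> x /set_mem cx; rewrite /= ch_toK' // fK. Qed.

Lemma pull_to_continuous (c : chart R M n) : {within f @^-1` ch_dom c, continuous (ch_to c \o f)}.
Proof.
rewrite (continuous_open_subspace _ (pull_dom_open c)) => x /set_mem cx.
have := @ch_to_continuous _ _ _ c; rewrite (continuous_open_subspace _ (ch_dom_open c)) => h.
by apply: continuous_comp; [exact: cf|apply: h; exact/mem_set].
Qed.

Lemma pull_of_continuous (c : chart R M n) :
  {within (ch_to c \o f) @` (f @^-1` ch_dom c), continuous (g \o ch_of c)}.
Proof.
rewrite pull_cod (continuous_open_subspace _ (ch_cod_open (c := c))) => x xc.
have := @ch_of_continuous _ _ _ c; rewrite (continuous_open_subspace _ (ch_cod_open (c := c))) => h.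
by apply: continuous_comp; [exact: h|exact: cg].
Qed.

Definition pull_chart (c : chart R M n) : chart R Q n :=
  Chart (@pull_dom_open c) (@pull_cod_open c) (@pull_toK c) (@pull_to_continuous c) (@pull_of_continuous c).

Lemma pull_hausdorff : hausdorff_space Q.
Proof.
have := manifold_hausdorff X; rewrite !open_hausdorff => H x y xy.
have [|[A B] /= [xA yB] [oA oB AB]] := H (f x) (f y).
  by apply: contra xy => /eqP/(can_inj fK) ->.
exists (f @^-1` A, f @^-1` B) => /=.
  by split; apply/mem_set; exact: set_mem.
split; [by move/continuousP: cf; apply|by move/continuousP: cf; apply|].
by rewrite -preimage_setI (eqP AB) preimage_set0.
Qed.

Lemma pull_second_countable : @second_countable Q.
Proof.
have [B cB [oB bB]] := manifold_second_countable X.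
exists [set f @^-1` U | U in B]; first exact: card_le_trans (card_image_le _ _) cB.
split=> [_ [U /oB oU <-]|x N nN]; first by move/continuousP: cf; apply.
have [|U [BU Ux] UN] := bB (f x) (g @^-1` N); first by apply: cg; rewrite fK.
exists (f @^-1` U); first by split=> //; exists U.
by move=> y Uy; have := UN _ Uy; rewrite /= fK.
Qed.

Lemma pull_manifold : exists Y : complexManifold R Q n,
  atlas Y = [set pull_chart c | c in atlas X] /\ biholomorphic Y X f.
Proof.
have ac x : exists2 c, [set pull_chart c | c in atlas X] c & ch_dom c x.
  by have [c Xc cx] := atlas_cover X (f x); exists (pull_chart c) => //; exists c.
have comp (c c' : chart R M n) x : atlas X c -> atlas X c' -> ch_dom c x -> ch_dom c' x ->
    differentiable (ch_to c' \o ch_of c) (ch_to c x) by move=> Xc Xc' cx cx'; exact: (@atlas_compat _ _ _ X c c').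
have E (c c' : chart R M n) : (ch_to c' \o f) \o (g \o ch_of c) = ch_to c' \o ch_of c.
  by apply/funext => w; rewrite /= gK.
have acm c c' : [set pull_chart c | c in atlas X] c -> [set pull_chart c | c in atlas X] c' ->
    forall x, ch_dom c x -> ch_dom c' x -> differentiable (ch_to c' \o ch_of c) (ch_to c x).
  move=> [c1 X1 <-] [c2 X2 <-] x /= h1 h2; rewrite E; exact: comp.
exists (ComplexManifold ac acm pull_hausdorff pull_second_countable); split=> //.
split; first split=> //.
  move=> c c' [c1 X1 <-] X2 x /= h1 h2.
  have h := comp c1 c' (f x) X1 X2 h1 h2; rewrite -(E c1 c') in h; exact: h.
exists g; split=> //; split=> // c c' X1 [c2 X2 <-] x h1 /=; rewrite gK => h2.
have h := comp c c2 x X1 X2 h1 h2; rewrite -(E c c2) in h; exact: h.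
Qed.
End Transport.

(** * Gluing the charts to a map from U(K) to M *)

Section Rel.
Context {R : realType} {M : topologicalType} {n : nat}.
Context (X : complexManifold R M n) (k : nat) (act : 'rV[C R]_k -> M -> M).
Context (Hsm : smooth_action X act) (Hps : preserves_complex_structure X act).
Context (Phi : 'rV[C R]_k -> M -> M) (HP : complex_flow X act Phi).
Context (d : nat) (Hd : (k + d)%N = n.*2) (x0 : M).
Context (Hcpt : compact [set: M]) (Mconn : connected [set: M]) (eff : effective act).

Local Notation stab := (stab Phi).
Local Notation NC := (@NC R M n X k act Phi d x0).
Local Notation subm := (subm X).
Local Notation hol := (hol X).

(** [Lam] is the differential of a homomorphism from the torus of dimension m onto that of dimension
    k. The numbering [ix] gives a ray shared by several charts a single index. The last two
    hypotheses say that [Lam] maps periods to periods and that every period is the image of a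
    period. *)
Context (A0 : NC) (m : nat) (Lam : 'M[R]_(m, k)) (ix : NC -> 'I_d -> 'I_m).
Hypothesis ixrow : forall A j, row (ix A j) Lam = row j (nl A).
Hypothesis ixeq : forall A B j l, row j (nl A) = row l (nl B) -> ix A j = ix B l.
Hypothesis Lfull : row_full Lam.
Hypothesis Lint : forall u : 'rV[R]_m, (forall a, cis (u 0 a) = 1) -> Exp (complexv (u *m Lam)) = onev k.
Hypothesis Llift : forall N : 'rV[R]_k, Exp (complexv N) = onev k ->
  exists2 u : 'rV[R]_m, u *m Lam = N & forall a, cis (u 0 a) = 1.

Definition ixmx A : 'M[R]_(d, m) := \matrix_(j, a) (a == ix A j)%:R.

Lemma ix_inj A : injective (ix A).
Proof.
move=> i j h; apply: (nc_rowneq (ncP A)); by rewrite -!ixrow h.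
Qed.

Lemma ixP A a : (exists j, a = ix A j) \/ forall j, a == ix A j = false.
Proof.
have [[j h]|h] := pselect (exists j, a = ix A j); first by left; exists j.
by right=> j; apply/eqP => h'; apply: h; exists j.
Qed.

Lemma row_ixmx A j : row j (ixmx A) = delta_mx 0 (ix A j).
Proof. by apply/rowP => a; rewrite !mxE eqxx. Qed.

Lemma ixmx_Lam A : ixmx A *m Lam = nl A.
Proof. by apply/row_matrixP => j; rewrite row_mul row_ixmx -rowE ixrow. Qed.

Lemma mul_ixmx A (b : 'rV[R]_d) j : (b *m ixmx A) 0 (ix A j) = b 0 j.
Proof.
rewrite mxE (bigD1 j) //= big1 ?addr0 => [|i ij]; first by rewrite mxE eqxx mulr1.
rewrite mxE; case: eqP => [/ix_inj h|_]; last by rewrite mulr0.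
by move: ij; rewrite h eqxx.
Qed.

Lemma mul_ixmx0 A (b : 'rV[R]_d) a : (forall j, a == ix A j = false) -> (b *m ixmx A) 0 a = 0.
Proof. by move=> h; rewrite mxE big1 // => j _; rewrite mxE h mulr0. Qed.

Lemma mul_cixmx A (b : 'rV[C R]_d) j : (b *m cmx (ixmx A)) 0 (ix A j) = b 0 j.
Proof.
rewrite mxE (bigD1 j) //= big1 ?addr0 => [|i ij]; first by rewrite !mxE eqxx mulr1.
rewrite !mxE; case: eqP => [/ix_inj h|_]; last by rewrite mulr0.
by move: ij; rewrite h eqxx.
Qed.

Lemma mul_cixmx0 A (b : 'rV[C R]_d) a : (forall j, a == ix A j = false) -> (b *m cmx (ixmx A)) 0 a = 0.
Proof. by move=> h; rewrite mxE big1 // => j _; rewrite !mxE h mulr0. Qed.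

(** Coordinates that are not rays of A are set to 1 rather than 0, so that [ins A] is multiplicative
    and sends exponentials to exponentials. *)
Definition off A : 'rV[C R]_m := \row_a (if [exists j, a == ix A j] then 0 else 1).
Definition ins A (y : 'rV[C R]_d) : 'rV[C R]_m := y *m cmx (ixmx A) + off A.

Lemma ins_ix A y j : ins A y 0 (ix A j) = y 0 j.
Proof.
rewrite mxE mul_cixmx [X in _ + X]mxE ifT ?addr0 //; apply/existsP; by exists j.
Qed.

Lemma ins_off A y a : (forall j, a == ix A j = false) -> ins A y 0 a = 1.
Proof.
move=> h; rewrite mxE mul_cixmx0 // add0r mxE; case: existsP => // -[j]; by rewrite h.
Qed.

Lemma cexp0 : cexp (0 : C R) = 1.
Proof. by rewrite -[X in cexp X](mulr0 'i%C) -rc0 cexp_i cis0. Qed.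

Lemma Exp_ixmx A b : Exp (b *m cmx (ixmx A)) = ins A (Exp b).
Proof.
apply/rowP => a; have [[j ->]|h] := ixP A a.
  by rewrite ins_ix [LHS]mxE mul_cixmx [RHS]mxE.
by rewrite ins_off // mxE mul_cixmx0 // mulr0 cexp0.
Qed.

Lemma ins_mulv A y y' : mulv (ins A y) (ins A y') = ins A (mulv y y').
Proof.
apply/rowP => a; rewrite [LHS]mxE; have [[j ->]|h] := ixP A a.
  by rewrite !ins_ix mxE.
by rewrite !ins_off // mulr1.
Qed.

Lemma cexp_abs1 (x : C R) : ab (cexp ('i%C * x)) = 1 -> x = rc (complex.Re x).
Proof.
rewrite ab_cexp_i -[RHS]expR0 => /expR_inj /eqP; rewrite oppr_eq0 => /eqP.
by case: x => a b /= ->.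
Qed.

Lemma period l l' y : Exp l = Exp l' -> Phi (l *m cmx Lam) y = Phi (l' *m cmx Lam) y.
Proof.
move=> h; have h1 a : cexp ('i%C * (l - l') 0 a) = 1.
  have /rowP/(_ a) := h; rewrite [LHS]mxE [RHS]mxE => E.
  apply: (mulIf (cexp_neq0 ('i%C * l' 0 a))); rewrite -cexpD mul1r -E; congr cexp.
  by rewrite [(l - l') 0 a]mxE [(- l') 0 a]mxE; ring.
have E : l = l' + complexv (realpart (l - l')).
  have -> : complexv (realpart (l - l')) = l - l'.
    apply/rowP => a; rewrite [LHS]mxE [realpart _ 0 a]mxE; symmetry; apply: cexp_abs1.
    by rewrite h1 ab1.
  by rewrite addrC subrK.
rewrite E mulmxDl -complexv_mul addrC (PhiD HP) (Phi_ker Hsm HP) //; apply: Lint => a.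
by rewrite -(h1 a) -cexp_i; congr (cexp ('i%C * _)); rewrite [realpart _ 0 a]mxE; symmetry;
  apply: cexp_abs1; rewrite h1 ab1.
Qed.

(** The graph of the map U(K) -> M, described chart by chart. A relation is used because a point z
    has many presentations, in one chart as well as in several; [Rel_fun] shows that they agree. *)
Definition Rel z y := exists A l y0, z = mulv (Exp l) (ins A y0) /\ y = Phi (l *m cmx Lam) (ns A y0).

Lemma Rel_Exp A l b : mulv (Exp l) (ins A (Exp b)) = Exp (l + b *m cmx (ixmx A)) /\
  Phi (l *m cmx Lam) (ns A (Exp b)) = Phi ((l + b *m cmx (ixmx A)) *m cmx Lam) x0.
Proof.
split; first by rewrite -Exp_ixmx ExpD.
have cM : cmx (ixmx A) *m cmx Lam = cmx (nl A) by rewrite -cmxM ixmx_Lam.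
have E0 : Phi (b *m cmx (nl A)) (ns A (onev d)) = ns A (Exp b).
  by rewrite (gc_eq (nc_gc (ncP A))) mulv1.
by rewrite (nc_x0 (ncP A)) in E0; rewrite mulmxDl -mulmxA cM (PhiD HP) E0.
Qed.

(** Replacing the zero coordinates of z by a small e' gives a point exp w of the complex torus whose
    image in the orbit of x0 is close to y. The approximating point depends on z and e' but on no
    presentation, so two values at z cannot be separated. *)
Lemma Rel_near z y N : Rel z y -> nbhs y N -> exists2 e : R, 0 < e & forall e', 0 < e' -> e' < e ->
  exists2 w, Exp w = \row_a (if z 0 a == 0 then rc e' else z 0 a) & N (Phi (w *m cmx Lam) x0).
Proof.
move=> [A [l [y0 [zE ->]]]] nN.
have [d1 d10 [U nU dU]] := Phi_cont2 Hsm Hps HP nN.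
have [d2 d20 h2] := gc_cont HP (nc_gc (ncP A)) nU.
pose F a := ab ((Exp l 0 a)^-1); pose S := 1 + \sum_a F a.
have F0 a : 0 <= F a by exact: ab_ge0.
have S0 : 0 < S by rewrite ltr_pwDl ?sumr_ge0.
have FS a : F a <= S by rewrite /S (bigD1 a) //= addrCA lerDl addr_ge0 ?sumr_ge0.
exists (d2 / S); first by rewrite divr_gt0.
move=> e e0 eS; pose y1 : 'rV[C R]_d := \row_j if y0 0 j == 0 then rc e / Exp l 0 (ix A j) else y0 0 j.
have El a : Exp l 0 a != 0 by rewrite mxE cexp_neq0.
have [|b bE] := torus_log (z := y1).
  move=> j; rewrite mxE; case: ifP => [_|/negbT //].
  by rewrite mulf_neq0 ?invr_neq0 // rc_eq0 gt_eqF.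
have [E1 E2] := Rel_Exp A l b.
exists (l + b *m cmx (ixmx A)).
  rewrite -E1 bE; apply/rowP => a; rewrite [LHS]mxE [RHS]mxE zE.
  have -> : mulv (Exp l) (ins A y0) 0 a = Exp l 0 a * ins A y0 0 a by rewrite [LHS]mxE.
  have [[j ->]|h] := ixP A a; last by rewrite !ins_off // mulr1 (negbTE (El a)).
  rewrite !ins_ix mulf_eq0 (negbTE (El _)) /= [y1 0 j]mxE; case: ifP => // _.
  by rewrite mulrC divfK.
rewrite -E2 bE; apply: dU; first by rewrite subrr rn0.
apply: h2; apply: le_lt_trans (_ : e * S < d2); last by rewrite -ltr_pdivlMr.
apply: rn_mx_le => [|i j]; first by rewrite mulr_ge0 // ltW.
rewrite ord1 !mxE; case: eqP => [->|_]; last by rewrite subrr ab0 mulr_ge0 // ltW.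
rewrite subr0 abM ab_rc gtr0_norm // ler_pM2l //; have := FS (ix A j); by rewrite /F mxE.
Qed.

Lemma Rel_fun z y y' : Rel z y -> Rel z y' -> y = y'.
Proof.
move=> r r'; apply: contrapT => ne.
have [N [N' [nN nN' NN]]] := hausdorff_sep (manifold_hausdorff X) ne.
have [e e0 he] := Rel_near r nN; have [e' e'0 he'] := Rel_near r' nN'.
pose q := Num.min e e' / 2; have m0 : 0 < Num.min e e' by rewrite lt_min e0.
have q0 : 0 < q by rewrite divr_gt0.
have qm : q < Num.min e e' by rewrite ltr_pdivrMr // ltr_pMr // ltr1n.
move: qm; rewrite lt_min => /andP[q1 q2].
have [w wE Nw] := he q q0 q1; have [w' wE' Nw'] := he' q q0 q2.
by apply: (NN _ Nw); rewrite (period (l' := w')) // wE wE'.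
Qed.

Lemma Rel_Phi z y v : Rel z y -> Rel (mulv (Exp v) z) (Phi (v *m cmx Lam) y).
Proof.
move=> [A [l [y0 [-> ->]]]]; exists A, (v + l), y0; split; first by rewrite mulvA ExpD.
by rewrite mulmxDl (PhiD HP).
Qed.

Lemma Rel_form A (z : 'rV[C R]_m) : (forall a, z 0 a = 0 -> exists j, a = ix A j) ->
  exists l y0, z = mulv (Exp l) (ins A y0).
Proof.
move=> h; pose ze : 'rV[C R]_m := \row_a if z 0 a == 0 then 1 else z 0 a.
have [|l lE] := torus_log (z := ze).
  by move=> a; rewrite mxE; case: ifP => [_|/negbT //]; rewrite oner_neq0.
exists l, (\row_j (z 0 (ix A j) != 0)%:R); rewrite lE; apply/rowP => a; rewrite [RHS]mxE.
have [[j ->]|ha] := ixP A a.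
  rewrite ins_ix !mxE; by case: eqP => [->|_] /=; rewrite ?mulr0 ?mulr1.
rewrite ins_off // mulr1 mxE; case: eqP => // /h[j aj].
by have := ha j; rewrite aj eqxx.
Qed.

Lemma Rel_zero (z : 'rV[C R]_m) y A l y0 : z = mulv (Exp l) (ins A y0) -> y = Phi (l *m cmx Lam) (ns A y0) ->
  forall a, z 0 a = 0 -> exists2 j, a = ix A j & y0 0 j = 0.
Proof.
move=> -> _ a; rewrite mxE => /eqP; rewrite mulf_eq0 mxE (negbTE (cexp_neq0 _)) /=.
have [[j ->]|ha] := ixP A a; first by rewrite ins_ix => /eqP; exists j.
by rewrite ins_off // oner_eq0.
Qed.

(** The zero coordinates of z' are rays of a chart around y, hence by [cp_row] rays of A, so z' can
    be presented in the chart A as well. Inside one chart [nc_form] describes the difference of the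
    parameters, and its period lifts to C^m. *)
Lemma Rel_fiber z z' y : Rel z y -> Rel z' y ->
  exists2 v, stab (v *m cmx Lam) x0 & z' = mulv (Exp v) z.
Proof.
move=> [A [l [y0 [zE yE]]]] r'; have [B [l' [y0' [zE' yE']]]] := r'.
have E : Phi (l *m cmx Lam) (ns A y0) = Phi (l' *m cmx Lam) (ns B y0') by rewrite -yE.
have [a za|l2 [y2 z2E]] := @Rel_form A z'.
  have [j -> yj] := Rel_zero zE' yE' za.
  have [i _ rE] := cp_row Hsm Hps HP (ncP B) (ncP A) (esym E) yj.
  by exists i; exact: ixeq.
have E2 : Phi (l *m cmx Lam) (ns A y0) = Phi (l2 *m cmx Lam) (ns A y2).
  by rewrite -yE; apply: (Rel_fun r'); exists A, l2, y2.
have E3 : Phi (l *m cmx Lam - l2 *m cmx Lam) (ns A y0) = ns A y2.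
  by rewrite addrC (PhiD HP) E2 -(PhiD HP) addNr (Phi0 HP).
have [eta [a [N [vE se EN yy]]]] := nc_form Hsm Hps HP (ncP A) E3.
have [u uE u1] := Llift EN.
exists (l2 - l + a *m cmx (ixmx A) + complexv u).
  have cM : cmx (ixmx A) *m cmx Lam = cmx (nl A) by rewrite -cmxM ixmx_Lam.
  have -> : (l2 - l + a *m cmx (ixmx A) + complexv u) *m cmx Lam = - eta.
    rewrite !mulmxDl mulNmx -mulmxA cM -complexv_mul uE.
    have -> : l2 *m cmx Lam - l *m cmx Lam = - (eta + a *m cmx (nl A) + complexv N) by rewrite -vE opprB.
    by move: (a *m _) (complexv N) => P Q; apply/rowP => i; rewrite !mxE; ring.
  exact: (stabN Hsm Hps HP se).
have Eu : Exp (complexv u) = onev m.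
  by rewrite Exp_cis; apply/rowP => i; rewrite !mxE u1.
rewrite z2E zE yy -ins_mulv -Exp_ixmx !ExpD Eu.
have El a' : Exp l 0 a' * Exp (- l) 0 a' = 1.
  by have := ExpD l (- l); rewrite subrr Exp0 => /rowP/(_ a'); rewrite [LHS]mxE [RHS]mxE.
apply/rowP => i; have := El i; rewrite !mxE.
move: (cexp _) (cexp _) (cexp _) (cexp _) (_ + _) => p q r s t; move=> h.
transitivity (s * r * (q * (p * t))); first by rewrite h mul1r.
by ring.
Qed.

Lemma Rel_surj y : exists z, Rel z y.
Proof.
have [A [u [z ->]]] := charts_cover Hsm Hps HP Mconn eff Hd Hcpt A0 y.
have /row_fullP[L' LE] := Lfull.
have cL : cmx L' *m cmx Lam = 1%:M := cmx_inv LE.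
exists (mulv (Exp (u *m cmx L')) (ins A z)), A, (u *m cmx L'), z; split=> //.
by rewrite -mulmxA cL mulmx1.
Qed.

Lemma qhol_mulv a b (f h : 'rV[C R]_a -> 'rV[C R]_b) p : qhol f p -> qhol h p ->
  qhol (fun x => mulv (f x) (h x)) p.
Proof.
move=> [f' hf] [h' hh].
have hs j := qhol_with_smul (qhol_with_mulr (delta_mx j 0 : 'M[C R]_(b, 1)) hf)
  (qhol_with_mulr (delta_mx j j : 'M[C R]_b) hh).
have q := qhol_with_sum (index_enum 'I_b) hs; eexists.
apply: qhol_with_ext ltr01 _ q => x _ /=; apply/rowP => i; rewrite summxE mxE (bigD1 i) //=.
rewrite big1 ?addr0 => [|j ji].
  rewrite -!colE mxE big_ord1 mxE; congr (_ * _).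
  rewrite mxE (bigD1 i) //= big1 ?addr0 => [|l li]; first by rewrite mxE !eqxx mulr1.
  by rewrite mxE (negbTE li) mulr0.
rewrite mxE big_ord1 [X in _ * X]mxE [X in _ * X]big1 ?mulr0 // => l _.
by rewrite mxE [i == j]eq_sym (negbTE ji) andbF mulr0.
Qed.

Lemma Theta_subm (A : NC) (x : 'rV[C R]_(m + d)) :
  subm (fun x : 'rV[C R]_(m + d) => Phi (lsubmx x *m cmx Lam) (ns A (rsubmx x))) x.
Proof.
have /row_fullP[L' LE] := Lfull.
have cL : cmx L' *m cmx Lam = 1%:M := cmx_inv LE.
pose B : 'M[C R]_(m + d, k + d) := block_mx (cmx Lam) 0 0 1%:M.
have fB : row_full B.
  apply/row_fullP; exists (block_mx (cmx L') 0 0 1%:M).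
  by rewrite mulmx_block !mulmx0 !mul0mx !mulmx1 !addr0 !add0r cL -scalar_mx_block.
have lE (y : 'rV[C R]_(m + d)) : y *m B + 0 = row_mx (lsubmx y *m cmx Lam) (rsubmx y).
  by rewrite addr0 -{1}(hsubmxK y) mul_row_block !mulmx0 mulmx1 addr0 add0r.
have h : subm (fun y : 'rV[C R]_(k + d) => Phi (lsubmx y) (ns A (rsubmx y))) (x *m B + 0).
  by rewrite lE; exact: (gc_subm (nc_gc (ncP A))).
have h2 := subm_comp (qhol_with_affine B 0 x) fB h.
by apply: subm_ext ltr01 _ h2 => y _; rewrite lE row_mxKl row_mxKr.
Qed.

(** A holomorphic right inverse of (l, y0) |-> exp l (ins A y0). On the rays of A the exponent stays
    fixed and y0 absorbs the variation of z'; on the other coordinates, where z' does not vanish, a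
    local logarithm is used. *)
Lemma Rel_section A l y0 (z := mulv (Exp l) (ins A y0)) :
  exists (s : 'rV[C R]_m -> 'rV[C R]_(m + d)) (r : R), [/\ 0 < r, qhol s z &
    forall z' : 'rV[C R]_m, rn (z' - z) < r -> z' = mulv (Exp (lsubmx (s z'))) (ins A (rsubmx (s z')))].
Proof.
have ii : 'i%C * (- 'i%C) = 1 :> C R by rewrite mulrN sqri opprK.
(* [Exp] has derivative i at 0; multiplying by -i and subtracting the value at 0 gives the
   normalization required by [inverse_function]. *)
pose f0 (x : 'rV[C R]_m) := Exp x *m (- 'i%C)%:M + const_mx 'i%C.
have qf : qhol_with f0 (fun u => diag_mx ('i%C *: Exp u) *m (- 'i%C)%:M) 0.
  exact: (qhol_with_comp (Exp_qhol 0) (qhol_with_affine (- 'i%C)%:M (const_mx 'i%C) _)).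
have f00 : f0 0 = 0 by apply/rowP => a; rewrite /f0 Exp0 mul_mx_scalar !mxE mulr1 addNr.
have [|r1 [r2 [g [g' [r10 r20 _ hg [qg _]]]]]] := inverse_function qf.
  rewrite Exp0; apply/matrixP => a b; rewrite mul_mx_scalar !mxE mulr1.
  by case: eqP => _; rewrite ?mulr1n ?mulr0n ?mulr0 // mulrC ii.
rewrite f00 in hg qg.
have El a : Exp l 0 a != 0 by rewrite mxE cexp_neq0.
pose D : 'M[C R]_m := diag_mx (\row_a (- 'i%C * (Exp l 0 a)^-1 * off A 0 a)).
pose cst : 'rV[C R]_m := \row_a ('i%C * off A 0 a).
pose w (z' : 'rV[C R]_m) := z' *m D + cst.
have wE z' a : w z' 0 a = 'i%C * off A 0 a * (1 - z' 0 a * (Exp l 0 a)^-1).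
  by rewrite /w mxE mul_mx_diag [X in X + _]mxE [X in _ * X + _]mxE [cst 0 a]mxE; ring.
have off_ix j : off A 0 (ix A j) = 0 by rewrite mxE ifT //; apply/existsP; exists j.
have off_off a : (forall j, a == ix A j = false) -> off A 0 a = 1.
  by move=> h; rewrite mxE; case: existsP => // -[j]; rewrite h.
have wz : w z = 0.
  apply/rowP => a; rewrite wE [RHS]mxE; have [[j ->]|h] := ixP A a.
    by rewrite off_ix mulr0 mul0r.
  rewrite [z 0 a]mxE ins_off // mulr1 divff // subrr mulr0; by [].
pose S : 'M[C R]_(m, d) := diag_mx (\row_a (Exp l 0 a)^-1) *m (cmx (ixmx A))^T.
have SE z' j : (z' *m S) 0 j = z' 0 (ix A j) / Exp l 0 (ix A j).
  rewrite /S mulmxA mxE (bigD1 (ix A j)) //= big1 ?addr0 => [|a aj].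
    by rewrite mul_mx_diag !mxE eqxx mulr1.
  by rewrite [X in _ * X]mxE !mxE (negbTE aj) mulr0.
have qw : qhol w z by eexists; exact: (qhol_with_affine D cst z).
have qgw : qhol (fun z' => g (w z')) z.
  by apply: (qhol_comp (f := w) qw); rewrite wz; exists g'.
have [G1 qG1] := qgw.
have [r r0 hr] := qhol_cont qw r20.
pose s z' := row_mx (g (w z')) (z' *m S + 0) *m 1%:M + row_mx l 0.
exists s, r; split=> // [|z' zr].
  have q1 := qhol_with_row qG1 (qhol_with_affine S 0 z).
  by eexists; exact: (qhol_with_comp q1 (qhol_with_affine 1%:M (row_mx l 0) _)).
have sE : s z' = row_mx (g (w z') + l) (z' *m S) by rewrite /s mulmx1 add_row_mx !addr0.
have [|gE _] := hg (w z'); first by have := hr z' zr; rewrite wz.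
have gE' a : Exp (g (w z')) 0 a = 1 + 'i%C * w z' 0 a.
  have /rowP/(_ a) := gE; rewrite /f0 mul_mx_scalar [LHS]mxE [X in X + _]mxE [const_mx _ 0 a]mxE => <-.
  by rewrite mulrDr mulrA ii mul1r sqri addrCA subrr addr0.
rewrite sE row_mxKl row_mxKr ExpD; apply/rowP => a; rewrite [RHS]mxE.
have -> : mulv (Exp (g (w z'))) (Exp l) 0 a = Exp (g (w z')) 0 a * Exp l 0 a by rewrite [LHS]mxE.
rewrite gE' wE; have [[j ->]|h] := ixP A a.
  by rewrite ins_ix SE off_ix mulr0 mul0r mulr0 addr0 mul1r mulrC divfK.
rewrite ins_off // off_off // !mulr1 mulrA sqri mulN1r opprB addrCA subrr addr0 divfK //.
Qed.

Lemma Rel_open z y : Rel z y -> exists2 r : R, 0 < r & forall z' : 'rV[C R]_m, rn (z' - z) < r -> exists y', Rel z' y'.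
Proof.
move=> [A [l [y0 [-> _]]]]; have [s [r [r0 _ h]]] := Rel_section A l y0.
exists r => // z' /h zE; exists (Phi (lsubmx (s z') *m cmx Lam) (ns A (rsubmx (s z')))).
by exists A, (lsubmx (s z')), (rsubmx (s z')).
Qed.

(** Holomorphy follows by composing the chart with the local section. For the rank, the submersion
    Th factors as fU after mu, so its full rank forces that of the derivative of fU. *)
Lemma Rel_subm (fU : 'rV[C R]_m -> M) z y : (forall z y, Rel z y -> fU z = y) -> Rel z y -> subm fU z.
Proof.
move=> fUP [A [l [y0 [zE _]]]]; have [s [r [r0 qs h]]] := Rel_section A l y0.
rewrite -zE in qs h.
pose Th (x : 'rV[C R]_(m + d)) := Phi (lsubmx x *m cmx Lam) (ns A (rsubmx x)).
have fTh x : fU (mulv (Exp (lsubmx x)) (ins A (rsubmx x))) = Th x.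
  by apply: fUP; exists A, (lsubmx x), (rsubmx x).
have hf : hol fU z.
  have h1 : hol (fun z' => Th (s z')) z by apply: (hol_comp qs); exact: (Theta_subm A (s z)).1.
  by apply: hol_ext r0 _ h1 => z' /h zE'; rewrite [in RHS]zE' fTh.
split=> // c Xc cz; have [G qG] := hf.2 c Xc cz; exists G => //.
pose mu (x : 'rV[C R]_(m + d)) := mulv (Exp (lsubmx x)) (ins A (rsubmx x)).
pose x1 := row_mx l y0.
have muE : mu x1 = z by rewrite /mu row_mxKl row_mxKr zE.
have [mu' qmu] : qhol mu x1.
  have ql : qhol (@lsubmx (C R) 1 m d) x1.
    eexists; apply: qhol_with_ext ltr01 _ (qhol_with_affine (col_mx 1%:M 0) 0 x1) => x _.
    by rewrite addr0 -{1}(hsubmxK x) mul_row_col mulmx0 mulmx1 addr0.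
  have qr : qhol (@rsubmx (C R) 1 m d) x1.
    eexists; apply: qhol_with_ext ltr01 _ (qhol_with_affine (col_mx 0 1%:M) 0 x1) => x _.
    by rewrite addr0 -{1}(hsubmxK x) mul_row_col mulmx0 mulmx1 add0r.
  apply: qhol_mulv.
    by apply: (qhol_comp ql); eexists; exact: Exp_qhol.
  by apply: (qhol_comp qr); eexists; exact: qhol_with_affine.
have cT : ch_dom c (Th x1) by rewrite -fTh -/(mu x1) muE.
have [G2 qG2 fG2] := (Theta_subm A x1).2 c Xc cT.
rewrite -muE in qG.
have q3 := qhol_with_comp qmu qG.
have q4 : qhol_with (fun x => ch_to c (Th x)) (fun x => mu' x *m G (mu x)) x1.
  by apply: qhol_with_ext ltr01 _ q3 => x _ /=; rewrite fTh.
move: fG2; rewrite (qhol_uniq qG2 q4) muE => /row_fullP[B BE]; apply/row_fullP.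
by exists (B *m mu' x1); rewrite -mulmxA.
Qed.

(** * The simplicial complex and conditions (a) and (b) *)

Definition KK : {set {set 'I_m}} :=
  [set S : {set 'I_m} | `[< exists A : NC, forall a, a \in S -> exists j, a = ix A j >]]%SET.

Lemma KKP (S : {set 'I_m}) : reflect (exists A : NC, forall a, a \in S -> exists j, a = ix A j) (S \in KK).
Proof. by rewrite inE; exact: asboolP. Qed.

Lemma KK_simplicial : simplicial_complex KK.
Proof.
move=> S S' /KKP[A hA] /fintype.subsetP sub; apply/KKP; exists A => a /sub; exact: hA.
Qed.

Context (h : {vspace 'rV[C R]_m}) (hP : forall v, v \in h <-> stab (v *m cmx Lam) x0).

(** An element t of H is related to x0, since its logarithm stabilizes x0. As a point of the
    coordinate torus it also has the presentation [ins A y0] with trivial exponent, so sg y0 = x0 in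
    the chart A, and injectivity of the slice gives t = 1. *)
Lemma condA : condition_a KK h.
Proof.
move=> S /KKP[A hA]; apply/seteqP; split=> [t [[v /= vh tE] [_ t1]]|t ->]; last first.
  split; first by exists 0; [exact: mem0v|exact: Exp0].
  by split=> [j|j _]; rewrite mxE ?oner_neq0.
have i1 : ins A (onev d) = onev m.
  apply/rowP => a; have [[j ->]|ha] := ixP A a; last by rewrite ins_off // mxE.
  by rewrite (ins_ix) !mxE.
have r1 : Rel t x0.
  exists A, v, (onev d); rewrite i1 -tE mulv1; split=> //.
  by rewrite (nc_x0 (ncP A)) (stab1 ((hP v).1 vh)).
pose y0 : 'rV[C R]_d := \row_j t 0 (ix A j).
have r2 : Rel t (ns A y0).
  exists A, 0, y0; rewrite mul0mx (Phi0 HP) mulv_Exp0; split=> //.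
  apply/rowP => a; have [[j ->]|ha] := ixP A a; first by rewrite (ins_ix) mxE.
  rewrite ins_off //; apply: t1; apply/negP => /hA[j aj]; have := ha j; by rewrite aj eqxx.
have E : ns A y0 = ns A (onev d).
  by rewrite (nc_x0 (ncP A)); exact: (Rel_fun r2 r1).
have y1 := gc_inj (nc_gc (ncP A)) E.
apply/rowP => a; rewrite [RHS]mxE; have [[j ->]|ha] := ixP A a.
  by have /rowP/(_ j) := y1; rewrite !mxE.
apply: t1; apply/negP => /hA[j aj]; have := ha j; by rewrite aj eqxx.
Qed.

Lemma realpart_mulR (v : 'rV[C R]_m) : realpart (v *m cmx Lam) = realpart v *m Lam.
Proof.
apply/rowP => i; rewrite !mxE Re_sum; apply: eq_bigr => a _; rewrite !mxE.
by case: (v 0 a) => x y; rewrite /rc /=; ring.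
Qed.

Lemma kap_h (A : NC) z : z \in h -> realpart z *m (Lam *m nk A) = 0.
Proof. by move=> /hP/(nc_kh (ncP A))[+ _]; rewrite realpart_mulR mulmxA. Qed.

Lemma cone_coord (A : NC) (S : {set 'I_m}) a : (forall a, a \in S -> exists j, a = ix A j) ->
  coord_cone S a -> a *m (Lam *m nk A) = \row_j a 0 (ix A j).
Proof.
move=> hA /coneP[_ aS].
have -> : a = (\row_j a 0 (ix A j)) *m ixmx A.
  apply/rowP => i; have [[j ->]|hi] := ixP A i; first by rewrite (mul_ixmx) mxE.
  rewrite mul_ixmx0 // aS //; apply/negP => /hA[j ij]; have := hi j; by rewrite ij eqxx.
rewrite mulmxA -(mulmxA _ _ Lam) (ixmx_Lam) -mulmxA (nc_lk (ncP A)) mulmx1.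
by apply/rowP => j; rewrite [RHS]mxE (mul_ixmx).
Qed.

Lemma cone_half (S S' : {set 'I_m}) a b : S \in KK -> S' \in KK -> coord_cone S a -> coord_cone S' b ->
  q h a = q h b -> forall i, a 0 i != 0 -> b 0 i = a 0 i.
Proof.
move=> /KKP[A hA] /KKP[B hB] ca cb /q_eq[z zh zE] i ai.
have [[a0 aS] [b0 bS]] := ((coneP _ _).1 ca, (coneP _ _).1 cb).
have [j ij] : exists j, i = ix A j by apply: hA; apply: contraR ai => /aS ->.
have EA := cone_coord hA ca; have EB := cone_coord hB cb.
have EB' : a *m (Lam *m nk B) = \row_l b 0 (ix B l).
  by rewrite -EB -[a](subrK b) zE mulmxDl (kap_h B zh) add0r.
rewrite mulmxA in EA; rewrite mulmxA in EB'.
have wA l : 0 <= (a *m Lam *m nk A) 0 l by rewrite EA mxE.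
have wB l : 0 <= (a *m Lam *m nk B) 0 l by rewrite EB' mxE.
have wj : (a *m Lam *m nk A) 0 j != 0 by rewrite EA mxE -ij.
have [l rE] := fan_cones Hsm Hps HP Hcpt (ncP A) (ncP B) wA wB wj.
by rewrite EA EB' [LHS]mxE [RHS]mxE -(ixeq rE) -ij.
Qed.

Lemma cone_inj (S S' : {set 'I_m}) a b : S \in KK -> S' \in KK -> coord_cone S a -> coord_cone S' b ->
  q h a = q h b -> a = b.
Proof.
move=> SK SK' ca cb E; apply/rowP => i; case: (eqVneq (a 0 i) 0) => [a0|ai].
  case: (eqVneq (b 0 i) 0) => [->|bi] //; exact: (cone_half SK' SK cb ca (esym E) bi).
by rewrite (cone_half SK SK' ca cb E ai).
Qed.

(** By [complete_cones] the image of u under [Lam] lies in the cone of some chart modulo the real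
    parts of the stabilizer. The coordinates in this cone give a; the difference u - a is the real
    part of a lift of the stabilizing vector plus a real vector killed by [Lam], and both belong to
    h. *)
Lemma q_onto x : exists2 S, S \in KK & exists2 a, coord_cone S a & q h a = x.
Proof.
have [u ->] := quotient_proj_surj x; rewrite -[quotient_proj _ u]/(q h u).
have [A hA] := complete_cones Hsm Hps HP Mconn eff Hd Hcpt A0 (u *m Lam).
pose b := u *m Lam *m nk A; pose a := b *m ixmx A.
pose S : {set 'I_m} := [set i | [exists j, i == ix A j]]%SET.
have SP i : reflect (exists j, i = ix A j) (i \in S).
  by rewrite inE; apply: (iffP existsP) => [[j /eqP]|[j ->]]; exists j.
exists S; first by apply/KKP; exists A => i /SP.
exists a.
  apply/coneP; split=> [i|i /SP ni].
    have [[j ->]|hi] := ixP A i; first by rewrite (mul_ixmx) hA.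
    by rewrite mul_ixmx0.
  by rewrite mul_ixmx0 // => j; apply/eqP => ij; apply: ni; exists j.
have [eta se wE] := nc_kw (ncP A) (u *m Lam).
have /row_fullP[L' LE] := Lfull.
have cL : cmx L' *m cmx Lam = 1%:M := cmx_inv LE.
pose v := eta *m cmx L'.
have vE : v *m cmx Lam = eta by rewrite /v -mulmxA cL mulmx1.
have vh : v \in h by apply/hP; rewrite vE.
pose y := u - a - realpart v.
have yL : y *m Lam = 0.
  rewrite /y !mulmxBl -realpart_mulR vE {1}wE -/b /a -(mulmxA _ _ Lam) (ixmx_Lam) addrK.
  by rewrite subrr.
have yh : complexv y \in h.
  by apply/hP; rewrite -complexv_mul yL complexv0 => t; rewrite scaler0 (Phi0 HP).
symmetry; apply/q_eq; exists (v + complexv y); first exact: memvD.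
have rD (v' : 'rV[C R]_m) (s : 'rV[R]_m) : realpart (v' + complexv s) = realpart v' + s.
  by apply/rowP => i; rewrite !mxE; case: (v' 0 i).
by rewrite rD /y [RHS]addrC subrK.
Qed.

Lemma cone_mono (S S' : {set 'I_m}) (a : 'rV[R]_m) : S \subset S' -> coord_cone S a -> coord_cone S' a.
Proof.
move=> /fintype.subsetP sub /coneP[a0 aS]; apply/coneP; split=> // i iS; apply: aS.
by apply: contra iS; exact: sub.
Qed.

(** The supporting functional is the sum of the coordinates of the chart A along the rays outside
    S'; it vanishes exactly on the common face. *)
Lemma cone_face (S S' : {set 'I_m}) : S \in KK -> S' \in KK ->
  face ((q h @` coord_cone S) `&` (q h @` coord_cone S')) (q h @` coord_cone S).
Proof.
move=> SK SK'; have /KKP[A hA] := SK.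
have -> : (q h @` coord_cone S) `&` (q h @` coord_cone S') = q h @` coord_cone (S :&: S')%SET.
  apply/seteqP; split=> [x [[a ca <-] [b cb /esym ab]]|x [a ca <-]].
    have E := cone_inj SK SK' ca cb ab; exists a => //; move: cb; rewrite -E => /coneP[_ aS'].
    have /coneP[a0 aS] := ca; apply/coneP; split=> // i; rewrite inE negb_and.
    by move=> /orP[/aS|/aS'].
  by split; exists a => //; apply: cone_mono ca; rewrite ?subsetIl ?subsetIr.
pose e : 'cV[R]_d := \col_j (ix A j \notin S')%:R.
have [z zh|u uE] := @qfun_exists _ _ h (Lam *m nk A *m e).
  by rewrite mulmxA (kap_h A zh) mul0mx.
have uS i : i \in S -> u (q h (delta_mx 0 i)) = (i \notin S')%:R.
  move=> /hA[j ->]; rewrite uE mulmxA mulmxA -rowE ixrow (nc_row (ncP A)) -rowE !mxE.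
  by [].
have u0 i : i \in S -> 0 <= u (q h (delta_mx 0 i)) by move=> iS; rewrite uS.
exists u; split.
  move=> x [a /coneP[a0 aS] <-]; rewrite q_expand linear_sum; apply: sumr_ge0 => i _.
  rewrite linearZ /=; have [iS|iS] := boolP (i \in S); last by rewrite aS // mul0r.
  by rewrite mulr_ge0 // u0.
rewrite (face_cone u0); congr (q h @` coord_cone _); apply/setP => i; rewrite !inE.
by case: (boolP (i \in S)) => //= iS; rewrite uS //; case: (i \in S'); rewrite ?eqxx ?oner_eq0.
Qed.

Lemma condB : condition_b KK h.
Proof.
have img s : [set q h @` s | s in SigmaK KK] s <-> exists2 S, S \in KK & s = q h @` coord_cone S.
  split=> [[_ [S SK <-] <-]|[S SK ->]]; first by exists S.
  by exists (coord_cone S) => //; exists S.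
split; last first.
  split=> [a _ //|a b /set_mem[_ [S SK <-] ca] /set_mem[_ [S' SK' <-] cb]|x _].
    exact: cone_inj SK SK' ca cb.
  have [S SK [a ca <-]] := q_onto x; exists a => //; exists (coord_cone S) => //; by exists S.
split; last first.
  apply/seteqP; split=> // x _; have [S SK [a ca <-]] := q_onto x.
  by exists (q h @` coord_cone S); [apply/img; exists S|exists a].
split=> [s /img[S _ ->]|s t /img[S SK ->] [u [u0 ->]]|s t /img[S SK ->] /img[S' SK' ->]].
- exact: polyhedral_q.
- have uS i : i \in S -> 0 <= u (q h (delta_mx 0 i)).
    move=> iS; apply: u0; exists (delta_mx 0 i) => //; apply/coneP; split=> j.
      by rewrite mxE eqxx; case: eqP.
    by rewrite mxE eqxx; case: eqP => // ->; rewrite iS.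
  rewrite (face_cone uS); apply/img; eexists; last by [].
  apply: (KK_simplicial SK); apply/fintype.subsetP => i; by rewrite inE => /andP[].
- by split; [|rewrite setIC]; exact: cone_face.
Qed.

(** * The orbit space U(K)/H and M *)

Local Open Scope quotient_scope.

Hypothesis dimh : (m - \dim h)%N = n.

Lemma UcomplexP (z : 'rV[C R]_m) : Ucomplex KK z <-> exists y, Rel z y.
Proof.
split=> [zU|[y [A [l [y0 [zE yE]]]]] S SK S0].
  have : [set a | z 0 a == 0]%SET \in KK.
    apply: contraT => /zU; case; by move=> j; rewrite inE => /eqP.
  move=> /KKP[A hA]; have [a za|l [y0 zE]] := Rel_form (A := A) (z := z).
    by apply: hA; rewrite inE za.
  by exists (Phi (l *m cmx Lam) (ns A y0)), A, l, y0.
move: SK => /negP; apply; apply/KKP; exists A => a /S0 za.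
by have [j ->] := Rel_zero zE yE za; exists j.
Qed.

Lemma h0_fix v y : stab v x0 -> Phi v y = y.
Proof.
move=> sv; have [A [u [z ->]]] := charts_cover Hsm Hps HP Mconn eff Hd Hcpt A0 y.
apply: stab1; apply: ((stab_Phi HP _ _ _).1); exact: (nc_h0 Hsm Hps HP (ncP A)).
Qed.

Definition Ufun (z : 'rV[C R]_m) : M :=
  if pselect (exists y, Rel z y) is left e then projT1 (cid e) else x0.

Lemma UfunP z y : Rel z y -> Ufun z = y.
Proof.
rewrite /Ufun => r; case: pselect => [e|ne]; last by case: ne; exists y.
by case: cid => y' /= r'; exact: (Rel_fun r' r).
Qed.

Lemma Ufun_Rel (z : Ucomplex KK) : Rel (val z) (Ufun (val z)).
Proof.
have /UcomplexP[y r] : Ucomplex KK (val z) by exact: set_valP.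
by rewrite (UfunP r).
Qed.

Lemma Ufun_orbit z v : (exists y, Rel z y) -> v \in h -> Ufun (mulv (Exp v) z) = Ufun z.
Proof.
move=> [y r] /hP sv; have := Rel_Phi v r; rewrite (h0_fix y sv) => r'.
by rewrite (UfunP r) (UfunP r').
Qed.

Local Notation OS := (orbit_space KK h).

Definition qmap (x : OS) : M := Ufun (val (repr x)).

Lemma qmap_pi z : qmap (orbit_pi h z) = Ufun (val z).
Proof.
have /eqmodP/asboolP[_ [v vh <-] e] : repr (orbit_pi h z) = z %[mod {eq_quot (@orbit_rel R m KK h)}].
  exact: reprK.
rewrite /qmap e Ufun_orbit //; exists (Ufun (val (repr (orbit_pi h z)))); exact: Ufun_Rel.
Qed.

Lemma qmap_inj : injective qmap.
Proof.
move=> x x' e; rewrite -(reprK x) -(reprK x'); apply/eqmodP/asboolP.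
have r1 := Ufun_Rel (repr x); have r2 := Ufun_Rel (repr x'); rewrite -/(qmap x') -e in r2.
have [v sv vE] := Rel_fiber r1 r2.
by exists (Exp v) => //; exists v => //; apply/hP.
Qed.

Definition Upt z (e : exists y, Rel z y) : Ucomplex KK := exist _ z (mem_set ((UcomplexP z).2 e)).

Lemma qmap_surj y : exists x, qmap x = y.
Proof.
have [z r] := Rel_surj y.
have e : exists y, Rel z y by exists y.
by exists (orbit_pi h (Upt e)); rewrite qmap_pi /=; exact: UfunP.
Qed.

Definition qinv y : OS := projT1 (cid (qmap_surj y)).

Lemma qinvK : cancel qinv qmap. Proof. by move=> y; rewrite /qinv; case: cid. Qed.
Lemma qmapK : cancel qmap qinv. Proof. by move=> x; apply: qmap_inj; rewrite qinvK. Qed.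

Lemma qmap_subm (z : Ucomplex KK) : subm Ufun (val z).
Proof. exact: (Rel_subm UfunP (Ufun_Rel z)). Qed.

Lemma qmap_continuous : continuous qmap.
Proof.
apply/quotient_continuous => z N; rewrite /= -[\pi_ _ z]/(orbit_pi h z) qmap_pi => nN.
have [r r0 hr] := (qmap_subm z).1.1 N nN.
have nB : nbhs (val z) [set w : 'rV[C R]_m | rn (w - val z) < r] by apply/nbhs_rn; exists r.
have nz := @initial_continuous (Ucomplex KK) _ set_val z _ nB.
have nz' : nbhs z [set w : Ucomplex KK | rn (val w - val z) < r] := nz.
suff : nbhs z [set w : Ucomplex KK | N (qmap (orbit_pi h w))] by [].
by apply: filterS nz' => w /= hw; rewrite qmap_pi; exact: hr.
Qed.

Lemma qinv_continuous : continuous qinv.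
Proof.
move=> y N nN; pose z := repr (qinv y).
have zE : orbit_pi h z = qinv y by exact: reprK.
have yE : Ufun (val z) = y by rewrite -qmap_pi zE qinvK.
rewrite -zE in nN; have := @pi_continuous _ {eq_quot (@orbit_rel R m KK h)} z N nN.
case=> _ /= [[W oW <-] /= Wz sW].
have /nbhs_rn[r r0 hr] : nbhs (val z) W by apply: open_nbhs_nbhs.
have [r1 r10 hr1] := Rel_open (Ufun_Rel z).
have m0 : 0 < Num.min r r1 by rewrite lt_min r0.
have := subm_open (qmap_subm z) m0; rewrite yE; apply: filterS => y' [z' zd <-] /=.
move: zd; rewrite lt_min => /andP[z1 z2]; have e := hr1 _ z2.
have -> : qinv (Ufun z') = orbit_pi h (Upt e) by rewrite -[RHS]qmapK qmap_pi.
exact: (sW (Upt e) (hr _ z1)).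
Qed.

Lemma torus_real e (t : 'rV[C R]_e) : torus t -> exists s, Exp (complexv s) = t.
Proof.
move=> tT; have [s sE] := fin_all_exists (fun j => @cis_surj R (t 0 j) (congr1 (@complex.Re R) (tT j))).
by exists (\row_j s j); rewrite Exp_cis; apply/rowP => j; rewrite !mxE -sE.
Qed.

Definition tlog e (t : 'rV[C R]_e) : 'rV[R]_e :=
  if pselect (exists s, Exp (complexv s) = t) is left e then projT1 (cid e) else 0.

(** The homomorphism of tori with differential [Lam]; by [rhoE] every choice of logarithm gives the
    same value. *)
Definition rho (t : 'rV[C R]_m) : 'rV[C R]_k := Exp (complexv (tlog t *m Lam)).

Lemma rhoE s : rho (Exp (complexv s)) = Exp (complexv (s *m Lam)).
Proof.
rewrite /rho /tlog; case: pselect => [e|ne]; last by case: ne; exists s.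
case: cid => s' /= sE; rewrite -[s'](subrK s) mulmxDl complexvD ExpD Lint; last first.
  move=> a; have /rowP/(_ a) := sE; rewrite !Exp_cis !mxE => E.
  by rewrite cisD E mulrC cisN.
by apply/rowP => j; rewrite !mxE mul1r.
Qed.

Lemma rho_cont : {within torus, continuous rho}.
Proof.
apply/subspace_continuousP => t tT; have [s0 s0E] := torus_real tT.
move=> N nN0; have nN : nbhs (rho t) N := nN0.
rewrite -s0E rhoE in nN; have [e e0 he] := (nbhs_rn _ _).1 nN.
have e2 : 0 < e / 2 by rewrite divr_gt0.
have [d1 d10 h1] := Exp_continuous (s0 *m Lam) e2.
pose K0 := m%:R * rn (cmx Lam) + 1; have K00 : 0 < K0 by rewrite ltr_wpDl // mulr_ge0 // rn_ge0.
have dK : 0 < d1 / K0 by rewrite divr_gt0.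
have fE : row_full (diag_mx ('i%C *: Exp (complexv s0))).
  apply/row_fullP; exists (diag_mx (\row_j ('i%C * Exp (complexv s0) 0 j)^-1)).
  rewrite mulmx_diag; apply/matrixP => i j; rewrite !mxE mulVf // mulf_neq0 ?cexp_neq0 //.
  by apply/eqP => /(congr1 (@complex.Im R))/eqP; rewrite oner_eq0.
(* The exponential map is open at s0, so points near t have logarithms near s0, and such points of
   the torus have real logarithms. *)
have [d2 d20 h2] := submersion_open (Exp_qhol (complexv s0)) fE dK.
have nB : nbhs t [set w : 'rV[C R]_m | rn (w - t) < d2] by apply/nbhs_rn; exists d2.
apply: filterS nB => w /= wd wT; rewrite -s0E in wd; have [x xd xE] := h2 w wd.
have xr : x = complexv (realpart x).
  apply/rowP => j; rewrite [RHS]mxE [realpart x 0 j]mxE; apply: cexp_abs1.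
  have := wT j; rewrite -xE mxE => hw; rewrite /ab hw; by [].
have wE : rho w = Exp (complexv (realpart x *m Lam)) by rewrite -xE {1}xr rhoE.
apply: he; rewrite -[from_subspace torus rho w]/(rho w) wE; apply: le_lt_trans (h1 _ _) _; last by rewrite ltr_pdivrMr // ltr_pMr // ltr1n.
rewrite -mulmxBl; apply: le_lt_trans (norm_mulmxR _ _) _.
have xd' : `|realpart x - s0| < d1 / K0 by rewrite -rn_complexv complexvB -xr.
apply: le_lt_trans (_ : K0 * `|realpart x - s0| < _).
  by rewrite mulrAC ler_wpM2r // /K0 lerDl.
by rewrite mulrC -ltr_pdivlMr.
Qed.

(** For the kernel: if s is mapped to a period, this period lifts to a period u, and t = exp (s - u)
    with s - u killed by [Lam], hence in h. Conversely an element of H in the compact torus has a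
    real logarithm, and no nonzero real vector stabilizes x0. *)
Lemma rho_iso : torus_quotient_iso h rho.
Proof.
split.
- move=> s t /torus_real[a <-] /torus_real[b <-].
  by rewrite -ExpD -complexvD !rhoE mulmxDl complexvD ExpD.
- exact: rho_cont.
- apply/seteqP; split=> [t [s /torus_real[a <-] <-]|t /torus_real[a <-]].
    rewrite rhoE; exact: torus_Exp.
  have /row_fullP[L' LE] := Lfull; exists (Exp (complexv (a *m L'))); first exact: torus_Exp.
  by rewrite rhoE -mulmxA LE mulmx1.
apply/seteqP; split=> [t [tT rt]|t [tT [v vh vE]]]; split=> //.
  have [s sE] := torus_real tT; move: rt; rewrite /= -sE rhoE => /Llift[u uE u1].
  exists (complexv (s - u)).
    apply/hP; rewrite -complexv_mul mulmxBl uE subrr complexv0 => r.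
    by rewrite scaler0 (Phi0 HP).
  rewrite complexvB ExpD; have -> : Exp (- complexv u) = onev m.
    rewrite -complexvN Exp_cis; apply/rowP => a; rewrite !mxE.
    by have := cisN (u 0 a); rewrite u1 mulr1.
  exact: mulv1.
have vr : v = complexv (realpart v).
  apply/rowP => j; rewrite [RHS]mxE [realpart v 0 j]mxE; apply: cexp_abs1.
  have := tT j; rewrite -vE mxE => hw; rewrite /ab hw; by [].
have /hP := vh; rewrite vr -complexv_mul => /(nc_real0 Hsm Hps HP (ncP A0)) E.
by rewrite /= -vE vr rhoE E complexv0 Exp0.
Qed.

Lemma qmap_act t : torus t -> forall x, qmap (orbit_act t x) = act (rho t) (qmap x).
Proof.
move=> tT x; have tC := torus_ctorus tT; rewrite -[x](reprK x) -[\pi_ _ _]/(orbit_pi h (repr x)).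
rewrite orbit_act_pi // !qmap_pi val_Uact //.
have [s <-] := torus_real tT; have r := Ufun_Rel (repr x).
by rewrite (UfunP (Rel_Phi _ r)) -complexv_mul rhoE (Phi_real HP).
Qed.

Lemma orbit_space_biholomorphic : exists (Y : complexManifold R OS (m - \dim h)%N),
  orbit_manifold Y /\ biholomorphic Y X qmap.
Proof.
(* The dimension m - dim h equals n only propositionally; generalizing it replaces a cast of the
   manifold structure. *)
suff H n' : n = n' -> exists Y : complexManifold R OS n', orbit_manifold Y /\ biholomorphic Y X qmap.
  exact: H (esym dimh).
move=> <-; have [Y [YE bY]] := pull_manifold X qmapK qinvK qmap_continuous qinv_continuous.
exists Y; split=> // c; rewrite YE => -[c1 X1 <-] z /= cz; rewrite qmap_pi in cz.
have [hU hG] := qmap_subm z; have [G qG fG] := hG c1 X1 cz.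
have [r r0 hr] := Rel_open (Ufun_Rel z).
have q2 : qhol_with (ch_to (pull_chart qmapK qinvK qmap_continuous qinv_continuous c1) \o orbit_pi_at h z) G (val z).
  apply: qhol_with_ext r0 _ qG => w /hr e /=; rewrite /orbit_pi_at qmap_pi insubdK //.
  by apply/mem_set/UcomplexP.
have [df dE] := qhol_diff q2; split; first exact: df.
move=> v; have /row_fullP[B BE] := fG; exists (v *m B).
by rewrite dE /= -mulmxA BE mulmx1.
Qed.
End Rel.

(** * The first chart, the indexing of rays, and the conclusion *)

Lemma vspace_matrix (F : fieldType) k (W : {vspace 'rV[F]_k}) : exists L : 'M[F]_(\dim W, k),
  row_free L /\ forall v, v \in W <-> (v <= L)%MS.
Proof.
pose X := vbasis W; pose L : 'M[F]_(\dim W, k) := \matrix_i X`_i.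
have LE (a : 'rV[F]_(\dim W)) : a *m L = \sum_(i < \dim W) a 0 i *: X`_i.
  by rewrite mulmx_sum_row; apply: eq_bigr => i _; rewrite rowK.
exists L; split.
  apply: inj_row_free => a; rewrite LE => aE; apply/rowP => i; rewrite mxE.
  have := basis_free (vbasisP W); rewrite -/X => /freeP h.
  by exact: (h (fun i => a 0 i) aE i).
move=> v; split=> [/coord_vbasis vE|/submxP[a ->]].
  apply/submxP; exists (\row_i coord X i v); rewrite LE {1}vE.
  by apply: eq_bigr => i _; rewrite mxE.
rewrite LE; apply: rpred_sum => i _; apply: rpredZ; apply: vbasis_mem.
by apply: mem_nth; rewrite size_tuple.
Qed.

Lemma dim_kernel (F : fieldType) k n (W : {vspace 'rV[F]_k}) (A : 'M[F]_(k, n)) :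
  (forall v, v \in W <-> v *m A = 0) -> (\dim W = k - \rank A)%N.
Proof.
move=> h; have [L [fL LE]] := vspace_matrix W.
have H (v : 'rV[F]_k) : (v <= kermx A)%MS <-> (v <= L)%MS.
  by rewrite -LE h; split=> [/sub_kermxP|e]; last apply/sub_kermxP.
rewrite -mxrank_ker -(eqP fL); apply/eqP; rewrite eqn_leq !mxrankS //; apply/rV_subP => v /H //.
Qed.

(** At a point realizing maximality, e = d and k + d = 2 n; the two inequalities of [isotropy_count]
    then leave only e + rank X0 = n. The point x0 is the point (1, ..., 1) of the resulting
    slice. *)
Lemma max_nchart (R : realType) (M : topologicalType) (n k : nat)
    (X : complexManifold R M n) (act : 'rV[C R]_k -> M -> M) (Phi : 'rV[C R]_k -> M -> M) :
  compact [set: M] -> connected [set: M] -> smooth_action X act ->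
  preserves_complex_structure X act -> maximal_action X act -> complex_flow X act Phi ->
  exists (d : nat) (x0 : M) (A : NC X act Phi d x0), (k + d = n.*2)%N.
Proof.
move=> Hcpt Mconn Hsm Hps [eff [p [d [[W [WE Wd]] kd]]]] HP.
have Hd : (k + d = n.*2)%N by rewrite -kd.
have [c Xc cp] := atlas_cover X p.
have E : d = (k - \rank (reim (Xm act c (ch_to c p))))%N.
  rewrite -Wd; apply: dim_kernel => v; rewrite WE -reimP (lieP Hsm Hps Xc cp).
  split=> hh s; first by have [_] := hh s.
  split; [exact: torus_Exp|exact: hh].
have [h1 h2 _] := isotropy_count Hsm Hps Mconn eff Xc cp.
have gp : good_point act c p.
  rewrite /good_point; move: h1 h2 E Hd; move: (\rank (reim _)) (\rank (Xm _ _ _)); clear; lia.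
have [e [lam [sg [eE gc]]]] := good_chart_exists Hsm Hps HP Mconn eff Xc cp gp.
have ed : e = d by rewrite eE -E.
move: lam sg gc; rewrite ed => lam sg gc.
have [kap [lk kh kw]] := kappa_exists Hsm Hps HP gc Hd.
have A : nchart X act Phi (sg (onev d)) lam kap p sg by split.
by exists d, (sg (onev d)), (MkNC A).
Qed.

(** The rays of the finitely many cones are listed without repetition and followed by the standard
    basis of R^k. The rows of the first kind map periods to periods by [gc_int]; those of the second
    kind make [Lam] onto and lift every period. *)
Lemma ray_index (R : realType) (M : topologicalType) (n k : nat)
    (X : complexManifold R M n) (act : 'rV[C R]_k -> M -> M) (Phi : 'rV[C R]_k -> M -> M)
    d x0 N (F : 'I_N -> NC X act Phi d x0) : (forall B, exists i, ncle B (F i)) ->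
  exists m (Lam : 'M[R]_(m, k)) (ix : NC X act Phi d x0 -> 'I_d -> 'I_m),
  [/\ forall A j, row (ix A j) Lam = row j (nl A),
      forall A B j l, row j (nl A) = row l (nl B) -> ix A j = ix B l,
      row_full Lam,
      forall u : 'rV[R]_m, (forall a, cis (u 0 a) = 1) -> Exp (complexv (u *m Lam)) = onev k &
      forall N : 'rV[R]_k, Exp (complexv N) = onev k ->
        exists2 u : 'rV[R]_m, u *m Lam = N & forall a, cis (u 0 a) = 1].
Proof.
move=> hF; pose ray (x : 'I_N * 'I_d) := row x.2 (nl (F x.1)).
pose rs := undup [seq ray x | x : 'I_N * 'I_d]; pose r := size rs.
pose Rm : 'M[R]_(r, k) := \matrix_(b < r) rs`_b.
pose Lam : 'M[R]_(r + k, k) := col_mx Rm 1%:M.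
have ixE (A : NC X act Phi d x0) j : exists b : 'I_r, rs`_b = row j (nl A).
  have [i /(_ j)[l ->]] := hF A.
  have inr : row l (nl (F i)) \in rs.
    by rewrite mem_undup; exact: (map_f ray (mem_enum _ (i, l))).
  have lt : (index (row l (nl (F i))) rs < r)%N by rewrite index_mem.
  by exists (Ordinal lt); rewrite /= nth_index.
pose ix A j : 'I_(r + k) := lshift k (projT1 (cid (ixE A j))).
exists (r + k)%N, Lam, ix; split.
- move=> A j; rewrite /ix; case: cid => b /= <-.
  by apply/rowP => i; rewrite [LHS]mxE col_mxEu mxE.
- move=> A B j l E; rewrite /ix; case: cid => b /= bE; case: cid => b' /= bE'.
  congr lshift; apply: val_inj; apply/eqP.
  by rewrite -(nth_uniq 0 (ltn_ord b) (ltn_ord b') (undup_uniq _)) -/rs bE bE' E.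
- by apply/row_fullP; exists (row_mx 0 1%:M); rewrite mul_row_col mul0mx mulmx1 add0r.
- move=> u u1; rewrite -(hsubmxK u) mul_row_col mulmx1 complexvD ExpD.
  have -> : Exp (complexv (rsubmx u)) = onev k.
    by rewrite Exp_cis; apply/rowP => i; rewrite !mxE u1.
  rewrite mulv1 mulmx_sum_row.
  elim/big_ind: _ => [|x y ex ey|b _]; first by rewrite complexv0 Exp0.
    by rewrite complexvD ExpD ex ey mulv1.
  have : rs`_b \in rs by rewrite mem_nth.
  rewrite mem_undup => /mapP[[i j] _ bE].
  rewrite rowK bE /ray /= rowE scalemxAl; apply: (gc_int (nc_gc (ncP (F i)))) => l.
  rewrite !mxE eqxx; case: eqP => _; rewrite ?mulr1 ?mulr0 ?cis0 //.
- move=> N0; rewrite Exp_cis => NE; exists (row_mx 0 N0).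
    by rewrite mul_row_col mul0mx mulmx1 add0r.
  move=> a; case: (split_ordP a) => b ->; first by rewrite row_mxEl mxE cis0.
  by rewrite row_mxEr; have /rowP/(_ b) := NE; rewrite !mxE.
Qed.

Theorem theorem4p9 (R : realType) (M : topologicalType) (n k : nat)
    (X : complexManifold R M n) (act : 'rV[C R]_k -> M -> M) :
  compact [set: M] -> connected [set: M] ->
  smooth_action X act ->
  preserves_complex_structure X act ->
  maximal_action X act ->
  exists (m : nat) (K : {set {set 'I_m}}) (h : {vspace 'rV[C R]_m}),
    [/\ simplicial_complex K, condition_a K h, condition_b K h &
      exists (Y : complexManifold R (orbit_space K h) (m - (\dim h)%VS)%N)
             (f : orbit_space K h -> M) (rho : 'rV[C R]_m -> 'rV[C R]_k),
        [/\ orbit_manifold Y,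
            biholomorphic Y X f,
            torus_quotient_iso h rho &
            forall t, torus t -> forall x,
              f (orbit_act t x) = act (rho t) (f x)]].
Proof.
move=> Hcpt Mconn Hsm Hps Hmax.
have [Phi HP] := global_flow Hsm Hps Hcpt; have eff := Hmax.1.
have [d [x0 [A0 Hd]]] := max_nchart Hcpt Mconn Hsm Hps Hmax HP.
have [N [F hF]] := finite_cones Hsm Hps HP Mconn eff Hd Hcpt A0.
have [m [Lam [ix [ixrow ixeq Lfull Lint Llift]]]] := ray_index hF.
have [c Xc cx] := atlas_cover X x0.
have fX : row_full (Xm act c (ch_to c x0)).
  move: cx; rewrite -(nc_x0 (ncP A0)) => cx; exact: (x0_full HP (nc_gc (ncP A0)) Xc cx).
pose B := cmx Lam *m Xm act c (ch_to c x0).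
have fB : row_full B.
  apply: row_full_mul fX; have /row_fullP[L' LE] := Lfull; apply/row_fullP; exists (cmx L').
  exact: cmx_inv.
(* The kernel of the composite C^m -> C^k -> T M at x0, that is, the Lie algebra of the stabilizer
   of x0 in C^m; it has codimension n because the orbit of x0 is open. *)
pose h := lker (linfun (mulmxr B : 'rV[C R]_m -> 'rV[C R]_n)).
have hB v : v \in h <-> v *m B = 0.
  by rewrite memv_ker lfunE /=; split=> [/eqP|->].
have hP v : v \in h <-> stab Phi (v *m cmx Lam) x0.
  by rewrite hB (stabP Hsm Hps HP _ Xc cx) mulmxA.
have dimh : (m - \dim h)%N = n.
  have nm : (n <= m)%N by rewrite -(eqP fB) rank_leq_row.
  by rewrite (dim_kernel hB) (eqP fB) subKn.
exists m, (KK ix), h; split.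
- exact: KK_simplicial.
- exact: (condA Hsm Hps HP ixrow Lint hP).
- exact: (condB Hsm Hps HP Hd Hcpt Mconn eff A0 ixrow ixeq Lfull hP).
have [Y [oY bY]] := orbit_space_biholomorphic Hsm Hps HP Hd Hcpt Mconn eff A0 ixrow ixeq Lfull Lint Llift hP dimh.
exists Y; eexists; exists (rho Lam); split; [exact: oY|exact: bY| |].
  exact: (rho_iso Hsm Hps HP A0 Lfull Lint Llift hP).
exact: (qmap_act Hsm Hps HP Hd Hcpt Mconn eff A0 ixrow Lint hP).
Qed.
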